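(* Let $\varphi$ be an analytic self-map of $\mathbb{D}$ and let $n$ be a positive integer. The operator $D_{\varphi,n}$ is compact on $H^{2}$ if and only if \[ N_{\varphi}(w)=o\Big(\big[\log(1/|w|)\big]^{2n+1}\Big)\qquad (|w|\to 1). \]
   Context: $\mathbb{D}$ is the open unit disk in $\mathbb{C}$ and $H^2$ is the Hardy space of analytic functions $f$ on $\mathbb{D}$ with $\|f\|^2=\lim_{r\to1}\frac{1}{2\pi}\int_0^{2\pi}|f(re^{i\theta})|^2\,d\theta<\infty$. For an analytic self-map $\varphi$ of $\mathbb{D}$ and a positive integer $n$, $D_{\varphi,n}$ is the operator $D_{\varphi,n}f=f^{(n)}\circ\varphi$. The Nevanlinna counting function is $N_{\varphi}(w)=\sum_{z\in\mathbb{D},\,\varphi(z)=w}\log(1/|z|)$ for $w\in\mathbb{D}\setminus\{\varphi(0)\}$ (multiplicities counted; $N_\varphi(w)=0$ if $w\notin\varphi(\mathbb{D})$), and $N_\varphi(\varphi(0))=\infty$. *)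

(* Defs.v *)
From Stdlib Require Import Reals List ClassicalEpsilon.
From Coquelicot Require Import Coquelicot.
Open Scope R_scope.

Notation CC := Coquelicot.Complex.C.

Definition Cis_derive (f : CC -> CC) (z l : CC) : Prop :=
  @is_derive C_AbsRing C_NormedModule f z l.

Definition in_disk (z : CC) : Prop := Cmod z < 1.

Definition analytic_on_disk (f : CC -> CC) : Prop :=
  forall z, in_disk z -> exists l, Cis_derive f z l.

(* The complex derivative (a chosen value; meaningful where f is
   complex-differentiable, where it is unique). *)
Definition Cderiv (f : CC -> CC) (z : CC) : CC :=
  epsilon (inhabits (RtoC 0)) (fun l => Cis_derive f z l).

Fixpoint Cderiv_n (n : nat) (f : CC -> CC) : CC -> CC :=
  match n with
  | O => f
  | S m => Cderiv (Cderiv_n m f)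
  end.

Definition self_map (phi : CC -> CC) : Prop :=
  analytic_on_disk phi /\ forall z, in_disk z -> in_disk (phi z).

Definition int_mean2 (f : CC -> CC) (r : R) : R :=
  / (2 * PI) * RInt (fun t => (Cmod (f (r * cos t, r * sin t)%R)) ^ 2) 0 (2 * PI).

Definition H2_limit (f : CC -> CC) (L : R) : Prop :=
  filterlim (int_mean2 f) (at_left 1) (locally L).

Definition in_H2 (f : CC -> CC) : Prop :=
  analytic_on_disk f /\ exists L : R, H2_limit f L.

Definition H2_norm2 (f : CC -> CC) : R :=
  epsilon (inhabits 0) (fun L => H2_limit f L).

Definition Dop (phi : CC -> CC) (n : nat) (f : CC -> CC) : CC -> CC :=
  fun z => Cderiv_n n f (phi z).

Definition compact_on_H2 (T : (CC -> CC) -> (CC -> CC)) : Prop :=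
  (forall f, in_H2 f -> in_H2 (T f)) /\
  forall u : nat -> (CC -> CC),
    (forall k, in_H2 (u k) /\ H2_norm2 (u k) <= 1) ->
    exists (s : nat -> nat) (g : CC -> CC),
      (forall k, (s k < s (S k))%nat) /\ in_H2 g /\
      is_lim_seq (fun k => H2_norm2 (fun z => Cminus (T (u (s k)) z) (g z))) 0.

Definition zero_order_ge (phi : CC -> CC) (w z : CC) (m : nat) : Prop :=
  phi z = w /\ (1 <= m)%nat /\
  forall j, (1 <= j)%nat -> (j < m)%nat -> Cderiv_n j phi z = RtoC 0.

Fixpoint weighted_log_sum (l : list (CC * nat)) : R :=
  match l with
  | nil => 0
  | (z, m) :: l' => INR m * ln (/ Cmod z) + weighted_log_sum l'
  end.

(* Nevanlinna counting function (multiplicities counted), as the supremum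
   of the finite partial sums; N_phi(phi 0) = +infinity by convention. *)
Definition nevanlinna (phi : CC -> CC) (w : CC) : Rbar :=
  if excluded_middle_informative (w = phi (RtoC 0)) then p_infty
  else Lub_Rbar (fun x => exists l : list (CC * nat),
         List.NoDup (map fst l) /\
         List.Forall (fun p => in_disk (fst p) /\ zero_order_ge phi w (fst p) (snd p)) l /\
         x = weighted_log_sum l).

(* Main.v *)
(* Write |f|^2 for the squared norm of f in H^2.

   Necessity: let k_w be the normalised reproducing kernel at w and h its n-th derivative. The
   function G = 1 - (h o phi) / h(w) vanishes on the fibre of w, so dividing out Blaschke factors
   gives 2 N(w) <= log (|G|^2 / |G(0)|^2), which is at most a constant times
   |h o phi|^2 (1 - |w|^2)^(2n+1). The kernels tend to 0 pointwise, so compactness forces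
   |h o phi| -> 0.

   Sufficiency: put F = f^(n) and H = F o phi. Jensen's formula bounds the mean of log |H - c| on
   |z| = r by log |H(0) - c| plus the sum of N over the zeros of F - c. If N is dominated by a
   positive combination of the functions w -> log+ (rho / |w|), Jensen's formula for F on the circles
   |w| = rho turns that sum into means of log |F - c|. Averaging over |c| = s yields a comparison of
   the means of log+ |H| / s and log+ |F| / s, and summing over dyadic s a comparison of the square
   means of H and F. This replaces the change of variables formula. Near the unit circle
   log^(2n+1) (1 / |w|) is dominated by the sum over j of 4^(-nj) log+ (rho_j / |w|) with
   rho_j = exp (-2^-j), and the corresponding combination of square means of f^(n) is bounded by
   |f|^2; away from it Littlewood's inequality bounds N, and f^(n) is small there when f is weakly
   small. *)

Require Import Defs.
From Stdlib Require Import ZArith Reals Lra Lia ClassicalEpsilon List.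
From Coquelicot Require Import Coquelicot.
Open Scope R_scope.

(** * Complex differentiability *)

(** The obstacle is that N is only a supremum over finite sets of zeros and is infinite at phi(0),
    while the classical area integrals call for a change of variables. Jensen's formula works with
    continuous functions on circles, for one value c at a time. Averaging over |c| = s succeeds
    because the mean of log |x - c| is log max(|x|, s): the subtracted terms log |F(0) - c| become
    at least log s, and only positive parts of logarithms survive. Squares come back because x^2 is
    comparable with the sum of 4^i log+ (x / 2^i) over all integers i. The exponent 2n + 1 has two
    origins: it is the power of 1 - |w|^2 in 1 / |h(w)|^2; and it is 2n, from the weights 4^(-nj)
    that cancel the factor k^(2n) which n derivatives put on the k-th squared coefficient, plus 1
    for the logarithm itself. The pole of N at phi(0) is matched by a logarithm centred there, that
    is, by Jensen's formula for F composed with a disk automorphism. Differentiability is given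
    pointwise only, so Cauchy's theory starts from Goursat's theorem on rectangles. *)

Notation ccont := (@continuous _ C_UniformSpace).

Lemma ccont_pair (U : UniformSpace) (f : U -> CC) (x : U) :
  continuous (fun y => Re (f y)) x -> continuous (fun y => Im (f y)) x -> ccont f x.
Proof.
  intros H1 H2 P [e He].
  assert (K1 := H1 (ball (Re (f x)) e) (locally_ball (Re (f x)) e)).
  assert (K2 := H2 (ball (Im (f x)) e) (locally_ball (Im (f x)) e)).
  unfold filtermap in *.
  generalize (filter_and _ _ K1 K2).
  apply filter_imp; intros y [Hy1 Hy2]; apply He; split; assumption.
Qed.

Lemma ccont_Re (U : UniformSpace) (f : U -> CC) (x : U) :
  ccont f x -> continuous (fun y => Re (f y)) x.
Proof.
  intros H P [e He]. apply (H (fun z : C_UniformSpace => P (Re z))).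
  exists e; intros y [Hy _]; apply He, Hy.
Qed.

Lemma ccont_Im (U : UniformSpace) (f : U -> CC) (x : U) :
  ccont f x -> continuous (fun y => Im (f y)) x.
Proof.
  intros H P [e He]. apply (H (fun z : C_UniformSpace => P (Im z))).
  exists e; intros y [_ Hy]; apply He, Hy.
Qed.

Lemma cont_plus (U : UniformSpace) (f g : U -> R) (x : U) :
  continuous f x -> continuous g x -> continuous (fun y => f y + g y) x.
Proof. exact (continuous_plus f g x). Qed.

Lemma cont_minus (U : UniformSpace) (f g : U -> R) (x : U) :
  continuous f x -> continuous g x -> continuous (fun y => f y - g y) x.
Proof. exact (continuous_minus f g x). Qed.

Lemma cont_opp (U : UniformSpace) (f : U -> R) (x : U) :
  continuous f x -> continuous (fun y => - f y) x.
Proof. exact (continuous_opp f x). Qed.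

Lemma cont_mult (U : UniformSpace) (f g : U -> R) (x : U) :
  continuous f x -> continuous g x -> continuous (fun y => f y * g y) x.
Proof. exact (continuous_mult f g x). Qed.

Lemma cont_comp_pt (U : UniformSpace) (f : U -> R) (h : R -> R) (x : U) :
  continuous f x -> continuity_pt h (f x) -> continuous (fun y => h (f y)) x.
Proof.
  intros H1 H2. apply (continuous_comp f h); [exact H1|].
  apply continuity_pt_filterlim, H2.
Qed.

Lemma cont_inv (U : UniformSpace) (f : U -> R) (x : U) :
  f x <> 0 -> continuous f x -> continuous (fun y => / f y) x.
Proof.
  intros H1 H2. apply (cont_comp_pt U f Rinv x H2).
  apply (continuity_pt_inv (fun t => t)); [apply continuity_pt_id|exact H1].
Qed.

Lemma cont_pow (U : UniformSpace) (f : U -> R) (n : nat) (x : U) :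
  continuous f x -> continuous (fun y => f y ^ n) x.
Proof.
  intros H; induction n as [|n IH]; simpl.
  - apply continuous_const.
  - apply cont_mult; assumption.
Qed.

Lemma cont_sqrt (U : UniformSpace) (f : U -> R) (x : U) :
  continuous f x -> continuous (fun y => sqrt (f y)) x.
Proof.
  intros H. apply (continuous_comp f sqrt); [exact H|apply continuous_sqrt].
Qed.

Lemma cont_max (U : UniformSpace) (f g : U -> R) (x : U) :
  continuous f x -> continuous g x -> continuous (fun y => Rmax (f y) (g y)) x.
Proof.
  intros H1 H2.
  apply (continuous_ext (fun y => / 2 * (f y + g y + Rabs (f y - g y)))).
  { intros y. unfold Rmax, Rabs. destruct (Rle_dec (f y) (g y)), (Rcase_abs (f y - g y)); lra. }
  apply cont_mult; [apply continuous_const|].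
  apply cont_plus; [apply cont_plus; assumption|].
  apply (cont_comp_pt U (fun y => f y - g y) Rabs); [apply cont_minus; assumption|].
  apply Rcontinuity_abs.
Qed.

Lemma ccont_const (U : UniformSpace) (c : CC) (x : U) : ccont (fun _ : U => c) x.
Proof. apply continuous_const. Qed.

Lemma ccont_id (x : CC) : ccont (fun y : C_UniformSpace => y) x.
Proof. apply continuous_id. Qed.

Lemma ccont_plus (U : UniformSpace) (f g : U -> CC) (x : U) :
  ccont f x -> ccont g x -> ccont (fun y => (f y + g y)%C) x.
Proof.
  intros H1 H2; apply ccont_pair.
  - exact (cont_plus _ _ _ _ (ccont_Re _ _ _ H1) (ccont_Re _ _ _ H2)).
  - exact (cont_plus _ _ _ _ (ccont_Im _ _ _ H1) (ccont_Im _ _ _ H2)).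
Qed.

Lemma ccont_opp (U : UniformSpace) (f : U -> CC) (x : U) :
  ccont f x -> ccont (fun y => (- f y)%C) x.
Proof.
  intros H; apply ccont_pair.
  - exact (cont_opp _ _ _ (ccont_Re _ _ _ H)).
  - exact (cont_opp _ _ _ (ccont_Im _ _ _ H)).
Qed.

Lemma ccont_minus (U : UniformSpace) (f g : U -> CC) (x : U) :
  ccont f x -> ccont g x -> ccont (fun y => (f y - g y)%C) x.
Proof. intros H1 H2; apply ccont_plus; [|apply ccont_opp]; assumption. Qed.

Lemma ccont_mult (U : UniformSpace) (f g : U -> CC) (x : U) :
  ccont f x -> ccont g x -> ccont (fun y => (f y * g y)%C) x.
Proof.
  intros H1 H2. assert (R1 := ccont_Re _ _ _ H1). assert (R2 := ccont_Re _ _ _ H2).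
  assert (I1 := ccont_Im _ _ _ H1). assert (I2 := ccont_Im _ _ _ H2). apply ccont_pair.
  - exact (cont_minus _ _ _ _ (cont_mult _ _ _ _ R1 R2) (cont_mult _ _ _ _ I1 I2)).
  - exact (cont_plus _ _ _ _ (cont_mult _ _ _ _ R1 I2) (cont_mult _ _ _ _ I1 R2)).
Qed.

Lemma ccont_conj (U : UniformSpace) (f : U -> CC) (x : U) :
  ccont f x -> ccont (fun y => Cconj (f y)) x.
Proof.
  intros H; apply ccont_pair.
  - exact (ccont_Re _ _ _ H).
  - exact (cont_opp _ _ _ (ccont_Im _ _ _ H)).
Qed.

Lemma ccont_RtoC (U : UniformSpace) (f : U -> R) (x : U) :
  continuous f x -> ccont (fun y => RtoC (f y)) x.
Proof. intros H1; apply ccont_pair; simpl; [assumption|apply continuous_const]. Qed.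

Lemma cont_Cmod (U : UniformSpace) (f : U -> CC) (x : U) :
  ccont f x -> continuous (fun y => Cmod (f y)) x.
Proof.
  intros H. exact (cont_sqrt _ _ _ (cont_plus _ _ _ _
    (cont_pow _ _ 2 _ (ccont_Re _ _ _ H)) (cont_pow _ _ 2 _ (ccont_Im _ _ _ H)))).
Qed.

Lemma Cmod2_pos (z : CC) : z <> RtoC 0 -> fst z ^ 2 + snd z ^ 2 <> 0.
Proof.
  intros H E. apply H. destruct z as [a b]; simpl in *.
  assert (a = 0) by nra. assert (b = 0) by nra. subst; reflexivity.
Qed.

Lemma ccont_inv (U : UniformSpace) (f : U -> CC) (x : U) :
  f x <> RtoC 0 -> ccont f x -> ccont (fun y => (/ f y)%C) x.
Proof.
  intros H0 H. apply Cmod2_pos in H0.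
  assert (Rf := ccont_Re _ _ _ H). assert (If := ccont_Im _ _ _ H).
  assert (D := cont_inv _ _ _ H0 (cont_plus _ _ _ _ (cont_pow _ _ 2 _ Rf) (cont_pow _ _ 2 _ If))).
  apply ccont_pair.
  - exact (cont_mult _ _ _ _ Rf D).
  - exact (cont_mult _ _ _ _ (cont_opp _ _ _ If) D).
Qed.

Lemma ccont_pow (U : UniformSpace) (f : U -> CC) (n : nat) (x : U) :
  ccont f x -> ccont (fun y => (f y ^ n)%C) x.
Proof.
  intros H; induction n as [|n IH]; simpl.
  - apply ccont_const.
  - apply ccont_mult; assumption.
Qed.

Lemma ccont_comp (U : UniformSpace) (f : U -> CC) (g : CC -> CC) (x : U) :
  ccont f x -> ccont (g : C_UniformSpace -> CC) (f x) -> ccont (fun y => g (f y)) x.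
Proof. intros H1 H2. exact (continuous_comp f g x H1 H2). Qed.

(** The uniform structure on the plane is that of a product, with square balls; the factor sqrt 2
    compares squares with discs. From here on all limits can be argued with the modulus. *)
Lemma locally_Cmod (z : CC) (P : CC -> Prop) :
  @locally C_UniformSpace z P <->
  exists d : R, 0 < d /\ forall y, Cmod (y - z) < d -> P y.
Proof.
  split.
  - intros [e He]. exists e; split; [apply cond_pos|].
    intros y Hy. apply He. apply C_NormedModule_mixin_compat1. exact Hy.
  - intros [d [Hd H]].
    assert (Hs : 0 < sqrt 2) by (apply sqrt_lt_R0; lra).
    assert (He : 0 < d / sqrt 2) by (apply Rdiv_lt_0_compat; lra).
    exists (mkposreal _ He). intros y Hy. apply H.
    apply (C_NormedModule_mixin_compat2 z y) in Hy. simpl in Hy.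
    replace (sqrt 2 * (d / sqrt 2)) with d in Hy by (field; lra). exact Hy.
Qed.

Lemma ccont_eps (f : CC -> CC) (z : CC) :
  ccont (f : C_UniformSpace -> CC) z <->
  forall e, 0 < e -> exists d, 0 < d /\ forall y, Cmod (y - z) < d -> Cmod (f y - f z) < e.
Proof.
  split.
  - intros H e He. apply locally_Cmod.
    apply (H (fun y => Cmod (y - f z) < e)). apply locally_Cmod. exists e; auto.
  - intros H P HP. apply locally_Cmod in HP. destruct HP as [e [He HP]].
    apply locally_Cmod. destruct (H e He) as [d [Hd H']]. exists d; split; auto.
Qed.

Lemma Cis_derive_eps (f : CC -> CC) (z l : CC) :
  Cis_derive f z l <->
  forall e, 0 < e -> exists d, 0 < d /\ forall y, Cmod (y - z) < d ->
    Cmod (f y - f z - (y - z) * l) <= e * Cmod (y - z).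
Proof.
  split.
  - intros [_ H] e He.
    specialize (H z (fun P H => H) (mkposreal e He)). simpl in H.
    apply locally_C, locally_Cmod in H. exact H.
  - intros H. split.
    + apply (is_linear_scal_l (K := C_AbsRing) (V := C_NormedModule) l).
    + intros x Hx e.
      assert (Hxz : z = x) by exact (is_filter_lim_locally_unique (K := C_AbsRing) (V := AbsRing_NormedModule C_AbsRing) _ _ Hx).
      subst x. apply locally_C, locally_Cmod.
      destruct (H e (cond_pos e)) as [d [Hd H']]. exists d; split; auto.
Qed.

(* Caratheodory's form of differentiability reduces the rules of calculus to
   those for continuous functions. *)
Lemma Cis_derive_slope (f : CC -> CC) (z l : CC) :
  Cis_derive f z l <->
  exists q : CC -> CC, ccont (q : C_UniformSpace -> CC) z /\ q z = l /\
    forall y, f y = (f z + q y * (y - z))%C.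
Proof.
  rewrite Cis_derive_eps. split.
  - intros H.
    exists (fun y => if Ceq_dec y z then l else ((f y - f z) / (y - z))%C).
    split; [|split].
    + apply ccont_eps. intros e He.
      destruct (H (e / 2)) as [d [Hd H']]; [lra|]. exists d; split; [exact Hd|].
      intros y Hy. destruct (Ceq_dec z z) as [_|n]; [|now destruct n].
      destruct (Ceq_dec y z) as [->|n].
      * replace (l - l)%C with (RtoC 0) by ring. rewrite Cmod_0; exact He.
      * assert (n' := Cminus_eq_contra _ _ n).
        assert (Hp := proj1 (Cmod_gt_0 _) n').
        replace ((f y - f z) / (y - z) - l)%C with ((f y - f z - (y - z) * l) / (y - z))%C
          by (field; exact n').
        rewrite Cmod_div by exact n'. specialize (H' y Hy).
        apply Rle_lt_trans with (e / 2); [|lra].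
        apply Rle_div_l; assumption.
    + destruct (Ceq_dec z z) as [_|n]; [reflexivity|now destruct n].
    + intros y. destruct (Ceq_dec y z) as [->|n]; [ring|].
      field. apply Cminus_eq_contra, n.
  - intros [q [Hq [Hl H]]] e He.
    destruct (proj1 (ccont_eps q z) Hq e He) as [d [Hd H']].
    exists d; split; [exact Hd|]. intros y Hy. rewrite (H y), <- Hl.
    replace (f z + q y * (y - z) - f z - (y - z) * q z)%C with ((q y - q z) * (y - z))%C by ring.
    rewrite Cmod_mult. apply Rmult_le_compat_r; [apply Cmod_ge_0|]. left; auto.
Qed.

Lemma Cis_derive_ext_loc (f g : CC -> CC) (z l : CC) :
  (exists d, 0 < d /\ forall y, Cmod (y - z) < d -> f y = g y) ->
  Cis_derive f z l -> Cis_derive g z l.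
Proof.
  intros [d0 [Hd0 E]] H. rewrite Cis_derive_eps in *. intros e He.
  destruct (H e He) as [d [Hd H']].
  exists (Rmin d d0); split; [apply Rmin_glb_lt; assumption|].
  intros y Hy. rewrite <- !E; [apply H'| |].
  - eapply Rlt_le_trans; [exact Hy|apply Rmin_l].
  - replace (z - z)%C with (RtoC 0) by ring. rewrite Cmod_0; exact Hd0.
  - eapply Rlt_le_trans; [exact Hy|apply Rmin_r].
Qed.

Lemma Cis_derive_cont (f : CC -> CC) (z l : CC) :
  Cis_derive f z l -> ccont (f : C_UniformSpace -> CC) z.
Proof.
  intros H. apply Cis_derive_slope in H. destruct H as [q [Hq [Hl H]]].
  apply (continuous_ext (fun y => (f z + q y * (y - z))%C)).
  - intros y; symmetry; apply H.
  - apply (ccont_plus _ (fun _ => f z) (fun y => (q y * (y - z))%C)); [apply ccont_const|].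
    apply (ccont_mult _ q (fun y => (y - z)%C)); [exact Hq|].
    apply (ccont_minus _ (fun y => y) (fun _ => z)); [apply ccont_id|apply ccont_const].
Qed.

Lemma Cis_derive_const (c z : CC) : Cis_derive (fun _ => c) z (RtoC 0).
Proof.
  apply Cis_derive_slope. exists (fun _ => RtoC 0).
  split; [apply ccont_const|split; [reflexivity|intros; ring]].
Qed.

Lemma Cis_derive_id (z : CC) : Cis_derive (fun y => y) z (RtoC 1).
Proof.
  apply Cis_derive_slope. exists (fun _ => RtoC 1).
  split; [apply ccont_const|split; [reflexivity|intros; ring]].
Qed.

Lemma Cis_derive_plus (f g : CC -> CC) (z l m : CC) :
  Cis_derive f z l -> Cis_derive g z m -> Cis_derive (fun y => (f y + g y)%C) z (l + m)%C.
Proof.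
  intros H1 H2. apply Cis_derive_slope in H1, H2. apply Cis_derive_slope.
  destruct H1 as [q [Hq [Hl H1]]], H2 as [p [Hp [Hm H2]]].
  exists (fun y => (q y + p y)%C). split; [apply (ccont_plus _ q p); assumption|].
  split; [now rewrite Hl, Hm|]. intros y. rewrite (H1 y), (H2 y). ring.
Qed.

Lemma Cis_derive_mult (f g : CC -> CC) (z l m : CC) :
  Cis_derive f z l -> Cis_derive g z m ->
  Cis_derive (fun y => (f y * g y)%C) z (l * g z + f z * m)%C.
Proof.
  intros H1 H2. assert (Hg := Cis_derive_cont _ _ _ H2).
  apply Cis_derive_slope in H1, H2. apply Cis_derive_slope.
  destruct H1 as [q [Hq [Hl H1]]], H2 as [p [Hp [Hm H2]]].
  exists (fun y => (q y * g y + f z * p y)%C). split; [|split].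
  - apply (ccont_plus _ (fun y => (q y * g y)%C) (fun y => (f z * p y)%C)).
    + apply (ccont_mult _ q g); assumption.
    + apply (ccont_mult _ (fun _ => f z) p); [apply ccont_const|assumption].
  - now rewrite Hl, Hm.
  - intros y. rewrite (H1 y). rewrite (H2 y) at 1 2. ring.
Qed.

Lemma Cis_derive_comp (f g : CC -> CC) (z l m : CC) :
  Cis_derive f (g z) l -> Cis_derive g z m -> Cis_derive (fun y => f (g y)) z (l * m)%C.
Proof.
  intros H1 H2. assert (Hg := Cis_derive_cont _ _ _ H2).
  apply Cis_derive_slope in H1, H2. apply Cis_derive_slope.
  destruct H1 as [q [Hq [Hl H1]]], H2 as [p [Hp [Hm H2]]].
  exists (fun y => (q (g y) * p y)%C). split; [|split].
  - apply (ccont_mult _ (fun y => q (g y)) p); [|assumption].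
    apply (ccont_comp _ g q); assumption.
  - now rewrite Hl, Hm.
  - intros y. rewrite (H1 (g y)). rewrite (H2 y) at 2. ring.
Qed.

Lemma Cis_derive_inv (z : CC) : z <> RtoC 0 -> Cis_derive (fun y => (/ y)%C) z (- / (z * z))%C.
Proof.
  intros Hz. apply Cis_derive_slope.
  (* At [y = 0] the slope must reproduce the default value of [/ 0], whatever it is. Since 0 stays
     away from [z], continuity at [z] only sees the other branch. *)
  exists (fun y => if Ceq_dec y (RtoC 0) then ((/ y - / z) / (y - z))%C else (- (/ y * / z))%C).
  split; [|split].
  - intros P HP.
    assert (H : ccont (fun y : C_UniformSpace => (- (/ y * / z))%C) z).
    { apply (ccont_opp _ (fun y => (/ y * / z)%C)).
      apply (ccont_mult _ (fun y => (/ y)%C) (fun _ => (/ z)%C)); [|apply ccont_const].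
      apply (ccont_inv _ (fun y => y)); [exact Hz|apply ccont_id]. }
    destruct (Ceq_dec z (RtoC 0)) as [E|_]; [contradiction|].
    specialize (H P HP). unfold filtermap in *.
    apply locally_Cmod in H. destruct H as [d [Hd H]].
    apply locally_Cmod. exists (Rmin d (Cmod z)).
    split; [apply Rmin_glb_lt; [exact Hd|apply Cmod_gt_0; exact Hz]|].
    intros y Hy. destruct (Ceq_dec y (RtoC 0)) as [->|n].
    + exfalso. replace (0 - z)%C with (- z)%C in Hy by ring. rewrite Cmod_opp in Hy.
      assert (Rmin d (Cmod z) <= Cmod z) by apply Rmin_r. lra.
    + apply H. eapply Rlt_le_trans; [exact Hy|apply Rmin_l].
  - destruct (Ceq_dec z (RtoC 0)) as [E|_]; [contradiction|].
    field. exact Hz.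
  - intros y. destruct (Ceq_dec y (RtoC 0)) as [->|n].
    + assert (E : (0 - z)%C <> RtoC 0).
      { intros E. apply Hz. replace z with (- (0 - z))%C by ring. rewrite E. ring. }
      unfold Cdiv. generalize (/ 0)%C as w; intros w.
      rewrite <- Cmult_assoc, Cinv_l by exact E. ring.
    + field. split; assumption.
Qed.

(** * Goursat's theorem for rectangles *)

Definition CInt (u : R -> CC) (a b : R) : CC :=
  (RInt (fun t => Re (u t)) a b, RInt (fun t => Im (u t)) a b).

Definition cont_on (u : R -> CC) (a b : R) : Prop :=
  forall t, a <= t <= b -> ccont u t.

Lemma ex_RInt_cont (u : R -> R) (a b : R) : a <= b ->
  (forall t, a <= t <= b -> continuous u t) -> ex_RInt u a b.
Proof.
  intros Hab H. apply (ex_RInt_continuous (V := R_CompleteNormedModule)).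
  rewrite Rmin_left, Rmax_right by assumption. exact H.
Qed.

Lemma ex_RInt_Re (u : R -> CC) (a b : R) : a <= b -> cont_on u a b ->
  ex_RInt (fun t => Re (u t)) a b.
Proof. intros; apply ex_RInt_cont; [assumption|]. intros; apply ccont_Re; auto. Qed.

Lemma ex_RInt_Im (u : R -> CC) (a b : R) : a <= b -> cont_on u a b ->
  ex_RInt (fun t => Im (u t)) a b.
Proof. intros; apply ex_RInt_cont; [assumption|]. intros; apply ccont_Im; auto. Qed.

Lemma RInt_ext_le (f g : R -> R) (a b : R) : a <= b ->
  (forall t, a <= t <= b -> f t = g t) -> RInt f a b = RInt g a b :> R.
Proof.
  intros Hab H. apply RInt_ext. rewrite Rmin_left, Rmax_right by assumption.
  intros; apply H; lra.
Qed.

Lemma CInt_ext (u v : R -> CC) (a b : R) : a <= b ->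
  (forall t, a <= t <= b -> u t = v t) -> CInt u a b = CInt v a b.
Proof.
  intros Hab H. unfold CInt. f_equal; apply RInt_ext_le; auto; intros; now rewrite H.
Qed.

Lemma RInt_plusR (f g : R -> R) (a b : R) : ex_RInt f a b -> ex_RInt g a b ->
  RInt (fun t => f t + g t) a b = RInt f a b + RInt g a b :> R.
Proof. exact (RInt_plus f g a b). Qed.

Lemma RInt_minusR (f g : R -> R) (a b : R) : ex_RInt f a b -> ex_RInt g a b ->
  RInt (fun t => f t - g t) a b = RInt f a b - RInt g a b :> R.
Proof. exact (RInt_minus f g a b). Qed.

Lemma RInt_scalR (f : R -> R) (k a b : R) : ex_RInt f a b ->
  RInt (fun t => k * f t) a b = k * RInt f a b :> R.
Proof. exact (RInt_scal f a b k). Qed.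

Lemma ex_RInt_minusR (f g : R -> R) (a b : R) : ex_RInt f a b -> ex_RInt g a b ->
  ex_RInt (fun t => f t - g t) a b.
Proof. exact (ex_RInt_minus f g a b). Qed.

Lemma ex_RInt_scalR (f : R -> R) (k a b : R) : ex_RInt f a b ->
  ex_RInt (fun t => k * f t) a b.
Proof. exact (ex_RInt_scal f a b k). Qed.

Lemma RInt_constR (k a b : R) : RInt (fun _ => k) a b = (b - a) * k :> R.
Proof. exact (RInt_const a b k). Qed.

Lemma CInt_plus (u v : R -> CC) (a b : R) : a <= b -> cont_on u a b -> cont_on v a b ->
  CInt (fun t => (u t + v t)%C) a b = (CInt u a b + CInt v a b)%C.
Proof.
  intros Hab H1 H2. apply injective_projections.
  - exact (RInt_plusR (fun t => Re (u t)) (fun t => Re (v t)) a b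
      (ex_RInt_Re u a b Hab H1) (ex_RInt_Re v a b Hab H2)).
  - exact (RInt_plusR (fun t => Im (u t)) (fun t => Im (v t)) a b
      (ex_RInt_Im u a b Hab H1) (ex_RInt_Im v a b Hab H2)).
Qed.

Lemma CInt_scal (c : CC) (u : R -> CC) (a b : R) : a <= b -> cont_on u a b ->
  CInt (fun t => (c * u t)%C) a b = (c * CInt u a b)%C.
Proof.
  intros Hab H. assert (H1 := ex_RInt_Re u a b Hab H). assert (H2 := ex_RInt_Im u a b Hab H).
  unfold CInt, Cmult; simpl. f_equal.
  - etransitivity.
    + apply (RInt_minusR (fun t => fst c * Re (u t)) (fun t => snd c * Im (u t)));
      apply ex_RInt_scalR; assumption.
    + f_equal; apply RInt_scalR; assumption.
  - etransitivity.
    + apply (RInt_plusR (fun t => fst c * Im (u t)) (fun t => snd c * Re (u t)));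
      apply ex_RInt_scalR; assumption.
    + f_equal; apply RInt_scalR; assumption.
Qed.

Lemma cont_on_mult (u v : R -> CC) (a b : R) : cont_on u a b -> cont_on v a b ->
  cont_on (fun t => (u t * v t)%C) a b.
Proof. intros H1 H2 t Ht. apply (ccont_mult _ u v); auto. Qed.

Lemma cont_on_const (c : CC) (a b : R) : cont_on (fun _ => c) a b.
Proof. intros t Ht. apply ccont_const. Qed.

Lemma cont_on_scal (c : CC) (u : R -> CC) (a b : R) : cont_on u a b ->
  cont_on (fun t => (c * u t)%C) a b.
Proof. intros H. apply (cont_on_mult (fun _ => c) u); [apply cont_on_const|exact H]. Qed.

Lemma cont_on_sub (u : R -> CC) (a b c d : R) : a <= c -> d <= b ->
  cont_on u a b -> cont_on u c d.
Proof. intros H1 H2 H t Ht. apply H; lra. Qed.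

Lemma CInt_minus (u v : R -> CC) (a b : R) : a <= b -> cont_on u a b -> cont_on v a b ->
  CInt (fun t => (u t - v t)%C) a b = (CInt u a b - CInt v a b)%C.
Proof.
  intros Hab H1 H2. apply injective_projections.
  - exact (RInt_minusR (fun t => Re (u t)) (fun t => Re (v t)) a b
      (ex_RInt_Re u a b Hab H1) (ex_RInt_Re v a b Hab H2)).
  - exact (RInt_minusR (fun t => Im (u t)) (fun t => Im (v t)) a b
      (ex_RInt_Im u a b Hab H1) (ex_RInt_Im v a b Hab H2)).
Qed.

Lemma CInt_Chasles (u : R -> CC) (a m b : R) : a <= m <= b -> cont_on u a b ->
  CInt u a b = (CInt u a m + CInt u m b)%C.
Proof.
  intros Hm H. assert (cont_on u a m) by (apply (cont_on_sub u a b); auto; lra).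
  assert (cont_on u m b) by (apply (cont_on_sub u a b); auto; lra).
  apply injective_projections; symmetry.
  - apply (RInt_Chasles (V := R_CompleteNormedModule) (fun t => Re (u t)));
    apply ex_RInt_Re; auto; lra.
  - apply (RInt_Chasles (V := R_CompleteNormedModule) (fun t => Im (u t)));
    apply ex_RInt_Im; auto; lra.
Qed.

Lemma CInt_const (c : CC) (a b : R) : CInt (fun _ => c) a b = (RtoC (b - a) * c)%C.
Proof.
  unfold CInt, Cmult, RtoC; simpl. rewrite !RInt_constR.
  unfold Re, Im. f_equal; ring.
Qed.

(** After the rotation by conj z / |z| the number becomes real. Applied to an integral, this reduces
    its triangle inequality to the monotonicity of real integrals. *)
Lemma Cmod_le_test (z : CC) (M : R) : 0 <= M ->
  (forall w, Cmod w = 1 -> Re (w * z) <= M) -> Cmod z <= M.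
Proof.
  intros HM H. destruct (Ceq_dec z (RtoC 0)) as [->|n]; [now rewrite Cmod_0|].
  assert (Hp := proj1 (Cmod_gt_0 z) n).
  assert (nc : RtoC (Cmod z) <> RtoC 0) by (intros E; apply RtoC_inj in E; lra).
  specialize (H (Cconj z / Cmod z)%C).
  rewrite Cmod_div, Cmod_conj, Cmod_R, Rabs_right in H by (assumption || lra).
  replace (Cconj z / Cmod z * z)%C with (RtoC (Cmod z)) in H.
  - apply H. field; lra.
  - replace (Cconj z / Cmod z * z)%C with (z * Cconj z / Cmod z)%C by (field; exact nc).
    rewrite <- Cmod2_conj, RtoC_pow. field. exact nc.
Qed.

Lemma Re_le_Cmod (z : CC) : Re z <= Cmod z.
Proof. eapply Rle_trans; [apply Rle_abs|apply re_le_Cmod]. Qed.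

Lemma Cmod_CInt_le (u : R -> CC) (v : R -> R) (a b : R) : a <= b -> cont_on u a b ->
  ex_RInt v a b -> (forall t, a <= t <= b -> Cmod (u t) <= v t) ->
  Cmod (CInt u a b) <= RInt v a b.
Proof.
  intros Hab H Hv Huv.
  apply Cmod_le_test.
  - apply RInt_ge_0; auto. intros; eapply Rle_trans; [apply Cmod_ge_0|apply Huv; lra].
  - intros w Hw. rewrite <- CInt_scal by assumption. unfold CInt; simpl.
    apply RInt_le; auto.
    + apply (ex_RInt_Re (fun t => (w * u t)%C)); [assumption|apply cont_on_scal, H].
    + intros t Ht. apply Rle_trans with (Cmod (w * u t)%C); [exact (Re_le_Cmod (w * u t)%C)|]. rewrite Cmod_mult, Hw, Rmult_1_l.
      apply Huv; lra.
Qed.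

Lemma Cmod_CInt_bound (u : R -> CC) (M a b : R) : a <= b -> cont_on u a b ->
  (forall t, a <= t <= b -> Cmod (u t) <= M) -> Cmod (CInt u a b) <= M * (b - a).
Proof.
  intros Hab H HM.
  assert (E : RInt (fun _ => M) a b = M * (b - a) :> R) by (rewrite RInt_constR; ring).
  rewrite <- E.
  apply Cmod_CInt_le; auto. apply ex_RInt_const.
Qed.

Definition rect_diff (g : CC -> CC) (a b c d : R) : Prop :=
  forall s t, a <= s <= b -> c <= t <= d -> exists l, Cis_derive g (s, t) l.

(** The contour integral over the boundary of the rectangle, counterclockwise; dz = i dt on the
    vertical sides. *)
Definition rect_int (g : CC -> CC) (a b c d : R) : CC :=
  (CInt (fun s => g (s, c)) a b + Ci * CInt (fun t => g (b, t)) c d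
   - CInt (fun s => g (s, d)) a b - Ci * CInt (fun t => g (a, t)) c d)%C.

Definition rect_cont (g : CC -> CC) (a b c d : R) : Prop :=
  forall s t, a <= s <= b -> c <= t <= d -> ccont (g : C_UniformSpace -> CC) (s, t).

Lemma rect_diff_cont (g : CC -> CC) (a b c d : R) :
  rect_diff g a b c d -> rect_cont g a b c d.
Proof. intros H s t Hs Ht. destruct (H s t Hs Ht) as [l Hl]. eapply Cis_derive_cont, Hl. Qed.

Lemma rect_cont_hor (g : CC -> CC) (a b c d t : R) :
  rect_cont g a b c d -> c <= t <= d -> cont_on (fun s => g (s, t)) a b.
Proof.
  intros H Ht s Hs. apply (ccont_comp _ (fun s => (s, t)) g).
  - apply ccont_pair; simpl; [apply continuous_id|apply continuous_const].
  - apply H; assumption.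
Qed.

Lemma rect_cont_ver (g : CC -> CC) (a b c d s : R) :
  rect_cont g a b c d -> a <= s <= b -> cont_on (fun t => g (s, t)) c d.
Proof.
  intros H Hs t Ht. apply (ccont_comp _ (fun t => (s, t)) g).
  - apply ccont_pair; simpl; [apply continuous_const|apply continuous_id].
  - apply H; assumption.
Qed.

Lemma rect_cont_sub (g : CC -> CC) (a b c d a' b' c' d' : R) :
  a <= a' -> b' <= b -> c <= c' -> d' <= d ->
  rect_cont g a b c d -> rect_cont g a' b' c' d'.
Proof. intros ? ? ? ? H s t Hs Ht. apply H; lra. Qed.

Lemma rect_int_hsplit (g : CC -> CC) (a m b c d : R) : a <= m <= b -> c <= d ->
  rect_cont g a b c d ->
  rect_int g a b c d = (rect_int g a m c d + rect_int g m b c d)%C.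
Proof.
  intros Hm Hc H. unfold rect_int.
  rewrite (CInt_Chasles (fun s => g (s, c)) a m b),
    (CInt_Chasles (fun s => g (s, d)) a m b); try assumption; try ring.
  all: apply (rect_cont_hor g a b c d); auto; lra.
Qed.

Lemma rect_int_vsplit (g : CC -> CC) (a b c m d : R) : a <= b -> c <= m <= d ->
  rect_cont g a b c d ->
  rect_int g a b c d = (rect_int g a b c m + rect_int g a b m d)%C.
Proof.
  intros Hm Hc H. unfold rect_int.
  rewrite (CInt_Chasles (fun t => g (a, t)) c m d),
    (CInt_Chasles (fun t => g (b, t)) c m d); try assumption; try ring.
  all: apply (rect_cont_ver g a b c d); auto; lra.
Qed.

Lemma rect_int_quarter (g : CC -> CC) (a b c d : R) : a <= b -> c <= d ->
  rect_cont g a b c d ->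
  let m := (a + b) / 2 in let n := (c + d) / 2 in
  rect_int g a b c d = (rect_int g a m c n + rect_int g a m n d
                        + rect_int g m b c n + rect_int g m b n d)%C.
Proof.
  intros Hab Hcd H m n. assert (a <= m <= b) by (unfold m; lra).
  assert (c <= n <= d) by (unfold n; lra).
  rewrite (rect_int_hsplit g a m b c d) by assumption.
  rewrite (rect_int_vsplit g a m c n d), (rect_int_vsplit g m b c n d); try lra; try ring.
  all: apply (rect_cont_sub g a b c d); auto; lra.
Qed.

Lemma CInt_affine (p q : CC) (a b : R) : a <= b ->
  CInt (fun s => (p + q * RtoC s)%C) a b
  = (RtoC (b - a) * p + q * RtoC ((b * b - a * a) / 2))%C.
Proof.
  intros Hab.
  assert (Hc : cont_on (fun s => RtoC s) a b).
  { intros t _. apply ccont_RtoC, continuous_id. }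
  rewrite (CInt_plus (fun _ => p) (fun s => (q * RtoC s)%C));
    [|assumption|apply cont_on_const|apply cont_on_scal, Hc].
  rewrite CInt_const, CInt_scal by assumption. f_equal. f_equal.
  unfold CInt, RtoC; simpl. f_equal.
  - apply is_RInt_unique.
    replace ((b * b - a * a) / 2) with (b * b / 2 - a * a / 2) by field.
    apply (is_RInt_derive (fun x => x * x / 2) (fun x => x) a b).
    + intros x _. auto_derive; [exact I|field].
    + intros x _. apply continuous_id.
  - rewrite RInt_constR. apply Rmult_0_r.
Qed.

(** Affine functions have an explicit primitive. They can be subtracted freely, so that Goursat's
    estimate only meets the first-order remainder. *)
Lemma rect_int_affine (p q : CC) (a b c d : R) : a <= b -> c <= d ->
  rect_int (fun z => (p + q * z)%C) a b c d = RtoC 0.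
Proof.
  intros Hab Hcd. unfold rect_int.
  rewrite (CInt_ext (fun s => (p + q * (s, c))%C)
     (fun s => ((p + q * (Ci * RtoC c)) + q * RtoC s)%C) a b Hab).
  2:{ intros t _. apply injective_projections; simpl; ring. }
  rewrite (CInt_ext (fun s => (p + q * (s, d))%C)
     (fun s => ((p + q * (Ci * RtoC d)) + q * RtoC s)%C) a b Hab).
  2:{ intros t _. apply injective_projections; simpl; ring. }
  rewrite (CInt_ext (fun t => (p + q * (b, t))%C)
     (fun t => ((p + q * RtoC b) + (q * Ci) * RtoC t)%C) c d Hcd).
  2:{ intros t _. apply injective_projections; simpl; ring. }
  rewrite (CInt_ext (fun t => (p + q * (a, t))%C)
     (fun t => ((p + q * RtoC a) + (q * Ci) * RtoC t)%C) c d Hcd).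
  2:{ intros t _. apply injective_projections; simpl; ring. }
  rewrite !CInt_affine by assumption.
  apply injective_projections; simpl; field.
Qed.

Lemma rect_int_minus (g h : CC -> CC) (a b c d : R) : a <= b -> c <= d ->
  rect_cont g a b c d -> rect_cont h a b c d ->
  rect_int (fun z => (g z - h z)%C) a b c d = (rect_int g a b c d - rect_int h a b c d)%C.
Proof.
  intros Hab Hcd Hg Hh. unfold rect_int.
  assert (Lc : c <= c <= d) by lra. assert (Ld : c <= d <= d) by lra.
  assert (La : a <= a <= b) by lra. assert (Lb : a <= b <= b) by lra.
  rewrite (CInt_minus (fun s => g (s, c)) (fun s => h (s, c)) a b Hab
      (rect_cont_hor g a b c d c Hg Lc) (rect_cont_hor h a b c d c Hh Lc)),
    (CInt_minus (fun s => g (s, d)) (fun s => h (s, d)) a b Hab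
      (rect_cont_hor g a b c d d Hg Ld) (rect_cont_hor h a b c d d Hh Ld)),
    (CInt_minus (fun t => g (a, t)) (fun t => h (a, t)) c d Hcd
      (rect_cont_ver g a b c d a Hg La) (rect_cont_ver h a b c d a Hh La)),
    (CInt_minus (fun t => g (b, t)) (fun t => h (b, t)) c d Hcd
      (rect_cont_ver g a b c d b Hg Lb) (rect_cont_ver h a b c d b Hh Lb)).
  ring.
Qed.

Lemma rect_int_bound (g : CC -> CC) (M a b c d : R) : a <= b -> c <= d ->
  rect_cont g a b c d ->
  (forall s t, a <= s <= b -> c <= t <= d -> Cmod (g (s, t)) <= M) ->
  Cmod (rect_int g a b c d) <= 2 * M * ((b - a) + (d - c)).
Proof.
  intros Hab Hcd Hg HM. unfold rect_int.
  assert (B1 : Cmod (CInt (fun s => g (s, c)) a b) <= M * (b - a)).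
  { apply Cmod_CInt_bound; auto. eapply rect_cont_hor; eauto; lra. intros; apply HM; lra. }
  assert (B2 : Cmod (CInt (fun s => g (s, d)) a b) <= M * (b - a)).
  { apply Cmod_CInt_bound; auto. eapply rect_cont_hor; eauto; lra. intros; apply HM; lra. }
  assert (B3 : Cmod (CInt (fun t => g (a, t)) c d) <= M * (d - c)).
  { apply Cmod_CInt_bound; auto. eapply rect_cont_ver; eauto; lra. intros; apply HM; lra. }
  assert (B4 : Cmod (CInt (fun t => g (b, t)) c d) <= M * (d - c)).
  { apply Cmod_CInt_bound; auto. eapply rect_cont_ver; eauto; lra. intros; apply HM; lra. }
  unfold Cminus.
  eapply Rle_trans; [apply Cmod_triangle|]. rewrite Cmod_opp.
  eapply Rle_trans; [apply Rplus_le_compat_r, Cmod_triangle|]. rewrite Cmod_opp.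
  eapply Rle_trans; [apply Rplus_le_compat_r, Rplus_le_compat_r, Cmod_triangle|].
  rewrite !Cmod_mult, Cmod_Ci. lra.
Qed.

Definition rect : Type := (R * R * R * R)%type.

Definition rect_norm (g : CC -> CC) (q : rect) : R :=
  let '(a, b, c, d) := q in Cmod (rect_int g a b c d).

(** Selects a quarter that carries at least one fourth of the contour integral. The last branch is
    reached only when the three others fail, and then the triangle inequality forces the fourth
    quarter to qualify. *)
Definition rect_step (g : CC -> CC) (q : rect) : rect :=
  let '(a, b, c, d) := q in
  let m := (a + b) / 2 in let n := (c + d) / 2 in
  let v := rect_norm g q / 4 in
  if Rle_dec v (rect_norm g (a, m, c, n)) then (a, m, c, n)
  else if Rle_dec v (rect_norm g (a, m, n, d)) then (a, m, n, d)
  else if Rle_dec v (rect_norm g (m, b, c, n)) then (m, b, c, n)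
  else (m, b, n, d).

Definition rect_in (g : CC -> CC) (q q' : rect) : Prop :=
  let '(a, b, c, d) := q in let '(a', b', c', d') := q' in
  a <= a' /\ b' <= b /\ c <= c' /\ d' <= d /\ a' <= b' /\ c' <= d' /\
  b' - a' = (b - a) / 2 /\ d' - c' = (d - c) / 2 /\ rect_norm g q / 4 <= rect_norm g q'.

Lemma rect_step_in (g : CC -> CC) (a b c d : R) : a <= b -> c <= d ->
  rect_cont g a b c d -> rect_in g (a, b, c, d) (rect_step g (a, b, c, d)).
Proof.
  intros Hab Hcd H. unfold rect_step.
  set (m := (a + b) / 2). set (n := (c + d) / 2).
  assert (Q := rect_int_quarter g a b c d Hab Hcd H). fold m n in Q. cbv zeta in Q.
  destruct (Rle_dec _ _) as [L1|L1];
    [|destruct (Rle_dec _ _) as [L2|L2]; [|destruct (Rle_dec _ _) as [L3|L3]]].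
  1-3: unfold rect_in; repeat split; unfold m, n; try lra; assumption.
  unfold rect_in; repeat split; unfold m, n; try lra.
  fold m n. unfold rect_norm in *.
  assert (T : Cmod (rect_int g a b c d) <= Cmod (rect_int g a m c n) + Cmod (rect_int g a m n d)
            + Cmod (rect_int g m b c n) + Cmod (rect_int g m b n d)).
  { rewrite Q. eapply Rle_trans; [apply Cmod_triangle|]. apply Rplus_le_compat_r.
    eapply Rle_trans; [apply Cmod_triangle|]. apply Rplus_le_compat_r. apply Cmod_triangle. }
  lra.
Qed.

(** The selected quarters shrink to a point where [g] differs from an affine function by little o of
    the distance, hence the integrals are little o of 4^(-k). A nonzero contour integral, however,
    loses at most a factor 4 per step. *)
Theorem Goursat (g : CC -> CC) (a b c d : R) : a <= b -> c <= d ->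
  rect_diff g a b c d -> rect_int g a b c d = RtoC 0.
Proof.
  intros Hab Hcd Hd. assert (Hc := rect_diff_cont g a b c d Hd).
  apply Cmod_eq_0. destruct (Rle_lt_or_eq_dec _ _ (Cmod_ge_0 (rect_int g a b c d))) as [Hp|E];
    [exfalso|symmetry; exact E].
  set (q := fun k => Nat.iter k (rect_step g) (a, b, c, d)).
  set (qa := fun k => fst (fst (fst (q k)))). set (qb := fun k => snd (fst (fst (q k)))).
  set (qc := fun k => snd (fst (q k))). set (qd := fun k => snd (q k)).
  assert (Eq : forall k, q k = (qa k, qb k, qc k, qd k)).
  { intros k. unfold qa, qb, qc, qd. now destruct (q k) as [[[? ?] ?] ?]. }
  assert (Hin : forall k, a <= qa k /\ qb k <= b /\ c <= qc k /\ qd k <= d /\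
     qa k <= qb k /\ qc k <= qd k /\ qb k - qa k = (b - a) / 2 ^ k /\
     qd k - qc k = (d - c) / 2 ^ k /\ Cmod (rect_int g a b c d) / 4 ^ k <= rect_norm g (q k)
     /\ rect_in g (q k) (q (S k))).
  { assert (Hs : forall k, rect_cont g (qa k) (qb k) (qc k) (qd k) -> qa k <= qb k -> qc k <= qd k ->
       rect_in g (q k) (q (S k))).
    { intros k H1 H2 H3. change (q (S k)) with (rect_step g (q k)).
      rewrite Eq. apply rect_step_in; assumption. }
    induction k as [|k IH].
    - assert (S0 : rect_in g (q 0%nat) (q 1%nat)) by (apply Hs; assumption).
      unfold qa, qb, qc, qd, q; simpl. repeat split; try lra. exact S0.
    - destruct IH as (I1 & I2 & I3 & I4 & I5 & I6 & I7 & I8 & I9 & I10).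
      rewrite (Eq k), (Eq (S k)) in I10. unfold rect_in in I10.
      destruct I10 as (J1 & J2 & J3 & J4 & J5 & J6 & J7 & J8 & J9).
      rewrite <- (Eq k), <- (Eq (S k)) in J9.
      assert (Hp2 : 2 ^ k <> 0) by (apply pow_nonzero; lra).
      assert (Hp4 : 4 ^ k <> 0) by (apply pow_nonzero; lra).
      repeat split; try lra.
      + rewrite J7, I7. simpl; field; assumption.
      + rewrite J8, I8. simpl; field; assumption.
      + apply Rle_trans with (rect_norm g (q k) / 4); [|exact J9].
        replace (Cmod (rect_int g a b c d) / 4 ^ S k)
          with (Cmod (rect_int g a b c d) / 4 ^ k / 4) by (simpl; field; assumption).
        lra.
      + apply Hs; try lra. apply (rect_cont_sub g a b c d); auto; lra. }
  assert (Hmono : forall k j, qa k <= qa (k + j)%nat /\ qb (k + j)%nat <= qb k /\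
            qc k <= qc (k + j)%nat /\ qd (k + j)%nat <= qd k).
  { intros k j; induction j as [|j IH]; [rewrite Nat.add_0_r; lra|].
    replace (k + S j)%nat with (S (k + j)) by lia.
    destruct (Hin (k + j)%nat) as (_ & _ & _ & _ & _ & _ & _ & _ & _ & J).
    rewrite (Eq (k + j)%nat), (Eq (S (k + j))) in J. unfold rect_in in J. lra. }
  assert (Hlim : forall (u v : nat -> R), (forall k j, u k <= u (k + j)%nat) ->
     (forall k j, v (k + j)%nat <= v k) -> (forall k, u k <= v k) ->
     exists x, forall k, u k <= x <= v k).
  { intros u v Hu Hv Huv.
    assert (Hle : forall j k, u j <= v k).
    { intros j k. apply Rle_trans with (u (j + k)%nat); [apply Hu|].
      apply Rle_trans with (v (j + k)%nat); [apply Huv|]. rewrite Nat.add_comm. apply Hv. }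
    destruct (completeness (fun x => exists k, x = u k)) as [x [Hx1 Hx2]].
    - exists (v 0%nat). intros y [k ->]. apply Hle.
    - exists (u 0%nat), 0%nat; reflexivity.
    - exists x; intros k; split.
      + apply Hx1. now exists k.
      + apply Hx2. intros y [j ->]. apply Hle. }
  destruct (Hlim qa qb) as [x Hx]; [apply Hmono|apply Hmono|apply Hin|].
  destruct (Hlim qc qd) as [y Hy]; [apply Hmono|apply Hmono|apply Hin|].
  destruct (Hd x y (Hx 0%nat) (Hy 0%nat)) as [l Hl].
  rewrite Cis_derive_eps in Hl.
  set (I0 := Cmod (rect_int g a b c d)) in *.
  set (L := (b - a) + (d - c)).
  assert (HL : 0 <= L) by (unfold L; lra).
  (* The remainder is at most [e] times the half perimeter L / 2^k, so the k-th integral is at most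
     2 e L^2 / 4^k. This [e] makes 2 e L^2 < I0; the added 1 covers a degenerate rectangle. *)
  set (e := I0 / (4 * (L * L + 1))).
  assert (He : 0 < e) by (apply Rdiv_lt_0_compat; [assumption|nra]).
  destruct (Hl e He) as [r [Hr Hlr]].
  assert (Hk : exists k, L / 2 ^ k < r).
  { destruct (pow_lt_1_zero (1/2)) with (y := r / (L + 1)) as [N HN].
    - rewrite Rabs_right; lra.
    - apply Rdiv_lt_0_compat; lra.
    - exists N. specialize (HN N (le_n N)).
      assert (P2 : 0 < 2 ^ N) by (apply pow_lt; lra).
      rewrite Rabs_right in HN by (apply Rle_ge, pow_le; lra).
      unfold Rdiv in HN at 1. rewrite Rmult_1_l, pow_inv in HN.
      unfold Rdiv. apply Rle_lt_trans with ((L + 1) * / 2 ^ N).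
      + apply Rmult_le_compat_r; [|lra]. left; apply Rinv_0_lt_compat; exact P2.
      + apply Rmult_lt_reg_l with (/ (L + 1)); [apply Rinv_0_lt_compat; lra|].
        rewrite <- Rmult_assoc, Rinv_l, Rmult_1_l by lra. unfold Rdiv in HN. lra. }
  destruct Hk as [k Hk].
  destruct (Hin k) as (I1 & I2 & I3 & I4 & I5 & I6 & I7 & I8 & I9 & _).
  assert (P2 : 0 < 2 ^ k) by (apply pow_lt; lra).
  set (w := qb k - qa k) in *. set (h := qd k - qc k) in *.
  assert (Ewh : w + h = L / 2 ^ k) by (rewrite I7, I8; unfold L; field; lra).
  assert (Hck : rect_cont g (qa k) (qb k) (qc k) (qd k))
    by (apply (rect_cont_sub g a b c d); auto).
  set (A := fun z : CC => ((g (x, y) - (x, y) * l) + l * z)%C).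
  assert (HA : rect_cont A (qa k) (qb k) (qc k) (qd k)).
  { intros s t _ _. unfold A.
    apply (ccont_plus _ (fun _ => (g (x, y) - (x, y) * l)%C) (fun z => (l * z)%C));
      [apply ccont_const|].
    apply (ccont_mult _ (fun _ => l) (fun z => z)); [apply ccont_const|apply ccont_id]. }
  assert (EA : rect_norm g (q k) = Cmod (rect_int (fun z => (g z - A z)%C) (qa k) (qb k) (qc k) (qd k))).
  { rewrite rect_int_minus by assumption. unfold A. rewrite rect_int_affine by assumption.
    rewrite Eq. unfold rect_norm. f_equal. ring. }
  assert (Hwh : forall s t, qa k <= s <= qb k -> qc k <= t <= qd k -> Cmod ((s, t) - (x, y))%C <= w + h).
  { intros s t Hs Ht. specialize (Hx k). specialize (Hy k).
    replace ((s, t) - (x, y))%C with (RtoC (s - x) + Ci * RtoC (t - y))%C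
      by (apply injective_projections; simpl; ring).
    eapply Rle_trans; [apply Cmod_triangle|]. rewrite Cmod_mult, Cmod_Ci, !Cmod_R.
    unfold w, h. assert (Rabs (s - x) <= qb k - qa k) by (apply Rabs_le; lra).
    assert (Rabs (t - y) <= qd k - qc k) by (apply Rabs_le; lra). lra. }
  assert (B : rect_norm g (q k) <= 2 * (e * (w + h)) * (w + h)).
  { rewrite EA. apply rect_int_bound; auto.
    - intros s t Hs Ht. apply (ccont_minus _ g A); [apply Hck|apply HA]; assumption.
    - intros s t Hs Ht. specialize (Hwh s t Hs Ht).
      replace (g (s, t) - A (s, t))%C with (g (s, t) - g (x, y) - ((s, t) - (x, y)) * l)%C
        by (unfold A; ring).
      eapply Rle_trans; [apply Hlr|].
      + eapply Rle_lt_trans; [exact Hwh|]. lra.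
      + apply Rmult_le_compat_l; lra. }
  rewrite Ewh in B.
  assert (B2 : I0 / 4 ^ k <= 2 * e * L * L / 4 ^ k).
  { eapply Rle_trans; [exact I9|]. eapply Rle_trans; [exact B|].
    replace (4 ^ k) with (2 ^ k * 2 ^ k) by (rewrite <- Rpow_mult_distr; f_equal; ring).
    right; field. lra. }
  assert (P4 : 0 < 4 ^ k) by (apply pow_lt; lra).
  apply Rmult_le_compat_r with (r := 4 ^ k) in B2; [|lra].
  unfold Rdiv in B2. rewrite !Rmult_assoc, Rinv_l in B2 by lra.
  assert (E : 2 * (e * (L * (L * 1))) = I0 * ((2 * (L * L)) / (4 * (L * L + 1))))
    by (unfold e; field; nra).
  rewrite E in B2. rewrite Rmult_1_r in B2.
  assert ((2 * (L * L)) / (4 * (L * L + 1)) < 1) by (apply Rlt_div_l; nra).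
  nra.
Qed.

(** * Circular means *)

Definition holo (r : R) (f : CC -> CC) : Prop :=
  forall z, Cmod z < r -> exists l, Cis_derive f z l.

Definition circ (r t : R) : CC := (r * cos t, r * sin t).

Definition cmean (u : R -> R) : R := / (2 * PI) * RInt u 0 (2 * PI).

Definition CM (u : R -> CC) : CC := (RtoC (/ (2 * PI)) * CInt u 0 (2 * PI))%C.

Lemma zero_in_disk : Cmod (RtoC 0) < 1.
Proof. rewrite Cmod_0. lra. Qed.

Lemma two_PI_pos : 0 < 2 * PI.
Proof. assert (H := PI_RGT_0). lra. Qed.

Lemma Cmod_circ (r t : R) : 0 <= r -> Cmod (circ r t) = r.
Proof.
  intros Hr. unfold Cmod, circ; simpl.
  replace (_ + _) with (r * r * ((sin t)² + (cos t)²)) by (unfold Rsqr; ring).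
  rewrite sin2_cos2, Rmult_1_r. apply sqrt_square, Hr.
Qed.

Lemma circ_cont (r t : R) : ccont (circ r) t.
Proof.
  apply ccont_pair; simpl; (apply cont_mult; [apply continuous_const|]).
  - apply continuous_cos.
  - apply continuous_sin.
Qed.

Lemma circ_RtoC (r t : R) : circ r t = (RtoC r * circ 1 t)%C.
Proof. apply injective_projections; simpl; ring. Qed.

(** This is what differentiates [cexp]: by the functional equation the first-order expansion at 0,
    split into real and imaginary part, serves at every point. *)
Lemma Cexp_small (e : R) : 0 < e -> exists d, 0 < d /\ forall s t, Rabs s < d -> Rabs t < d ->
  Rabs (exp s * cos t - 1 - s) <= e * (Rabs s + Rabs t) /\
  Rabs (exp s * sin t - t) <= e * (Rabs s + Rabs t).
Proof.
  intros He.
  assert (Hlim : forall f l, derivable_pt_lim f 0 l -> forall e, 0 < e -> exists d, 0 < d /\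
    forall s, Rabs s < d -> Rabs (f s - f 0 - l * s) <= e * Rabs s).
  { intros f l H e' He'. destruct (H e' He') as [d Hd]. exists d; split; [apply cond_pos|].
    intros s Hs. destruct (Req_dec s 0) as [->|n].
    - rewrite Rabs_R0. replace (f 0 - f 0 - l * 0) with 0 by ring. rewrite Rabs_R0. lra.
    - specialize (Hd s n Hs). rewrite Rplus_0_l in Hd.
      replace (f s - f 0 - l * s) with (((f s - f 0) / s - l) * s) by (field; exact n).
      rewrite Rabs_mult. apply Rmult_le_compat_r; [apply Rabs_pos|lra]. }
  assert (He4 : 0 < e / 4) by lra.
  destruct (Hlim exp (exp 0) (derivable_pt_lim_exp 0) (Rmin (e / 4) 1)) as [d1 [D1 H1]];
    [apply Rmin_glb_lt; lra|].
  destruct (Hlim cos (- sin 0) (derivable_pt_lim_cos 0) (e / 4) He4) as [d2 [D2 H2]].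
  destruct (Hlim sin (cos 0) (derivable_pt_lim_sin 0) (e / 4) He4) as [d3 [D3 H3]].
  rewrite exp_0 in H1. rewrite sin_0, cos_0 in H2. rewrite sin_0, cos_0 in H3.
  exists (Rmin (Rmin d1 (Rmin d2 d3)) (Rmin 1 (e / 4))).
  split; [repeat apply Rmin_glb_lt; lra|].
  intros s t Hs Ht.
  assert (K1 : Rmin (Rmin d1 (Rmin d2 d3)) (Rmin 1 (e / 4)) <= Rmin d1 (Rmin d2 d3)) by apply Rmin_l.
  assert (K2 : Rmin (Rmin d1 (Rmin d2 d3)) (Rmin 1 (e / 4)) <= Rmin 1 (e / 4)) by apply Rmin_r.
  assert (K3 : Rmin 1 (e / 4) <= 1) by apply Rmin_l.
  assert (K4 : Rmin 1 (e / 4) <= e / 4) by apply Rmin_r.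
  assert (K5 : Rmin d1 (Rmin d2 d3) <= d1) by apply Rmin_l.
  assert (K6 : Rmin d1 (Rmin d2 d3) <= Rmin d2 d3) by apply Rmin_r.
  assert (K7 : Rmin d2 d3 <= d2) by apply Rmin_l.
  assert (K8 : Rmin d2 d3 <= d3) by apply Rmin_r.
  specialize (H1 s). specialize (H2 t). specialize (H3 t).
  assert (G1 : Rabs (exp s - 1 - 1 * s) <= Rmin (e / 4) 1 * Rabs s) by (apply H1; lra).
  assert (G2 : Rabs (cos t - 1 - - 0 * t) <= e / 4 * Rabs t) by (apply H2; lra).
  assert (G3 : Rabs (sin t - 0 - 1 * t) <= e / 4 * Rabs t) by (apply H3; lra).
  assert (M1 : Rmin (e / 4) 1 <= e / 4) by apply Rmin_l.
  assert (M2 : Rmin (e / 4) 1 <= 1) by apply Rmin_r.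
  assert (Ps := Rabs_pos s). assert (Pt := Rabs_pos t).
  set (A := exp s - 1 - 1 * s) in *. set (B := cos t - 1 - - 0 * t) in *.
  set (C := sin t - 0 - 1 * t) in *.
  assert (GA1 : Rabs A <= e / 4 * Rabs s) by nra.
  assert (GA2 : Rabs A <= Rabs s) by nra.
  assert (Ex : exp s = 1 + s + A) by (unfold A; ring).
  assert (X : Rabs (1 + s + A) <= 3).
  { eapply Rle_trans; [apply Rabs_triang|]. assert (X := Rabs_triang 1 s). rewrite Rabs_R1 in X. lra. }
  assert (X2 : Rabs (s + A) <= 2 * Rabs s) by (eapply Rle_trans; [apply Rabs_triang|]; lra).
  split.
  - replace (exp s * cos t - 1 - s) with (A + (1 + s + A) * B).
    2:{ rewrite Ex. unfold B. ring. }
    eapply Rle_trans; [apply Rabs_triang|]. rewrite Rabs_mult.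
    assert (Rabs (1 + s + A) * Rabs B <= 3 * (e / 4 * Rabs t))
      by (apply Rmult_le_compat; auto using Rabs_pos). nra.
  - replace (exp s * sin t - t) with ((1 + s + A) * C + (s + A) * t).
    2:{ rewrite Ex. unfold C. ring. }
    eapply Rle_trans; [apply Rabs_triang|]. rewrite !Rabs_mult.
    assert (Rabs (1 + s + A) * Rabs C <= 3 * (e / 4 * Rabs t))
      by (apply Rmult_le_compat; auto using Rabs_pos).
    assert (Rabs (s + A) * Rabs t <= 2 * Rabs s * Rabs t) by (apply Rmult_le_compat_r; auto).
    nra.
Qed.

Definition cexp (z : CC) : CC := circ (exp (fst z)) (snd z).

Lemma Cmod_le_Rabs (z : CC) : Cmod z <= Rabs (fst z) + Rabs (snd z).
Proof.
  replace (Cmod z) with (Cmod (RtoC (fst z) + Ci * RtoC (snd z))%C).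
  - eapply Rle_trans; [apply Cmod_triangle|]. rewrite Cmod_mult, Cmod_Ci, !Cmod_R. lra.
  - f_equal. apply injective_projections; simpl; ring.
Qed.

Lemma Rabs_fst_le (z : CC) : Rabs (fst z) <= Cmod z.
Proof. eapply Rle_trans; [apply Rmax_l|apply Rmax_Cmod]. Qed.

Lemma Rabs_snd_le (z : CC) : Rabs (snd z) <= Cmod z.
Proof. eapply Rle_trans; [apply Rmax_r|apply Rmax_Cmod]. Qed.

Lemma Cis_derive_cexp (z : CC) : Cis_derive cexp z (cexp z).
Proof.
  apply Cis_derive_eps. intros e He.
  assert (Hp : 0 < exp (fst z)) by apply exp_pos.
  destruct (Cexp_small (e / (4 * exp (fst z)))) as [d [Hd H]].
  { apply Rdiv_lt_0_compat; lra. }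
  exists d; split; [exact Hd|]. intros y Hy.
  set (s := fst y - fst z). set (t := snd y - snd z).
  assert (Hs : Rabs s <= Cmod (y - z)) by exact (Rabs_fst_le (y - z)%C).
  assert (Ht : Rabs t <= Cmod (y - z)) by exact (Rabs_snd_le (y - z)%C).
  destruct (H s t) as [A B]; try lra.
  assert (E : (cexp y - cexp z - (y - z) * cexp z)%C
     = (cexp z * ((exp s * cos t - 1 - s)%R, (exp s * sin t - t)%R))%C).
  { unfold cexp. replace (exp (fst y)) with (exp (fst z) * exp s)
      by (rewrite <- exp_plus; f_equal; unfold s; ring).
    replace (snd y) with (snd z + t) by (unfold t; ring).
    apply injective_projections; unfold circ; simpl; rewrite ?cos_plus, ?sin_plus;
      change (fst y + - fst z) with s; change (snd y + - snd z) with t; ring. }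
  rewrite E, Cmod_mult. unfold cexp at 1. rewrite Cmod_circ by lra.
  eapply Rle_trans; [apply Rmult_le_compat_l; [lra|apply Cmod_le_Rabs]|]. simpl.
  apply Rle_trans with (exp (fst z) * (4 * (e / (4 * exp (fst z))) * Cmod (y - z))).
  - apply Rmult_le_compat_l; [lra|].
    assert (0 < e / (4 * exp (fst z))) by (apply Rdiv_lt_0_compat; lra). nra.
  - right. field. lra.
Qed.

(* In logarithmic coordinates the two vertical sides of the rectangle cancel by periodicity. *)
Lemma annulus_mean (h : CC -> CC) (r1 r2 : R) : 0 < r1 <= r2 ->
  (forall z, r1 <= Cmod z <= r2 -> exists l, Cis_derive h z l) ->
  CM (fun t => h (circ r1 t)) = CM (fun t => h (circ r2 t)).
Proof.
  intros [H1 H2] H. assert (P := two_PI_pos).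
  assert (Hl : ln r1 <= ln r2) by (destruct H2 as [H2|H2]; [left; apply ln_increasing; lra|subst; lra]).
  assert (G : rect_int (fun z => h (cexp z)) (ln r1) (ln r2) 0 (2 * PI) = RtoC 0).
  { apply Goursat; [assumption|lra|]. intros s t Hs Ht.
    destruct (H (cexp (s, t))) as [l Hh].
    - unfold cexp; simpl. rewrite Cmod_circ by (left; apply exp_pos).
      split.
      + rewrite <- (exp_ln r1) by lra. destruct (proj1 Hs) as [L|L];
          [left; apply exp_increasing, L|rewrite L; lra].
      + rewrite <- (exp_ln r2) by lra. destruct (proj2 Hs) as [L|L];
          [left; apply exp_increasing, L|rewrite L; lra].
    - eexists. apply (Cis_derive_comp h cexp); [exact Hh|apply Cis_derive_cexp]. }
  unfold rect_int, cexp in G; simpl in G.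
  rewrite !exp_ln in G by lra.
  rewrite (CInt_ext (fun s => h (circ (exp s) (2 * PI))) (fun s => h (circ (exp s) 0))) in G.
  2: assumption.
  2:{ intros s _. unfold circ. rewrite cos_2PI, sin_2PI, cos_0, sin_0. reflexivity. }
  unfold CM. f_equal.
  set (A := CInt (fun s : R => h (circ (exp s) 0)) (ln r1) (ln r2)) in G.
  set (I2 := CInt (fun t : R => h (circ r2 t)) 0 (2 * PI)) in *.
  set (I1 := CInt (fun t : R => h (circ r1 t)) 0 (2 * PI)) in *.
  assert (E : (I2 - I1)%C = RtoC 0).
  { replace (I2 - I1)%C with (- Ci * (A + Ci * I2 - A - Ci * I1))%C.
    - rewrite G. ring.
    - replace (- Ci * (A + Ci * I2 - A - Ci * I1))%C with (- (Ci * Ci) * (I2 - I1))%C by ring.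
      replace (- (Ci * Ci))%C with (RtoC 1); [ring|].
      apply injective_projections; simpl; ring. }
  symmetry. apply Ceq_minus, E.
Qed.

(** The common form of all compactness arguments below. One number is both the radius of a
    neighbourhood and the scale in [P]; as [P] survives shrinking of the scale, the smallest scale
    of a finite cover is valid everywhere. *)
Lemma compact_unif (P : R -> R -> Prop) (a b : R) :
  (forall t, a <= t <= b -> exists d, 0 < d /\ forall t', a <= t' <= b -> Rabs (t' - t) < d -> P d t') ->
  (forall d d' t, 0 < d' <= d -> P d t -> P d' t) ->
  exists d, 0 < d /\ forall t, a <= t <= b -> P d t.
Proof.
  intros H Hm.
  (* The covering theorem asks for a gauge on the whole line; the guard leaves it free outside the
     interval. *)
  set (Q := fun (t : R) (d : posreal) => a <= t <= b ->
    forall t', a <= t' <= b -> Rabs (t' - t) < d -> P d t').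
  assert (HQ : forall t, exists d, Q t d).
  { intros t. destruct (Classical_Prop.classic (a <= t <= b)) as [Ht|Ht].
    - destruct (H t Ht) as [d [Hd H']]. exists (mkposreal d Hd). intros _. exact H'.
    - exists (mkposreal 1 Rlt_0_1). intros K; contradiction. }
  set (delta := fun t => proj1_sig (constructive_indefinite_description _ (HQ t))).
  destruct (compactness_value_1d a b delta) as [d Hd].
  exists d; split; [apply cond_pos|]. intros x Hx.
  apply Classical_Prop.NNPP. intros Hn. apply (Hd x Hx). intros [t [Ht [Hxt Hdt]]].
  apply Hn. apply (Hm (delta t)); [split; [apply cond_pos|exact Hdt]|].
  assert (K : Q t (delta t)) by (unfold delta; apply proj2_sig).
  exact (K Ht x Hx Hxt).
Qed.

(** Compactness is available for angles in [0, 2 PI]; this carries its consequences to all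
    angles. *)
Lemma circ_period_pt (r t : R) : exists t', 0 <= t' <= 2 * PI /\ circ r t' = circ r t.
Proof.
  assert (P := two_PI_pos).
  set (k := Int_part (t / (2 * PI))).
  exists (t - IZR k * (2 * PI)).
  assert (B := base_Int_part (t / (2 * PI))). fold k in B.
  assert (E : t = t / (2 * PI) * (2 * PI)) by (field; lra).
  split.
  - split.
    + assert (IZR k * (2 * PI) <= t / (2 * PI) * (2 * PI)) by (apply Rmult_le_compat_r; lra). lra.
    + assert (t / (2 * PI) * (2 * PI) <= (IZR k + 1) * (2 * PI)) by (apply Rmult_le_compat_r; lra). lra.
  - assert (Hz : forall (z : Z) x, cos (x + IZR z * (2 * PI)) = cos x /\ sin (x + IZR z * (2 * PI)) = sin x).
    { intros z x. destruct z as [|p|p].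
      - rewrite Rmult_0_l, Rplus_0_r. auto.
      - rewrite <- positive_nat_Z, <- INR_IZR_INZ.
        replace (INR (Pos.to_nat p) * (2 * PI)) with (2 * INR (Pos.to_nat p) * PI) by ring.
        split; [apply cos_period|apply sin_period].
      - rewrite <- Pos2Z.opp_pos, opp_IZR, <- positive_nat_Z, <- INR_IZR_INZ.
        set (m := Pos.to_nat p).
        split.
        + rewrite <- (cos_period (x + - INR m * (2 * PI)) m). f_equal. ring.
        + rewrite <- (sin_period (x + - INR m * (2 * PI)) m). f_equal. ring. }
    destruct (Hz k (t - IZR k * (2 * PI))) as [C1 C2].
    unfold circ. rewrite <- C1, <- C2. do 2 f_equal; f_equal; ring.
Qed.

Lemma circ_dist (r r' t t' : R) : 0 <= r -> Cmod (circ r' t' - circ r t) <= Rabs (r' - r) + 2 * r * Rabs (t' - t).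
Proof.
  intros Hr.
  replace (circ r' t' - circ r t)%C with
    (RtoC (r' - r) * circ 1 t' + RtoC r * (circ 1 t' - circ 1 t))%C
    by (apply injective_projections; simpl; ring).
  eapply Rle_trans; [apply Cmod_triangle|]. rewrite !Cmod_mult, !Cmod_R, Cmod_circ by lra.
  rewrite (Rabs_right r) by lra.
  assert (K : Cmod (circ 1 t' - circ 1 t) <= 2 * Rabs (t' - t)).
  { eapply Rle_trans; [apply Cmod_le_Rabs|]. simpl.
    assert (L : forall f f', (forall x, derivable_pt_lim f x (f' x)) -> (forall x, Rabs (f' x) <= 1) ->
       Rabs (f t' - f t) <= Rabs (t' - t)).
    { intros f f' Hd Hb.
      destruct (MVT_gen f t t' f') as [c [_ Hc]].
      - intros x _. apply is_derive_Reals, Hd.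
      - intros x _. apply derivable_continuous_pt. exists (f' x). apply Hd.
      - rewrite Hc, Rabs_mult. assert (X := Hb c). assert (Y := Rabs_pos (t' - t)). nra. }
    assert (L1 : Rabs (cos t' - cos t) <= Rabs (t' - t)).
    { apply (L cos (fun x => - sin x)); [apply derivable_pt_lim_cos|].
      intros x. rewrite Rabs_Ropp. apply Rabs_le, SIN_bound. }
    assert (L2 : Rabs (sin t' - sin t) <= Rabs (t' - t)).
    { apply (L sin cos); [apply derivable_pt_lim_sin|].
      intros x. apply Rabs_le, COS_bound. }
    replace (1 * cos t' + - (1 * cos t)) with (cos t' - cos t) by ring.
    replace (1 * sin t' + - (1 * sin t)) with (sin t' - sin t) by ring. lra. }
  assert (r * Cmod (circ 1 t' - circ 1 t) <= r * (2 * Rabs (t' - t))) by (apply Rmult_le_compat_l; assumption).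
  lra.
Qed.

(** Its purpose is that circular means depend continuously on the radius. *)
Lemma circle_unif (q : CC -> CC) (r0 : R) : 0 <= r0 ->
  (forall z, Cmod z = r0 -> ccont (q : C_UniformSpace -> CC) z) ->
  forall e, 0 < e -> exists d, 0 < d /\ forall r, Rabs (r - r0) < d ->
    forall t, Cmod (q (circ r t) - q (circ r0 t)) <= e.
Proof.
  intros Hr0 Hq e He.
  destruct (compact_unif (fun d t => forall r, Rabs (r - r0) < d -> Cmod (q (circ r t) - q (circ r0 t)) <= e)
    0 (2 * PI)) as [d [Hd H]].
  - intros t _.
    destruct (proj1 (ccont_eps q (circ r0 t)) (Hq _ (Cmod_circ r0 t Hr0)) (e / 2)) as [d [Hd H]]; [lra|].
    assert (Hk : 0 < d / (2 * (1 + r0))) by (apply Rdiv_lt_0_compat; lra).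
    assert (Ek : d = (2 * (1 + r0)) * (d / (2 * (1 + r0)))) by (field; lra).
    exists (d / (2 * (1 + r0))). split; [exact Hk|].
    intros t' _ Ht r Hr.
    assert (D1 := circ_dist r0 r t t' Hr0). assert (D2 := circ_dist r0 r0 t t' Hr0).
    assert (Hd1 : 2 * r0 * Rabs (t' - t) <= 2 * r0 * (d / (2 * (1 + r0)))) by (apply Rmult_le_compat_l; lra).
    assert (Z : Rabs (r0 - r0) = 0) by (rewrite Rminus_diag; apply Rabs_R0).
    assert (A : Cmod (q (circ r t') - q (circ r0 t)) < e / 2) by (apply H; nra).
    assert (B : Cmod (q (circ r0 t') - q (circ r0 t)) < e / 2) by (apply H; nra).
    replace (q (circ r t') - q (circ r0 t'))%C
      with ((q (circ r t') - q (circ r0 t)) + - (q (circ r0 t') - q (circ r0 t)))%C by ring.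
    eapply Rle_trans; [apply Cmod_triangle|]. rewrite Cmod_opp. lra.
  - intros d d' t [H1 H2] H r Hr. apply H. lra.
  - exists d; split; [exact Hd|]. intros r Hr t.
    destruct (circ_period_pt 1 t) as [t' [Ht' E]].
    rewrite (circ_RtoC r t), (circ_RtoC r0 t), <- E, <- !circ_RtoC. apply H; assumption.
Qed.

(** * Cauchy's formula and Taylor series *)

Definition cc (u : R -> CC) : Prop := forall t, ccont u t.
Definition rc (v : R -> R) : Prop := forall t, continuous v t.

Lemma cc_on (u : R -> CC) (a b : R) : cc u -> cont_on u a b.
Proof. intros H t _. apply H. Qed.

Lemma rc_int (v : R -> R) (a b : R) : a <= b -> rc v -> ex_RInt v a b.
Proof. intros Hab H. apply ex_RInt_cont; auto. Qed.

Lemma cmean_ext (u v : R -> R) : (forall t, u t = v t) -> cmean u = cmean v.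
Proof. intros H. unfold cmean. f_equal. apply RInt_ext. auto. Qed.

Lemma cmean_plus (u v : R -> R) : rc u -> rc v -> cmean (fun t => u t + v t) = cmean u + cmean v.
Proof.
  assert (P := two_PI_pos). intros Hu Hv. unfold cmean.
  rewrite RInt_plusR by (apply rc_int; auto; lra). ring.
Qed.

Lemma cmean_minus (u v : R -> R) : rc u -> rc v -> cmean (fun t => u t - v t) = cmean u - cmean v.
Proof.
  assert (P := two_PI_pos). intros Hu Hv. unfold cmean.
  rewrite RInt_minusR by (apply rc_int; auto; lra). ring.
Qed.

Lemma cmean_scal (k : R) (u : R -> R) : rc u -> cmean (fun t => k * u t) = k * cmean u.
Proof.
  assert (P := two_PI_pos). intros Hu. unfold cmean.
  rewrite RInt_scalR by (apply rc_int; auto; lra). ring.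
Qed.

Lemma cmean_const (k : R) : cmean (fun _ => k) = k.
Proof. assert (P := two_PI_pos). unfold cmean. rewrite RInt_constR. field. lra. Qed.

Lemma cmean_le (u v : R -> R) : rc u -> rc v -> (forall t, u t <= v t) -> cmean u <= cmean v.
Proof.
  assert (P := two_PI_pos). intros Hu Hv H. unfold cmean.
  apply Rmult_le_compat_l; [left; apply Rinv_0_lt_compat; lra|].
  apply RInt_le; [lra| | |]; auto; apply rc_int; auto; lra.
Qed.

Lemma cmean_le_const (u : R -> R) (M : R) : rc u -> (forall t, u t <= M) -> cmean u <= M.
Proof.
  intros Hu H. rewrite <- (cmean_const M). apply cmean_le; auto.
  intros t; apply continuous_const.
Qed.

Lemma CM_eq (u : R -> CC) : CM u = (cmean (fun t => Re (u t)), cmean (fun t => Im (u t))).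
Proof. unfold CM, CInt, cmean. apply injective_projections; simpl; ring. Qed.

Lemma CM_ext (u v : R -> CC) : (forall t, u t = v t) -> CM u = CM v.
Proof.
  intros H. rewrite !CM_eq. f_equal; apply cmean_ext; intros; now rewrite H.
Qed.

Lemma CM_plus (u v : R -> CC) : cc u -> cc v -> CM (fun t => (u t + v t)%C) = (CM u + CM v)%C.
Proof.
  assert (P := two_PI_pos). intros Hu Hv. unfold CM.
  rewrite CInt_plus by (try apply cc_on; auto; lra). ring.
Qed.

Lemma CM_minus (u v : R -> CC) : cc u -> cc v -> CM (fun t => (u t - v t)%C) = (CM u - CM v)%C.
Proof.
  assert (P := two_PI_pos). intros Hu Hv. unfold CM.
  rewrite CInt_minus by (try apply cc_on; auto; lra). ring.
Qed.

Lemma CM_scal (c : CC) (u : R -> CC) : cc u -> CM (fun t => (c * u t)%C) = (c * CM u)%C.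
Proof.
  assert (P := two_PI_pos). intros Hu. unfold CM.
  rewrite CInt_scal by (try apply cc_on; auto; lra). ring.
Qed.

Lemma CM_const (c : CC) : CM (fun _ => c) = c.
Proof.
  rewrite CM_eq. rewrite (cmean_const (Re c)), (cmean_const (Im c)). now destruct c.
Qed.

Lemma Cmod_CM_le (u : R -> CC) (v : R -> R) : cc u -> rc v -> (forall t, Cmod (u t) <= v t) ->
  Cmod (CM u) <= cmean v.
Proof.
  assert (P := two_PI_pos). intros Hu Hv H. unfold CM, cmean.
  assert (Pi : 0 < / (2 * PI)) by (apply Rinv_0_lt_compat; lra).
  rewrite Cmod_mult, Cmod_R, Rabs_right by lra.
  apply Rmult_le_compat_l; [lra|]. apply Cmod_CInt_le; auto; try lra.
  - apply cc_on, Hu.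
  - apply rc_int; auto; lra.
Qed.

Lemma Cmod_CM_bound (u : R -> CC) (M : R) : cc u -> (forall t, Cmod (u t) <= M) -> Cmod (CM u) <= M.
Proof.
  intros Hu H. rewrite <- (cmean_const M). apply Cmod_CM_le; auto.
  intros t; apply continuous_const.
Qed.

Lemma cc_plus (u v : R -> CC) : cc u -> cc v -> cc (fun t => (u t + v t)%C).
Proof. intros Hu Hv t. apply (ccont_plus _ u v); auto. Qed.

Lemma cc_minus (u v : R -> CC) : cc u -> cc v -> cc (fun t => (u t - v t)%C).
Proof. intros Hu Hv t. apply (ccont_minus _ u v); auto. Qed.

Lemma cc_mult (u v : R -> CC) : cc u -> cc v -> cc (fun t => (u t * v t)%C).
Proof. intros Hu Hv t. apply (ccont_mult _ u v); auto. Qed.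

Lemma cc_const (c : CC) : cc (fun _ => c).
Proof. intros t. apply ccont_const. Qed.

Lemma cc_inv (u : R -> CC) : cc u -> (forall t, u t <> RtoC 0) -> cc (fun t => (/ u t)%C).
Proof. intros Hu Hn t. apply (ccont_inv _ u); auto. Qed.

Lemma cc_pow (u : R -> CC) (n : nat) : cc u -> cc (fun t => (u t ^ n)%C).
Proof. intros Hu t. apply (ccont_pow _ u); auto. Qed.

Lemma cc_circ (r : R) : cc (circ r).
Proof. intros t. apply circ_cont. Qed.

Lemma holo_cont (r : R) (f : CC -> CC) (z : CC) : holo r f -> Cmod z < r ->
  ccont (f : C_UniformSpace -> CC) z.
Proof. intros H Hz. destruct (H z Hz) as [l Hl]. eapply Cis_derive_cont, Hl. Qed.

Lemma cc_holo (r p : R) (f : CC -> CC) : holo r f -> 0 <= p < r -> cc (fun t => f (circ p t)).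
Proof.
  intros H Hp t. apply (ccont_comp _ (circ p) f); [apply circ_cont|].
  apply (holo_cont r); [exact H|]. rewrite Cmod_circ; lra.
Qed.

Lemma rc_Cmod (u : R -> CC) : cc u -> rc (fun t => Cmod (u t)).
Proof. intros H t. apply cont_Cmod, H. Qed.

Lemma rc_pow (v : R -> R) (n : nat) : rc v -> rc (fun t => v t ^ n).
Proof. intros H t. apply cont_pow, H. Qed.

Lemma holo_const (r : R) (c : CC) : holo r (fun _ => c).
Proof. intros z _. eexists. apply Cis_derive_const. Qed.

Lemma holo_id (r : R) : holo r (fun z => z).
Proof. intros z _. eexists. apply Cis_derive_id. Qed.

Lemma holo_plus (r : R) (f g : CC -> CC) : holo r f -> holo r g -> holo r (fun z => (f z + g z)%C).
Proof.
  intros Hf Hg z Hz. destruct (Hf z Hz) as [l Hl], (Hg z Hz) as [m Hm].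
  eexists. apply (Cis_derive_plus f g); eassumption.
Qed.

Lemma holo_mult (r : R) (f g : CC -> CC) : holo r f -> holo r g -> holo r (fun z => (f z * g z)%C).
Proof.
  intros Hf Hg z Hz. destruct (Hf z Hz) as [l Hl], (Hg z Hz) as [m Hm].
  eexists. apply (Cis_derive_mult f g); eassumption.
Qed.

Lemma Cis_derive_ext (f g : CC -> CC) (z l : CC) : (forall y, f y = g y) ->
  Cis_derive f z l -> Cis_derive g z l.
Proof. intros H. apply Cis_derive_ext_loc. exists 1; split; [lra|auto]. Qed.

Lemma holo_ext (r : R) (f g : CC -> CC) : (forall z, Cmod z < r -> f z = g z) -> holo r f -> holo r g.
Proof.
  intros E H z Hz. destruct (H z Hz) as [l Hl]. exists l.
  apply (Cis_derive_ext_loc f g); [|exact Hl].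
  exists (r - Cmod z); split; [lra|]. intros y Hy. apply E.
  replace y with ((y - z) + z)%C by ring. eapply Rle_lt_trans; [apply Cmod_triangle|]. lra.
Qed.

Lemma holo_opp (r : R) (f : CC -> CC) : holo r f -> holo r (fun z => (- f z)%C).
Proof.
  intros H. apply (holo_ext r (fun z => (- RtoC 1 * f z)%C)).
  - intros z _. ring.
  - apply holo_mult; [apply holo_const|exact H].
Qed.

Lemma holo_minus (r : R) (f g : CC -> CC) : holo r f -> holo r g -> holo r (fun z => (f z - g z)%C).
Proof. intros Hf Hg. apply (holo_plus r f (fun z => (- g z)%C)); [exact Hf|apply holo_opp, Hg]. Qed.

Lemma holo_comp (r s : R) (f g : CC -> CC) : holo r f -> holo s g ->
  (forall z, Cmod z < s -> Cmod (g z) < r) -> holo s (fun z => f (g z)).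
Proof.
  intros Hf Hg H z Hz. destruct (Hf (g z) (H z Hz)) as [l Hl], (Hg z Hz) as [m Hm].
  eexists. apply (Cis_derive_comp f g); eassumption.
Qed.

Lemma holo_inv (r : R) (f : CC -> CC) : holo r f -> (forall z, Cmod z < r -> f z <> RtoC 0) ->
  holo r (fun z => (/ f z)%C).
Proof.
  intros Hf H z Hz. destruct (Hf z Hz) as [l Hl].
  eexists. apply (Cis_derive_comp Cinv f); [apply Cis_derive_inv, H, Hz|exact Hl].
Qed.

Lemma holo_pow (r : R) (f : CC -> CC) (n : nat) : holo r f -> holo r (fun z => (f z ^ n)%C).
Proof.
  intros H. induction n as [|n IH]; simpl; [apply holo_const|].
  apply holo_mult; assumption.
Qed.

Lemma holo_sub (r s : R) (f : CC -> CC) : s <= r -> holo r f -> holo s f.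
Proof. intros Hs H z Hz. apply H. lra. Qed.

Lemma mean_limit (M : R -> CC) (c : CC) (r0 a b : R) : a < b -> a <= r0 <= b ->
  (forall r, a < r < b -> M r = c) ->
  (forall e, 0 < e -> exists d, 0 < d /\ forall r, a < r < b -> Rabs (r - r0) < d -> Cmod (M r - M r0) <= e) ->
  M r0 = c.
Proof.
  intros Hab H0 Hc HM.
  apply Ceq_minus, Cmod_eq_0. apply Rle_antisym; [|apply Cmod_ge_0].
  apply le_epsilon. intros e He. rewrite Rplus_0_l.
  destruct (HM e He) as [d [Hd H]].
  assert (exists r, a < r < b /\ Rabs (r - r0) < d) as [r [Hr Hrd]].
  { destruct (Rlt_dec a r0) as [L|L].
    - exists (r0 - Rmin d (r0 - a) / 2).
      assert (0 < Rmin d (r0 - a)) by (apply Rmin_glb_lt; lra).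
      assert (Rmin d (r0 - a) <= d) by apply Rmin_l.
      assert (Rmin d (r0 - a) <= r0 - a) by apply Rmin_r.
      split; [lra|]. rewrite Rabs_left; lra.
    - exists (r0 + Rmin d (b - a) / 2).
      assert (0 < Rmin d (b - a)) by (apply Rmin_glb_lt; lra).
      assert (Rmin d (b - a) <= d) by apply Rmin_l.
      assert (Rmin d (b - a) <= b - a) by apply Rmin_r.
      split; [lra|]. rewrite Rabs_right; lra. }
  specialize (H r Hr Hrd). rewrite (Hc r Hr) in H.
  replace (M r0 - c)%C with (- (c - M r0))%C by ring. rewrite Cmod_opp. exact H.
Qed.

(* The singularity at [w] is harmless: the circular means of [z q(z)] are constant on both
   sides of [|w|], continuous across it, and vanish at radius 0. *)
Lemma mean_slope_zero (q : CC -> CC) (R0 : R) (w : CC) :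
  Cmod w < R0 ->
  (forall z, Cmod z < R0 -> ccont (q : C_UniformSpace -> CC) z) ->
  (forall z, Cmod z < R0 -> z <> w -> exists l, Cis_derive q z l) ->
  forall r, 0 < r < R0 -> CM (fun t => (circ r t * q (circ r t))%C) = RtoC 0.
Proof.
  intros Hw Hc Hd.
  set (h := fun z => (z * q z)%C).
  set (M := fun r => CM (fun t => h (circ r t))).
  assert (Hhc : forall z, Cmod z < R0 -> ccont (h : C_UniformSpace -> CC) z).
  { intros z Hz. apply (ccont_mult _ (fun z => z) q); [apply ccont_id|auto]. }
  assert (Hcc : forall r, 0 <= r < R0 -> cc (fun t => h (circ r t))).
  { intros r Hr t. apply (ccont_comp _ (circ r) h); [apply circ_cont|]. apply Hhc.
    rewrite Cmod_circ; lra. }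
  assert (HM : forall r0, 0 <= r0 < R0 -> forall e, 0 < e -> exists d, 0 < d /\
     forall r, 0 <= r < R0 -> Rabs (r - r0) < d -> Cmod (M r - M r0) <= e).
  { intros r0 Hr0 e He. destruct (circle_unif h r0) with (e := e) as [d [Hd' H]]; try lra.
    - intros z Hz. apply Hhc. lra.
    - exists d; split; [exact Hd'|]. intros r Hr Hrd. unfold M.
      rewrite <- CM_minus by (apply Hcc; lra).
      apply Cmod_CM_bound; [apply cc_minus; apply Hcc; lra|]. intros t. apply H, Hrd. }
  assert (Hconst : forall r1 r2, 0 < r1 <= r2 -> r2 < R0 -> (r2 < Cmod w \/ Cmod w < r1) -> M r1 = M r2).
  { intros r1 r2 H1 H2 H3. apply annulus_mean; [exact H1|].
    intros z Hz. destruct (Hd z) as [l Hl]; [lra|intros ->; lra|].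
    eexists. apply (Cis_derive_mult (fun z => z) q); [apply Cis_derive_id|exact Hl]. }
  assert (M0 : M 0 = RtoC 0).
  { unfold M. rewrite <- (CM_const (RtoC 0)). apply CM_ext. intros t. unfold h, circ.
    rewrite !Rmult_0_l. change (0, 0)%R with (RtoC 0). ring. }
  assert (Hbelow : forall r, 0 <= r < Cmod w -> M r = RtoC 0).
  { intros r Hr. destruct (Req_dec r 0) as [->|n]; [exact M0|].
    rewrite <- M0. symmetry. apply (mean_limit M (M r) 0 0 r); try lra.
    - intros s Hs. apply Hconst; lra.
    - intros e He. destruct (HM 0) with (e := e) as [d [Hd' H]]; try lra.
      exists d; split; [exact Hd'|]. intros s Hs. apply H. lra. }
  assert (Hat : M (Cmod w) = RtoC 0).
  { assert (Pw := Cmod_ge_0 w). destruct (Req_dec (Cmod w) 0) as [->|n]; [exact M0|].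
    apply (mean_limit M (RtoC 0) (Cmod w) 0 (Cmod w)); try lra.
    - intros s Hs. apply Hbelow; lra.
    - intros e He. destruct (HM (Cmod w)) with (e := e) as [d [Hd' H]]; try lra.
      exists d; split; [exact Hd'|]. intros s Hs. apply H. lra. }
  intros r Hr. change (M r = RtoC 0).
  destruct (Rlt_le_dec r (Cmod w)) as [L|L]; [apply Hbelow; lra|].
  destruct (Req_dec r (Cmod w)) as [->|n]; [exact Hat|].
  rewrite <- Hat. symmetry. apply (mean_limit M (M r) (Cmod w) (Cmod w) r); try lra.
  - intros s Hs. apply Hconst; try lra. assert (Pw := Cmod_ge_0 w). lra.
  - assert (Pw := Cmod_ge_0 w). intros e He. destruct (HM (Cmod w)) with (e := e) as [d [Hd' H]]; try lra.
    exists d; split; [exact Hd'|]. intros s Hs. apply H. lra.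
Qed.

(** The difference quotient, completed at [w] by the derivative. At [w] it is known to be
    continuous, but not yet differentiable, which is exactly the singularity that [mean_slope_zero]
    tolerates. *)
Lemma slope_exists (f : CC -> CC) (R0 : R) (w : CC) : holo R0 f -> Cmod w < R0 ->
  exists q : CC -> CC,
    (forall z, Cmod z < R0 -> ccont (q : C_UniformSpace -> CC) z) /\
    (forall z, Cmod z < R0 -> z <> w -> exists l, Cis_derive q z l) /\
    (forall y, f y = (f w + q y * (y - w))%C).
Proof.
  intros Hf Hw. destruct (Hf w Hw) as [l Hl]. apply Cis_derive_slope in Hl.
  destruct Hl as [q [Hq [_ H]]]. exists q.
  assert (Hd : forall z, Cmod z < R0 -> z <> w -> exists l, Cis_derive q z l).
  { intros z Hz n. destruct (Hf z Hz) as [m Hm]. eexists.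
    apply (Cis_derive_ext_loc (fun y => ((f y + - f w) * / (y + - w))%C)).
    - exists (Cmod (z - w)). split; [apply Cmod_gt_0, Cminus_eq_contra, n|].
      intros y Hy. rewrite (H y).
      assert (y <> w).
      { intros ->. replace (w - z)%C with (- (z - w))%C in Hy by ring. rewrite Cmod_opp in Hy. lra. }
      field. apply Cminus_eq_contra; assumption.
    - apply (Cis_derive_mult (fun y => (f y + - f w)%C) (fun y => (/ (y + - w))%C)).
      + apply (Cis_derive_plus f (fun _ => (- f w)%C)); [exact Hm|apply Cis_derive_const].
      + apply (Cis_derive_comp Cinv (fun y => (y + - w)%C)).
        * apply Cis_derive_inv. apply Cminus_eq_contra, n.
        * apply (Cis_derive_plus (fun y => y) (fun _ => (- w)%C)); [apply Cis_derive_id|apply Cis_derive_const]. }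
  split; [|split; assumption].
  intros z Hz. destruct (Ceq_dec z w) as [->|n]; [exact Hq|].
  destruct (Hd z Hz n) as [l' Hl']. eapply Cis_derive_cont, Hl'.
Qed.

(** * Finite sums, limits, and the Taylor expansion from the Cauchy integral *)

Fixpoint csum (a : nat -> CC) (n : nat) : CC :=
  match n with O => RtoC 0 | S m => (csum a m + a m)%C end.

Fixpoint rsum (a : nat -> R) (n : nat) : R :=
  match n with O => 0 | S m => rsum a m + a m end.

Definition ctends (u : nat -> CC) (l : CC) : Prop := is_lim_seq (fun n => Cmod (u n - l)) 0.

Lemma ctends_bound (u : nat -> CC) (l : CC) (v : nat -> R) :
  (forall n, Cmod (u n - l) <= v n) -> is_lim_seq v 0 -> ctends u l.
Proof.
  intros H Hv. apply (is_lim_seq_le_le (fun _ => 0) _ v).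
  - intros n; split; [apply Cmod_ge_0|apply H].
  - apply is_lim_seq_const.
  - exact Hv.
Qed.

Lemma ctends_eps (u : nat -> CC) (l : CC) : ctends u l <->
  forall e, 0 < e -> exists N, forall n, (N <= n)%nat -> Cmod (u n - l) < e.
Proof.
  split.
  - intros H e He. apply is_lim_seq_spec in H. destruct (H (mkposreal e He)) as [N HN].
    exists N. intros n Hn. specialize (HN n Hn). simpl in HN. rewrite Rminus_0_r in HN.
    eapply Rle_lt_trans; [apply Rle_abs|exact HN].
  - intros H. apply is_lim_seq_spec. intros e. destruct (H e (cond_pos e)) as [N HN].
    exists N. intros n Hn. rewrite Rminus_0_r, Rabs_right by (apply Rle_ge, Cmod_ge_0). auto.
Qed.

Lemma ctends_unique (u : nat -> CC) (l m : CC) : ctends u l -> ctends u m -> l = m.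
Proof.
  rewrite !ctends_eps. intros H1 H2. apply Ceq_minus, Cmod_eq_0, Rle_antisym; [|apply Cmod_ge_0].
  apply le_epsilon. intros e He. rewrite Rplus_0_l.
  destruct (H1 (e / 2)) as [N1 K1]; [lra|]. destruct (H2 (e / 2)) as [N2 K2]; [lra|].
  specialize (K1 (N1 + N2)%nat ltac:(lia)). specialize (K2 (N1 + N2)%nat ltac:(lia)).
  replace (l - m)%C with (- (u (N1 + N2)%nat - l) + (u (N1 + N2)%nat - m))%C by ring.
  eapply Rle_trans; [apply Cmod_triangle|]. rewrite Cmod_opp. lra.
Qed.

(** Cauchy's integral for the k-th Taylor coefficient: dz / (2 pi i z) is the normalised angle. *)
Definition tcoef (f : CC -> CC) (r : R) (k : nat) : CC :=
  CM (fun t => (f (circ r t) * / (circ r t) ^ k)%C).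

Lemma circ_nz (r t : R) : 0 < r -> circ r t <> RtoC 0.
Proof. intros Hr. apply Cmod_gt_0. rewrite Cmod_circ; lra. Qed.

Lemma tcoef_indep (f : CC -> CC) (R0 r1 r2 : R) (k : nat) : holo R0 f -> 0 < r1 <= r2 -> r2 < R0 ->
  tcoef f r1 k = tcoef f r2 k.
Proof.
  intros Hf H1 H2. apply (annulus_mean (fun z => (f z * / z ^ k)%C)); [exact H1|].
  intros z Hz. destruct (Hf z) as [l Hl]; [lra|].
  destruct (holo_pow R0 (fun z => z) k (holo_id R0) z) as [m Hm]; [lra|].
  eexists. apply (Cis_derive_mult f (fun z => (/ z ^ k)%C)); [exact Hl|].
  apply (Cis_derive_comp Cinv (fun z => (z ^ k)%C)); [|exact Hm].
  apply Cis_derive_inv, Cpow_nz. apply Cmod_gt_0. lra.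
Qed.

Lemma CM_csum (u : nat -> R -> CC) (K : nat) : (forall k, cc (u k)) ->
  cc (fun t => csum (fun k => u k t) K) /\
  CM (fun t => csum (fun k => u k t) K) = csum (fun k => CM (u k)) K.
Proof.
  intros H. induction K as [|K [I1 I2]]; simpl.
  - split; [apply cc_const|apply CM_const].
  - split; [apply (cc_plus (fun t => csum (fun k => u k t) K) (u K)); auto|].
    rewrite (CM_plus (fun t => csum (fun k => u k t) K) (u K)), I2; auto.
Qed.

Lemma csum_ext (a b : nat -> CC) (K : nat) : (forall k, (k < K)%nat -> a k = b k) -> csum a K = csum b K.
Proof.
  intros H. induction K as [|K IH]; simpl; [reflexivity|].
  rewrite IH, H; auto.
Qed.

Lemma csum_scal (c : CC) (a : nat -> CC) (K : nat) : csum (fun k => (c * a k)%C) K = (c * csum a K)%C.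
Proof. induction K as [|K IH]; simpl; [ring|rewrite IH; ring]. Qed.

(** The geometric series is kept with its exact remainder, so integrating it only takes a finite sum
    and a bound. *)
Lemma cauchy_kernel_geom (z w : CC) (K : nat) : z <> RtoC 0 -> z <> w ->
  (z / (z - w))%C = (csum (fun k => w ^ k * / z ^ k) K + w ^ K * / z ^ K * (z / (z - w)))%C.
Proof.
  intros Hz Hw. assert (Hm := Cminus_eq_contra _ _ Hw).
  induction K as [|K IH]; simpl.
  - field. exact Hm.
  - rewrite IH at 1. field. repeat split; auto. apply Cpow_nz, Hz.
Qed.

Lemma geom_lim (x : R) (B : R) : 0 <= x < 1 -> is_lim_seq (fun n => B * x ^ n) 0.
Proof.
  intros Hx. replace (Finite 0) with (Rbar_mult (Finite B) (Finite 0)) by (simpl; f_equal; ring).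
  apply is_lim_seq_scal_l. apply is_lim_seq_geom. rewrite Rabs_right; lra.
Qed.

Lemma holo_circle_bounded (u : R -> CC) : cc u ->
  exists B, 0 < B /\ forall t, 0 <= t <= 2 * PI -> Cmod (u t) <= B.
Proof.
  intros Hu. assert (P := two_PI_pos).
  destruct (continuity_ab_maj (fun t => Cmod (u t)) 0 (2 * PI)) as [x [Hx _]]; [lra| |].
  - intros c _. apply continuity_pt_filterlim. apply (rc_Cmod u Hu c).
  - exists (Cmod (u x) + 1). split; [assert (X := Cmod_ge_0 (u x)); lra|].
    intros t Ht. specialize (Hx t Ht). lra.
Qed.

Lemma circle_bound (f : CC -> CC) (r : R) : cc (fun t => f (circ r t)) ->
  exists B, 0 < B /\ forall t, Cmod (f (circ r t)) <= B.
Proof.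
  intros H. destruct (holo_circle_bounded _ H) as [B [HB K]]. exists B; split; [exact HB|].
  intros t. destruct (circ_period_pt 1 t) as [t' [Ht' E]].
  rewrite circ_RtoC, <- E, <- circ_RtoC. apply K, Ht'.
Qed.

(** Only values on the circle enter: the series tends to the Cauchy integral, before it is known
    that this integral equals [f w]. It is applied to [f] and to the constant 1. *)
Lemma cauchy_series_aux (f : CC -> CC) (r : R) (w : CC) : Cmod w < r -> cc (fun t => f (circ r t)) ->
  ctends (csum (fun k => (tcoef f r k * w ^ k)%C))
    (CM (fun t => (f (circ r t) * (circ r t / (circ r t - w)))%C)).
Proof.
  intros Hw Hf. assert (Pw := Cmod_ge_0 w). assert (Hr : 0 < r) by lra.
  destruct (circle_bound f r Hf) as [B [HB Hb]].
  assert (Hnw : forall t, circ r t <> w).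
  { intros t E. assert (X := Cmod_circ r t (Rlt_le _ _ Hr)). rewrite E in X. lra. }
  assert (Hker : cc (fun t => (circ r t / (circ r t - w))%C)).
  { apply cc_mult; [apply cc_circ|]. apply (cc_inv (fun t => (circ r t - w)%C)).
    - apply cc_minus; [apply cc_circ|apply cc_const].
    - intros t. apply Cminus_eq_contra, Hnw. }
  assert (Hp : forall k, cc (fun t => (/ circ r t ^ k)%C)).
  { intros k. apply (cc_inv (fun t => (circ r t ^ k)%C)).
    - apply cc_pow, cc_circ.
    - intros t. apply Cpow_nz, circ_nz, Hr. }
  apply (ctends_bound _ _ (fun K => B * (r / (r - Cmod w)) * (Cmod w / r) ^ K)).
  - intros K.
    assert (E : csum (fun k => (tcoef f r k * w ^ k)%C) K
        = CM (fun t => csum (fun k => (w ^ k * (f (circ r t) * / circ r t ^ k))%C) K)).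
    { destruct (CM_csum (fun k t => (w ^ k * (f (circ r t) * / circ r t ^ k))%C) K) as [_ E].
      - intros k. apply cc_mult; [apply cc_const|apply cc_mult; auto].
      - rewrite E. apply csum_ext. intros k _. unfold tcoef. rewrite CM_scal; [ring|].
        apply cc_mult; auto. }
    rewrite E, <- CM_minus.
    + apply Cmod_CM_bound.
      * apply cc_minus; [|apply cc_mult; auto].
        apply (CM_csum (fun k t => (w ^ k * (f (circ r t) * / circ r t ^ k))%C)).
        intros k. apply cc_mult; [apply cc_const|apply cc_mult; auto].
      * intros t. set (z := circ r t).
        assert (Hz : z <> RtoC 0) by (apply circ_nz, Hr).
        replace (csum (fun k => (w ^ k * (f z * / z ^ k))%C) K)
          with (f z * csum (fun k => (w ^ k * / z ^ k)%C) K)%C.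
        2:{ rewrite <- csum_scal. apply csum_ext. intros; ring. }
        rewrite (cauchy_kernel_geom z w K Hz (Hnw t)).
        replace (f z * csum (fun k => w ^ k * / z ^ k) K -
           f z * (csum (fun k => w ^ k * / z ^ k) K + w ^ K * / z ^ K * (z / (z - w))))%C
          with (- (f z * ((w / z) ^ K * (z / (z - w)))))%C.
        2:{ unfold Cdiv at 1. rewrite Cpow_mult_l, Cpow_inv by exact Hz. ring. }
        assert (Hzw := Cminus_eq_contra _ _ (Hnw t)). fold z in Hzw.
        rewrite Cmod_opp, !Cmod_mult, Cmod_pow, !Cmod_div by assumption.
        assert (Ez : Cmod z = r) by (apply Cmod_circ; lra). rewrite Ez.
        assert (Lz : r - Cmod w <= Cmod (z - w)).
        { assert (T := Cmod_triangle (z - w) w). replace (z - w + w)%C with z in T by ring. lra. }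
        rewrite Rmult_assoc. apply Rmult_le_compat.
        -- apply Cmod_ge_0.
        -- apply Rmult_le_pos; [apply pow_le, Rdiv_le_0_compat; lra|].
           apply Rdiv_le_0_compat; lra.
        -- apply Hb.
        -- rewrite Rmult_comm. apply Rmult_le_compat_r; [apply pow_le, Rdiv_le_0_compat; lra|].
           apply Rmult_le_compat_l; [lra|]. apply Rinv_le_contravar; lra.
    + apply (CM_csum (fun k t => (w ^ k * (f (circ r t) * / circ r t ^ k))%C)).
      intros k. apply cc_mult; [apply cc_const|apply cc_mult; auto].
    + apply cc_mult; auto.
  - apply geom_lim. split; [apply Rdiv_le_0_compat; lra|]. apply Rlt_div_l; lra.
Qed.

(** For k > 0 the mean of z^(-k) is independent of the radius, yet it scales like r^(-k). Comparing
    the radii 1 and 2 forces it to vanish. *)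
Lemma tcoef_one (r : R) (k : nat) : 0 < r -> tcoef (fun _ => RtoC 1) r k = if Nat.eqb k 0 then RtoC 1 else RtoC 0.
Proof.
  intros Hr. destruct k as [|k]; simpl Nat.eqb.
  - unfold tcoef. transitivity (CM (fun _ => RtoC 1)); [|apply CM_const].
    apply CM_ext. intros t.
    change ((RtoC 1 * / RtoC 1)%C = RtoC 1). apply Cinv_r, C1_nz.
  - assert (Hs : forall p, 0 < p -> tcoef (fun _ => RtoC 1) p (S k)
       = (/ RtoC p ^ S k * tcoef (fun _ => RtoC 1) 1 (S k))%C).
    { intros p Hp. unfold tcoef. rewrite <- CM_scal.
      - apply CM_ext. intros t. rewrite circ_RtoC, Cpow_mult_l. field.
        split; apply Cpow_nz; [apply circ_nz; lra|]. intros E; apply RtoC_inj in E; lra.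
      - apply cc_mult; [apply cc_const|]. apply (cc_inv (fun t => (circ 1 t ^ S k)%C)).
        + apply cc_pow, cc_circ.
        + intros t. apply Cpow_nz, circ_nz. lra. }
    assert (E : tcoef (fun _ => RtoC 1) 1 (S k) = tcoef (fun _ => RtoC 1) 2 (S k)).
    { apply (tcoef_indep _ 3); try lra. apply holo_const. }
    rewrite (Hs r Hr). rewrite (Hs 2) in E by lra.
    set (c := tcoef (fun _ => RtoC 1) 1 (S k)) in *.
    assert (Ec : (RtoC (1 - / 2 ^ S k) * c)%C = RtoC 0).
    { rewrite RtoC_minus, RtoC_inv, RtoC_pow by (apply pow_nonzero; lra).
      replace ((1 - / 2 ^ S k) * c)%C with (c - / 2 ^ S k * c)%C by ring.
      rewrite <- E. ring. }
    assert (Hn : 1 - / 2 ^ S k <> 0).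
    { assert (1 < 2 ^ S k) by (apply Rlt_pow_R1; [lra|lia]).
      assert (/ 2 ^ S k < 1) by (rewrite <- Rinv_1; apply Rinv_lt_contravar; lra). lra. }
    replace c with (RtoC 0); [ring|].
    destruct (Ceq_dec c (RtoC 0)) as [->|n]; [reflexivity|].
    exfalso. apply (Cmult_neq_0 _ c) in Ec; [exact Ec| |exact n].
    intros E'. apply RtoC_inj in E'. contradiction.
Qed.

(** Cauchy's formula: the mean of z (f z - f w) / (z - w) is 0 by [mean_slope_zero] and the mean of
    z / (z - w) is 1, so the limit found in [cauchy_series_aux] is [f w]. *)
Theorem taylor (f : CC -> CC) (R0 r : R) (w : CC) : holo R0 f -> Cmod w < r -> r < R0 ->
  ctends (csum (fun k => (tcoef f r k * w ^ k)%C)) (f w).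
Proof.
  intros Hf Hw Hr. assert (Pw := Cmod_ge_0 w).
  assert (Hc : cc (fun t => f (circ r t))) by (apply (cc_holo R0); [exact Hf|lra]).
  assert (H1 := cauchy_series_aux f r w Hw Hc).
  (* The series of the constant 1 evaluates the mean of the kernel: its nonempty partial sums all
     equal 1. *)
  assert (K : CM (fun t => (circ r t / (circ r t - w))%C) = RtoC 1).
  { assert (H2 := cauchy_series_aux (fun _ => RtoC 1) r w Hw (cc_const (RtoC 1))).
    apply (ctends_unique (csum (fun k => (tcoef (fun _ => RtoC 1) r k * w ^ k)%C))).
    - rewrite (CM_ext _ (fun t => (1 * (circ r t / (circ r t - w)))%C)) by (intros; ring). exact H2.
    - apply ctends_eps. intros e He. exists 1%nat. intros n Hn.
      assert (E : csum (fun k => (tcoef (fun _ => RtoC 1) r k * w ^ k)%C) n = RtoC 1).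
      { destruct n as [|n]; [lia|]. clear Hn. induction n as [|n IH].
        - simpl. rewrite tcoef_one by lra. simpl. ring.
        - change (csum ?u (S (S n))) with (csum u (S n) + u (S n))%C. rewrite IH.
          rewrite tcoef_one by lra. simpl. ring. }
      rewrite E. replace (1 - 1)%C with (RtoC 0) by ring. rewrite Cmod_0. exact He. }
  destruct (slope_exists f R0 w Hf ltac:(lra)) as [q [Hq1 [Hq2 Hq3]]].
  assert (Z := mean_slope_zero q R0 w ltac:(lra) Hq1 Hq2 r ltac:(lra)).
  assert (Hnw : forall t, circ r t <> w).
  { intros t E. assert (X := Cmod_circ r t ltac:(lra)). rewrite E in X. lra. }
  assert (Hker : cc (fun t => (circ r t / (circ r t - w))%C)).
  { apply cc_mult; [apply cc_circ|]. apply (cc_inv (fun t => (circ r t - w)%C)).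
    - apply cc_minus; [apply cc_circ|apply cc_const].
    - intros t. apply Cminus_eq_contra, Hnw. }
  rewrite (CM_ext _ (fun t => (f (circ r t) * (circ r t / (circ r t - w))
       - f w * (circ r t / (circ r t - w)))%C)) in Z.
  2:{ intros t. rewrite (Hq3 (circ r t)). field. apply Cminus_eq_contra, Hnw. }
  rewrite (CM_minus (fun t => (f (circ r t) * (circ r t / (circ r t - w)))%C)
     (fun t => (f w * (circ r t / (circ r t - w)))%C)) in Z
    by (apply cc_mult; auto using cc_const).
  rewrite CM_scal, K in Z by exact Hker.
  replace (f w) with (CM (fun t => (f (circ r t) * (circ r t / (circ r t - w)))%C)); [exact H1|].
  apply Ceq_minus. rewrite <- Z. ring.
Qed.

(** * Power series *)

Lemma csum_plus (a b : nat -> CC) (K : nat) :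
  csum (fun k => (a k + b k)%C) K = (csum a K + csum b K)%C.
Proof. induction K as [|K IH]; simpl; [ring|rewrite IH; ring]. Qed.

Lemma csum_shift (a : nat -> CC) (K : nat) : csum a (S K) = (a 0%nat + csum (fun k => a (S k)) K)%C.
Proof.
  induction K as [|K IH]; [simpl; ring|].
  change (csum a (S (S K))) with (csum a (S K) + a (S K))%C. rewrite IH. simpl. ring.
Qed.

Lemma rsum_ext (a b : nat -> R) (K : nat) : (forall k, (k < K)%nat -> a k = b k) -> rsum a K = rsum b K.
Proof. intros H. induction K as [|K IH]; simpl; [reflexivity|]. rewrite IH, H; auto. Qed.

Lemma rsum_le (a b : nat -> R) (K : nat) : (forall k, (k < K)%nat -> a k <= b k) -> rsum a K <= rsum b K.
Proof.
  intros H. induction K as [|K IH]; simpl; [lra|].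
  assert (a K <= b K) by auto. assert (rsum a K <= rsum b K) by auto. lra.
Qed.

Lemma rsum_scal (c : R) (a : nat -> R) (K : nat) : rsum (fun k => c * a k) K = c * rsum a K.
Proof. induction K as [|K IH]; simpl; [ring|rewrite IH; ring]. Qed.

Lemma rsum_plus (a b : nat -> R) (K : nat) : rsum (fun k => a k + b k) K = rsum a K + rsum b K.
Proof. induction K as [|K IH]; simpl; [ring|rewrite IH; ring]. Qed.

Lemma rsum_pos (a : nat -> R) (K : nat) : (forall k, (k < K)%nat -> 0 <= a k) -> 0 <= rsum a K.
Proof.
  intros H. replace 0 with (rsum (fun _ => 0) K); [apply rsum_le; auto|].
  clear H. induction K; simpl; lra.
Qed.

Lemma rsum_mono (a : nat -> R) (K m : nat) : (forall k, 0 <= a k) -> rsum a K <= rsum a (K + m).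
Proof.
  intros H. induction m as [|m IH]; [rewrite Nat.add_0_r; lra|].
  rewrite Nat.add_succ_r. simpl. specialize (H (K + m)%nat). lra.
Qed.

Lemma rsum_term (a : nat -> R) (K k : nat) : (forall j, 0 <= a j) -> (k < K)%nat -> a k <= rsum a K.
Proof.
  intros H Hk. induction K as [|K IH]; [lia|]. simpl.
  destruct (Nat.eq_dec k K) as [->|n].
  - assert (0 <= rsum a K) by (apply rsum_pos; auto). lra.
  - specialize (H K). specialize (IH ltac:(lia)). lra.
Qed.

Lemma rsum_shift (a : nat -> R) (K : nat) : rsum a (S K) = a 0%nat + rsum (fun k => a (S k)) K.
Proof.
  induction K as [|K IH]; [simpl; ring|].
  change (rsum a (S (S K))) with (rsum a (S K) + a (S K)). rewrite IH. simpl. ring.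
Qed.

Lemma rsum_geom (y : R) (K : nat) : y <> 1 -> rsum (fun k => y ^ k) K = (1 - y ^ K) / (1 - y).
Proof.
  intros H. induction K as [|K IH]; simpl; [field; lra|]. rewrite IH. field. lra.
Qed.

Lemma rsum_geom_le (y : R) (K : nat) : 0 <= y < 1 -> rsum (fun k => y ^ k) K <= / (1 - y).
Proof.
  intros H. rewrite rsum_geom by lra.
  assert (0 <= y ^ K) by (apply pow_le; lra).
  apply Rmult_le_reg_r with (1 - y); [lra|]. unfold Rdiv.
  rewrite Rmult_assoc, Rinv_l by lra. lra.
Qed.

Lemma Cmod_csum_le (a : nat -> CC) (K : nat) : Cmod (csum a K) <= rsum (fun k => Cmod (a k)) K.
Proof.
  induction K as [|K IH]; simpl; [rewrite Cmod_0; lra|].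
  eapply Rle_trans; [apply Cmod_triangle|]. lra.
Qed.

Lemma csum_split (a : nat -> CC) (K m : nat) :
  csum a (K + m) = (csum a K + csum (fun k => a (K + k)%nat) m)%C.
Proof.
  induction m as [|m IH]; [rewrite Nat.add_0_r; simpl; ring|].
  rewrite Nat.add_succ_r. simpl. rewrite IH. ring.
Qed.

Lemma rsum_split (a : nat -> R) (K m : nat) : rsum a (K + m) = rsum a K + rsum (fun k => a (K + k)%nat) m.
Proof.
  induction m as [|m IH]; [rewrite Nat.add_0_r; simpl; ring|].
  rewrite Nat.add_succ_r. simpl. rewrite IH. ring.
Qed.

Lemma ctends_const_plus (u : nat -> CC) (l c : CC) : ctends u l -> ctends (fun n => (c + u n)%C) (c + l)%C.
Proof.
  intros H. unfold ctends. eapply is_lim_seq_ext; [|exact H].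
  intros n. cbv beta. f_equal. ring.
Qed.

Lemma ctends_scal (u : nat -> CC) (l c : CC) : ctends u l -> ctends (fun n => (c * u n)%C) (c * l)%C.
Proof.
  intros H. apply (ctends_bound _ _ (fun n => Cmod c * Cmod (u n - l))).
  - intros n. rewrite <- Cmod_mult. right. f_equal. ring.
  - replace (Finite 0) with (Rbar_mult (Finite (Cmod c)) (Finite 0)) by (simpl; f_equal; ring).
    apply is_lim_seq_scal_l. exact H.
Qed.

Lemma ctends_plus (u v : nat -> CC) (l m : CC) : ctends u l -> ctends v m ->
  ctends (fun n => (u n + v n)%C) (l + m)%C.
Proof.
  intros H1 H2. apply (ctends_bound _ _ (fun n => Cmod (u n - l) + Cmod (v n - m))).
  - intros n. replace (u n + v n - (l + m))%C with ((u n - l) + (v n - m))%C by ring.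
    apply Cmod_triangle.
  - replace (Finite 0) with (Finite (0 + 0)) by (f_equal; ring). apply is_lim_seq_plus'; assumption.
Qed.

Lemma ctends_ext (u v : nat -> CC) (l : CC) : (forall n, u n = v n) -> ctends u l -> ctends v l.
Proof. intros E H. eapply is_lim_seq_ext; [|exact H]. intros n; cbv beta; now rewrite E. Qed.

Lemma ctends_shift (u : nat -> CC) (l : CC) : ctends u l <-> ctends (fun n => u (S n)) l.
Proof. unfold ctends. apply (is_lim_seq_incr_1 (fun n => Cmod (u n - l))). Qed.

Lemma ctends_Cmod_le (u : nat -> CC) (l : CC) (M : R) : ctends u l -> (forall n, Cmod (u n) <= M) -> Cmod l <= M.
Proof.
  intros H HM. apply le_epsilon. intros e He.
  destruct (proj1 (ctends_eps u l) H e He) as [N HN]. specialize (HN N (le_n N)).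
  specialize (HM N). replace l with (u N + - (u N - l))%C by ring.
  eapply Rle_trans; [apply Cmod_triangle|]. rewrite Cmod_opp. lra.
Qed.

Lemma is_lim_seq_abs_minus (u : nat -> R) (l : R) : is_lim_seq u (Finite l) -> is_lim_seq (fun k => Rabs (u k - l)) 0.
Proof.
  intros Hu. replace (Finite 0) with (Rbar_abs (Finite (l - l)))
    by (simpl; f_equal; rewrite Rminus_diag; apply Rabs_R0).
  apply is_lim_seq_abs, is_lim_seq_minus'; [exact Hu|apply is_lim_seq_const].
Qed.

(** The tail estimate serves twice: for large [K] as uniform convergence, and at [K = 0] as a bound
    for the sum itself. *)
Lemma geom_csum (a : nat -> CC) (C y : R) : 0 <= C -> 0 <= y < 1 -> (forall k, Cmod (a k) <= C * y ^ k) ->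
  exists l, ctends (csum a) l /\ forall K, Cmod (l - csum a K) <= C * y ^ K / (1 - y).
Proof.
  intros HC Hy Ha.
  assert (Hex : ex_series (fun k => C * y ^ k)).
  { apply (ex_series_scal C (fun k => y ^ k)). apply ex_series_geom. rewrite Rabs_right; lra. }
  assert (Hs : forall p : CC -> R, (forall z, Rabs (p z) <= Cmod z) ->
     (forall z w, p (z + w)%C = p z + p w) -> p (RtoC 0) = 0 -> exists l, is_lim_seq (fun K => p (csum a K)) (Finite l)).
  { intros p Hp Hadd H0.
    assert (E : ex_series (fun k => p (a k))).
    { apply (ex_series_le (K := R_AbsRing) (V := R_CompleteNormedModule) _ (fun k => C * y ^ k)).
      - intros k. eapply Rle_trans; [apply Hp|apply Ha].
      - exact Hex. }
    destruct E as [l Hl]. exists l.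
    apply is_lim_seq_incr_1. eapply is_lim_seq_ext; [|exact Hl].
    intros n. induction n as [|n IH].
    - rewrite sum_O. simpl. rewrite Hadd, H0. ring.
    - rewrite sum_Sn, IH. change (csum a (S (S n))) with (csum a (S n) + a (S n))%C.
      rewrite Hadd. reflexivity. }
  destruct (Hs fst Rabs_fst_le) as [l1 H1]; [reflexivity|reflexivity|].
  destruct (Hs snd Rabs_snd_le) as [l2 H2]; [reflexivity|reflexivity|].
  assert (Hlim : ctends (csum a) (l1, l2)).
  { apply (ctends_bound _ _ (fun n => Rabs (fst (csum a n) - l1) + Rabs (snd (csum a n) - l2))).
    - intros n. apply Cmod_le_Rabs.
    - replace (Finite 0) with (Finite (0 + 0)) by (f_equal; ring).
      apply is_lim_seq_plus'.
      + exact (is_lim_seq_abs_minus _ l1 H1).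
      + exact (is_lim_seq_abs_minus _ l2 H2). }
  exists (l1, l2). split; [exact Hlim|]. intros K.
  assert (T : ctends (fun m => csum (fun k => a (K + k)%nat) m) ((l1, l2) - csum a K)%C).
  { rewrite ctends_eps in *. intros e He. destruct (Hlim e He) as [N HN]. exists N.
    intros n Hn. specialize (HN (K + n)%nat ltac:(lia)). rewrite csum_split in HN.
    match goal with |- Cmod ?x < _ => match type of HN with Cmod ?y < _ => replace x with y by ring end end.
    exact HN. }
  apply (ctends_Cmod_le _ _ _ T). intros m.
  eapply Rle_trans; [apply Cmod_csum_le|].
  apply Rle_trans with (rsum (fun k => (C * y ^ K) * y ^ k) m).
  - apply rsum_le. intros k _. eapply Rle_trans; [apply Ha|]. rewrite pow_add. right; ring.
  - rewrite rsum_scal. unfold Rdiv. apply Rmult_le_compat_l; [|apply rsum_geom_le, Hy].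
    apply Rmult_le_pos; [exact HC|apply pow_le; lra].
Qed.

(** Bernoulli's inequality for the base 1 + h = 1 / y. *)
Lemma linear_geom_bound (y : R) : 0 < y < 1 -> exists C, 0 < C /\ forall k, INR (S k) * y ^ k <= C.
Proof.
  intros Hy. set (h := / y - 1).
  assert (Hh : 0 < h).
  { unfold h. assert (1 < / y) by (rewrite <- Rinv_1 at 1; apply Rinv_lt_contravar; lra). lra. }
  exists (1 + / h). assert (Hih : 0 < / h) by (apply Rinv_0_lt_compat, Hh).
  split; [lra|]. intros k.
  assert (Hk : 1 + INR k * h <= (1 + h) ^ k).
  { induction k as [|k IH]; [simpl; lra|]. rewrite S_INR. simpl.
    assert (0 <= INR k) by apply pos_INR. nra. }
  assert (E : y ^ k * (1 + h) ^ k = 1).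
  { rewrite <- Rpow_mult_distr. replace (y * (1 + h)) with 1 by (unfold h; field; lra). apply pow1. }
  assert (P : 0 < y ^ k) by (apply pow_lt; lra).
  assert (0 <= INR k) by apply pos_INR.
  assert (A : INR (S k) <= (1 + / h) * (1 + INR k * h)).
  { rewrite S_INR. replace ((1 + / h) * (1 + INR k * h)) with (1 + / h + INR k * h + INR k) by (field; lra).
    nra. }
  apply Rle_trans with ((1 + / h) * (1 + h) ^ k * y ^ k).
  - apply Rmult_le_compat_r; [lra|]. eapply Rle_trans; [exact A|].
    apply Rmult_le_compat_l; lra.
  - rewrite Rmult_assoc, (Rmult_comm (_ ^ k)), E. lra.
Qed.

(** Each factor [INR (S k)] is paid for by one half of the geometric decay, that is, by passing from
    the ratio to its square root. *)
Lemma poly_geom_bound (m : nat) : forall x, 0 <= x < 1 -> exists C y, 0 < C /\ 0 < y < 1 /\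
  forall k, INR (S k) ^ m * x ^ k <= C * y ^ k.
Proof.
  induction m as [|m IH]; intros x Hx.
  - exists 1, ((x + 1) / 2). split; [lra|]. split; [lra|]. intros k. simpl. rewrite !Rmult_1_l.
    apply pow_incr. lra.
  - destruct (IH x Hx) as (C & y & HC & Hy & H).
    assert (Hs : 0 < sqrt y < 1).
    { split; [apply sqrt_lt_R0; lra|]. rewrite <- sqrt_1. apply sqrt_lt_1; lra. }
    destruct (linear_geom_bound (sqrt y) Hs) as (D & HD & H2).
    exists (C * D), (sqrt y). split; [nra|]. split; [exact Hs|]. intros k.
    assert (E : y ^ k = sqrt y ^ k * sqrt y ^ k) by (rewrite <- Rpow_mult_distr, sqrt_sqrt by lra; reflexivity).
    simpl pow. specialize (H k). specialize (H2 k). rewrite E in H.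
    assert (P : 0 < sqrt y ^ k) by (apply pow_lt; lra).
    assert (Q : 0 <= INR (S k)) by apply pos_INR.
    apply Rle_trans with (INR (S k) * (C * (sqrt y ^ k * sqrt y ^ k))).
    + rewrite Rmult_assoc. apply Rmult_le_compat_l; assumption.
    + replace (INR (S k) * (C * (sqrt y ^ k * sqrt y ^ k))) with (C * sqrt y ^ k * (INR (S k) * sqrt y ^ k)) by ring.
      replace (C * D * sqrt y ^ k) with (C * sqrt y ^ k * D) by ring.
      apply Rmult_le_compat_l; [nra|exact H2].
Qed.

(** Radius of convergence at least 1, in Abel's form. Bounds of this kind come directly from
    Cauchy's estimates and survive termwise differentiation. *)
Definition growth (a : nat -> CC) : Prop :=
  forall r, 0 < r < 1 -> exists B, 0 < B /\ forall k, Cmod (a k) * r ^ k <= B.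

Definition has_ps (a : nat -> CC) (f : CC -> CC) : Prop :=
  forall z, Cmod z < 1 -> ctends (csum (fun k => (a k * z ^ k)%C)) (f z).

(** Abel's comparison with a radius [s] between [r] and 1: the ratio r / s leaves room for any power
    of [k]. *)
Lemma growth_geom (a : nat -> CC) (m : nat) (r : R) : growth a -> 0 <= r < 1 ->
  exists C y, 0 < C /\ 0 < y < 1 /\ forall k, INR (S k) ^ m * (Cmod (a k) * r ^ k) <= C * y ^ k.
Proof.
  intros Ha Hr. set (s := (r + 1) / 2).
  destruct (Ha s) as [B [HB Hb]]; [unfold s; lra|].
  destruct (poly_geom_bound m (r / s)) as (C & y & HC & Hy & H).
  { unfold s. split; [apply Rdiv_le_0_compat; lra|apply Rlt_div_l; lra]. }
  exists (B * C), y. split; [nra|]. split; [exact Hy|]. intros k.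
  specialize (Hb k). specialize (H k).
  assert (E : r ^ k = s ^ k * (r / s) ^ k).
  { rewrite <- Rpow_mult_distr. f_equal. unfold s. field. lra. }
  rewrite E. assert (0 <= INR (S k) ^ m) by (apply pow_le, pos_INR).
  assert (0 <= (r / s) ^ k) by (apply pow_le, Rdiv_le_0_compat; unfold s; lra).
  apply Rle_trans with ((INR (S k) ^ m * (r / s) ^ k) * B).
  - replace (INR (S k) ^ m * (Cmod (a k) * (s ^ k * (r / s) ^ k)))
      with ((INR (S k) ^ m * (r / s) ^ k) * (Cmod (a k) * s ^ k)) by ring.
    apply Rmult_le_compat_l; [apply Rmult_le_pos; assumption|exact Hb].
  - replace (B * C * y ^ k) with (C * y ^ k * B) by ring. apply Rmult_le_compat_r; [lra|exact H].
Qed.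

Lemma growth_deriv (a : nat -> CC) : growth a -> growth (fun k => (INR (S k) * a (S k))%C).
Proof.
  intros Ha r Hr. destruct (growth_geom a 1 r Ha) as (C & y & HC & Hy & H); [lra|].
  exists (C / r). split; [apply Rdiv_lt_0_compat; lra|]. intros k.
  specialize (H (S k)). rewrite Cmod_mult, Cmod_R, Rabs_right by (apply Rle_ge, pos_INR).
  apply (Rmult_le_reg_r r); [lra|]. replace (C / r * r) with C by (field; lra).
  assert (y ^ S k <= 1) by (rewrite <- (pow1 (S k)); apply pow_incr; lra).
  apply Rle_trans with (C * y ^ S k); [|nra].
  eapply Rle_trans; [|exact H]. rewrite pow_1, (S_INR (S k)).
  replace (INR (S k) * Cmod (a (S k)) * r ^ k * r) with (INR (S k) * (Cmod (a (S k)) * r ^ S k)) by (simpl; ring).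
  apply Rmult_le_compat_r; [|lra].
  apply Rmult_le_pos; [apply Cmod_ge_0|apply pow_le; lra].
Qed.

Lemma growth_ps (a : nat -> CC) : growth a -> exists f, has_ps a f.
Proof.
  intros Ha.
  assert (H : forall z, exists l, Cmod z < 1 -> ctends (csum (fun k => (a k * z ^ k)%C)) l).
  { intros z. destruct (Rlt_dec (Cmod z) 1) as [Hz|Hz].
    - destruct (growth_geom a 0 (Cmod z) Ha) as (C & y & HC & Hy & H).
      { split; [apply Cmod_ge_0|exact Hz]. }
      destruct (geom_csum (fun k => (a k * z ^ k)%C) C y) as [l [Hl _]]; try lra.
      + intros k. specialize (H k). rewrite pow_O, Rmult_1_l in H. rewrite Cmod_mult, Cmod_pow. exact H.
      + exists l. auto.
    - exists (RtoC 0). intros; contradiction. }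
  exists (fun z => proj1_sig (constructive_indefinite_description _ (H z))).
  intros z Hz. destruct (constructive_indefinite_description _ (H z)) as [l Hl]. simpl. auto.
Qed.

(* [d k] stands for [k z^(k-1)], without the truncated predecessor. *)
Lemma pow_taylor2 (y z : CC) (r : R) : 0 <= r -> Cmod y <= r -> Cmod z <= r ->
  let d := fix d k := match k with O => RtoC 0 | S j => (z ^ j + z * d j)%C end in
  forall k, r ^ 2 * Cmod (y ^ k - z ^ k - d k * (y - z)) <= INR k ^ 2 * r ^ k * Cmod (y - z) ^ 2
    /\ r * Cmod (d k) <= INR k * r ^ k.
Proof.
  intros Hr Hy Hz d. assert (Py := Cmod_ge_0 y). assert (Pz := Cmod_ge_0 z).
  induction k as [|k [IH1 IH2]].
  - simpl. replace (1 - 1 - 0 * (y - z))%C with (RtoC 0) by ring. rewrite Cmod_0. split; lra.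
  - assert (Pk : 0 <= INR k) by apply pos_INR.
    assert (Pr : 0 <= r ^ k) by (apply pow_le, Hr).
    set (D := Cmod (y - z)) in *. assert (PD : 0 <= D) by apply Cmod_ge_0.
    split.
    + assert (E : (y ^ S k - z ^ S k - d (S k) * (y - z) =
         y * (y ^ k - z ^ k - d k * (y - z)) + d k * (y - z) * (y - z))%C) by (simpl; ring).
      rewrite E. eapply Rle_trans; [apply Rmult_le_compat_l; [apply pow_le, Hr|apply Cmod_triangle]|].
      rewrite !Cmod_mult. fold D.
      set (A := Cmod (y ^ k - z ^ k - d k * (y - z))) in *. assert (PA : 0 <= A) by apply Cmod_ge_0.
      rewrite S_INR. simpl pow in *.
      assert (X1 : r * (r * 1) * (Cmod y * A) <= r * (INR k * (INR k * 1) * r ^ k * (D * (D * 1)))).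
      { replace (r * (r * 1) * (Cmod y * A)) with (Cmod y * (r * (r * 1) * A)) by ring.
        apply Rmult_le_compat; auto. apply Rmult_le_pos; nra. }
      assert (X2 : r * (r * 1) * (Cmod (d k) * D * D) <= r * (INR k * r ^ k) * (D * D)).
      { replace (r * (r * 1) * (Cmod (d k) * D * D)) with (r * (r * Cmod (d k)) * (D * D)) by ring.
        apply Rmult_le_compat_r; [nra|]. apply Rmult_le_compat_l; assumption. }
      assert (X3 : 0 <= r * r ^ k * (D * D)) by (repeat apply Rmult_le_pos; auto).
      nra.
    + assert (T : Cmod (d (S k)) <= r ^ k + r * Cmod (d k)).
      { simpl. eapply Rle_trans; [apply Cmod_triangle|]. rewrite Cmod_mult, Cmod_pow.
        apply Rplus_le_compat; [apply pow_incr; lra|].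
        apply Rmult_le_compat_r; [apply Cmod_ge_0|exact Hz]. }
      rewrite S_INR. simpl pow. assert (r * Cmod (d (S k)) <= r * (r ^ k + r * Cmod (d k)))
        by (apply Rmult_le_compat_l; assumption). nra.
Qed.

(** The second-order remainders of the monomials, estimated in [pow_taylor2], sum to at most M |y -
    z|^2, which is stronger than differentiability. *)
Theorem ps_derive (a : nat -> CC) (f g : CC -> CC) : growth a -> has_ps a f ->
  has_ps (fun k => (INR (S k) * a (S k))%C) g ->
  forall z, Cmod z < 1 -> Cis_derive f z (g z).
Proof.
  intros Ha Hf Hg z Hz. set (r := (Cmod z + 1) / 2). assert (Pz := Cmod_ge_0 z).
  assert (Hr : Cmod z < r < 1) by (unfold r; lra).
  (* The exponent 2 pays for the factor [INR k ^ 2] of [pow_taylor2]. *)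
  destruct (growth_geom a 2 r Ha) as (C & y0 & HC & Hy0 & HB); [lra|].
  set (M := C / (1 - y0) / r ^ 2).
  assert (HM : 0 < M).
  { unfold M. apply Rdiv_lt_0_compat; [apply Rdiv_lt_0_compat; lra|apply pow_lt; lra]. }
  assert (Q : forall y, Cmod y < r -> Cmod (f y - f z - (y - z) * g z) <= M * Cmod (y - z) ^ 2).
  { intros y Hy.
    set (d := fix d k := match k with O => RtoC 0 | S j => (z ^ j + z * d j)%C end).
    assert (Ed : forall k, d (S k) = (INR (S k) * z ^ k)%C).
    { induction k as [|k IH]; [simpl; ring|].
      change (d (S (S k))) with (z ^ S k + z * d (S k))%C. rewrite IH, (S_INR (S k)), RtoC_plus.
      simpl Cpow. ring. }
    assert (Hd : ctends (csum (fun k => (a k * d k)%C)) (g z)).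
    { apply ctends_shift. eapply ctends_ext; [|exact (Hg z Hz)].
      intros n. rewrite csum_shift.
      replace (a 0%nat * d 0%nat)%C with (RtoC 0) by (simpl; ring).
      rewrite Cplus_0_l. apply csum_ext. intros k _. rewrite Ed. ring. }
    assert (T : ctends (fun K => (csum (fun k => (a k * y ^ k)%C) K + (RtoC (-1) * csum (fun k => (a k * z ^ k)%C) K
         + - (y - z) * csum (fun k => (a k * d k)%C) K))%C) (f y + (RtoC (-1) * f z + - (y - z) * g z))%C).
    { apply ctends_plus; [apply Hf; lra|]. apply ctends_plus; apply ctends_scal; [apply Hf; lra|exact Hd]. }
    replace (f y - f z - (y - z) * g z)%C with (f y + (RtoC (-1) * f z + - (y - z) * g z))%C.
    2:{ replace (RtoC (-1)) with (- RtoC 1)%C by (apply injective_projections; simpl; ring). ring. }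
    apply (ctends_Cmod_le _ _ _ T). intros K.
    replace (_ + _)%C with (csum (fun k => (a k * (y ^ k - z ^ k - d k * (y - z)))%C) K).
    2:{ rewrite <- !csum_scal, <- !csum_plus. apply csum_ext. intros k _.
        replace (RtoC (-1)) with (- RtoC 1)%C by (apply injective_projections; simpl; ring). ring. }
    eapply Rle_trans; [apply Cmod_csum_le|].
    assert (Pr2 : 0 < r ^ 2) by (apply pow_lt; lra).
    apply Rle_trans with (rsum (fun k => (C / r ^ 2 * Cmod (y - z) ^ 2) * y0 ^ k) K).
    - apply rsum_le. intros k _. rewrite Cmod_mult.
      destruct (pow_taylor2 y z r) with (k := k) as [E _]; try lra. fold d in E.
      apply Rmult_le_reg_l with (r ^ 2); [exact Pr2|].
      replace (r ^ 2 * (C / r ^ 2 * Cmod (y - z) ^ 2 * y0 ^ k)) with (C * y0 ^ k * Cmod (y - z) ^ 2)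
        by (field; lra).
      apply Rle_trans with (Cmod (a k) * (INR k ^ 2 * r ^ k * Cmod (y - z) ^ 2)).
      + replace (r ^ 2 * (Cmod (a k) * Cmod (y ^ k - z ^ k - d k * (y - z))))
          with (Cmod (a k) * (r ^ 2 * Cmod (y ^ k - z ^ k - d k * (y - z)))) by ring.
        apply Rmult_le_compat_l; [apply Cmod_ge_0|exact E].
      + replace (Cmod (a k) * (INR k ^ 2 * r ^ k * Cmod (y - z) ^ 2))
          with (INR k ^ 2 * (Cmod (a k) * r ^ k) * Cmod (y - z) ^ 2) by ring.
        apply Rmult_le_compat_r; [apply pow_le, Cmod_ge_0|].
        eapply Rle_trans; [|apply HB]. apply Rmult_le_compat_r.
        * apply Rmult_le_pos; [apply Cmod_ge_0|apply pow_le; lra].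
        * apply pow_incr. split; [apply pos_INR|]. rewrite S_INR. lra.
    - rewrite rsum_scal. unfold M.
      replace (C / (1 - y0) / r ^ 2 * Cmod (y - z) ^ 2) with ((C / r ^ 2 * Cmod (y - z) ^ 2) * / (1 - y0))
        by (field; split; lra).
      apply Rmult_le_compat_l; [|apply rsum_geom_le; lra].
      apply Rmult_le_pos; [apply Rdiv_le_0_compat; lra|apply pow_le, Cmod_ge_0]. }
  apply Cis_derive_eps. intros e He.
  exists (Rmin (r - Cmod z) (e / M)). split.
  { apply Rmin_glb_lt; [lra|apply Rdiv_lt_0_compat; assumption]. }
  intros y Hy.
  assert (M1 := Rmin_l (r - Cmod z) (e / M)). assert (M2 := Rmin_r (r - Cmod z) (e / M)).
  eapply Rle_trans; [apply Q|].
  - replace y with ((y - z) + z)%C by ring. eapply Rle_lt_trans; [apply Cmod_triangle|]. lra.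
  - assert (P := Cmod_ge_0 (y - z)). simpl. rewrite Rmult_1_r, <- Rmult_assoc.
    apply Rmult_le_compat_r; [exact P|].
    apply Rle_trans with (M * (e / M)); [apply Rmult_le_compat_l; lra|]. right; field. lra.
Qed.

(** The radius 1/2 is only a normalisation; [coef_eq] gives every other radius in (0, 1). *)
Definition coef (f : CC -> CC) (k : nat) : CC := tcoef f (1 / 2) k.

Lemma coef_eq (f : CC -> CC) (r : R) (k : nat) : holo 1 f -> 0 < r < 1 -> coef f k = tcoef f r k.
Proof.
  intros Hf Hr. unfold coef. destruct (Rle_dec r (1 / 2)) as [L|L].
  - symmetry. apply (tcoef_indep f 1); try lra. exact Hf.
  - apply (tcoef_indep f 1); try lra. exact Hf.
Qed.

Lemma tcoef_cc (f : CC -> CC) (r : R) (k : nat) : 0 < r -> cc (fun t => f (circ r t)) ->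
  cc (fun t => (f (circ r t) * / circ r t ^ k)%C).
Proof.
  intros Hr Hf. apply cc_mult; [exact Hf|]. apply (cc_inv (fun t => (circ r t ^ k)%C)).
  - apply cc_pow, cc_circ.
  - intros t. apply Cpow_nz, circ_nz, Hr.
Qed.

Lemma tcoef_bound (f : CC -> CC) (r B : R) (k : nat) : 0 < r -> cc (fun t => f (circ r t)) ->
  (forall t, Cmod (f (circ r t)) <= B) -> Cmod (tcoef f r k) * r ^ k <= B.
Proof.
  intros Hr Hf HB. assert (P : 0 < r ^ k) by (apply pow_lt, Hr).
  apply Rle_trans with (B * / r ^ k * r ^ k); [|right; field; lra].
  apply Rmult_le_compat_r; [lra|]. apply Cmod_CM_bound; [apply tcoef_cc; assumption|].
  intros t. assert (N := circ_nz r t Hr).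
  rewrite Cmod_mult, Cmod_inv, Cmod_pow, Cmod_circ by (try apply Cpow_nz; auto; lra).
  apply Rmult_le_compat_r; [left; apply Rinv_0_lt_compat, P|apply HB].
Qed.

Lemma coef_growth (f : CC -> CC) : holo 1 f -> growth (coef f).
Proof.
  intros Hf r Hr. assert (Hc : cc (fun t => f (circ r t))) by (apply (cc_holo 1); auto; lra).
  destruct (circle_bound f r Hc) as [B [HB Hb]].
  exists B; split; [exact HB|]. intros k. rewrite (coef_eq f r k Hf Hr).
  apply tcoef_bound; auto; lra.
Qed.

Lemma coef_ps (f : CC -> CC) : holo 1 f -> has_ps (coef f) f.
Proof.
  intros Hf z Hz. set (r := (Cmod z + 1) / 2). assert (Pz := Cmod_ge_0 z).
  eapply ctends_ext; [|apply (taylor f 1 r z Hf); unfold r; lra].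
  intros n. apply csum_ext. intros k _. rewrite (coef_eq f r k Hf); [reflexivity|unfold r; lra].
Qed.

Lemma mean_value (f : CC -> CC) (R0 r : R) : holo R0 f -> 0 < r < R0 ->
  CM (fun t => f (circ r t)) = f (RtoC 0).
Proof.
  intros Hf Hr. assert (T := taylor f R0 r (RtoC 0) Hf). rewrite Cmod_0 in T.
  specialize (T (proj1 Hr) (proj2 Hr)).
  apply (ctends_unique _ _ _) with (2 := T).
  apply ctends_eps. intros e He. exists 1%nat. intros [|n] Hn; [lia|]. clear Hn.
  rewrite csum_shift. rewrite (csum_ext _ (fun k => (RtoC 0 * RtoC 0)%C)).
  2:{ intros k _. simpl. ring. }
  rewrite csum_scal.
  replace (tcoef f r 0) with (CM (fun t => f (circ r t))).
  2:{ apply CM_ext. intros t. change (f (circ r t) = (f (circ r t) * / RtoC 1)%C). field. }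
  match goal with |- Cmod ?x < _ => replace x with (RtoC 0) by (simpl; ring) end.
  rewrite Cmod_0. exact He.
Qed.

Lemma tcoef_pow (r : R) (j k : nat) : 0 < r ->
  tcoef (fun z => (z ^ j)%C) r k = if Nat.eqb j k then RtoC 1 else RtoC 0.
Proof.
  intros Hr. destruct (Nat.eqb_spec j k) as [->|n].
  - transitivity (CM (fun _ => RtoC 1)); [|apply CM_const]. apply CM_ext. intros t.
    apply Cinv_r, Cpow_nz, circ_nz, Hr.
  - destruct (Nat.lt_total j k) as [L|[L|L]]; [|contradiction|].
    + replace (RtoC 0) with (tcoef (fun _ => RtoC 1) r (k - j)).
      * apply CM_ext. intros t. assert (N := circ_nz r t Hr).
        replace k with (j + (k - j))%nat at 1 by lia. rewrite Cpow_add_r. field.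
        split; apply Cpow_nz, N.
      * rewrite tcoef_one by exact Hr. destruct (k - j)%nat eqn:E; [lia|reflexivity].
    + transitivity (CM (fun t => (circ r t ^ (j - k))%C)).
      * apply CM_ext. intros t. assert (N := circ_nz r t Hr).
        replace j with ((j - k) + k)%nat at 1 by lia. rewrite Cpow_add_r. field. apply Cpow_nz, N.
      * rewrite (mean_value (fun z => (z ^ (j - k))%C) (r + 1) r); [|apply holo_pow, holo_id|lra].
        destruct (j - k)%nat eqn:E; [lia|]. simpl. ring.
Qed.

(** The partial sums converge uniformly on the circle of radius 1/2, and by orthogonality their k-th
    coefficient is exactly [a k] as soon as K > k. *)
Lemma coef_unique (a : nat -> CC) (f : CC -> CC) : growth a -> holo 1 f -> has_ps a f ->
  forall k, coef f k = a k.
Proof.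
  intros Ha Hf Hps k. unfold coef.
  destruct (growth_geom a 0 (1 / 2) Ha) as (C & y & HC & Hy & HB); [lra|].
  assert (Hc : cc (fun t => f (circ (1 / 2) t))) by (apply (cc_holo 1); auto; lra).
  set (S := fun K z => csum (fun j => (a j * z ^ j)%C) K).
  assert (HS : forall K, cc (fun t => S K (circ (1 / 2) t))).
  { intros K. apply (CM_csum (fun j t => (a j * circ (1 / 2) t ^ j)%C)).
    intros j. apply cc_mult; [apply cc_const|apply cc_pow, cc_circ]. }
  assert (Htail : forall K t, Cmod (f (circ (1 / 2) t) - S K (circ (1 / 2) t)) <= C * y ^ K / (1 - y)).
  { intros K t. assert (Em : Cmod (circ (1 / 2) t) = 1 / 2) by (apply Cmod_circ; lra).
    destruct (geom_csum (fun j => (a j * circ (1 / 2) t ^ j)%C) C y) as [l [Hl Ht]]; try lra.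
    - intros j. specialize (HB j). rewrite pow_O, Rmult_1_l in HB.
      rewrite Cmod_mult, Cmod_pow, Em. exact HB.
    - replace (f (circ (1 / 2) t)) with l; [apply Ht|].
      apply (ctends_unique _ _ _ Hl). apply Hps. lra. }
  apply Ceq_minus, Cmod_eq_0, Rle_antisym; [|apply Cmod_ge_0].
  assert (Hlim : is_lim_seq (fun n => (C / (1 - y) * / (1 / 2) ^ k) * y ^ n) 0) by (apply geom_lim; lra).
  apply (is_lim_seq_le_loc (fun _ => Cmod (tcoef f (1 / 2) k - a k)) (fun n => (C / (1 - y) * / (1 / 2) ^ k) * y ^ n)
    (Finite (Cmod (tcoef f (1 / 2) k - a k))) (Finite 0)); [|apply is_lim_seq_const|exact Hlim].
  exists (k + 1)%nat. intros K HK.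
  assert (E : tcoef (S K) (1 / 2) k = a k).
  { unfold tcoef. rewrite (CM_ext _ (fun t => csum (fun j => (a j * (circ (1 / 2) t ^ j * / circ (1 / 2) t ^ k))%C) K)).
    2:{ intros t. unfold S. rewrite Cmult_comm, <- csum_scal. apply csum_ext. intros; ring. }
    assert (Hjk : forall j, cc (fun t => (circ (1 / 2) t ^ j * / circ (1 / 2) t ^ k)%C)).
    { intros j. apply (tcoef_cc (fun z => (z ^ j)%C)); [lra|]. apply cc_pow, cc_circ. }
    destruct (CM_csum (fun j t => (a j * (circ (1 / 2) t ^ j * / circ (1 / 2) t ^ k))%C) K) as [_ E].
    { intros j. apply cc_mult; [apply cc_const|apply Hjk]. }
    rewrite E.
    rewrite (csum_ext _ (fun j => (a j * (if Nat.eqb j k then RtoC 1 else RtoC 0))%C)).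
    2:{ intros j _. rewrite CM_scal by apply Hjk. f_equal. apply (tcoef_pow (1 / 2) j k). lra. }
    assert (Z : forall n, (n <= k)%nat -> csum (fun j => (a j * (if Nat.eqb j k then RtoC 1 else RtoC 0))%C) n = RtoC 0).
    { induction n as [|n IH]; intros Hn; simpl; [reflexivity|].
      rewrite IH by lia. destruct (Nat.eqb_spec n k); [lia|]. ring. }
    replace K with (k + Datatypes.S (K - k - 1))%nat by lia.
    induction (K - k - 1)%nat as [|m IH].
    - rewrite Nat.add_1_r. simpl. rewrite Z, Nat.eqb_refl by lia. ring.
    - rewrite Nat.add_succ_r. simpl csum. rewrite IH.
      destruct (Nat.eqb_spec (k + Datatypes.S m) k); [lia|]. ring. }
  rewrite <- E at 1. unfold tcoef. rewrite <- CM_minus by (apply tcoef_cc; auto; lra).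
  apply Cmod_CM_bound.
  - apply cc_minus; apply tcoef_cc; auto; lra.
  - intros t. set (z := circ (1 / 2) t).
    assert (N : z <> RtoC 0) by (apply circ_nz; lra).
    replace (f z * / z ^ k - S K z * / z ^ k)%C with ((f z - S K z) * / z ^ k)%C by ring.
    rewrite Cmod_mult, Cmod_inv, Cmod_pow by (apply Cpow_nz, N).
    unfold z at 3. rewrite Cmod_circ by lra.
    replace (C / (1 - y) * / (1 / 2) ^ k * y ^ K) with (C * y ^ K / (1 - y) * / (1 / 2) ^ k)
      by (field; split; [apply pow_nonzero; lra|lra]).
    apply Rmult_le_compat_r; [|apply Htail].
    left. apply Rinv_0_lt_compat, pow_lt. lra.
Qed.

(** * Derivatives, division by a zero, Parseval *)

Lemma Cis_derive_unique (f : CC -> CC) (z l m : CC) : Cis_derive f z l -> Cis_derive f z m -> l = m.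
Proof.
  intros H1 H2.
  rewrite <- (is_C_derive_unique f z l H1), <- (is_C_derive_unique f z m H2). reflexivity.
Qed.

Lemma Cderiv_correct (f : CC -> CC) (z l : CC) : Cis_derive f z l -> Cderiv f z = l.
Proof.
  intros H. apply (Cis_derive_unique f z); [|exact H].
  unfold Cderiv. apply epsilon_spec. now exists l.
Qed.

Lemma Cderiv_spec (r : R) (f : CC -> CC) (z : CC) : holo r f -> Cmod z < r -> Cis_derive f z (Cderiv f z).
Proof.
  intros H Hz. destruct (H z Hz) as [l Hl]. now rewrite (Cderiv_correct f z l Hl).
Qed.

Lemma ps_holo (a : nat -> CC) (f : CC -> CC) : growth a -> has_ps a f -> holo 1 f.
Proof.
  intros Ha Hf z Hz. destruct (growth_ps _ (growth_deriv a Ha)) as [g Hg].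
  exists (g z). apply (ps_derive a f g); assumption.
Qed.

(** The chosen value [Cderiv f] agrees on the disk with the sum of the differentiated series, which
    is again a power series; hence derivatives can be iterated and their coefficients read off. *)
Lemma holo_deriv (f : CC -> CC) : holo 1 f ->
  holo 1 (Cderiv f) /\ forall k, coef (Cderiv f) k = (INR (S k) * coef f (S k))%C.
Proof.
  intros Hf. assert (Ha := coef_growth f Hf).
  destruct (growth_ps _ (growth_deriv _ Ha)) as [g Hg].
  assert (E : forall z, Cmod z < 1 -> g z = Cderiv f z).
  { intros z Hz. symmetry. apply Cderiv_correct.
    apply (ps_derive (coef f)); auto. apply coef_ps, Hf. }
  assert (Hh : holo 1 (Cderiv f)).
  { apply (holo_ext 1 g); [exact E|]. eapply ps_holo; [|exact Hg]. apply growth_deriv, Ha. }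
  split; [exact Hh|]. intros k.
  apply (coef_unique (fun k => (INR (S k) * coef f (S k))%C)); auto.
  - apply growth_deriv, Ha.
  - intros z Hz. rewrite <- E by exact Hz. apply Hg, Hz.
Qed.

Lemma holo_deriv_n (n : nat) (f : CC -> CC) : holo 1 f -> holo 1 (Cderiv_n n f).
Proof. intros Hf. induction n as [|n IH]; simpl; [exact Hf|]. apply holo_deriv, IH. Qed.

(** The exact factor is (k + 1) ... (k + n); the power (k + n)^n has the same order in k. *)
Lemma coef_deriv_n (n : nat) (f : CC -> CC) (k : nat) : holo 1 f ->
  Cmod (coef (Cderiv_n n f) k) <= INR (k + n) ^ n * Cmod (coef f (k + n)).
Proof.
  intros Hf. revert k. induction n as [|n IH]; intros k.
  - simpl. rewrite Nat.add_0_r. lra.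
  - simpl Cderiv_n. rewrite (proj2 (holo_deriv _ (holo_deriv_n n f Hf))).
    rewrite Cmod_mult, Cmod_R, Rabs_right by (apply Rle_ge, pos_INR).
    specialize (IH (S k)). replace (S k + n)%nat with (k + S n)%nat in IH by lia.
    simpl pow. rewrite Rmult_assoc.
    apply Rmult_le_compat; auto using pos_INR, Cmod_ge_0. apply le_INR. lia.
Qed.

Lemma disk_near (z : CC) (f g : CC -> CC) : Cmod z < 1 -> (forall y, Cmod y < 1 -> f y = g y) ->
  exists d, 0 < d /\ forall y, Cmod (y - z) < d -> f y = g y.
Proof.
  intros Hz E. exists (1 - Cmod z); split; [lra|]. intros y Hy. apply E.
  replace y with ((y - z) + z)%C by ring. eapply Rle_lt_trans; [apply Cmod_triangle|]. lra.
Qed.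

Lemma Cderiv_ext (f g : CC -> CC) : holo 1 f -> (forall z, Cmod z < 1 -> f z = g z) ->
  forall z, Cmod z < 1 -> Cderiv f z = Cderiv g z.
Proof.
  intros Hf E z Hz. symmetry. apply Cderiv_correct.
  apply (Cis_derive_ext_loc f g); [apply disk_near; assumption|].
  apply (Cderiv_spec 1); assumption.
Qed.

Lemma Cis_derive_minus (f g : CC -> CC) (z l m : CC) :
  Cis_derive f z l -> Cis_derive g z m -> Cis_derive (fun y => (f y - g y)%C) z (l - m)%C.
Proof.
  intros H1 H2. apply (Cis_derive_plus f (fun y => (- g y)%C)); [exact H1|].
  replace (- m)%C with (RtoC 0 * g z + - RtoC 1 * m)%C by ring.
  apply (Cis_derive_ext (fun y => (- RtoC 1 * g y)%C)); [intros; ring|].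
  apply (Cis_derive_mult (fun _ => (- RtoC 1)%C) g); [apply Cis_derive_const|exact H2].
Qed.

Lemma Cis_derive_pow (f : CC -> CC) (z l : CC) (m : nat) : Cis_derive f z l ->
  Cis_derive (fun y => (f y ^ S m)%C) z (RtoC (INR (S m)) * f z ^ m * l)%C.
Proof.
  intros H. induction m as [|m IH].
  - replace (RtoC (INR 1) * f z ^ 0 * l)%C with l by (simpl; ring).
    apply (Cis_derive_ext f); [intros y; simpl; ring|exact H].
  - replace (RtoC (INR (S (S m))) * f z ^ S m * l)%C
      with (l * f z ^ S m + f z * (RtoC (INR (S m)) * f z ^ m * l))%C.
    2:{ rewrite (S_INR (S m)), RtoC_plus. simpl Cpow. ring. }
    apply (Cis_derive_ext (fun y => (f y * f y ^ S m)%C)); [intros y; reflexivity|].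
    apply (Cis_derive_mult f (fun y => (f y ^ S m)%C)); assumption.
Qed.

Lemma Cderiv_n_minus (n : nat) (f g : CC -> CC) : holo 1 f -> holo 1 g ->
  forall z, Cmod z < 1 -> Cderiv_n n (fun y => (f y - g y)%C) z = (Cderiv_n n f z - Cderiv_n n g z)%C.
Proof.
  intros Hf Hg. induction n as [|n IH]; [reflexivity|]. intros z Hz. simpl.
  rewrite (Cderiv_ext _ _ (holo_deriv_n n _ (holo_minus 1 f g Hf Hg)) IH z Hz).
  apply Cderiv_correct. apply Cis_derive_minus; apply (Cderiv_spec 1); auto using holo_deriv_n.
Qed.

Lemma coef_minus (f g : CC -> CC) (k : nat) : holo 1 f -> holo 1 g ->
  coef (fun z => (f z - g z)%C) k = (coef f k - coef g k)%C.
Proof.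
  intros Hf Hg. unfold coef, tcoef. rewrite <- CM_minus.
  - apply CM_ext. intros; ring.
  - apply tcoef_cc; [lra|]. apply (cc_holo 1); auto; lra.
  - apply tcoef_cc; [lra|]. apply (cc_holo 1); auto; lra.
Qed.

Lemma coef_ext (f g : CC -> CC) (k : nat) : (forall z, Cmod z < 1 -> f z = g z) -> coef f k = coef g k.
Proof.
  intros E. apply CM_ext. intros t. rewrite E; [reflexivity|]. rewrite Cmod_circ; lra.
Qed.

Lemma coef_scal (c : CC) (f : CC -> CC) (k : nat) : holo 1 f -> coef (fun z => (c * f z)%C) k = (c * coef f k)%C.
Proof.
  intros Hf. unfold coef, tcoef. rewrite <- CM_scal.
  - apply CM_ext. intros; ring.
  - apply tcoef_cc; [lra|]. apply (cc_holo 1); auto; lra.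
Qed.

Lemma coef_const (c : CC) (k : nat) : (0 < k)%nat -> coef (fun _ => c) k = RtoC 0.
Proof.
  intros Hk.
  rewrite (coef_ext (fun _ => c) (fun _ => (c * RtoC 1)%C)) by (intros; ring).
  rewrite (coef_scal c (fun _ => RtoC 1)) by apply holo_const.
  unfold coef. rewrite tcoef_one by lra. destruct k; [lia|]. simpl. ring.
Qed.

Lemma coef_0 (f : CC -> CC) : holo 1 f -> coef f 0 = f (RtoC 0).
Proof.
  intros Hf. rewrite <- (mean_value f 1 (1 / 2) Hf) by lra. apply CM_ext. intros t.
  change ((f (circ (1 / 2) t) * / RtoC 1)%C = f (circ (1 / 2) t)). field.
Qed.

(* Synthetic division: [b k] is the value at [w] of the series shifted by [k] places. *)
Theorem holo_divide (f : CC -> CC) (w : CC) : holo 1 f -> Cmod w < 1 -> f w = RtoC 0 ->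
  exists g, holo 1 g /\ forall z, Cmod z < 1 -> f z = ((z - w) * g z)%C.
Proof.
  intros Hf Hw H0. assert (Pw := Cmod_ge_0 w). set (a := coef f).
  assert (Ha : growth a) by (apply coef_growth, Hf).
  assert (Hex : forall r, Cmod w < r < 1 -> exists D, 0 < D /\ forall k, exists l,
      ctends (csum (fun i => (a (k + i)%nat * w ^ i)%C)) l /\ Cmod l * r ^ k <= D).
  { intros r Hr. destruct (Ha r) as [B [HB Hb]]; [lra|].
    assert (Hy : 0 <= Cmod w / r < 1) by (split; [apply Rdiv_le_0_compat|apply Rlt_div_l]; lra).
    exists (B / (1 - Cmod w / r)). split; [apply Rdiv_lt_0_compat; lra|].
    intros k. assert (Pk : 0 < r ^ k) by (apply pow_lt; lra).
    destruct (geom_csum (fun i => (a (k + i)%nat * w ^ i)%C) (B / r ^ k) (Cmod w / r)) as [l [Hl Ht]]; auto.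
    - apply Rdiv_le_0_compat; lra.
    - intros i. rewrite Cmod_mult, Cmod_pow. specialize (Hb (k + i)%nat).
      rewrite pow_add in Hb. assert (Pi : 0 < r ^ i) by (apply pow_lt; lra).
      replace (B / r ^ k * (Cmod w / r) ^ i) with (B / (r ^ k * r ^ i) * Cmod w ^ i).
      2:{ unfold Rdiv. rewrite Rpow_mult_distr, pow_inv. field. lra. }
      apply Rmult_le_compat_r; [apply pow_le, Pw|].
      apply (Rmult_le_reg_r (r ^ k * r ^ i)); [nra|].
      replace (B / (r ^ k * r ^ i) * (r ^ k * r ^ i)) with B by (field; lra). exact Hb.
    - exists l. split; [exact Hl|]. specialize (Ht 0%nat). simpl in Ht.
      replace (l - 0)%C with l in Ht by ring.
      apply Rle_trans with (B / r ^ k * 1 / (1 - Cmod w / r) * r ^ k).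
      + apply Rmult_le_compat_r; lra.
      + right. field. lra. }
  set (r0 := (Cmod w + 1) / 2).
  destruct (Hex r0) as [D0 [_ HD0]]; [unfold r0; lra|].
  set (b := fun k => proj1_sig (constructive_indefinite_description _ (HD0 k))).
  assert (Hb : forall k, ctends (csum (fun i => (a (k + i)%nat * w ^ i)%C)) (b k)).
  { intros k. exact (proj1 (proj2_sig (constructive_indefinite_description _ (HD0 k)))). }
  assert (Hb0 : b 0%nat = RtoC 0).
  { rewrite <- H0. apply (ctends_unique _ _ _ (Hb 0%nat)). simpl. apply coef_ps; assumption. }
  assert (Hrec : forall k, b k = (a k + w * b (S k))%C).
  { intros k. apply (ctends_unique (csum (fun i => (a (k + i)%nat * w ^ i)%C))); [apply Hb|].
    apply ctends_shift. apply (ctends_ext (fun n => (a k + w * csum (fun i => (a (S k + i)%nat * w ^ i)%C) n)%C)).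
    - intros n. rewrite csum_shift, Nat.add_0_r, <- csum_scal. simpl Cpow.
      rewrite Cmult_1_r. f_equal. apply csum_ext. intros i _.
      replace (k + S i)%nat with (S k + i)%nat by lia. ring.
    - apply ctends_const_plus, ctends_scal, Hb. }
  (* [Hex] works for radii above [Cmod w] only; a smaller radius inherits the bound of a larger
     one. *)
  assert (Hbg : growth b).
  { intros r Hr. set (s := Rmax r r0).
    assert (S1 : r <= s) by apply Rmax_l. assert (S2 : r0 <= s) by apply Rmax_r.
    assert (S3 : s < 1) by (apply Rmax_lub_lt; unfold r0; lra).
    destruct (Hex s) as [D [HD K]]; [unfold r0 in *; lra|].
    exists D. split; [exact HD|]. intros k. destruct (K k) as [l [Hl Hl2]].
    rewrite (ctends_unique _ _ _ (Hb k) Hl). eapply Rle_trans; [|exact Hl2].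
    apply Rmult_le_compat_l; [apply Cmod_ge_0|]. apply pow_incr; lra. }
  assert (Hbg' : growth (fun k => b (S k))).
  { intros r Hr. destruct (Hbg r Hr) as [B [HB K]]. exists (B / r).
    split; [apply Rdiv_lt_0_compat; lra|]. intros k. specialize (K (S k)).
    apply (Rmult_le_reg_r r); [lra|]. replace (B / r * r) with B by (field; lra).
    simpl in K. lra. }
  destruct (growth_ps _ Hbg') as [g Hg].
  exists g. split; [eapply ps_holo; eassumption|]. intros z Hz.
  apply (ctends_unique (csum (fun k => (a k * z ^ k)%C))); [apply coef_ps; assumption|].
  (* The recursion telescopes. The boundary term at 0 is [b 0], the value of [f] at [w], and the one
     at K tends to 0. *)
  assert (T : forall K, ((z - w) * csum (fun k => b (S k) * z ^ k) K =
     csum (fun k => a k * z ^ k) K + b K * z ^ K)%C).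
  { induction K as [|K IH].
    - simpl. rewrite Hb0. ring.
    - simpl csum. rewrite Cmult_plus_distr_l, IH. rewrite (Hrec K) at 1. simpl Cpow. ring. }
  replace ((z - w) * g z)%C with ((z - w) * g z + RtoC 0)%C by ring.
  apply (ctends_ext (fun K => ((z - w) * csum (fun k => b (S k) * z ^ k) K + - (b K * z ^ K))%C)).
  - intros K. rewrite T. ring.
  - apply ctends_plus; [apply ctends_scal, Hg, Hz|].
    destruct (growth_geom b 0 (Cmod z) Hbg) as (C & y & HC & Hy & HB).
    { split; [apply Cmod_ge_0|exact Hz]. }
    apply (ctends_bound _ _ (fun K => C * y ^ K)).
    + intros K. replace (- (b K * z ^ K) - 0)%C with (- (b K * z ^ K))%C by ring.
      rewrite Cmod_opp, Cmod_mult, Cmod_pow. specialize (HB K). rewrite pow_O, Rmult_1_l in HB. exact HB.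
    + apply geom_lim. lra.
Qed.

(** * Parseval's identity on circles *)

Lemma cc_conj (u : R -> CC) : cc u -> cc (fun t => Cconj (u t)).
Proof. intros H t. apply (ccont_conj _ u), H. Qed.

Lemma csum_conj (a : nat -> CC) (K : nat) : Cconj (csum a K) = csum (fun k => Cconj (a k)) K.
Proof.
  induction K as [|K IH]; simpl.
  - apply injective_projections; simpl; ring.
  - rewrite Cplus_conj, IH. reflexivity.
Qed.

Lemma csum_RtoC (a : nat -> R) (K : nat) : csum (fun k => RtoC (a k)) K = RtoC (rsum a K).
Proof. induction K as [|K IH]; simpl; [reflexivity|]. rewrite IH, RtoC_plus. reflexivity. Qed.

(** Only one factor of f conj(f) is replaced by a partial sum. The mean of the product is then a
    finite combination of Cauchy coefficients, and uniform convergence on the circle gives the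
    limit. *)
Theorem parseval (f : CC -> CC) (r : R) : holo 1 f -> 0 < r < 1 ->
  is_lim_seq (rsum (fun k => Cmod (coef f k) ^ 2 * (r ^ 2) ^ k)) (int_mean2 f r).
Proof.
  intros Hf Hr. set (a := coef f).
  assert (Hc : cc (fun t => f (circ r t))) by (apply (cc_holo 1); auto; lra).
  destruct (circle_bound f r Hc) as [B [HB Hb]].
  destruct (growth_geom a 0 r (coef_growth f Hf)) as (C & y & HC & Hy & HCy); [lra|].
  set (S := fun K t => csum (fun k => (a k * circ r t ^ k)%C) K).
  assert (HS : forall K, cc (S K)).
  { intros K. apply (CM_csum (fun k t => (a k * circ r t ^ k)%C)).
    intros k. apply cc_mult; [apply cc_const|apply cc_pow, cc_circ]. }
  assert (Htail : forall K t, Cmod (f (circ r t) - S K t) <= C * y ^ K / (1 - y)).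
  { intros K t. assert (Em : Cmod (circ r t) = r) by (apply Cmod_circ; lra).
    destruct (geom_csum (fun k => (a k * circ r t ^ k)%C) C y) as [l [Hl Ht]]; try lra.
    - intros k. specialize (HCy k). rewrite pow_O, Rmult_1_l in HCy.
      rewrite Cmod_mult, Cmod_pow, Em. exact HCy.
    - replace (f (circ r t)) with l; [apply Ht|].
      apply (ctends_unique _ _ _ Hl). apply coef_ps; [exact Hf|lra]. }
  assert (E1 : RtoC (int_mean2 f r) = CM (fun t => (f (circ r t) * Cconj (f (circ r t)))%C)).
  { rewrite (CM_ext _ (fun t => RtoC (Cmod (f (circ r t)) ^ 2))).
    2:{ intros t. symmetry. apply Cmod2_conj. }
    rewrite CM_eq. simpl Re. simpl Im. rewrite (cmean_const 0). reflexivity. }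
  assert (E2 : forall K, RtoC (rsum (fun k => Cmod (a k) ^ 2 * (r ^ 2) ^ k) K)
     = CM (fun t => (f (circ r t) * Cconj (S K t))%C)).
  { intros K. rewrite (CM_ext _ (fun t => csum (fun k =>
       (Cconj (a k) * RtoC ((r ^ 2) ^ k) * (f (circ r t) * / circ r t ^ k))%C) K)).
    2:{ intros t. unfold S. rewrite csum_conj, <- csum_scal. apply csum_ext. intros k _.
        rewrite Cmult_conj, Cpow_conj.
        assert (N : (circ r t ^ k)%C <> RtoC 0) by (apply Cpow_nz, circ_nz; lra).
        (* On the circle conj z = r^2 / z, which turns conjugate powers into the negative powers of
           [tcoef]. *)
        assert (X : (circ r t ^ k * Cconj (circ r t) ^ k)%C = RtoC ((r ^ 2) ^ k)).
        { rewrite <- Cpow_mult_l, <- Cmod2_conj, Cmod_circ by lra. rewrite <- RtoC_pow. reflexivity. }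
        rewrite <- X. field. exact N. }
    assert (Hk : forall k, cc (fun t => (f (circ r t) * / circ r t ^ k)%C)).
    { intros k. apply tcoef_cc; auto; lra. }
    destruct (CM_csum (fun k t => (Cconj (a k) * RtoC ((r ^ 2) ^ k) * (f (circ r t) * / circ r t ^ k))%C) K) as [_ E].
    { intros k. apply cc_mult; [apply cc_const|apply Hk]. }
    rewrite E, <- csum_RtoC. apply csum_ext. intros k _.
    rewrite CM_scal by apply Hk. fold (tcoef f r k). rewrite <- (coef_eq f r k Hf Hr). fold a.
    rewrite RtoC_mult, Cmod2_conj. fold (a k). ring. }
  apply is_lim_seq_spec. intros e.
  assert (L : is_lim_seq (fun K => (B * (C / (1 - y))) * y ^ K) 0) by (apply geom_lim; lra).
  apply is_lim_seq_spec in L. destruct (L e) as [N HN]. exists N. intros K HK.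
  specialize (HN K HK). rewrite Rminus_0_r in HN.
  apply Rle_lt_trans with (2 := HN). eapply Rle_trans; [|apply Rle_abs].
  rewrite <- Cmod_R, RtoC_minus, E1, E2, <- CM_minus.
  - apply Cmod_CM_bound.
    + apply cc_minus; apply cc_mult; auto; apply cc_conj; auto.
    + intros t.
      replace (f (circ r t) * Cconj (S K t) - f (circ r t) * Cconj (f (circ r t)))%C
        with (- (f (circ r t) * Cconj (f (circ r t) - S K t)))%C by (rewrite Cminus_conj; ring).
      rewrite Cmod_opp, Cmod_mult, Cmod_conj. rewrite Rmult_assoc.
      apply Rmult_le_compat; auto using Cmod_ge_0.
      replace (C / (1 - y) * y ^ K) with (C * y ^ K / (1 - y)) by (field; lra). apply Htail.
  - apply cc_mult; auto. apply cc_conj; auto.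
  - apply cc_mult; auto. apply cc_conj; auto.
Qed.

(** * Jensen's inequality *)

Definition per (v : R -> R) : Prop := forall t, v (t + 2 * PI) = v t.

Lemma RInt_period_shift (v : R -> R) (a : R) : rc v -> per v ->
  RInt v a (a + 2 * PI) = RInt v 0 (2 * PI) :> R.
Proof.
  intros Hv Hp.
  assert (Hex : forall x y, ex_RInt v x y).
  { intros x y. apply (ex_RInt_continuous (V := R_CompleteNormedModule)). intros z _. apply Hv. }
  assert (E : RInt v (2 * PI) (a + 2 * PI) = RInt v 0 a :> R).
  { symmetry. rewrite (RInt_ext v (fun t => 1 * v (1 * t + 2 * PI))).
    2:{ intros t _. rewrite !Rmult_1_l. symmetry; apply Hp. }
    etransitivity; [apply (RInt_comp_lin v 1 (2 * PI) 0 a); apply Hex|].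
    f_equal; ring. }
  assert (C1 : RInt v a 0 + RInt v 0 (2 * PI) = RInt v a (2 * PI)) by (apply (RInt_Chasles v); apply Hex).
  assert (C2 : RInt v a (2 * PI) + RInt v (2 * PI) (a + 2 * PI) = RInt v a (a + 2 * PI))
    by (apply (RInt_Chasles v); apply Hex).
  assert (C3 : RInt v 0 a + RInt v a 0 = RInt v 0 0) by (apply (RInt_Chasles v); apply Hex).
  rewrite RInt_point in C3. change (zero : R) with 0 in C3. lra.
Qed.

Lemma riemann_error (v : R -> R) (e a : R) (M : nat) : rc v -> per v -> (0 < M)%nat ->
  (forall t t', a <= t <= a + 2 * PI -> 0 <= t' - t <= 2 * PI / INR M -> Rabs (v t' - v t) <= e) ->
  Rabs (rsum (fun j => v (a + 2 * PI * INR j / INR M)) M / INR M - cmean v) <= e.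
Proof.
  intros Hv Hp HM He. assert (P := two_PI_pos).
  assert (PM : 0 < INR M) by (apply lt_0_INR, HM).
  set (h := 2 * PI / INR M) in *.
  assert (Hh : 0 < h) by (apply Rdiv_lt_0_compat; lra).
  assert (Hex : forall x y, ex_RInt v x y).
  { intros x y. apply (ex_RInt_continuous (V := R_CompleteNormedModule)). intros z _. apply Hv. }
  assert (K : forall n, (n <= M)%nat ->
    Rabs (h * rsum (fun j => v (a + INR j * h)) n - RInt v a (a + INR n * h)) <= INR n * h * e).
  { induction n as [|n IH]; intros Hn.
    - simpl. replace (a + 0 * h) with a by ring. rewrite RInt_point. change (zero : R) with 0.
      replace (h * 0 - 0) with 0 by ring. rewrite Rabs_R0. lra.
    - specialize (IH ltac:(lia)).
      assert (C : RInt v a (a + INR n * h) + RInt v (a + INR n * h) (a + INR (S n) * h)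
         = RInt v a (a + INR (S n) * h)) by (apply (RInt_Chasles v); apply Hex).
      assert (Hnh : 0 <= INR n * h) by (apply Rmult_le_pos; [apply pos_INR|lra]).
      assert (HnM : INR n * h <= 2 * PI).
      { replace (2 * PI) with (INR M * h) by (unfold h; field; lra).
        apply Rmult_le_compat_r; [lra|]. apply le_INR. lia. }
      assert (D : Rabs (h * v (a + INR n * h) - RInt v (a + INR n * h) (a + INR (S n) * h)) <= h * e).
      { assert (E1 : RInt (fun _ => v (a + INR n * h)) (a + INR n * h) (a + INR (S n) * h)
           = h * v (a + INR n * h) :> R) by (rewrite RInt_constR, S_INR; ring).
        rewrite <- E1.
        rewrite <- (RInt_minusR (fun _ => v (a + INR n * h)) v _ _ (ex_RInt_const _ _ _) (Hex _ _)).
        rewrite S_INR in *.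
        replace (h * e) with ((a + (INR n + 1) * h - (a + INR n * h)) * e) by ring.
        apply abs_RInt_le_const.
        - lra.
        - apply ex_RInt_minusR; [apply ex_RInt_const|apply Hex].
        - intros t Ht. rewrite Rabs_minus_sym. apply He; lra. }
      simpl rsum. rewrite <- C, S_INR in *.
      replace (h * (rsum (fun j => v (a + INR j * h)) n + v (a + INR n * h)) -
         (RInt v a (a + INR n * h) + RInt v (a + INR n * h) (a + (INR n + 1) * h)))
        with ((h * rsum (fun j => v (a + INR j * h)) n - RInt v a (a + INR n * h))
          + (h * v (a + INR n * h) - RInt v (a + INR n * h) (a + (INR n + 1) * h))) by ring.
      eapply Rle_trans; [apply Rabs_triang|]. lra. }
  specialize (K M (le_n M)).
  replace (INR M * h) with (2 * PI) in K by (unfold h; field; lra).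
  rewrite (RInt_period_shift v a Hv Hp) in K.
  rewrite (rsum_ext _ (fun j => v (a + INR j * h))).
  2:{ intros j _. f_equal. unfold h. field. lra. }
  unfold cmean. set (S0 := rsum _ M) in *. set (I0 := RInt v 0 (2 * PI)) in *.
  replace (S0 / INR M - / (2 * PI) * I0) with (/ (2 * PI) * (h * S0 - I0)) by (unfold h; field; lra).
  rewrite Rabs_mult, (Rabs_right (/ (2 * PI))) by (apply Rle_ge; left; apply Rinv_0_lt_compat; lra).
  apply (Rmult_le_reg_l (2 * PI)); [lra|]. rewrite <- Rmult_assoc, Rinv_r by lra. lra.
Qed.

(** The uniformity in the starting angle [a] is the point: in [jensen] the product over rotations
    must be bounded at every point of the circle. *)
Lemma riemann_unif (v : R -> R) (e : R) : rc v -> per v -> 0 < e ->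
  exists M, (0 < M)%nat /\ forall a, 0 <= a <= 2 * PI ->
    Rabs (rsum (fun j => v (a + 2 * PI * INR j / INR M)) M / INR M - cmean v) <= e.
Proof.
  intros Hv Hp He. assert (P := two_PI_pos).
  (* The nodes start at a <= 2 PI and run through one period, so they stay below 4 PI. *)
  destruct (compact_unif (fun d t => forall t', Rabs (t' - t) < d -> Rabs (v t' - v t) <= e) 0 (4 * PI))
    as [d [Hd H]].
  - intros t _. assert (Hc := Hv t). apply continuity_pt_filterlim in Hc.
    destruct (Hc (e / 2)) as [d [Hd H]]; [lra|]. unfold dist in H; simpl in H; unfold Rdist in H.
    assert (K : forall s, Rabs (s - t) < d -> Rabs (v s - v t) < e / 2).
    { intros s Hs. destruct (Req_dec t s) as [<-|n].
      - rewrite Rminus_diag, Rabs_R0. lra.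
      - apply H. split; [|exact Hs]. split; [exact I|exact n]. }
    exists (d / 2). split; [lra|]. intros s _ Hs t' Ht'.
    replace (v t' - v s) with ((v t' - v t) - (v s - v t)) by ring.
    assert (A1 : Rabs (v t' - v t) < e / 2).
    { apply K. replace (t' - t) with ((t' - s) + (s - t)) by ring.
      eapply Rle_lt_trans; [apply Rabs_triang|]. lra. }
    assert (A2 : Rabs (v s - v t) < e / 2) by (apply K; lra).
    unfold Rminus at 1. eapply Rle_trans; [apply Rabs_triang|]. rewrite Rabs_Ropp. lra.
  - intros d d' t Hd H t' Ht'. apply H. lra.
  - destruct (INR_unbounded (2 * PI / d)) as [M HM].
    assert (0 < 2 * PI / d) by (apply Rdiv_lt_0_compat; lra).
    assert (HM0 : (0 < M)%nat) by (apply INR_lt; simpl; lra).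
    exists M. split; [exact HM0|]. intros a Ha. apply riemann_error; auto.
    intros t t' Ht Ht'. apply H; [lra|]. rewrite Rabs_right by lra.
    assert (2 * PI / INR M < d); [|lra].
    apply (Rmult_lt_reg_r (INR M)); [lra|].
    replace (2 * PI / INR M * INR M) with (2 * PI / d * d) by (field; lra).
    rewrite Rmult_comm. apply Rmult_lt_compat_l; lra.
Qed.

Fixpoint cprod (f : nat -> CC) (n : nat) : CC :=
  match n with O => RtoC 1 | S m => (cprod f m * f m)%C end.

Lemma circ_mult (r t s : R) : (circ r t * circ 1 s)%C = circ r (t + s).
Proof.
  unfold circ. rewrite cos_plus, sin_plus. apply injective_projections; simpl; ring.
Qed.

Lemma circ_period (r t : R) : circ r (t + 2 * PI) = circ r t.
Proof.
  unfold circ. rewrite cos_plus, sin_plus, cos_2PI, sin_2PI.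
  apply injective_projections; simpl; ring.
Qed.

Lemma exp_pow_INR (k : nat) (x : R) : exp x ^ k = exp (INR k * x).
Proof.
  induction k as [|k IH]; [simpl; rewrite Rmult_0_l, exp_0; reflexivity|].
  rewrite S_INR. simpl. rewrite IH, <- exp_plus. f_equal. ring.
Qed.

(* Multiplying [G] over the rotations by the M-th roots of unity turns the geometric mean
   over the circle into the mean value property of a single analytic function. *)
Theorem jensen (G : CC -> CC) (R0 r : R) (v : R -> R) : holo R0 G -> 0 < r < R0 ->
  rc v -> per v -> (forall t, Cmod (G (circ r t)) <= exp (v t)) ->
  Cmod (G (RtoC 0)) <= exp (cmean v).
Proof.
  intros HG Hr Hv Hp HB.
  assert (K : forall e, 0 < e -> Cmod (G (RtoC 0)) <= exp (cmean v + e)).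
  { intros e He. destruct (riemann_unif v e Hv Hp He) as [M [HM H]].
    assert (PM : 0 < INR M) by (apply lt_0_INR, HM).
    set (s := fun j => 2 * PI * INR j / INR M).
    set (Q := fun n z => cprod (fun j => G (z * circ 1 (s j))%C) n).
    assert (HQ : forall n, holo R0 (Q n)).
    { induction n as [|n IH]; [apply holo_const|].
      apply (holo_mult R0 (Q n) (fun z => G (z * circ 1 (s n))%C)); [exact IH|].
      apply (holo_comp R0 R0 G (fun z => (z * circ 1 (s n))%C)); [exact HG| |].
      - apply holo_mult; [apply holo_id|apply holo_const].
      - intros z Hz. rewrite Cmod_mult, Cmod_circ; lra. }
    assert (HQ0 : forall n, Q n (RtoC 0) = (G (RtoC 0) ^ n)%C).
    { induction n as [|n IH]; [reflexivity|]. unfold Q in *. simpl. rewrite IH, Cmult_0_l. ring. }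
    assert (HQb : forall n t, Cmod (Q n (circ r t)) <= exp (rsum (fun j => v (t + s j)) n)).
    { intros n t. induction n as [|n IH].
      - unfold Q; simpl. rewrite Cmod_1, exp_0. lra.
      - unfold Q in *; simpl. rewrite Cmod_mult, exp_plus, circ_mult.
        apply Rmult_le_compat; auto using Cmod_ge_0. }
    assert (Hbound : Cmod (Q M (RtoC 0)) <= exp (INR M * (cmean v + e))).
    { rewrite <- (mean_value (Q M) R0 r (HQ M) Hr).
      apply Cmod_CM_bound; [apply (cc_holo R0); [apply HQ|lra]|].
      intros t. destruct (circ_period_pt 1 t) as [t' [Ht' E]].
      rewrite circ_RtoC, <- E, <- circ_RtoC. eapply Rle_trans; [apply HQb|].
      specialize (H t' Ht').
      assert (L : rsum (fun j => v (t' + s j)) M / INR M <= cmean v + e).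
      { unfold s. assert (A := Rle_abs (rsum (fun j => v (t' + 2 * PI * INR j / INR M)) M / INR M - cmean v)). lra. }
      assert (L2 : rsum (fun j => v (t' + s j)) M <= INR M * (cmean v + e)).
      { apply (Rmult_le_compat_l (INR M)) in L; [|lra].
        replace (INR M * (rsum (fun j => v (t' + s j)) M / INR M)) with (rsum (fun j => v (t' + s j)) M) in L
          by (field; lra). exact L. }
      destruct L2 as [L2|L2]; [left; apply exp_increasing, L2|rewrite L2; lra]. }
    rewrite HQ0, Cmod_pow in Hbound.
    rewrite <- exp_pow_INR in Hbound.
    destruct (Rle_lt_dec (Cmod (G (RtoC 0))) (exp (cmean v + e))) as [L|L]; [exact L|].
    exfalso. assert (exp (cmean v + e) ^ M < Cmod (G (RtoC 0)) ^ M); [|lra].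
    clear - L HM. assert (P := exp_pos (cmean v + e)).
    destruct M as [|M]; [lia|]. induction M as [|M IH]; [simpl; lra|].
    specialize (IH ltac:(lia)). simpl in *.
    apply Rmult_le_0_lt_compat; try lra.
    apply Rmult_le_pos; [lra|apply pow_le; lra]. }
  destruct (Req_dec (Cmod (G (RtoC 0))) 0) as [Z|n]; [rewrite Z; left; apply exp_pos|].
  assert (Pg : 0 < Cmod (G (RtoC 0))) by (assert (X := Cmod_ge_0 (G (RtoC 0))); lra).
  rewrite <- (exp_ln _ Pg) in *.
  assert (L : ln (Cmod (G (RtoC 0))) <= cmean v).
  { apply le_epsilon. intros e He. specialize (K e He). destruct K as [K|K].
    - left. apply exp_lt_inv, K.
    - right. apply exp_inv, K. }
  destruct L as [L|L]; [left; apply exp_increasing, L|rewrite L; lra].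
Qed.

(** * Truncated logarithms, zero products and Blaschke factors *)

Lemma ln_le' (x y : R) : 0 < x -> x <= y -> ln x <= ln y.
Proof. intros Hx [H|H]; [left; apply ln_increasing; assumption|rewrite H; lra]. Qed.

Lemma exp_le' (x y : R) : x <= y -> exp x <= exp y.
Proof. intros [H|H]; [left; apply exp_increasing; assumption|rewrite H; lra]. Qed.

(** The logarithm of the modulus, cut off below at level log k. It is continuous through zeros, so
    every mean of a logarithm is an integral of a continuous function, and it exceeds log |z|, which
    is the right direction for Jensen's inequality. *)
Definition lmax (k : R) (z : CC) : R := ln (Rmax (Cmod z) k).

Lemma lmax_cont (U : UniformSpace) (k : R) (f : U -> CC) (x : U) : 0 < k ->
  ccont f x -> continuous (fun y => lmax k (f y)) x.
Proof.
  intros Hk H. apply (cont_comp_pt U (fun y => Rmax (Cmod (f y)) k) ln).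
  - apply cont_max; [apply cont_Cmod, H|apply continuous_const].
  - apply derivable_continuous_pt. exists (/ Rmax (Cmod (f x)) k). apply derivable_pt_lim_ln.
    apply Rlt_le_trans with k; [exact Hk|apply Rmax_r].
Qed.

Lemma rc_lmax (k : R) (u : R -> CC) : 0 < k -> cc u -> rc (fun t => lmax k (u t)).
Proof. intros Hk H t. apply lmax_cont; auto. Qed.

Lemma le_exp_lmax (k : R) (z : CC) : 0 < k -> Cmod z <= exp (lmax k z).
Proof.
  intros Hk. unfold lmax. rewrite exp_ln; [apply Rmax_l|].
  apply Rlt_le_trans with k; [exact Hk|apply Rmax_r].
Qed.

Lemma lmax_eq (k : R) (z : CC) : k <= Cmod z -> lmax k z = ln (Cmod z).
Proof. intros H. unfold lmax. now rewrite Rmax_left. Qed.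

Lemma jensen_lmax (G : CC -> CC) (R0 r k : R) : holo R0 G -> 0 < r < R0 -> 0 < k -> G (RtoC 0) <> RtoC 0 ->
  ln (Cmod (G (RtoC 0))) <= cmean (fun t => lmax k (G (circ r t))).
Proof.
  intros HG Hr Hk H0.
  assert (J : Cmod (G (RtoC 0)) <= exp (cmean (fun t => lmax k (G (circ r t))))).
  { apply (jensen G R0 r); auto.
    - apply rc_lmax; [exact Hk|]. apply (cc_holo R0); [exact HG|lra].
    - intros t. rewrite circ_period. reflexivity.
    - intros t. apply le_exp_lmax, Hk. }
  rewrite <- (ln_exp (cmean _)). apply ln_le'; [apply Cmod_gt_0, H0|exact J].
Qed.

Lemma rc_ln (u : R -> CC) : cc u -> (forall t, u t <> RtoC 0) -> rc (fun t => ln (Cmod (u t))).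
Proof.
  intros H Hn t. apply (cont_comp_pt _ (fun t => Cmod (u t)) ln); [apply cont_Cmod, H|].
  apply derivable_continuous_pt. exists (/ Cmod (u t)). apply derivable_pt_lim_ln.
  apply Cmod_gt_0, Hn.
Qed.

(** The reverse inequality comes from Jensen's inequality for 1 / G. *)
Lemma jensen_zero_free (G : CC -> CC) (R0 r : R) : holo R0 G -> 0 < r < R0 ->
  (forall z, Cmod z < R0 -> G z <> RtoC 0) ->
  cmean (fun t => ln (Cmod (G (circ r t)))) <= ln (Cmod (G (RtoC 0))).
Proof.
  intros HG Hr Hn.
  assert (Hc : cc (fun t => G (circ r t))) by (apply (cc_holo R0); [exact HG|lra]).
  assert (Hnt : forall t, G (circ r t) <> RtoC 0) by (intros t; apply Hn; rewrite Cmod_circ; lra).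
  assert (Hrc := rc_ln _ Hc Hnt).
  assert (Z : G (RtoC 0) <> RtoC 0) by (apply Hn; rewrite Cmod_0; lra).
  assert (J : Cmod (/ G (RtoC 0)) <= exp (cmean (fun t => - 1 * ln (Cmod (G (circ r t)))))).
  { apply (jensen (fun z => (/ G z)%C) R0 r); auto.
    - apply holo_inv; assumption.
    - intros t. apply cont_mult; [apply continuous_const|apply Hrc].
    - intros t. rewrite circ_period. reflexivity.
    - intros t. replace (-1 * ln (Cmod (G (circ r t)))) with (- ln (Cmod (G (circ r t)))) by ring.
      rewrite exp_Ropp, exp_ln by (apply Cmod_gt_0, Hnt). rewrite Cmod_inv by apply Hnt. lra. }
  rewrite cmean_scal in J by exact Hrc.
  rewrite Cmod_inv in J by exact Z.
  assert (Pz : 0 < Cmod (G (RtoC 0))) by (apply Cmod_gt_0, Z).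
  apply ln_le' in J; [|apply Rinv_0_lt_compat, Pz].
  rewrite ln_exp, ln_Rinv in J by exact Pz. lra.
Qed.

(** A monic polynomial given by its roots; repetitions in the list are multiplicities. *)
Definition zprod (l : list CC) (z : CC) : CC := fold_right (fun a p => ((z - a) * p)%C) (RtoC 1) l.

Definition lsum (f : CC -> R) (l : list CC) : R := fold_right (fun a s => f a + s) 0 l.

Lemma holo_zprod (r : R) (l : list CC) : holo r (zprod l).
Proof.
  induction l as [|a l IH]; [apply holo_const|].
  apply (holo_mult r (fun z => (z - a)%C) (zprod l)); [|exact IH].
  apply holo_minus; [apply holo_id|apply holo_const].
Qed.

Lemma zprod_nz (l : list CC) (z : CC) : (forall a, In a l -> z <> a) -> zprod l z <> RtoC 0.
Proof.
  induction l as [|a l IH]; intros H; [apply C1_nz|]. simpl.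
  apply Cmult_neq_0.
  - apply Cminus_eq_contra, H. now left.
  - apply IH. intros b Hb. apply H. now right.
Qed.

Lemma zprod_nz_inv (l : list CC) (z : CC) : zprod l z <> RtoC 0 -> forall a, In a l -> z <> a.
Proof.
  induction l as [|b l IH]; intros H a; [intros []|]. intros [->|Ha] E; apply H; simpl; subst.
  - ring.
  - assert (Z : ~ zprod l a <> RtoC 0) by (intros X; exact (IH X a Ha eq_refl)).
    apply Classical_Prop.NNPP in Z. rewrite Z. ring.
Qed.

Lemma zeros_nz (l : list CC) (q Q : CC -> CC) :
  (forall z, Cmod z < 1 -> Q z = (zprod l z * q z)%C) -> Q (RtoC 0) <> RtoC 0 ->
  forall a, In a l -> a <> RtoC 0.
Proof.
  intros E HQ a Ha Ea. rewrite E in HQ by exact zero_in_disk.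
  apply (zprod_nz_inv l (RtoC 0)) with (a := a); auto.
  intros Z. apply HQ. rewrite Z. ring.
Qed.

(** This is log+ (r / |a|), the contribution of a zero at [a] to Jensen's formula on |z| = r; the
    maximum makes it 0 for zeros outside. *)
Definition blog (r : R) (a : CC) : R := ln (Rmax r (Cmod a) / Cmod a).

(* The factors [z - a] with [|a| < r] are replaced by [(r^2 - conj a * z) / r], which has the
   same modulus on [|z| = r] (a Blaschke factor). *)
Lemma blaschke_swap (l : list CC) (q : CC -> CC) (r R0 : R) : 0 < r -> holo R0 q ->
  (forall a, In a l -> a <> RtoC 0) ->
  exists Q, holo R0 Q /\ (forall t, Cmod (Q (circ r t)) = Cmod (zprod l (circ r t) * q (circ r t))) /\
    Cmod (Q (RtoC 0)) = Cmod (zprod l (RtoC 0) * q (RtoC 0)) * exp (lsum (blog r) l).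
Proof.
  intros Hr Hq. induction l as [|a l IH]; intros Ha.
  - exists (fun z => (RtoC 1 * q z)%C). split; [apply holo_mult; [apply holo_const|exact Hq]|].
    split; [reflexivity|]. simpl. rewrite exp_0. ring.
  - destruct IH as [Q [H1 [H2 H3]]]; [intros b Hb; apply Ha; now right|].
    assert (Na : 0 < Cmod a) by (apply Cmod_gt_0, Ha; now left).
    assert (Eb : exp (blog r a) = Rmax r (Cmod a) / Cmod a).
    { unfold blog. apply exp_ln. apply Rdiv_lt_0_compat; [|exact Na].
      apply Rlt_le_trans with r; [exact Hr|apply Rmax_l]. }
    simpl lsum. change (fold_right _ 0 l) with (lsum (blog r) l). rewrite exp_plus, Eb.
    simpl zprod. change (fold_right _ (RtoC 1) l) with (zprod l).
    destruct (Rlt_dec (Cmod a) r) as [L|L].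
    + exists (fun z => ((RtoC (r ^ 2) - Cconj a * z) * RtoC (/ r) * Q z)%C). split; [|split].
      * apply (holo_mult R0 (fun z => ((RtoC (r ^ 2) - Cconj a * z) * RtoC (/ r))%C) Q); [|exact H1].
        apply holo_mult; [|apply holo_const]. apply holo_minus; [apply holo_const|].
        apply holo_mult; [apply holo_const|apply holo_id].
      * intros t. set (z := circ r t).
        change (fold_right (fun a p => ((z - a) * p)%C) (RtoC 1) l) with (zprod l z).
        rewrite <- Cmult_assoc. rewrite !(Cmod_mult _ (_ * _)%C), Cmod_mult.
        assert (H2t := H2 t). fold z in H2t. rewrite H2t.
        assert (Ez : Cmod z = r) by (apply Cmod_circ; lra).
        replace (RtoC (r ^ 2) - Cconj a * z)%C with (z * Cconj (z - a))%C.
        2:{ rewrite <- Ez, Cmod2_conj, Cminus_conj. ring. }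
        rewrite !Cmod_mult, Cmod_conj, Ez, Cmod_R, Rabs_right by (left; apply Rinv_0_lt_compat, Hr).
        field. lra.
      * change (fold_right (fun a p => ((RtoC 0 - a) * p)%C) (RtoC 1) l) with (zprod l (RtoC 0)).
        rewrite Rmax_left by lra.
        replace ((RtoC (r ^ 2) - Cconj a * 0) * RtoC (/ r))%C with (RtoC r).
        2:{ rewrite RtoC_inv, RtoC_pow by lra. field. intros E; apply RtoC_inj in E; lra. }
        rewrite <- Cmult_assoc. rewrite Cmod_mult, H3, Cmod_R, Rabs_right by lra.
        rewrite (Cmod_mult (0 - a)). replace (0 - a)%C with (- a)%C by ring. rewrite Cmod_opp.
        field. lra.
    + exists (fun z => ((z - a) * Q z)%C). split; [|split].
      * apply (holo_mult R0 (fun z => (z - a)%C) Q); [|exact H1].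
        apply holo_minus; [apply holo_id|apply holo_const].
      * intros t. set (z := circ r t).
        change (fold_right (fun a p => ((z - a) * p)%C) (RtoC 1) l) with (zprod l z).
        rewrite <- Cmult_assoc, (Cmod_mult (z - a)), (Cmod_mult (z - a)).
        assert (H2t := H2 t). fold z in H2t. rewrite H2t. reflexivity.
      * change (fold_right (fun a p => ((RtoC 0 - a) * p)%C) (RtoC 1) l) with (zprod l (RtoC 0)).
        rewrite Rmax_right by lra.
        rewrite <- Cmult_assoc, (Cmod_mult (0 - a)), (Cmod_mult (0 - a)), H3. field. lra.
Qed.

(** * Zeros and the counting function *)

(** Swapping the listed factors for Blaschke factors keeps the modulus on the circle and raises it
    at 0 by exactly the zero sum. The list may be partial: further zeros stay in [q] and preserve
    the inequality. *)
Lemma jensen_zeros (l : list CC) (q Q : CC -> CC) (r k : R) : 0 < r < 1 -> 0 < k -> holo 1 q ->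
  (forall z, Cmod z < 1 -> Q z = (zprod l z * q z)%C) -> Q (RtoC 0) <> RtoC 0 ->
  ln (Cmod (Q (RtoC 0))) + lsum (blog r) l <= cmean (fun t => lmax k (Q (circ r t))).
Proof.
  intros Hr Hk Hq E HQ.
  assert (C0 := zero_in_disk).
  assert (Hl := zeros_nz l q Q E HQ).
  destruct (blaschke_swap l q r 1) as [B [HB [HB1 HB2]]]; auto; [lra|].
  rewrite <- E in HB2 by exact C0.
  assert (P : 0 < Cmod (Q (RtoC 0))) by (apply Cmod_gt_0, HQ).
  assert (B0 : B (RtoC 0) <> RtoC 0).
  { apply Cmod_gt_0. rewrite HB2. apply Rmult_lt_0_compat; [exact P|apply exp_pos]. }
  assert (J := jensen_lmax B 1 r k HB Hr Hk B0).
  rewrite HB2, ln_mult, ln_exp in J by (auto using exp_pos).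
  eapply Rle_trans; [exact J|]. right. apply cmean_ext. intros t.
  unfold lmax. rewrite HB1, E; [reflexivity|]. rewrite Cmod_circ; lra.
Qed.

(** The exponentiated form, suited to mean squares: the mean value property is applied to the square
    of the function produced by [blaschke_swap]. *)
Lemma jensen_zeros_sq (l : list CC) (q Q : CC -> CC) (r : R) : 0 < r < 1 -> holo 1 q ->
  (forall z, Cmod z < 1 -> Q z = (zprod l z * q z)%C) -> Q (RtoC 0) <> RtoC 0 ->
  Cmod (Q (RtoC 0)) ^ 2 * exp (2 * lsum (blog r) l) <= int_mean2 Q r.
Proof.
  intros Hr Hq E HQ.
  assert (C0 := zero_in_disk).
  assert (Hl := zeros_nz l q Q E HQ).
  destruct (blaschke_swap l q r 1) as [B [HB [HB1 HB2]]]; auto; [lra|].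
  rewrite <- E in HB2 by exact C0.
  assert (M := mean_value (fun z => (B z ^ 2)%C) 1 r (holo_pow 1 B 2 HB) Hr). cbv beta in M.
  assert (HBc : cc (fun t => B (circ r t))) by (apply (cc_holo 1); [exact HB|lra]).
  replace (Cmod (Q (RtoC 0)) ^ 2 * exp (2 * lsum (blog r) l)) with (Cmod (B (RtoC 0) ^ 2)%C).
  2:{ rewrite Cmod_pow, HB2, Rpow_mult_distr. f_equal. simpl. rewrite Rmult_1_r, <- exp_plus.
      f_equal. ring. }
  rewrite <- M. change (int_mean2 Q r) with (cmean (fun t => Cmod (Q (circ r t)) ^ 2)).
  apply Rle_trans with (cmean (fun t => Cmod (B (circ r t)) ^ 2)).
  - apply Cmod_CM_le.
    + apply cc_pow, HBc.
    + apply rc_pow, rc_Cmod, HBc.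
    + intros t. rewrite Cmod_pow. lra.
  - right. apply cmean_ext. intros t. rewrite HB1, E; [reflexivity|]. rewrite Cmod_circ; lra.
Qed.

Lemma lsum_le (f g : CC -> R) (l : list CC) : (forall a, In a l -> f a <= g a) -> lsum f l <= lsum g l.
Proof.
  induction l as [|a l IH]; intros H; simpl; [lra|].
  assert (f a <= g a) by (apply H; now left).
  assert (lsum f l <= lsum g l) by (apply IH; intros b Hb; apply H; now right).
  unfold lsum in *. lra.
Qed.

Lemma lsum_const (c : R) (l : list CC) : lsum (fun _ => c) l = INR (length l) * c.
Proof.
  induction l as [|a l IH]; [simpl; ring|].
  simpl length. rewrite S_INR. simpl. fold (lsum (fun _ => c) l). rewrite IH. ring.
Qed.

Lemma holo_near (f : CC -> CC) (r : R) (a : CC) : holo r f -> Cmod a < r -> f a <> RtoC 0 ->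
  exists d, 0 < d /\ forall y, Cmod (y - a) < d -> f y <> RtoC 0.
Proof.
  intros Hf Ha Hn. assert (Hc := holo_cont r f a Hf Ha).
  destruct (proj1 (ccont_eps f a) Hc (Cmod (f a))) as [d [Hd H]]; [apply Cmod_gt_0, Hn|].
  exists d; split; [exact Hd|]. intros y Hy E. specialize (H y Hy). rewrite E in H.
  replace (0 - f a)%C with (- f a)%C in H by ring. rewrite Cmod_opp in H. lra.
Qed.

(** Zeros are divided out one at a time. By Jensen's inequality on the larger circle of radius [s]
    each costs at least log (s / r), while the total is bounded by the maximum of |G| there, so the
    process stops. *)
Theorem holo_factor (G : CC -> CC) (r : R) : holo 1 G -> 0 < r < 1 -> G (RtoC 0) <> RtoC 0 ->
  exists l q, holo 1 q /\ (forall z, Cmod z < 1 -> G z = (zprod l z * q z)%C) /\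
    (forall a, In a l -> Cmod a <= r) /\ (forall z, Cmod z <= r -> q z <> RtoC 0).
Proof.
  intros HG Hr H0. set (s := (1 + r) / 2).
  assert (Hs : r < s < 1) by (unfold s; lra).
  assert (Hc : cc (fun t => G (circ s t))) by (apply (cc_holo 1); auto; lra).
  destruct (circle_bound G s Hc) as [B [HB Hb]].
  assert (P0 : 0 < Cmod (G (RtoC 0))) by (apply Cmod_gt_0, H0).
  assert (Hlen : forall l q, holo 1 q -> (forall z, Cmod z < 1 -> G z = (zprod l z * q z)%C) ->
     (forall a, In a l -> Cmod a <= r) -> INR (length l) * ln (s / r) <= ln (Rmax B 1) - ln (Cmod (G (RtoC 0)))).
  { intros l q Hq E Hl.
    assert (J := jensen_zeros l q G s 1 ltac:(lra) Rlt_0_1 Hq E H0).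
    assert (U : cmean (fun t => lmax 1 (G (circ s t))) <= ln (Rmax B 1)).
    { apply cmean_le_const; [apply rc_lmax; [lra|exact Hc]|]. intros t. apply ln_le'.
      - apply Rlt_le_trans with 1; [lra|apply Rmax_r].
      - apply Rmax_lub; [|apply Rmax_r]. eapply Rle_trans; [apply Hb|apply Rmax_l]. }
    assert (L : INR (length l) * ln (s / r) <= lsum (blog s) l).
    { rewrite <- lsum_const. apply lsum_le. intros a Ha.
      assert (Na := zeros_nz l q G E H0 a Ha).
      specialize (Hl a Ha). apply Cmod_gt_0 in Na. unfold blog.
      rewrite Rmax_left by lra. apply ln_le'; [apply Rdiv_lt_0_compat; lra|].
      apply Rmult_le_compat_l; [lra|]. apply Rinv_le_contravar; lra. }
    lra. }
  apply Classical_Prop.NNPP. intros Hn.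
  assert (K : forall m, exists l q, length l = m /\ holo 1 q /\
     (forall z, Cmod z < 1 -> G z = (zprod l z * q z)%C) /\ (forall a, In a l -> Cmod a <= r)).
  { induction m as [|m [l [q [Hm [Hq [E Hl]]]]]].
    - exists nil, G. repeat split; auto; [intros; simpl; ring|intros a []].
    - assert (Z : exists a, Cmod a <= r /\ q a = RtoC 0).
      { apply Classical_Prop.NNPP. intros Hz. apply Hn. exists l, q. repeat split; auto.
        intros z Hzr Hqz. apply Hz. now exists z. }
      destruct Z as [a [Ha Hqa]].
      destruct (holo_divide q a Hq) as [g [Hg Eg]]; auto; [lra|].
      exists (a :: l), g. simpl. repeat split; auto.
      + intros z Hz. rewrite E, Eg by exact Hz. fold (zprod l z). ring.
      + intros b [<-|Hb']; auto. }
  assert (Hp : 0 < ln (s / r)).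
  { rewrite <- ln_1. apply ln_increasing; [lra|]. apply (Rmult_lt_reg_r r); [lra|].
    replace (s / r * r) with s by (field; lra). lra. }
  destruct (INR_unbounded ((ln (Rmax B 1) - ln (Cmod (G (RtoC 0)))) / ln (s / r))) as [m Hm].
  destruct (K m) as [l [q [Hm' [Hq [E Hl]]]]].
  specialize (Hlen l q Hq E Hl). rewrite Hm' in Hlen.
  apply (Rmult_lt_compat_r (ln (s / r))) in Hm; [|exact Hp].
  replace ((ln (Rmax B 1) - ln (Cmod (G (RtoC 0)))) / ln (s / r) * ln (s / r))
    with (ln (Rmax B 1) - ln (Cmod (G (RtoC 0)))) in Hm by (field; lra). lra.
Qed.

(** Off [a] one divides; at [a] continuity decides, tested at a + h. *)
Lemma cancel_factor (A B : CC -> CC) (a : CC) : holo 1 A -> holo 1 B -> Cmod a < 1 ->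
  (forall z, Cmod z < 1 -> ((z - a) * A z = (z - a) * B z)%C) ->
  forall z, Cmod z < 1 -> A z = B z.
Proof.
  intros HA HB Ha E.
  assert (Hne : forall z, Cmod z < 1 -> z <> a -> A z = B z).
  { intros z Hz n. assert (n' := Cminus_eq_contra _ _ n).
    replace (A z) with (/ (z - a) * ((z - a) * A z))%C by (field; exact n').
    rewrite E by exact Hz. field. exact n'. }
  intros z Hz. destruct (Ceq_dec z a) as [->|n]; [|auto].
  apply Classical_Prop.NNPP. intros n.
  destruct (holo_near (fun z => (A z - B z)%C) 1 a (holo_minus 1 A B HA HB) Ha) as [d [Hd H]].
  { apply Cminus_eq_contra, n. }
  set (h := Rmin d (1 - Cmod a) / 2).
  assert (Hh : 0 < h < Rmin d (1 - Cmod a)).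
  { assert (0 < Rmin d (1 - Cmod a)) by (apply Rmin_glb_lt; lra). unfold h; lra. }
  assert (M1 := Rmin_l d (1 - Cmod a)). assert (M2 := Rmin_r d (1 - Cmod a)).
  assert (Eh : Cmod (a + h - a) = h).
  { replace (a + h - a)%C with (RtoC h) by ring. rewrite Cmod_R. apply Rabs_right; lra. }
  apply (H (a + h)%C); [lra|]. apply (proj1 (Ceq_minus _ _)). apply Hne.
  - eapply Rle_lt_trans; [apply Cmod_triangle|]. rewrite Cmod_R, Rabs_right by lra. lra.
  - intros Ea. apply (proj1 (Ceq_minus _ _)) in Ea. rewrite Ea, Cmod_0 in Eh. lra.
Qed.

(** The constant [c] is a falling factorial. Its positivity is what counts: for j = k the k-th
    derivative at [a] vanishes only if [g a] does. *)
Lemma order_deriv (f g : CC -> CC) (a : CC) (k : nat) : holo 1 g -> Cmod a < 1 ->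
  (forall z, Cmod z < 1 -> f z = ((z - a) ^ k * g z)%C) ->
  forall j, (j <= k)%nat -> exists h c, 0 < c /\ holo 1 h /\ h a = (RtoC c * g a)%C /\
    forall z, Cmod z < 1 -> Cderiv_n j f z = ((z - a) ^ (k - j) * h z)%C.
Proof.
  intros Hg Ha E. induction j as [|j IH]; intros Hj.
  - exists g, 1. repeat split; auto; [lra|ring|]. intros z Hz. rewrite Nat.sub_0_r. apply E, Hz.
  - destruct IH as [h [c [Hc [Hh [Hha Eh]]]]]; [lia|].
    set (i := (k - S j)%nat). replace (k - j)%nat with (S i) in Eh by (unfold i; lia).
    exists (fun z => (RtoC (INR (S i)) * h z + (z - a) * Cderiv h z)%C), (INR (S i) * c).
    assert (Pi : 0 < INR (S i)) by (apply lt_0_INR; lia).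
    repeat split.
    + nra.
    + apply (holo_plus 1 (fun z => (RtoC (INR (S i)) * h z)%C) (fun z => ((z - a) * Cderiv h z)%C)).
      * apply holo_mult; [apply holo_const|exact Hh].
      * apply (holo_mult 1 (fun z => (z - a)%C) (Cderiv h)); [|apply holo_deriv, Hh].
        apply holo_minus; [apply holo_id|apply holo_const].
    + rewrite Hha, RtoC_mult. ring.
    + intros z Hz. simpl Cderiv_n. apply Cderiv_correct.
      apply (Cis_derive_ext_loc (fun z => ((z - a) ^ S i * h z)%C)).
      { apply disk_near; [exact Hz|]. intros y Hy. symmetry. apply Eh, Hy. }
      assert (Dp : Cis_derive (fun z => ((z - a) ^ S i)%C) z (RtoC (INR (S i)) * (z - a) ^ i * (1 - 0))%C).
      { apply (Cis_derive_pow (fun z => (z - a)%C)).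
        apply (Cis_derive_minus (fun z => z) (fun _ => a)); [apply Cis_derive_id|apply Cis_derive_const]. }
      replace ((z - a) ^ i * (RtoC (INR (S i)) * h z + (z - a) * Cderiv h z))%C
        with (RtoC (INR (S i)) * (z - a) ^ i * (1 - 0) * h z + (z - a) ^ S i * Cderiv h z)%C by (simpl; ring).
      apply (Cis_derive_mult (fun z => ((z - a) ^ S i)%C) h); [exact Dp|].
      apply (Cderiv_spec 1); assumption.
Qed.

(** By [order_deriv] each further vanishing derivative makes the cofactor vanish at [a], and it can
    be divided once more. *)
Lemma order_divide (f : CC -> CC) (a : CC) (m : nat) : holo 1 f -> Cmod a < 1 ->
  (forall j, (j < m)%nat -> Cderiv_n j f a = RtoC 0) ->
  exists g, holo 1 g /\ forall z, Cmod z < 1 -> f z = ((z - a) ^ m * g z)%C.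
Proof.
  intros Hf Ha. induction m as [|m IH]; intros H.
  - exists f. split; [exact Hf|]. intros z _. simpl. ring.
  - destruct IH as [g [Hg E]]; [auto|].
    destruct (order_deriv f g a m Hg Ha E m (le_n m)) as [h [c [Hc [Hh [Hha Eh]]]]].
    assert (Z : h a = RtoC 0).
    { rewrite <- (H m) by lia. rewrite Eh by exact Ha. rewrite Nat.sub_diag. simpl. ring. }
    assert (Zg : g a = RtoC 0).
    { replace (g a) with (/ RtoC c * (RtoC c * g a))%C by (field; intros X; apply RtoC_inj in X; lra).
      rewrite <- Hha, Z. ring. }
    destruct (holo_divide g a Hg Ha Zg) as [g' [Hg' E']].
    exists g'. split; [exact Hg'|]. intros z Hz. rewrite E, E' by exact Hz. simpl. ring.
Qed.

(** A factor that is nonzero at [a] does not affect the order there. This lets zeros at distinct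
    points accumulate in [divisor_factor]. *)
Lemma order_coprime (P g h : CC -> CC) (a : CC) (m : nat) : holo 1 P -> holo 1 h -> Cmod a < 1 ->
  P a <> RtoC 0 -> holo 1 g ->
  (forall z, Cmod z < 1 -> (P z * g z = (z - a) ^ m * h z)%C) ->
  exists g', holo 1 g' /\ forall z, Cmod z < 1 -> g z = ((z - a) ^ m * g' z)%C.
Proof.
  intros HP Hh Ha HPa. revert g. induction m as [|m IH]; intros g Hg E.
  - exists g. split; [exact Hg|]. intros z _. simpl. ring.
  - assert (Z : g a = RtoC 0).
    { replace (g a) with (/ P a * (P a * g a))%C by (field; exact HPa).
      rewrite E by exact Ha. simpl. ring. }
    destruct (holo_divide g a Hg Ha Z) as [g1 [Hg1 E1]].
    destruct (IH g1 Hg1) as [g' [Hg' E']].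
    + apply (cancel_factor (fun z => (P z * g1 z)%C) (fun z => ((z - a) ^ m * h z)%C) a); auto.
      * apply holo_mult; assumption.
      * apply (holo_mult 1 (fun z => ((z - a) ^ m)%C) h); [|exact Hh].
        apply holo_pow, holo_minus; [apply holo_id|apply holo_const].
      * intros z Hz. specialize (E z Hz). rewrite E1 in E by exact Hz. simpl in E.
        replace ((z - a) * (P z * g1 z))%C with (P z * ((z - a) * g1 z))%C by ring.
        rewrite E. ring.
    + exists g'. split; [exact Hg'|]. intros z Hz. rewrite E1, E' by exact Hz. simpl. ring.
Qed.

Lemma Cderiv_n_const (c : CC) (j : nat) : (1 <= j)%nat -> forall z, Cmod z < 1 ->
  Cderiv_n j (fun _ => c) z = RtoC 0.
Proof.
  intros Hj. destruct j as [|j]; [lia|]. clear Hj. induction j as [|j IH]; intros z Hz.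
  - apply Cderiv_correct, Cis_derive_const.
  - change (Cderiv (Cderiv_n (S j) (fun _ => c)) z = RtoC 0).
    apply Cderiv_correct. apply (Cis_derive_ext_loc (fun _ => RtoC 0)); [|apply Cis_derive_const].
    apply disk_near; [exact Hz|]. intros y Hy. symmetry. apply IH, Hy.
Qed.

(** * Translation between points with multiplicities and lists of repeated zeros *)

Fixpoint expand (L : list (CC * nat)) : list CC :=
  match L with nil => nil | (a, m) :: L' => repeat a m ++ expand L' end.

Lemma zprod_app (l l' : list CC) (z : CC) : zprod (l ++ l') z = (zprod l z * zprod l' z)%C.
Proof.
  induction l as [|a l IH]; simpl; [ring|].
  fold (zprod (l ++ l') z) (zprod l z). rewrite IH. ring.
Qed.

Lemma zprod_repeat (a : CC) (m : nat) (z : CC) : zprod (repeat a m) z = ((z - a) ^ m)%C.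
Proof. induction m as [|m IH]; simpl; [reflexivity|]. fold (zprod (repeat a m) z). now rewrite IH. Qed.

Lemma lsum_app (f : CC -> R) (l l' : list CC) : lsum f (l ++ l') = lsum f l + lsum f l'.
Proof.
  induction l as [|a l IH]; simpl; [ring|].
  fold (lsum f (l ++ l')) (lsum f l). rewrite IH. ring.
Qed.

Lemma lsum_repeat (f : CC -> R) (a : CC) (m : nat) : lsum f (repeat a m) = INR m * f a.
Proof.
  induction m as [|m IH]; [simpl; ring|]. rewrite S_INR. simpl.
  fold (lsum f (repeat a m)). rewrite IH. ring.
Qed.

Lemma weighted_log_sum_expand (L : list (CC * nat)) :
  weighted_log_sum L = lsum (fun a => ln (/ Cmod a)) (expand L).
Proof.
  induction L as [|[a m] L IH]; [reflexivity|]. simpl.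
  rewrite lsum_app, lsum_repeat, IH. reflexivity.
Qed.

Lemma expand_in (L : list (CC * nat)) (a : CC) : In a (expand L) -> In a (map fst L).
Proof.
  induction L as [|[b m] L IH]; simpl; [auto|]. intros H.
  apply in_app_or in H. destruct H as [H|H]; [left; symmetry; eapply repeat_spec; eauto|right; auto].
Qed.

Lemma divisor_factor (phi : CC -> CC) (w : CC) (L : list (CC * nat)) : holo 1 phi ->
  NoDup (map fst L) ->
  List.Forall (fun p => in_disk (fst p) /\ zero_order_ge phi w (fst p) (snd p)) L ->
  exists g, holo 1 g /\ forall z, Cmod z < 1 -> (phi z - w = zprod (expand L) z * g z)%C.
Proof.
  intros Hphi. assert (Hd : holo 1 (fun z => (phi z - w)%C)) by (apply holo_minus; [exact Hphi|apply holo_const]).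
  induction L as [|[a m] L IH]; intros HN HF.
  - exists (fun z => (phi z - w)%C). split; [exact Hd|]. intros z _. simpl. ring.
  - simpl in HN. inversion HN as [|? ? Hna HN']; subst. inversion HF as [|? ? Hx HF']; subst.
    destruct Hx as [Ha [Hw [Hm Hder]]]. simpl in *. unfold in_disk in Ha.
    destruct (IH HN' HF') as [g [Hg E]].
    destruct (order_divide (fun z => (phi z - w)%C) a m Hd Ha) as [h [Hh Eh]].
    (* [zero_order_ge] speaks of the derivatives of order at least 1 only; order 0 is the equation
       [phi a = w]. *)
    { intros [|j] Hj; [simpl; rewrite Hw; ring|].
      rewrite (Cderiv_n_minus (S j) phi (fun _ => w) Hphi (holo_const 1 w) a Ha).
      rewrite (Cderiv_n_const w (S j)) by (auto; lia).
      rewrite Hder by lia. ring. }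
    destruct (order_coprime (zprod (expand L)) g h a m) as [g' [Hg' E']]; auto.
    + apply holo_zprod.
    + apply zprod_nz. intros b Hb ->. apply Hna, expand_in, Hb.
    + intros z Hz. rewrite <- E, <- Eh by exact Hz. reflexivity.
    + exists g'. split; [exact Hg'|]. intros z Hz.
      rewrite zprod_app, zprod_repeat, E, E' by exact Hz. ring.
Qed.

Fixpoint insert_zero (a : CC) (L : list (CC * nat)) : list (CC * nat) :=
  match L with
  | nil => (a, 1%nat) :: nil
  | (b, m) :: L' => if Ceq_dec a b then (b, S m) :: L' else (b, m) :: insert_zero a L'
  end.

Lemma insert_zero_fst (a b : CC) (L : list (CC * nat)) :
  In b (map fst (insert_zero a L)) -> b = a \/ In b (map fst L).
Proof.
  induction L as [|[c m] L IH]; simpl; [intros [H|[]]; auto|].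
  destruct (Ceq_dec a c) as [E|E]; simpl; [tauto|]. intros [H|H]; [tauto|]. apply IH in H. tauto.
Qed.

Lemma insert_zero_nodup (a : CC) (L : list (CC * nat)) :
  NoDup (map fst L) -> NoDup (map fst (insert_zero a L)).
Proof.
  induction L as [|[c m] L IH]; simpl; intros H; [constructor; [auto|constructor]|].
  inversion H as [|? ? H1 H2]; subst. destruct (Ceq_dec a c) as [E|E]; simpl; constructor; auto.
  intros X. apply insert_zero_fst in X. destruct X as [->|X]; auto.
Qed.

Lemma insert_zero_sum (a : CC) (L : list (CC * nat)) :
  weighted_log_sum (insert_zero a L) = ln (/ Cmod a) + weighted_log_sum L.
Proof.
  induction L as [|[c m] L IH]; [simpl; ring|].
  simpl insert_zero. destruct (Ceq_dec a c) as [->|E].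
  - cbn [weighted_log_sum]. rewrite S_INR. ring.
  - cbn [weighted_log_sum]. rewrite IH. ring.
Qed.

(** The supremum in [nevanlinna] runs over distinct points with multiplicities, so repeated zeros
    must be regrouped. The divisibility by (z - a)^m is recorded because it yields the vanishing
    derivatives. *)
Lemma group_zeros (l : list CC) : exists L : list (CC * nat), NoDup (map fst L) /\
  weighted_log_sum L = lsum (fun a => ln (/ Cmod a)) l /\
  List.Forall (fun p => In (fst p) l /\ (1 <= snd p)%nat /\
     exists h, holo 1 h /\ forall z, zprod l z = ((z - fst p) ^ (snd p) * h z)%C) L.
Proof.
  induction l as [|a l [L [H1 [H2 H3]]]].
  - exists nil. repeat split; constructor.
  - exists (insert_zero a L). split; [apply insert_zero_nodup, H1|].
    split; [rewrite insert_zero_sum, H2; reflexivity|].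
    assert (Hlin : holo 1 (fun z => (z - a)%C)) by (apply holo_minus; [apply holo_id|apply holo_const]).
    assert (Hmono : forall L, List.Forall (fun p => In (fst p) l /\ (1 <= snd p)%nat /\
       exists h, holo 1 h /\ forall z, zprod l z = ((z - fst p) ^ (snd p) * h z)%C) L ->
       List.Forall (fun p => In (fst p) (a :: l) /\ (1 <= snd p)%nat /\
       exists h, holo 1 h /\ forall z, zprod (a :: l) z = ((z - fst p) ^ (snd p) * h z)%C) L).
    { intros L'. apply List.Forall_impl. intros [b m] [I1 [I2 [h [Hh E]]]]. simpl in *.
      split; [now right|]. split; [exact I2|].
      exists (fun z => ((z - a) * h z)%C). split; [apply (holo_mult 1 (fun z => (z - a)%C) h); assumption|].
      intros z. fold (zprod l z). rewrite E. ring. }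
    clear H1 H2. induction L as [|[b m] L IH]; simpl.
    + constructor; [|constructor]. simpl. split; [now left|]. split; [lia|].
      exists (zprod l). split; [apply holo_zprod|]. intros z. fold (zprod l z). ring.
    + inversion H3 as [|? ? Hx H3']; subst. destruct (Ceq_dec a b) as [->|n].
      * constructor; [|apply Hmono, H3']. destruct Hx as [I1 [I2 [h [Hh E]]]]. simpl in *.
        split; [now right|]. split; [lia|]. exists h. split; [exact Hh|].
        intros z. fold (zprod l z). rewrite E. ring.
      * constructor; [|apply IH, H3'].
        assert (X := Hmono ((b, m) :: nil) (List.Forall_cons _ Hx (List.Forall_nil _))).
        inversion X; subst; assumption.
Qed.

(** The use of N in the sufficiency part: any finite factorisation of phi - w can be charged to
    it. *)
Lemma nevanlinna_ge (phi q : CC -> CC) (w : CC) (l : list CC) : holo 1 phi -> holo 1 q ->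
  w <> phi (RtoC 0) -> (forall a, In a l -> Cmod a < 1) ->
  (forall z, Cmod z < 1 -> (phi z - w = zprod l z * q z)%C) ->
  Rbar_le (Finite (lsum (fun a => ln (/ Cmod a)) l)) (nevanlinna phi w).
Proof.
  intros Hphi Hq Hw Hl E. unfold nevanlinna.
  destruct (excluded_middle_informative _) as [X|_]; [contradiction|].
  apply Lub_Rbar_correct. destruct (group_zeros l) as [L [H1 [H2 H3]]].
  exists L. split; [exact H1|]. split; [|symmetry; exact H2].
  eapply List.Forall_impl; [|exact H3]. intros [a m] [I1 [I2 [h [Hh Eh]]]]. simpl in *.
  assert (Ha : Cmod a < 1) by auto. split; [exact Ha|].
  assert (Hhq : holo 1 (fun z => (h z * q z)%C)) by (apply holo_mult; assumption).
  assert (E' : forall z, Cmod z < 1 -> (phi z - w = (z - a) ^ m * (h z * q z))%C).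
  { intros z Hz. rewrite E, Eh by exact Hz. ring. }
  split; [|split; [exact I2|]].
  - apply (proj2 (Ceq_minus _ _)). rewrite E' by exact Ha. destruct m; [lia|]. simpl. ring.
  - intros j Hj Hjm.
    destruct (order_deriv (fun z => (phi z - w)%C) _ a m Hhq Ha E' j) as [g [c [_ [_ [_ Eg]]]]]; [lia|].
    specialize (Eg a Ha).
    rewrite (Cderiv_n_minus j phi (fun _ => w) Hphi (holo_const 1 w) a Ha) in Eg.
    rewrite (Cderiv_n_const w j Hj a Ha) in Eg.
    replace (Cderiv_n j phi a) with (Cderiv_n j phi a - 0)%C by ring. rewrite Eg.
    destruct (m - j)%nat eqn:Em; [lia|]. simpl. ring.
Qed.

(** * The Hardy space and its kernels *)

Lemma coef_sum_le_mean2 (f : CC -> CC) (r : R) (K : nat) : holo 1 f -> 0 < r < 1 ->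
  rsum (fun k => Cmod (coef f k) ^ 2 * (r ^ 2) ^ k) K <= int_mean2 f r.
Proof.
  intros Hf Hr. assert (L := parseval f r Hf Hr).
  apply (is_lim_seq_le_loc (fun _ => rsum (fun k => Cmod (coef f k) ^ 2 * (r ^ 2) ^ k) K) _ (Finite _) (Finite _))
    with (3 := L); [|apply is_lim_seq_const].
  exists K. intros n Hn. replace n with (K + (n - K))%nat by lia. apply rsum_mono.
  intros k. apply Rmult_le_pos; [apply pow_le, Cmod_ge_0|]. apply pow_le, pow_le. lra.
Qed.

Lemma mean2_le_of_coef_sum (f : CC -> CC) (r B : R) : holo 1 f -> 0 < r < 1 ->
  (forall K, rsum (fun k => Cmod (coef f k) ^ 2 * (r ^ 2) ^ k) K <= B) -> int_mean2 f r <= B.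
Proof.
  intros Hf Hr H. assert (L := parseval f r Hf Hr).
  apply (is_lim_seq_le _ (fun _ => B) (Finite _) (Finite B)) with (2 := L); [exact H|apply is_lim_seq_const].
Qed.

(** Each term of Parseval's series increases with the radius. *)
Lemma mean2_mono (f : CC -> CC) (r s : R) : holo 1 f -> 0 < r <= s -> s < 1 ->
  int_mean2 f r <= int_mean2 f s.
Proof.
  intros Hf Hr Hs. apply mean2_le_of_coef_sum; [exact Hf|lra|]. intros K.
  eapply Rle_trans; [|apply (coef_sum_le_mean2 f s K); auto; lra].
  apply rsum_le. intros k _. apply Rmult_le_compat_l; [apply pow_le, Cmod_ge_0|].
  apply pow_incr. split; [apply pow_le; lra|apply pow_incr; lra].
Qed.

Lemma mean2_ext (f g : CC -> CC) (r : R) : 0 < r < 1 -> (forall z, Cmod z < 1 -> f z = g z) ->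
  int_mean2 f r = int_mean2 g r.
Proof.
  intros Hr E. apply (cmean_ext (fun t => Cmod (f (circ r t)) ^ 2) (fun t => Cmod (g (circ r t)) ^ 2)).
  intros t. rewrite E; [reflexivity|]. rewrite Cmod_circ; lra.
Qed.

Lemma H2_norm2_limit (f : CC -> CC) : in_H2 f -> H2_limit f (H2_norm2 f).
Proof. intros [_ HL]. unfold H2_norm2. apply epsilon_spec, HL. Qed.

Lemma H2_limit_near (f : CC -> CC) (L e r : R) : H2_limit f L -> 0 < e -> r < 1 ->
  exists s, r < s < 1 /\ Rabs (int_mean2 f s - L) < e.
Proof.
  intros H He Hr.
  assert (H' := H (ball L (mkposreal e He)) (locally_ball L (mkposreal e He))).
  unfold filtermap, at_left, within in H'. destruct H' as [d Hd].
  set (h := Rmin d (1 - r) / 2).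
  assert (Hm : 0 < Rmin d (1 - r)) by (apply Rmin_glb_lt; [apply cond_pos|lra]).
  assert (M1 := Rmin_l d (1 - r)). assert (M2 := Rmin_r d (1 - r)).
  exists (1 - h). split; [unfold h; lra|]. apply (Hd (1 - h)); [|unfold h; lra].
  change (Rabs (1 - h - 1) < d). rewrite Rabs_left; unfold h; lra.
Qed.

Lemma mean2_le_norm (f : CC -> CC) (r : R) : in_H2 f -> 0 < r < 1 -> int_mean2 f r <= H2_norm2 f.
Proof.
  intros Hf Hr. apply le_epsilon. intros e He.
  destruct (H2_limit_near f _ e r (H2_norm2_limit f Hf) He) as [s [Hs H]]; [lra|].
  assert (int_mean2 f r <= int_mean2 f s) by (apply mean2_mono; [exact (proj1 Hf)|lra|lra]).
  apply Rabs_lt_between' in H. lra.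
Qed.

(** Monotone means converge to their supremum, so a uniform bound gives both the limit that [in_H2]
    asks for and the norm estimate. *)
Lemma H2_of_bound (f : CC -> CC) (B : R) : holo 1 f -> (forall r, 0 < r < 1 -> int_mean2 f r <= B) ->
  in_H2 f /\ H2_norm2 f <= B.
Proof.
  intros Hf HB.
  destruct (completeness (fun x => exists r, 0 < r < 1 /\ x = int_mean2 f r)) as [L [HL1 HL2]].
  - exists B. intros x [r [Hr ->]]. auto.
  - exists (int_mean2 f (1 / 2)), (1 / 2). split; [lra|reflexivity].
  - assert (HL : H2_limit f L).
    { intros P [e He].
      assert (Hex : exists r, 0 < r < 1 /\ L - e < int_mean2 f r).
      { apply Classical_Prop.NNPP. intros Hn. assert (L <= L - e); [|assert (X := cond_pos e); lra].
        apply HL2. intros x [r [Hr ->]]. apply Rnot_lt_le. intros X. apply Hn. now exists r. }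
      destruct Hex as [r [Hr HLr]].
      assert (Hd : 0 < 1 - r) by lra. exists (mkposreal _ Hd). intros s Hs Hs1. apply He.
      assert (Hs' : Rabs (s - 1) < 1 - r) by exact Hs.
      rewrite Rabs_left in Hs' by lra.
      assert (int_mean2 f r <= int_mean2 f s) by (apply mean2_mono; auto; lra).
      assert (int_mean2 f s <= L) by (apply HL1; exists s; split; [lra|reflexivity]).
      change (Rabs (int_mean2 f s - L) < e). apply Rabs_lt_between'. assert (X := cond_pos e). lra. }
    assert (Hin : in_H2 f) by (split; [exact Hf|now exists L]).
    split; [exact Hin|]. apply le_epsilon. intros e He.
    destruct (H2_limit_near f _ e 0 (H2_norm2_limit f Hin) He) as [s [Hs H]]; [lra|].
    apply Rabs_lt_between' in H. specialize (HB s Hs). lra.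
Qed.

Lemma norm2_pos (f : CC -> CC) : in_H2 f -> 0 <= H2_norm2 f.
Proof.
  intros Hf. eapply Rle_trans; [|apply (mean2_le_norm f (1 / 2) Hf); lra].
  eapply Rle_trans; [|apply (coef_sum_le_mean2 f (1 / 2) 0 (proj1 Hf)); lra]. simpl. lra.
Qed.

(** The limit r -> 1 in Parseval's inequality, made quantitative by Bernoulli: r^(2k) >= 1 - K (1 -
    r^2) for k < K. *)
Lemma coef_sum_le_norm2 (f : CC -> CC) (K : nat) : in_H2 f ->
  rsum (fun k => Cmod (coef f k) ^ 2) K <= H2_norm2 f.
Proof.
  intros Hf. set (S := rsum (fun k => Cmod (coef f k) ^ 2) K).
  assert (PS : 0 <= S) by (apply rsum_pos; intros; apply pow_le, Cmod_ge_0).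
  assert (HK : forall r, 0 < r < 1 -> S * (1 - INR K * (1 - r ^ 2)) <= H2_norm2 f).
  { intros r Hr. eapply Rle_trans; [|apply (mean2_le_norm f r Hf Hr)].
    eapply Rle_trans; [|apply (coef_sum_le_mean2 f r K (proj1 Hf) Hr)].
    unfold S. rewrite Rmult_comm, <- rsum_scal. apply rsum_le. intros k Hk.
    rewrite Rmult_comm. apply Rmult_le_compat_l; [apply pow_le, Cmod_ge_0|].
    assert (B : forall j, 1 - INR j * (1 - r ^ 2) <= (r ^ 2) ^ j).
    { assert (Hy : 0 < r ^ 2 < 1) by (simpl; nra). set (y := r ^ 2) in *. clearbody y.
      induction j as [|j IH]; [simpl; lra|]. rewrite S_INR.
      change (y ^ Datatypes.S j) with (y * y ^ j). assert (Pj : 0 <= INR j) by apply pos_INR.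
      assert (X : y * (1 - INR j * (1 - y)) <= y * y ^ j) by (apply Rmult_le_compat_l; lra).
      assert (0 <= INR j * (1 - y) * (1 - y)) by (repeat apply Rmult_le_pos; lra). lra. }
    eapply Rle_trans; [|apply B]. assert (INR k <= INR K) by (apply le_INR; lia).
    assert (0 <= 1 - r ^ 2) by (simpl; nra).
    assert (INR k * (1 - r ^ 2) <= INR K * (1 - r ^ 2)) by (apply Rmult_le_compat_r; assumption). lra. }
  apply le_epsilon. intros e He.
  assert (PK : 0 <= INR K) by apply pos_INR.
  (* At r = 1 - d one has 1 - r^2 <= 2 d, so the loss S K (1 - r^2) is at most [e]. *)
  set (d := Rmin (1 / 2) (e / (2 * (S * INR K + 1)))).
  assert (PSK : 0 <= S * INR K) by nra.
  assert (Hd : 0 < d) by (apply Rmin_glb_lt; [lra|apply Rdiv_lt_0_compat; lra]).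
  assert (D1 : d <= 1 / 2) by apply Rmin_l.
  assert (D2 : d <= e / (2 * (S * INR K + 1))) by apply Rmin_r.
  specialize (HK (1 - d) ltac:(lra)).
  assert (D3 : (2 * (S * INR K + 1)) * d <= e).
  { apply (Rmult_le_compat_l (2 * (S * INR K + 1))) in D2; [|lra].
    replace (2 * (S * INR K + 1) * (e / (2 * (S * INR K + 1)))) with e in D2 by (field; lra). exact D2. }
  replace (1 - (1 - d) ^ 2) with (2 * d - d * d) in HK by ring. nra.
Qed.

Lemma H2_of_coef (f : CC -> CC) (B : R) : holo 1 f ->
  (forall K, rsum (fun k => Cmod (coef f k) ^ 2) K <= B) -> in_H2 f /\ H2_norm2 f <= B.
Proof.
  intros Hf H. apply H2_of_bound; [exact Hf|]. intros r Hr. apply mean2_le_of_coef_sum; auto.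
  intros K. eapply Rle_trans; [|apply (H K)]. apply rsum_le. intros k _.
  rewrite <- (Rmult_1_r (Cmod (coef f k) ^ 2)) at 2.
  apply Rmult_le_compat_l; [apply pow_le, Cmod_ge_0|].
  rewrite <- (pow1 k). apply pow_incr. split; [apply pow_le; lra|]. simpl; nra.
Qed.

Lemma coef_le_norm (f : CC -> CC) (k : nat) : in_H2 f -> Cmod (coef f k) <= sqrt (H2_norm2 f).
Proof.
  intros Hf. rewrite <- (sqrt_pow2 (Cmod (coef f k))) by apply Cmod_ge_0.
  apply sqrt_le_1_alt. eapply Rle_trans; [|apply (coef_sum_le_norm2 f (S k) Hf)].
  apply (rsum_term (fun k => Cmod (coef f k) ^ 2)); [|lia]. intros; apply pow_le, Cmod_ge_0.
Qed.

(** All coefficients are bounded by the norm, which gives a geometric series: cruder than the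
    reproducing kernel bound, but enough to turn norm convergence into pointwise convergence. *)
Lemma H2_pointwise (f : CC -> CC) (z : CC) : in_H2 f -> Cmod z < 1 ->
  Cmod (f z) <= sqrt (H2_norm2 f) / (1 - Cmod z).
Proof.
  intros Hf Hz. apply (ctends_Cmod_le _ _ _ (coef_ps f (proj1 Hf) z Hz)). intros K.
  eapply Rle_trans; [apply Cmod_csum_le|].
  apply Rle_trans with (rsum (fun k => sqrt (H2_norm2 f) * Cmod z ^ k) K).
  - apply rsum_le. intros k _. rewrite Cmod_mult, Cmod_pow.
    apply Rmult_le_compat_r; [apply pow_le, Cmod_ge_0|apply coef_le_norm, Hf].
  - rewrite rsum_scal. apply Rmult_le_compat_l; [apply sqrt_pos|].
    apply rsum_geom_le. split; [apply Cmod_ge_0|exact Hz].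
Qed.

Lemma Cmod_minus_sq (a b : CC) : Cmod (a - b) ^ 2 <= 2 * Cmod a ^ 2 + 2 * Cmod b ^ 2.
Proof.
  assert (T := Cmod_triangle a (- b)). rewrite Cmod_opp in T. fold (a - b)%C in T.
  assert (P := Cmod_ge_0 (a - b)). assert (Pa := Cmod_ge_0 a). assert (Pb := Cmod_ge_0 b).
  apply Rle_trans with ((Cmod a + Cmod b) ^ 2); [apply pow_incr; lra|].
  assert (Q := pow2_ge_0 (Cmod a - Cmod b)). nra.
Qed.

Lemma H2_minus (f g : CC -> CC) : in_H2 f -> in_H2 g ->
  in_H2 (fun z => (f z - g z)%C) /\
  H2_norm2 (fun z => (f z - g z)%C) <= 2 * H2_norm2 f + 2 * H2_norm2 g.
Proof.
  intros Hf Hg. apply H2_of_coef; [apply holo_minus; [apply Hf|apply Hg]|].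
  intros K. apply Rle_trans with (2 * rsum (fun k => Cmod (coef f k) ^ 2) K + 2 * rsum (fun k => Cmod (coef g k) ^ 2) K).
  - rewrite <- !rsum_scal, <- rsum_plus. apply rsum_le. intros k _.
    rewrite coef_minus by (apply Hf || apply Hg). apply Cmod_minus_sq.
  - assert (X := coef_sum_le_norm2 f K Hf). assert (Y := coef_sum_le_norm2 g K Hg). lra.
Qed.

(** * Normalised kernels, their derivatives, and the passage to radius 1 in zero sums *)

Definition kern (w z : CC) : CC := (RtoC (sqrt (1 - Cmod w ^ 2)) * / (1 - Cconj w * z))%C.

Lemma kern_den (w z : CC) : Cmod w < 1 -> Cmod z < 1 ->
  1 - Cmod z <= Cmod (1 - Cconj w * z) /\ (1 - Cconj w * z)%C <> RtoC 0.
Proof.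
  intros Hw Hz. assert (T := Cmod_triangle (1 - Cconj w * z) (Cconj w * z)).
  replace (1 - Cconj w * z + Cconj w * z)%C with (RtoC 1) in T by ring.
  rewrite Cmod_1, Cmod_mult, Cmod_conj in T.
  assert (Pw := Cmod_ge_0 w). assert (Pz := Cmod_ge_0 z).
  assert (A : 1 - Cmod z <= Cmod (1 - Cconj w * z)) by nra.
  split; [exact A|]. apply Cmod_gt_0. lra.
Qed.

Lemma Cis_derive_kern_inv (w z : CC) : Cmod w < 1 -> Cmod z < 1 ->
  Cis_derive (fun y => (/ (1 - Cconj w * y))%C) z (Cconj w * (/ (1 - Cconj w * z)) ^ 2)%C.
Proof.
  intros Hw Hz. destruct (kern_den w z Hw Hz) as [_ N].
  replace (Cconj w * (/ (1 - Cconj w * z)) ^ 2)%C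
    with (- / ((1 - Cconj w * z) * (1 - Cconj w * z)) * (0 - (0 * z + Cconj w * 1)))%C by (field; exact N).
  apply (Cis_derive_comp Cinv (fun y => (1 - Cconj w * y)%C)); [apply Cis_derive_inv, N|].
  apply (Cis_derive_minus (fun _ => RtoC 1) (fun y => (Cconj w * y)%C)); [apply Cis_derive_const|].
  apply (Cis_derive_mult (fun _ => Cconj w) (fun y => y)); [apply Cis_derive_const|apply Cis_derive_id].
Qed.

Lemma kern_holo (w : CC) : Cmod w < 1 -> holo 1 (kern w).
Proof.
  intros Hw z Hz. eexists.
  apply (Cis_derive_mult (fun _ => RtoC (sqrt (1 - Cmod w ^ 2))) (fun y => (/ (1 - Cconj w * y))%C)).
  - apply Cis_derive_const.
  - apply Cis_derive_kern_inv; assumption.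
Qed.

Lemma kern_deriv (w : CC) (n : nat) : Cmod w < 1 -> forall z, Cmod z < 1 ->
  Cderiv_n n (kern w) z = (RtoC (sqrt (1 - Cmod w ^ 2)) * RtoC (INR (fact n)) * Cconj w ^ n
    * (/ (1 - Cconj w * z)) ^ S n)%C.
Proof.
  intros Hw. induction n as [|n IH]; intros z Hz.
  - unfold kern. simpl. ring.
  - simpl Cderiv_n. apply Cderiv_correct.
    apply (Cis_derive_ext_loc (fun z => (RtoC (sqrt (1 - Cmod w ^ 2)) * RtoC (INR (fact n)) * Cconj w ^ n
      * (/ (1 - Cconj w * z)) ^ S n)%C)).
    { apply disk_near; [exact Hz|]. intros y Hy. symmetry. apply IH, Hy. }
    set (c := (RtoC (sqrt (1 - Cmod w ^ 2)) * RtoC (INR (fact n)) * Cconj w ^ n)%C).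
    set (p := (/ (1 - Cconj w * z))%C).
    replace (RtoC (sqrt (1 - Cmod w ^ 2)) * RtoC (INR (fact (S n))) * Cconj w ^ S n * p ^ S (S n))%C
      with (0 * p ^ S n + c * (RtoC (INR (S n)) * p ^ n * (Cconj w * p ^ 2)))%C.
    2:{ unfold c. rewrite fact_simpl, mult_INR, RtoC_mult. simpl Cpow. ring. }
    apply (Cis_derive_mult (fun _ => c) (fun y => ((/ (1 - Cconj w * y)) ^ S n)%C)).
    + apply Cis_derive_const.
    + apply (Cis_derive_pow (fun y => (/ (1 - Cconj w * y))%C)). apply Cis_derive_kern_inv; assumption.
Qed.

Lemma kern_H2 (w : CC) : Cmod w < 1 -> in_H2 (kern w) /\ H2_norm2 (kern w) <= 1.
Proof.
  intros Hw. set (c := RtoC (sqrt (1 - Cmod w ^ 2))). assert (Pw := Cmod_ge_0 w).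
  assert (Hww : 0 <= Cmod w ^ 2 < 1) by (simpl; nra).
  assert (Hc2 : Cmod c ^ 2 = 1 - Cmod w ^ 2).
  { unfold c. rewrite Cmod_R, Rabs_right by (apply Rle_ge, sqrt_pos). apply pow2_sqrt. lra. }
  assert (Hg : growth (fun k => (c * Cconj w ^ k)%C)).
  { intros r Hr. exists (Cmod c + 1). split; [assert (X := Cmod_ge_0 c); lra|]. intros k.
    rewrite Cmod_mult, Cmod_pow, Cmod_conj. rewrite Rmult_assoc, <- Rpow_mult_distr.
    assert ((Cmod w * r) ^ k <= 1) by (rewrite <- (pow1 k); apply pow_incr; nra).
    assert (X := Cmod_ge_0 c). nra. }
  assert (Hps : has_ps (fun k => (c * Cconj w ^ k)%C) (kern w)).
  { intros z Hz. destruct (kern_den w z Hw Hz) as [_ N].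
    assert (Pz := Cmod_ge_0 z).
    apply (ctends_bound _ _ (fun K => Cmod (kern w z) * (Cmod w * Cmod z) ^ K)).
    - intros K. replace (csum (fun k => c * Cconj w ^ k * z ^ k) K - kern w z)%C
        with (- (kern w z * (Cconj w * z) ^ K))%C.
      + rewrite Cmod_opp, Cmod_mult, Cmod_pow, Cmod_mult, Cmod_conj. lra.
      + unfold kern. fold c. induction K as [|K IH]; [simpl; field; exact N|].
        simpl csum.
        replace (csum (fun k => c * Cconj w ^ k * z ^ k) K + c * Cconj w ^ K * z ^ K - c * / (1 - Cconj w * z))%C
          with (csum (fun k => c * Cconj w ^ k * z ^ k) K - c * / (1 - Cconj w * z) + c * Cconj w ^ K * z ^ K)%C by ring.
        rewrite <- IH. rewrite !Cpow_mult_l. simpl Cpow. field. exact N.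
    - apply geom_lim. nra. }
  assert (Hh := kern_holo w Hw).
  apply H2_of_coef; [exact Hh|]. intros K.
  rewrite (rsum_ext _ (fun k => (1 - Cmod w ^ 2) * (Cmod w ^ 2) ^ k)).
  2:{ intros k _. rewrite (coef_unique _ _ Hg Hh Hps), Cmod_mult, Cmod_pow, Cmod_conj, Rpow_mult_distr, Hc2.
      f_equal. rewrite <- !pow_mult. f_equal. lia. }
  rewrite rsum_scal. apply (Rmult_le_reg_l (/ (1 - Cmod w ^ 2))); [apply Rinv_0_lt_compat; lra|].
  rewrite <- Rmult_assoc, Rinv_l, Rmult_1_l, Rmult_1_r by lra. apply rsum_geom_le; lra.
Qed.

Lemma blog_ge (r : R) (a : CC) : 0 < r -> 0 < Cmod a -> ln (/ Cmod a) + ln r <= blog r a.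
Proof.
  intros Hr Ha. unfold blog. rewrite <- ln_mult by (auto; apply Rinv_0_lt_compat, Ha).
  apply ln_le'; [apply Rmult_lt_0_compat; auto; apply Rinv_0_lt_compat, Ha|].
  rewrite Rmult_comm. apply Rmult_le_compat_r; [left; apply Rinv_0_lt_compat, Ha|apply Rmax_l].
Qed.

Lemma lsum_plus (f g : CC -> R) (l : list CC) : lsum (fun a => f a + g a) l = lsum f l + lsum g l.
Proof. induction l as [|a l IH]; simpl; [ring|]. unfold lsum in *. rewrite IH. ring. Qed.

(** Replacing radius 1 by [r] costs at most log (1 / r) per zero. With log (1 / r) = e / (m + 1) all
    [m] zeros together cost at most [e]. *)
Lemma blog_sum_limit (l : list CC) (B : R) : (forall a, In a l -> 0 < Cmod a) ->
  (forall r, 0 < r < 1 -> lsum (blog r) l <= B) -> lsum (fun a => ln (/ Cmod a)) l <= B.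
Proof.
  intros Hl Hbl. apply le_epsilon. intros e He.
  set (m := INR (length l)). assert (Pm : 0 <= m) by apply pos_INR.
  set (r := exp (- (e / (m + 1)))).
  assert (Hr : 0 < r < 1).
  { split; [apply exp_pos|]. rewrite <- exp_0. apply exp_increasing.
    assert (0 < e / (m + 1)) by (apply Rdiv_lt_0_compat; lra). lra. }
  assert (S1 : lsum (fun a => ln (/ Cmod a)) l + m * ln r <= lsum (blog r) l).
  { unfold m. rewrite <- lsum_const, <- lsum_plus. apply lsum_le. intros a Ha.
    apply blog_ge; [lra|auto]. }
  assert (Elr : m * ln r = - (e * (m / (m + 1)))) by (unfold r; rewrite ln_exp; field; lra).
  assert (m / (m + 1) <= 1) by (apply Rle_div_l; lra).
  specialize (Hbl r Hr). nra.
Qed.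

(* With [h] the n-th derivative of the kernel at [w], the function [1 - h(phi z) / h(w)]
   vanishes on the fibre of [w], so its zeros are controlled by its H^2 norm. *)
Lemma nevanlinna_kernel_bound (phi : CC -> CC) (n : nat) (w : CC) (L : list (CC * nat)) :
  self_map phi -> Cmod w < 1 ->
  in_H2 (Dop phi n (kern w)) ->
  let b := Cderiv_n n (kern w) w in
  b <> RtoC 0 -> Cmod (Cderiv_n n (kern w) (phi (RtoC 0))) <= Cmod b / 2 ->
  w <> phi (RtoC 0) ->
  NoDup (map fst L) ->
  List.Forall (fun p => in_disk (fst p) /\ zero_order_ge phi w (fst p) (snd p)) L ->
  weighted_log_sum L <= 2 * H2_norm2 (Dop phi n (kern w)) / Cmod b ^ 2.
Proof.
  intros [Hphi Hself] Hw HT b Hb Hb2 Hw0 HN HF.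
  assert (C0 := zero_in_disk).
  change (holo 1 phi) in Hphi.
  set (h := Cderiv_n n (kern w)). assert (Hh : holo 1 h) by apply holo_deriv_n, kern_holo, Hw.
  set (N := H2_norm2 (Dop phi n (kern w))).
  assert (PN : 0 <= N) by apply norm2_pos, HT.
  set (k := fun z => (1 - / b * h z)%C).
  assert (Hk : holo 1 k).
  { apply (holo_minus 1 (fun _ => RtoC 1) (fun z => (/ b * h z)%C)); [apply holo_const|].
    apply holo_mult; [apply holo_const|exact Hh]. }
  assert (Hkw : k w = RtoC 0).
  { unfold k. change (h w) with b. field. exact Hb. }
  destruct (holo_divide k w Hk Hw Hkw) as [q [Hq Eq]].
  destruct (divisor_factor phi w L Hphi HN HF) as [g [Hg Eg]].
  set (l := expand L) in *.
  set (G := fun z => k (phi z)).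
  assert (HG : holo 1 G) by (apply (holo_comp 1 1 k phi); assumption).
  assert (EG : forall z, Cmod z < 1 -> G z = (zprod l z * (g z * q (phi z)))%C).
  { intros z Hz. unfold G. rewrite Eq by (apply Hself, Hz). rewrite Eg by exact Hz. ring. }
  assert (Hgq : holo 1 (fun z => (g z * q (phi z))%C)).
  { apply holo_mult; [exact Hg|]. apply (holo_comp 1 1 q phi); assumption. }
  assert (Pb : 0 < Cmod b) by (apply Cmod_gt_0, Hb).
  assert (HG0 : 1 / 2 <= Cmod (G (RtoC 0))).
  { assert (T := Cmod_triangle (G (RtoC 0)) (/ b * h (phi (RtoC 0)))).
    replace (G (RtoC 0) + / b * h (phi (RtoC 0)))%C with (RtoC 1) in T by (unfold G, k; ring).
    rewrite Cmod_1, Cmod_mult, Cmod_inv in T by exact Hb.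
    assert (/ Cmod b * Cmod (h (phi (RtoC 0))) <= 1 / 2); [|lra].
    apply (Rmult_le_reg_l (Cmod b)); [exact Pb|].
    rewrite <- Rmult_assoc, Rinv_r, Rmult_1_l by lra. unfold h. lra. }
  assert (HG0' : G (RtoC 0) <> RtoC 0) by (apply Cmod_gt_0; lra).
  set (F := Dop phi n (kern w)).
  (* By Parseval: beyond the constant term, the coefficients of [G] are those of [F] divided by - b.
     The constant term is kept apart because it is divided out below. *)
  assert (Hmean : forall r, 0 < r < 1 -> int_mean2 G r <= Cmod (G (RtoC 0)) ^ 2 + N / Cmod b ^ 2).
  { intros r Hr. apply mean2_le_of_coef_sum; auto. intros [|K].
    - simpl rsum. apply Rplus_le_le_0_compat; [apply pow_le, Cmod_ge_0|].
      apply Rdiv_le_0_compat; [exact PN|apply pow_lt, Pb].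
    - rewrite rsum_shift, coef_0 by exact HG. rewrite pow_O, Rmult_1_r. apply Rplus_le_compat_l.
      apply Rle_trans with (rsum (fun j => / Cmod b ^ 2 * Cmod (coef F (S j)) ^ 2) K).
      + apply rsum_le. intros j _.
        rewrite (coef_ext G (fun z => (RtoC 1 - / b * F z)%C)) by (intros; reflexivity).
        rewrite (coef_minus (fun _ => RtoC 1) (fun z => (/ b * F z)%C)); [|apply holo_const|].
        2:{ apply holo_mult; [apply holo_const|exact (proj1 HT)]. }
        rewrite coef_const by lia. rewrite coef_scal by exact (proj1 HT).
        replace (0 - / b * coef F (S j))%C with (- (/ b * coef F (S j)))%C by ring.
        rewrite Cmod_opp, Cmod_mult, Cmod_inv by exact Hb.
        rewrite Rpow_mult_distr, pow_inv.
        rewrite <- (Rmult_1_r (/ Cmod b ^ 2 * Cmod (coef F (S j)) ^ 2)) at 2.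
        apply Rmult_le_compat_l.
        * apply Rmult_le_pos; [left; apply Rinv_0_lt_compat, pow_lt, Pb|apply pow_le, Cmod_ge_0].
        * rewrite <- (pow1 (S j)). apply pow_incr. split; [apply pow_le; lra|]. simpl; nra.
      + rewrite rsum_scal, Rmult_comm. apply Rmult_le_compat_r; [left; apply Rinv_0_lt_compat, pow_lt, Pb|].
        eapply Rle_trans; [|apply (coef_sum_le_norm2 F (S K) HT)]. rewrite rsum_shift.
        assert (X := pow2_ge_0 (Cmod (coef F 0))). lra. }
  assert (Hbl : forall r, 0 < r < 1 -> lsum (blog r) l <= 2 * N / Cmod b ^ 2).
  { intros r Hr. assert (J := jensen_zeros_sq l _ G r Hr Hgq EG HG0').
    specialize (Hmean r Hr). set (x := Cmod (G (RtoC 0)) ^ 2) in *.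
    assert (Px : 1 / 4 <= x) by (unfold x; simpl; nra).
    set (y := N / Cmod b ^ 2) in *.
    assert (Py : 0 <= y) by (apply Rdiv_le_0_compat; [exact PN|apply pow_lt, Pb]).
    (* Division of x exp (2 sum) <= x + y by x >= 1/4; the inequality 1 + 4 y <= exp (4 y) then
       removes the exponential. *)
    assert (E : exp (2 * lsum (blog r) l) <= 1 + 4 * y).
    { apply (Rmult_le_reg_l x); [lra|]. nra. }
    assert (1 + 4 * y <= exp (4 * y)) by apply exp_ineq1_le.
    assert (2 * lsum (blog r) l <= 4 * y).
    { destruct (Rle_lt_dec (2 * lsum (blog r) l) (4 * y)) as [X|X]; [exact X|].
      apply exp_increasing in X. lra. }
    replace (2 * N / Cmod b ^ 2) with (2 * y) by (unfold y, Rdiv; ring). lra. }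
  rewrite weighted_log_sum_expand. fold l. change (fold_right (fun a s => ln (/ Cmod a) + s) 0 l) with (lsum (fun a => ln (/ Cmod a)) l).
  apply blog_sum_limit; [|exact Hbl].
  intros a Ha. apply Cmod_gt_0. exact (zeros_nz l _ G EG HG0' a Ha).
Qed.

(** * Necessity *)

Lemma ln_inv_ge (x : R) : 0 < x -> 1 - x <= ln (/ x).
Proof.
  intros Hx. rewrite ln_Rinv by exact Hx.
  assert (H := exp_ineq1_le (ln x)). rewrite exp_ln in H by exact Hx. lra.
Qed.

(** The origin of the exponent: in |b|^2 the normalisation contributes [d] and the denominator
    d^(-2n-2). The lower bound 1/2 for |w| turns the factor |w|^(2n) into 4^(-n). *)
Lemma kern_deriv_at (w : CC) (n : nat) : / 2 <= Cmod w < 1 ->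
  let b := Cderiv_n n (kern w) w in
  b <> RtoC 0 /\ / Cmod b ^ 2 <= 4 ^ n * (1 - Cmod w ^ 2) ^ (2 * n + 1).
Proof.
  intros [Hw1 Hw] b. set (d := 1 - Cmod w ^ 2). assert (Hd : 0 < d) by (unfold d; simpl; nra).
  assert (Ed : (1 - Cconj w * w)%C = RtoC d).
  { unfold d. rewrite RtoC_minus, Cmod2_conj. ring. }
  assert (Pd : forall m, 0 < d ^ m) by (intros; apply pow_lt, Hd).
  assert (Eb : Cmod b ^ 2 = INR (fact n) ^ 2 * (Cmod w ^ n) ^ 2 * / d ^ (2 * n + 1)).
  { unfold b. rewrite kern_deriv by assumption. rewrite Ed. fold d.
    rewrite !Cmod_mult, !Cmod_pow, Cmod_conj, Cmod_inv by (intros E; apply RtoC_inj in E; lra).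
    rewrite !Cmod_R, (Rabs_right d), (Rabs_right (INR _)), (Rabs_right (sqrt d))
      by (try apply Rle_ge, pos_INR; try apply Rle_ge, sqrt_pos; lra).
    rewrite !Rpow_mult_distr, pow2_sqrt by lra. rewrite pow_inv, pow_inv, <- (pow_mult d).
    replace (S n * 2)%nat with (S (2 * n + 1)) by lia.
    change (d ^ S (2 * n + 1)) with (d * d ^ (2 * n + 1)).
    specialize (Pd (2 * n + 1)%nat). set (W := Cmod w ^ n). field. lra. }
  assert (Hf : 1 <= INR (fact n)) by (apply (le_INR 1), lt_O_fact).
  assert (Hwn : (/ 2) ^ n <= Cmod w ^ n) by (apply pow_incr; lra).
  assert (P2 : 0 < (/ 2) ^ n) by (apply pow_lt; lra).
  assert (Hlow : (/ 4) ^ n * / d ^ (2 * n + 1) <= Cmod b ^ 2).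
  { rewrite Eb. apply Rmult_le_compat_r; [left; apply Rinv_0_lt_compat, Pd|].
    replace ((/ 4) ^ n) with (1 * ((/ 2) ^ n) ^ 2).
    - apply Rmult_le_compat; try lra; [apply pow_le; lra| |apply pow_incr; lra].
      rewrite <- (pow1 2). apply pow_incr. lra.
    - rewrite Rmult_1_l, <- pow_mult, Nat.mul_comm, pow_mult. f_equal. simpl. field. }
  assert (Pl : 0 < (/ 4) ^ n * / d ^ (2 * n + 1)).
  { apply Rmult_lt_0_compat; [apply pow_lt; lra|apply Rinv_0_lt_compat, Pd]. }
  split.
  - intros E. rewrite E, Cmod_0 in Hlow. assert (Z : 0 ^ 2 = 0) by ring. lra.
  - apply Rle_trans with (/ ((/ 4) ^ n * / d ^ (2 * n + 1))).
    + apply Rinv_le_contravar; assumption.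
    + rewrite pow_inv, Rinv_mult, !Rinv_inv. apply Rle_refl.
Qed.

(** For fixed [z] the only dependence on [w] is the normalising factor, which tends to 0 at the unit
    circle; hence the pointwise convergence of the images of the kernels to 0. *)
Lemma kern_deriv_bound (w z : CC) (n : nat) : Cmod w < 1 -> Cmod z < 1 ->
  Cmod (Cderiv_n n (kern w) z) <= sqrt (1 - Cmod w ^ 2) * (INR (fact n) * (/ (1 - Cmod z)) ^ S n).
Proof.
  intros Hw Hz. rewrite kern_deriv by assumption. destruct (kern_den w z Hw Hz) as [A N].
  rewrite !Cmod_mult, !Cmod_pow, Cmod_conj, Cmod_inv, !Cmod_R by exact N.
  rewrite (Rabs_right (INR _)), (Rabs_right (sqrt _)) by (try apply Rle_ge, pos_INR; apply Rle_ge, sqrt_pos).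
  rewrite !Rmult_assoc. apply Rmult_le_compat_l; [apply sqrt_pos|].
  apply Rmult_le_compat_l; [apply pos_INR|].
  assert (Cmod w ^ n <= 1) by (rewrite <- (pow1 n); apply pow_incr; split; [apply Cmod_ge_0|lra]).
  assert (P : 0 <= (/ Cmod (1 - Cconj w * z)) ^ S n)
    by (apply pow_le; left; apply Rinv_0_lt_compat, Cmod_gt_0, N).
  apply Rle_trans with (1 * (/ Cmod (1 - Cconj w * z)) ^ S n).
  - apply Rmult_le_compat_r; assumption.
  - rewrite Rmult_1_l. apply pow_incr. split; [left; apply Rinv_0_lt_compat, Cmod_gt_0, N|].
    apply Rinv_le_contravar; lra.
Qed.

(** With a = phi(0) this keeps 1 - h(phi(0)) / h(w) at least 1/2 in modulus. The two sides share the
    normalising factor and differ by the powers of 1 - |a| and of [d]. *)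
Lemma kern_deriv_ratio (w a : CC) (n : nat) : / 2 <= Cmod w < 1 -> Cmod a < 1 ->
  1 - Cmod w ^ 2 <= (1 - Cmod a) / (2 ^ S n * INR (fact n) + 1) ->
  Cmod (Cderiv_n n (kern w) a) <= Cmod (Cderiv_n n (kern w) w) / 2.
Proof.
  intros [Hw1 Hw] Ha Hd. set (d := 1 - Cmod w ^ 2) in *.
  assert (Pd : 0 < d) by (unfold d; simpl; nra).
  assert (Ed : (1 - Cconj w * w)%C = RtoC d).
  { unfold d. rewrite RtoC_minus, Cmod2_conj. ring. }
  eapply Rle_trans; [apply kern_deriv_bound; assumption|]. fold d.
  rewrite kern_deriv by assumption. rewrite Ed. fold d.
  rewrite !Cmod_mult, !Cmod_pow, Cmod_conj, Cmod_inv by (intros E; apply RtoC_inj in E; lra).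
  rewrite !Cmod_R, (Rabs_right d), (Rabs_right (INR _)), (Rabs_right (sqrt d))
    by (try apply Rle_ge, pos_INR; try apply Rle_ge, sqrt_pos; lra).
  assert (Ps := sqrt_pos d).
  assert (Hf : 1 <= INR (fact n)) by (apply (le_INR 1), lt_O_fact).
  unfold Rdiv at 1. rewrite !Rmult_assoc. apply Rmult_le_compat_l; [exact Ps|].
  apply Rmult_le_compat_l; [lra|].
  set (A := 1 - Cmod a) in *. assert (PA : 0 < A) by (unfold A; lra).
  set (D := 2 ^ S n * INR (fact n) + 1) in *.
  assert (P2 : 1 <= 2 ^ S n) by (apply pow_R1_Rle; lra).
  assert (PD : 2 ^ S n <= D) by (unfold D; nra).
  assert (HdA : 2 ^ S n * d <= A).
  { apply Rle_trans with (D * d); [apply Rmult_le_compat_r; lra|].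
    apply (Rmult_le_compat_l D) in Hd; [|lra].
    replace (D * (A / D)) with A in Hd by (field; lra). exact Hd. }
  assert (Hwn : (/ 2) ^ n <= Cmod w ^ n) by (apply pow_incr; lra).
  apply Rle_trans with ((/ 2) ^ n * ((/ d) ^ S n * / 2)).
  2:{ apply Rmult_le_compat_r; [|exact Hwn]. apply Rmult_le_pos; [|lra].
      apply pow_le. left; apply Rinv_0_lt_compat, Pd. }
  replace ((/ 2) ^ n * ((/ d) ^ S n * / 2)) with ((/ 2 * / d) ^ S n)
    by (rewrite Rpow_mult_distr; simpl; ring).
  apply pow_incr. split; [left; apply Rinv_0_lt_compat, PA|].
  rewrite <- Rinv_mult. apply Rinv_le_contravar; [nra|].
  apply Rle_trans with (2 ^ S n * d); [|exact HdA]. apply Rmult_le_compat_r; [lra|].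
  simpl. assert (1 <= 2 ^ n) by (apply pow_R1_Rle; lra). lra.
Qed.

Lemma increasing_seq_ge (s : nat -> nat) : (forall k, (s k < s (S k))%nat) -> forall k, (k <= s k)%nat.
Proof. intros H k. induction k as [|k IH]; [lia|]. specialize (H k). lia. Qed.

Lemma is_lim_seq_small (u : nat -> R) (e : R) : is_lim_seq u 0 -> 0 < e ->
  exists N, forall n, (N <= n)%nat -> Rabs (u n) < e.
Proof.
  intros H He. apply is_lim_seq_spec in H. destruct (H (mkposreal e He)) as [N HN].
  exists N. intros n Hn. specialize (HN n Hn). now rewrite Rminus_0_r in HN.
Qed.

(* The kernels converge to 0 on compact sets, so 0 is the only possible limit of their images. *)
Lemma compact_kern_small (phi : CC -> CC) (n : nat) (w : nat -> CC) : self_map phi ->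
  compact_on_H2 (Dop phi n) -> (forall k, Cmod (w k) < 1) ->
  is_lim_seq (fun k => 1 - Cmod (w k) ^ 2) 0 ->
  forall e, 0 < e -> forall N, exists k, (N <= k)%nat /\ H2_norm2 (Dop phi n (kern (w k))) < e.
Proof.
  intros [Hphi Hself] [HT Hcomp] Hw Hlim e He N.
  destruct (Hcomp (fun k => kern (w k))) as [s [g [Hs [Hg Hconv]]]].
  { intros k. apply kern_H2, Hw. }
  assert (Hin : forall k, in_H2 (Dop phi n (kern (w k)))) by (intros k; apply HT, kern_H2, Hw).
  set (D := fun k z => (Dop phi n (kern (w (s k))) z - g z)%C).
  assert (HD : forall k, in_H2 (D k)) by (intros k; apply H2_minus; auto).
  assert (Hslim : is_lim_seq (fun k => 1 - Cmod (w (s k)) ^ 2) 0).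
  { apply (is_lim_seq_subseq (fun k => 1 - Cmod (w k) ^ 2) 0 s); [|exact Hlim].
    apply eventually_subseq. intros k; apply Hs. }
  assert (Hg0 : forall z, Cmod z < 1 -> g z = RtoC 0).
  { intros z Hz. apply Cmod_eq_0, Rle_antisym; [|apply Cmod_ge_0].
    assert (Hpz : Cmod (phi z) < 1) by (apply Hself, Hz).
    set (C1 := INR (fact n) * (/ (1 - Cmod (phi z))) ^ S n). set (C2 := / (1 - Cmod z)).
    assert (L : is_lim_seq (fun k => sqrt (1 - Cmod (w (s k)) ^ 2) * C1 + sqrt (H2_norm2 (D k)) * C2) 0).
    { replace (Finite 0) with (Finite (sqrt 0 * C1 + sqrt 0 * C2)) by (rewrite sqrt_0; f_equal; ring).
      assert (Cs : forall u, is_lim_seq u 0 -> is_lim_seq (fun k => sqrt (u k)) (sqrt 0)).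
      { intros u Hu. apply (is_lim_seq_continuous sqrt u 0); [|exact Hu].
        apply continuity_pt_sqrt. lra. }
      apply is_lim_seq_plus'.
      - apply is_lim_seq_mult'; [apply Cs, Hslim|apply is_lim_seq_const].
      - apply is_lim_seq_mult'; [apply Cs, Hconv|apply is_lim_seq_const]. }
    apply (is_lim_seq_le (fun _ => Cmod (g z)) _ (Finite (Cmod (g z))) (Finite 0)) with (3 := L);
      [|apply is_lim_seq_const].
    intros k. assert (A := kern_deriv_bound (w (s k)) (phi z) n (Hw _) Hpz). fold C1 in A.
    assert (B := H2_pointwise (D k) z (HD k) Hz). fold C2 in B.
    replace (g z) with (Dop phi n (kern (w (s k))) z + - D k z)%C by (unfold D; ring).
    eapply Rle_trans; [apply Cmod_triangle|]. rewrite Cmod_opp. unfold Rdiv in B. fold C2 in B.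
    apply Rplus_le_compat; [exact A|exact B]. }
  destruct (is_lim_seq_small _ e Hconv He) as [N2 HN2].
  exists (s (N + N2)%nat).
  assert (G := increasing_seq_ge s Hs (N + N2)). split; [lia|].
  assert (X := HN2 (N + N2)%nat ltac:(lia)).
  apply Rle_lt_trans with (H2_norm2 (D (N + N2)%nat)).
  - apply (H2_of_bound (Dop phi n (kern (w (s (N + N2)%nat))))); [exact (proj1 (Hin _))|].
    intros r Hr. rewrite (mean2_ext _ (D (N + N2)%nat)) by (auto; intros z Hz; unfold D; rewrite Hg0 by exact Hz; ring).
    apply mean2_le_norm; auto.
  - eapply Rle_lt_trans; [apply Rle_abs|exact X].
Qed.

Theorem compact_imp_little_o (phi : CC -> CC) (n : nat) : self_map phi -> compact_on_H2 (Dop phi n) ->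
  forall eps : R, 0 < eps ->
     exists delta : R, delta < 1 /\
       forall w : CC, delta < Cmod w -> Cmod w < 1 ->
         Rbar_le (nevanlinna phi w) (Finite (eps * (ln (/ Cmod w)) ^ (2 * n + 1))).
Proof.
  intros Hphi Hcomp eps Heps. apply Classical_Prop.NNPP. intros Hn.
  (* The shift by 2 keeps all counterexamples above modulus 1/2, as [kern_deriv_at] requires. *)
  assert (Hseq : forall k : nat, exists w, 1 - / (INR k + 2) < Cmod w < 1 /\
     ~ Rbar_le (nevanlinna phi w) (Finite (eps * (ln (/ Cmod w)) ^ (2 * n + 1)))).
  { intros k. apply Classical_Prop.NNPP. intros Hk. apply Hn.
    exists (1 - / (INR k + 2)). assert (Pk := pos_INR k).
    split; [assert (0 < / (INR k + 2)) by (apply Rinv_0_lt_compat; lra); lra|].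
    intros w H1 H2. apply Classical_Prop.NNPP. intros H3. apply Hk. exists w. auto. }
  set (w := fun k => proj1_sig (constructive_indefinite_description _ (Hseq k))).
  assert (Hw : forall k, 1 - / (INR k + 2) < Cmod (w k) < 1 /\
     ~ Rbar_le (nevanlinna phi (w k)) (Finite (eps * (ln (/ Cmod (w k))) ^ (2 * n + 1)))).
  { intros k. exact (proj2_sig (constructive_indefinite_description _ (Hseq k))). }
  assert (Hw1 : forall k, Cmod (w k) < 1) by (intros k; apply Hw).
  assert (Hinv : forall k, 0 < / (INR k + 2) <= / 2).
  { intros k. assert (Pk := pos_INR k). split; [apply Rinv_0_lt_compat; lra|apply Rinv_le_contravar; lra]. }
  assert (Hlim : is_lim_seq (fun k => 1 - Cmod (w k) ^ 2) 0).
  { apply (is_lim_seq_le_le (fun _ => 0) _ (fun k => 2 * / (INR k + 2))).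
    - intros k. destruct (Hw k) as [[A B] _]. specialize (Hinv k). simpl. split; nra.
    - apply is_lim_seq_const.
    - replace (Finite 0) with (Rbar_mult (Finite 2) (Finite 0)) by (simpl; f_equal; ring).
      apply is_lim_seq_scal_l.
      replace (Finite 0) with (Rbar_inv p_infty) by reflexivity.
      apply is_lim_seq_inv; [|discriminate].
      apply (is_lim_seq_plus _ _ p_infty (Finite 2)); [apply is_lim_seq_INR|apply is_lim_seq_const|reflexivity]. }
  set (a := phi (RtoC 0)).
  assert (Ha : Cmod a < 1) by (apply (proj2 Hphi); unfold in_disk; rewrite Cmod_0; lra).
  set (e1 := (1 - Cmod a) / (2 ^ S n * INR (fact n) + 1)).
  assert (He1 : 0 < e1).
  { apply Rdiv_lt_0_compat; [lra|].
    assert (0 < 2 ^ S n) by (apply pow_lt; lra). assert (X := pos_INR (fact n)). nra. }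
  (* The factor 2 comes from [nevanlinna_kernel_bound], 4^n from [kern_deriv_at], and 2^(2n+1) from
     1 - |v|^2 <= 2 log (1 / |v|). *)
  set (e2 := eps / (2 * 4 ^ n * 2 ^ (2 * n + 1))).
  assert (P4 : 0 < 4 ^ n) by (apply pow_lt; lra).
  assert (P2 : 0 < 2 ^ (2 * n + 1)) by (apply pow_lt; lra).
  assert (He2 : 0 < e2) by (apply Rdiv_lt_0_compat; [lra|]; apply Rmult_lt_0_compat; lra).
  (* The bound 1 - |a|^2 excludes v = a, where the counting function is infinite; [e1] is the
     threshold of [kern_deriv_ratio]. *)
  destruct (is_lim_seq_small _ (Rmin e1 (1 - Cmod a ^ 2)) Hlim) as [N HN].
  { apply Rmin_glb_lt; [exact He1|]. assert (X := Cmod_ge_0 a). simpl; nra. }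
  destruct (compact_kern_small phi n w Hphi Hcomp Hw1 Hlim e2 He2 N) as [k [Hk Hsmall]].
  specialize (HN k Hk). destruct (Hw k) as [[A B] C]. apply C. clear C.
  specialize (Hinv k). set (v := w k) in *.
  assert (Hd : 0 < 1 - Cmod v ^ 2) by (simpl; nra).
  rewrite Rabs_right in HN by lra.
  assert (M1 := Rmin_l e1 (1 - Cmod a ^ 2)). assert (M2 := Rmin_r e1 (1 - Cmod a ^ 2)).
  assert (Hv : / 2 <= Cmod v < 1) by lra.
  assert (Hva : v <> a) by (intros E; rewrite E in HN; lra).
  destruct (kern_deriv_at v n Hv) as [Hb1 Hb2].
  assert (Hb3 := kern_deriv_ratio v a n Hv Ha ltac:(fold e1; lra)).
  unfold nevanlinna. destruct (excluded_middle_informative _) as [X|_]; [contradiction|].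
  apply Lub_Rbar_correct. intros x [L [HL1 [HL2 ->]]]. simpl.
  assert (HTv : in_H2 (Dop phi n (kern v))) by (apply (proj1 Hcomp), kern_H2; lra).
  eapply Rle_trans; [apply (nevanlinna_kernel_bound phi n v L); auto; lra|].
  set (T := H2_norm2 (Dop phi n (kern v))) in *.
  assert (PT : 0 <= T) by apply norm2_pos, HTv.
  set (Lv := ln (/ Cmod v)).
  assert (HLv : 1 - Cmod v <= Lv) by (apply ln_inv_ge; lra).
  assert (Hpow : (1 - Cmod v ^ 2) ^ (2 * n + 1) <= 2 ^ (2 * n + 1) * Lv ^ (2 * n + 1)).
  { rewrite <- Rpow_mult_distr. apply pow_incr. split; [lra|]. simpl; nra. }
  assert (PL : 0 <= Lv ^ (2 * n + 1)) by (apply pow_le; lra).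
  unfold Rdiv.
  apply Rle_trans with (2 * T * (4 ^ n * (2 ^ (2 * n + 1) * Lv ^ (2 * n + 1)))).
  - apply Rmult_le_compat_l; [lra|]. eapply Rle_trans; [exact Hb2|].
    apply Rmult_le_compat_l; lra.
  - replace (2 * T * (4 ^ n * (2 ^ (2 * n + 1) * Lv ^ (2 * n + 1))))
      with (T * (2 * 4 ^ n * 2 ^ (2 * n + 1)) * Lv ^ (2 * n + 1)) by ring.
    apply Rmult_le_compat_r; [exact PL|].
    replace eps with (e2 * (2 * 4 ^ n * 2 ^ (2 * n + 1))) by (unfold e2; field; lra).
    apply Rmult_le_compat_r; [|lra]. left. apply Rmult_lt_0_compat; lra.
Qed.

(** * Averaging over circles of values *)

Lemma Rabs_Cmod_minus (x y : CC) : Rabs (Cmod x - Cmod y) <= Cmod (x - y).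
Proof.
  assert (A := Cmod_triangle (x - y) y). replace (x - y + y)%C with x in A by ring.
  assert (B := Cmod_triangle (y - x) x). replace (y - x + x)%C with y in B by ring.
  replace (y - x)%C with (- (x - y))%C in B by ring. rewrite Cmod_opp in B.
  apply Rabs_le. lra.
Qed.

Lemma ln_lipschitz (k x y : R) : 0 < k -> k <= x -> k <= y -> ln x - ln y <= Rabs (x - y) / k.
Proof.
  intros Hk Hx Hy. rewrite <- ln_div by lra.
  assert (H := exp_ineq1_le (ln (x / y))). rewrite exp_ln in H by (apply Rdiv_lt_0_compat; lra).
  assert (E : x / y = 1 + (x - y) / y) by (field; lra).
  assert ((x - y) / y <= Rabs (x - y) / k); [|lra].
  apply Rle_trans with (Rabs (x - y) / y).
  - apply Rmult_le_compat_r; [left; apply Rinv_0_lt_compat; lra|apply Rle_abs].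
  - apply Rmult_le_compat_l; [apply Rabs_pos|apply Rinv_le_contravar; lra].
Qed.

Lemma lmax_lipschitz (k : R) (x y : CC) : 0 < k -> Rabs (lmax k x - lmax k y) <= Cmod (x - y) / k.
Proof.
  intros Hk. unfold lmax.
  assert (M : Rabs (Rmax (Cmod x) k - Rmax (Cmod y) k) <= Cmod (x - y)).
  { eapply Rle_trans; [|apply Rabs_Cmod_minus].
    unfold Rmax; destruct (Rle_dec (Cmod x) k), (Rle_dec (Cmod y) k);
      unfold Rabs; repeat destruct (Rcase_abs _); lra. }
  assert (A := ln_lipschitz k _ _ Hk (Rmax_r (Cmod x) k) (Rmax_r (Cmod y) k)).
  assert (B := ln_lipschitz k _ _ Hk (Rmax_r (Cmod y) k) (Rmax_r (Cmod x) k)).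
  rewrite (Rabs_minus_sym (Rmax (Cmod y) k)) in B.
  assert (C : Rabs (Rmax (Cmod x) k - Rmax (Cmod y) k) / k <= Cmod (x - y) / k).
  { apply Rmult_le_compat_r; [left; apply Rinv_0_lt_compat, Hk|exact M]. }
  apply Rabs_le. lra.
Qed.

Lemma lmax_mono (k k' : R) (x : CC) : 0 < k <= k' -> lmax k x <= lmax k' x.
Proof.
  intros Hk. apply ln_le'.
  - apply Rlt_le_trans with k; [lra|apply Rmax_r].
  - apply Rmax_lub; [apply Rmax_l|]. apply Rle_trans with k'; [lra|apply Rmax_r].
Qed.

Lemma lmax_cmod (k : R) (x y : CC) : Cmod x = Cmod y -> lmax k x = lmax k y.
Proof. intros E. unfold lmax. now rewrite E. Qed.

(** For |x| < s the function x - z vanishes inside |z| = s. The reflected form is analytic in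
    e^(it), has value [s] at 0, and its zero lies outside the unit circle. *)
Lemma Cmod_reflect (s t : R) (x : CC) : 0 <= s -> Cmod (x - circ s t) = Cmod (RtoC s - Cconj x * circ 1 t).
Proof.
  intros Hs. rewrite <- (Cmod_conj (x - circ s t)).
  replace (RtoC s - Cconj x * circ 1 t)%C with (- (circ 1 t * Cconj (x - circ s t)))%C.
  - rewrite Cmod_opp, Cmod_mult, Cmod_circ by lra. ring.
  - rewrite Cminus_conj. rewrite (circ_RtoC s t), Cmult_conj.
    assert (E : (circ 1 t * Cconj (circ 1 t))%C = RtoC 1).
    { rewrite <- Cmod2_conj, Cmod_circ by lra. f_equal. ring. }
    replace (Cconj (RtoC s)) with (RtoC s) by (apply injective_projections; simpl; ring).
    replace (- (circ 1 t * (Cconj x - RtoC s * Cconj (circ 1 t))))%C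
      with (RtoC s * (circ 1 t * Cconj (circ 1 t)) - Cconj x * circ 1 t)%C by ring.
    rewrite E. ring.
Qed.

(** One half of the fact that log |x - s e^(it)| has mean log max(|x|, s): Jensen's inequality for x
    - z and for its reflection. *)
Lemma circle_log_lower (s k : R) (x : CC) : 0 < s -> 0 < k ->
  ln (Rmax (Cmod x) s) <= cmean (fun t => lmax k (x - circ s t)).
Proof.
  intros Hs Hk.
  assert (L1 : ln s <= cmean (fun t => lmax k (x - circ s t))).
  { assert (J := jensen_lmax (fun z => (RtoC s - Cconj x * z)%C) 2 1 k). cbv beta in J.
    replace (RtoC s - Cconj x * 0)%C with (RtoC s) in J by ring.
    rewrite Cmod_R, Rabs_right in J by lra.
    rewrite (cmean_ext _ (fun t => lmax k (RtoC s - Cconj x * circ 1 t))).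
    - apply J; try lra.
      + apply holo_minus; [apply holo_const|apply holo_mult; [apply holo_const|apply holo_id]].
      + intros E; apply RtoC_inj in E; lra.
    - intros t. apply lmax_cmod, Cmod_reflect. lra. }
  destruct (Rle_dec (Cmod x) s) as [L|L]; [rewrite Rmax_right; assumption|].
  rewrite Rmax_left by lra.
  assert (J := jensen_lmax (fun z => (x - z)%C) (2 * s) s k). cbv beta in J.
  replace (x - 0)%C with x in J by ring. apply J; try lra.
  - apply holo_minus; [apply holo_const|apply holo_id].
  - apply Cmod_gt_0. lra.
Qed.

(** The other half. The distance [m] from the circle makes the truncation inactive and leaves a
    zero-free function on a slightly larger disk. *)
Lemma circle_log_upper (s m : R) (x : CC) : 0 < s -> 0 < m -> m <= Rabs (Cmod x - s) ->
  cmean (fun t => lmax m (x - circ s t)) <= ln (Rmax (Cmod x) s).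
Proof.
  intros Hs Hm Hx.
  assert (Hd : forall t, m <= Cmod (x - circ s t)).
  { intros t. eapply Rle_trans; [exact Hx|]. rewrite <- (Cmod_circ s t) at 1 by lra. apply Rabs_Cmod_minus. }
  assert (Px := Cmod_ge_0 x).
  destruct (Rle_dec (Cmod x) s) as [L|L].
  - rewrite Rmax_right by assumption.
    assert (L' : Cmod x < s).
    { destruct L as [L|L]; [exact L|]. rewrite L, Rminus_diag, Rabs_R0 in Hx. lra. }
    (* A radius strictly between 1 and s / |x|, the modulus of the zero of the reflected function,
       written so that x = 0 is allowed. *)
    set (R0 := 2 * s / (Cmod x + s)).
    assert (HR0 : 1 < R0).
    { apply (Rmult_lt_reg_r (Cmod x + s)); [lra|]. unfold R0.
      replace (2 * s / (Cmod x + s) * (Cmod x + s)) with (2 * s) by (field; lra). lra. }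
    assert (J := jensen_zero_free (fun z => (RtoC s - Cconj x * z)%C) R0 1). cbv beta in J.
    replace (RtoC s - Cconj x * 0)%C with (RtoC s) in J by ring.
    rewrite Cmod_R, Rabs_right in J by lra.
    rewrite (cmean_ext _ (fun t => ln (Cmod (RtoC s - Cconj x * circ 1 t)))).
    + apply J; try lra.
      * apply holo_minus; [apply holo_const|apply holo_mult; [apply holo_const|apply holo_id]].
      * intros z Hz E.
        assert (E' : RtoC s = (Cconj x * z)%C).
        { replace (RtoC s) with (RtoC s - Cconj x * z + Cconj x * z)%C by ring. rewrite E. ring. }
        apply (f_equal Cmod) in E'. rewrite Cmod_R, Rabs_right, Cmod_mult, Cmod_conj in E' by lra.
        assert (Cmod x * Cmod z <= Cmod x * R0) by (apply Rmult_le_compat_l; lra).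
        assert (Cmod x * R0 < s); [|lra].
        apply (Rmult_lt_reg_r (Cmod x + s)); [lra|]. unfold R0.
        replace (Cmod x * (2 * s / (Cmod x + s)) * (Cmod x + s)) with (2 * s * Cmod x) by (field; lra). nra.
    + intros t. rewrite lmax_eq by apply Hd. rewrite Cmod_reflect by lra. reflexivity.
  - rewrite Rmax_left by lra.
    assert (J := jensen_zero_free (fun z => (x - z)%C) (Cmod x) s). cbv beta in J.
    replace (x - 0)%C with x in J by ring.
    rewrite (cmean_ext _ (fun t => ln (Cmod (x - circ s t)))).
    + apply J; try lra.
      * apply holo_minus; [apply holo_const|apply holo_id].
      * intros z Hz E. apply Ceq_minus in E. subst. lra.
    + intros t. apply lmax_eq, Hd.
Qed.

(** A majorant with slack, valid without any distance from |y| to [s]: for u <= 1/2 the mean in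
    [circle_log_Psi] is at most [ln s], and for u >= 1/2 the trivial bound u is below 4 u - 1. That
    it vanishes for small u keeps the later sum over scales finite. *)
Definition Psi (u : R) : R := Rmax 0 (4 * u - 1).

Lemma circle_log_Psi (s : R) (y : CC) : 0 < s ->
  cmean (fun t => lmax (s / 2) (y - circ s t)) <= ln s + Psi (Cmod y / s).
Proof.
  intros Hs. assert (Py := Cmod_ge_0 y). unfold Psi.
  destruct (Rle_dec (Cmod y) (s / 2)) as [L|L].
  - apply Rle_trans with (ln (Rmax (Cmod y) s)).
    + apply circle_log_upper; try lra. rewrite Rabs_left1; lra.
    + rewrite Rmax_right by lra. assert (X := Rmax_l 0 (4 * (Cmod y / s) - 1)). lra.
  - apply Rle_trans with (ln s + Cmod y / s).
    + apply cmean_le_const.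
      * apply rc_lmax; [lra|]. apply cc_minus; [apply cc_const|apply cc_circ].
      * intros t. unfold lmax.
        apply Rle_trans with (ln (s * (1 + Cmod y / s))).
        -- apply ln_le'; [apply Rlt_le_trans with (s / 2); [lra|apply Rmax_r]|].
           replace (s * (1 + Cmod y / s)) with (Cmod y + s) by (field; lra).
           apply Rmax_lub; [|lra]. unfold Cminus. eapply Rle_trans; [apply Cmod_triangle|].
           rewrite Cmod_opp, Cmod_circ; lra.
        -- assert (0 < Cmod y / s) by (apply Rdiv_lt_0_compat; lra).
           rewrite ln_mult by lra.
           assert (E := exp_ineq1_le (ln (1 + Cmod y / s))). rewrite exp_ln in E by lra. lra.
    + apply Rplus_le_compat_l. eapply Rle_trans; [|apply Rmax_r].
      assert (1 / 2 <= Cmod y / s); [|lra].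
      apply (Rmult_le_reg_r s); [exact Hs|]. replace (Cmod y / s * s) with (Cmod y) by (field; lra). lra.
Qed.

(** * Averages over equally spaced angles *)

(** The circle of values [c] is averaged by finite sums, so that exchanging this average with a
    circular mean is linearity ([cmean_avg]). *)
Definition avg (M : nat) (v : R -> R) : R := rsum (fun i => v (2 * PI * INR i / INR M)) M / INR M.

Lemma avg_lipschitz (v : R -> R) (La : R) (M : nat) : rc v -> per v -> (0 < M)%nat -> 0 <= La ->
  (forall t t', Rabs (v t' - v t) <= La * Rabs (t' - t)) ->
  Rabs (avg M v - cmean v) <= La * (2 * PI / INR M).
Proof.
  intros Hv Hp HM HLa HL. unfold avg.
  rewrite (rsum_ext _ (fun j => v (0 + 2 * PI * INR j / INR M))) by (intros; f_equal; ring).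
  apply riemann_error; auto. intros t t' _ Ht. eapply Rle_trans; [apply HL|].
  apply Rmult_le_compat_l; [exact HLa|]. rewrite Rabs_right; lra.
Qed.

Lemma avg_le (M : nat) (u v : R -> R) : (0 < M)%nat ->
  (forall t, 0 <= t <= 2 * PI -> u t <= v t) -> avg M u <= avg M v.
Proof.
  intros HM H. assert (P := two_PI_pos). assert (PM : 0 < INR M) by (apply lt_0_INR, HM).
  unfold avg, Rdiv. apply Rmult_le_compat_r; [left; apply Rinv_0_lt_compat, PM|].
  apply rsum_le. intros i Hi. apply H. assert (Pi := pos_INR i).
  assert (INR i < INR M) by (apply lt_INR, Hi). split.
  - apply Rmult_le_pos; [nra|left; apply Rinv_0_lt_compat, PM].
  - apply (Rmult_le_reg_r (INR M)); [exact PM|].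
    rewrite Rmult_assoc, Rinv_l by lra. nra.
Qed.

Lemma avg_plus (M : nat) (u v : R -> R) : avg M (fun t => u t + v t) = avg M u + avg M v.
Proof. unfold avg. rewrite rsum_plus. unfold Rdiv; ring. Qed.

Lemma avg_scal (M : nat) (k : R) (u : R -> R) : avg M (fun t => k * u t) = k * avg M u.
Proof. unfold avg. rewrite rsum_scal. unfold Rdiv; ring. Qed.

Lemma avg_const (M : nat) (k : R) : (0 < M)%nat -> avg M (fun _ => k) = k.
Proof.
  intros HM. assert (PM : 0 < INR M) by (apply lt_0_INR, HM). unfold avg.
  assert (E : rsum (fun _ => k) M = INR M * k).
  { clear. induction M as [|M IH]; [simpl; ring|]. rewrite S_INR. simpl. rewrite IH. ring. }
  rewrite E. field. lra.
Qed.

Lemma avg_rsum (M J : nat) (u : nat -> R -> R) :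
  avg M (fun t => rsum (fun j => u j t) J) = rsum (fun j => avg M (u j)) J.
Proof.
  induction J as [|J IH]; simpl.
  - unfold avg. assert (E : rsum (fun _ => 0) M = 0) by (clear; induction M; simpl; lra).
    rewrite E. unfold Rdiv; ring.
  - rewrite avg_plus, IH. reflexivity.
Qed.

Lemma rc_rsum (u : nat -> R -> R) (J : nat) : (forall j, rc (u j)) -> rc (fun t => rsum (fun j => u j t) J).
Proof.
  intros H. induction J as [|J IH]; simpl; intros t; [apply continuous_const|].
  apply (cont_plus _ (fun t => rsum (fun j => u j t) J) (u J)); auto. apply H.
Qed.

Lemma cmean_rsum (u : nat -> R -> R) (J : nat) : (forall j, rc (u j)) ->
  cmean (fun t => rsum (fun j => u j t) J) = rsum (fun j => cmean (u j)) J.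
Proof.
  intros H. induction J as [|J IH]; simpl; [apply cmean_const|].
  rewrite cmean_plus, IH; auto. apply rc_rsum, H.
Qed.

Lemma cmean_avg (h : R -> R -> R) (M : nat) : (forall t, rc (fun u => h u t)) ->
  rc (fun u => avg M (h u)) /\ cmean (fun u => avg M (h u)) = avg M (fun t => cmean (fun u => h u t)).
Proof.
  intros H.
  set (g := fun j u => / INR M * h u (2 * PI * INR j / INR M)).
  assert (Hg : forall j, rc (g j)) by (intros j t; apply cont_mult; [apply continuous_const|apply H]).
  assert (E : forall u, avg M (h u) = rsum (fun j => g j u) M).
  { intros u. unfold avg, g. rewrite rsum_scal. unfold Rdiv. ring. }
  split.
  - intros t. apply (continuous_ext (fun u => rsum (fun j => g j u) M)); [intros; symmetry; apply E|].
    apply rc_rsum, Hg.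
  - rewrite (cmean_ext _ (fun u => rsum (fun j => g j u) M)) by apply E.
    rewrite cmean_rsum by exact Hg. unfold avg, g.
    rewrite (rsum_ext _ (fun j => / INR M * cmean (fun u => h u (2 * PI * INR j / INR M)))).
    + rewrite rsum_scal. unfold Rdiv; ring.
    + intros j _. apply cmean_scal, H.
Qed.

Lemma circ_lipschitz (s t t' : R) : 0 <= s -> Cmod (circ s t' - circ s t) <= 2 * s * Rabs (t' - t).
Proof.
  intros Hs. assert (H := circ_dist s s t t' Hs). rewrite Rminus_diag, Rabs_R0 in H. lra.
Qed.

Lemma lmax_circ_lipschitz (s k t t' : R) (x : CC) : 0 <= s -> 0 < k ->
  Rabs (lmax k (x - circ s t') - lmax k (x - circ s t)) <= 2 * s / k * Rabs (t' - t).
Proof.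
  intros Hs Hk. eapply Rle_trans; [apply lmax_lipschitz, Hk|].
  replace (x - circ s t' - (x - circ s t))%C with (- (circ s t' - circ s t))%C by ring.
  rewrite Cmod_opp. unfold Rdiv. rewrite (Rmult_comm (2 * s * / k)), <- Rmult_assoc.
  apply Rmult_le_compat_r; [left; apply Rinv_0_lt_compat, Hk|].
  rewrite Rmult_comm. apply circ_lipschitz, Hs.
Qed.

Lemma avg_lmax_circ (s k e : R) (M : nat) (x : CC) : 0 < s -> 0 < k -> (0 < M)%nat ->
  2 * s / k * (2 * PI / INR M) <= e ->
  Rabs (avg M (fun t => lmax k (x - circ s t)) - cmean (fun t => lmax k (x - circ s t))) <= e.
Proof.
  intros Hs Hk HM He. eapply Rle_trans; [|exact He].
  apply avg_lipschitz; auto.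
  - apply rc_lmax; [exact Hk|]. apply cc_minus; [apply cc_const|apply cc_circ].
  - intros t. now rewrite circ_period.
  - apply Rdiv_le_0_compat; lra.
  - intros t t'. apply lmax_circ_lipschitz; lra.
Qed.

Lemma large_nat (x e : R) : 0 < e -> exists M, (0 < M)%nat /\ forall n, (M <= n)%nat -> x / INR n <= e.
Proof.
  intros He. destruct (INR_unbounded (Rabs x / e)) as [M HM].
  assert (P : 0 <= Rabs x / e) by (apply Rdiv_le_0_compat; [apply Rabs_pos|exact He]).
  exists (S M). split; [lia|]. intros n Hn.
  assert (INR M < INR n) by (apply lt_INR; lia).
  apply Rle_div_l; [lra|].
  apply Rle_trans with (Rabs x); [apply Rle_abs|].
  apply (Rmult_lt_compat_l e) in HM; [|exact He].
  replace (e * (Rabs x / e)) with (Rabs x) in HM by (field; lra). nra.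
Qed.

(** The interval is shrunk once per point, to the end farther from it. This supplies values of [s]
    for which |c| = s misses finitely many base values by a margin. *)
Lemma avoid_finite (x : nat -> R) (J : nat) (a b : R) : a < b ->
  exists s m, a < s < b /\ 0 < m /\ forall j, (j < J)%nat -> m <= Rabs (x j - s).
Proof.
  intros Hab.
  assert (K : exists a' b' m, a < a' /\ a' < b' /\ b' < b /\ 0 < m /\
    forall j, (j < J)%nat -> forall s, a' <= s <= b' -> m <= Rabs (x j - s)).
  { induction J as [|J [a' [b' [m [H1 [H2 [H3 [H4 H5]]]]]]]].
    - exists (a + (b - a) / 3), (a + 2 * (b - a) / 3), 1. repeat split; try lra. intros; lia.
    - set (d := (b' - a') / 3).
      assert (M1 := Rmin_l m d). assert (M2 := Rmin_r m d).
      destruct (Rle_dec (x J) ((a' + b') / 2)) as [L|L].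
      + exists (b' - d / 2), b', (Rmin m d). unfold d in *.
        repeat split; try lra; [apply Rmin_glb_lt; lra|].
        intros j Hj s Hs. destruct (Nat.eq_dec j J) as [->|n].
        * rewrite Rabs_left1 by lra. lra.
        * apply Rle_trans with m; [exact M1|]. apply H5; [lia|lra].
      + exists a', (a' + d / 2), (Rmin m d). unfold d in *.
        repeat split; try lra; [apply Rmin_glb_lt; lra|].
        intros j Hj s Hs. destruct (Nat.eq_dec j J) as [->|n].
        * rewrite Rabs_right by lra. lra.
        * apply Rle_trans with m; [exact M1|]. apply H5; [lia|lra]. }
  destruct K as [a' [b' [m [H1 [H2 [H3 [H4 H5]]]]]]].
  exists a', m. repeat split; try lra. intros j Hj. apply H5; [exact Hj|lra].
Qed.

Lemma rc_Psi (u : R -> CC) (s : R) : cc u -> rc (fun t => Psi (Cmod (u t) / s)).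
Proof.
  intros H t. apply cont_max; [apply continuous_const|]. apply cont_minus; [|apply continuous_const].
  apply cont_mult; [apply continuous_const|]. apply cont_mult; [apply rc_Cmod, H|apply continuous_const].
Qed.

(** The output of Jensen's formula for a single value [c]. The truncation level on the left may
    depend on [c]; on the right every level is allowed, since truncation only raises the mean. *)
Definition pointwise_dominated (X : R -> CC) (x0 : CC) (J : nat) (wt : nat -> R)
    (Y : nat -> R -> CC) (y0 : nat -> CC) : Prop :=
  forall c k, 0 < k -> c <> x0 -> (forall j, (j < J)%nat -> c <> y0 j) ->
  exists k0, 0 < k0 /\
    cmean (fun u => lmax k0 (X u - c)) <= ln (Cmod (x0 - c)) +
      rsum (fun j => wt j * (cmean (fun u => lmax k (Y j u - c)) - ln (Cmod (y0 j - c)))) J.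

Lemma cmean_lmax_lipschitz (X : R -> CC) (k : R) (c c' : CC) : cc X -> 0 < k ->
  cmean (fun u => lmax k (X u - c')) <= cmean (fun u => lmax k (X u - c)) + Cmod (c' - c) / k.
Proof.
  intros HX Hk.
  assert (Hr : forall c, rc (fun u => lmax k (X u - c))).
  { intros d. apply rc_lmax; [exact Hk|]. apply cc_minus; [exact HX|apply cc_const]. }
  rewrite <- (cmean_const (Cmod (c' - c) / k)), <- cmean_plus by (auto; intros t; apply continuous_const).
  apply cmean_le; auto.
  - intros t. apply cont_plus; [apply Hr|apply continuous_const].
  - intros u. assert (L := lmax_lipschitz k (X u - c') (X u - c) Hk).
    replace (X u - c' - (X u - c))%C with (- (c' - c))%C in L by ring. rewrite Cmod_opp in L.
    assert (A := Rle_abs (lmax k (X u - c') - lmax k (X u - c))). lra.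
Qed.

(* Truncating the logarithm at a level [k0] that works for all [c] on the circle (by compactness)
   removes every singularity before averaging over [c]. *)
Lemma uniform_truncation (X : R -> CC) (x0 : CC) (J : nat) (wt : nat -> R)
    (Y : nat -> R -> CC) (y0 : nat -> CC) (s m e : R) :
  cc X -> (forall j, cc (Y j)) -> (forall j, 0 <= wt j) ->
  pointwise_dominated X x0 J wt Y y0 ->
  0 < s -> 0 < m -> m <= Rabs (Cmod x0 - s) -> (forall j, (j < J)%nat -> m <= Rabs (Cmod (y0 j) - s)) ->
  0 < e ->
  exists k0, 0 < k0 /\ forall t, 0 <= t <= 2 * PI ->
    cmean (fun u => lmax k0 (X u - circ s t)) <= lmax m (x0 - circ s t) +
      rsum (fun j => wt j * (cmean (fun u => lmax (s / 2) (Y j u - circ s t)) - lmax m (y0 j - circ s t))) J + e.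
Proof.
  intros HX HY Hwt Hdom Hs Hm Hx0 Hy0 He.
  assert (Hdist : forall x t, m <= Rabs (Cmod x - s) -> m <= Cmod (x - circ s t)).
  { intros x t H. eapply Rle_trans; [exact H|]. rewrite <- (Cmod_circ s t) at 1 by lra. apply Rabs_Cmod_minus. }
  apply (compact_unif (fun k0 t => cmean (fun u => lmax k0 (X u - circ s t)) <= lmax m (x0 - circ s t) +
      rsum (fun j => wt j * (cmean (fun u => lmax (s / 2) (Y j u - circ s t)) - lmax m (y0 j - circ s t))) J + e)).
  - intros t0 _. set (c0 := circ s t0).
    assert (Hs2 : 0 < s / 2) by lra.
    destruct (Hdom c0 (s / 2) Hs2) as [k0 [Hk0 H]].
    { intros E. specialize (Hdist x0 t0 Hx0). fold c0 in Hdist. rewrite E in Hdist.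
      replace (x0 - x0)%C with (RtoC 0) in Hdist by ring. rewrite Cmod_0 in Hdist. lra. }
    { intros j Hj E. specialize (Hdist (y0 j) t0 (Hy0 j Hj)). fold c0 in Hdist. rewrite E in Hdist.
      replace (y0 j - y0 j)%C with (RtoC 0) in Hdist by ring. rewrite Cmod_0 in Hdist. lra. }
    set (W := rsum wt J). assert (PW : 0 <= W) by (apply rsum_pos; auto).
    (* A Lipschitz constant in [c] for the difference of the two sides, since truncation at level k
       makes the logarithm Lipschitz with constant 1 / k. *)
    set (La := / k0 + / m + W * (/ (s / 2) + / m)).
    assert (Pk : 0 < / k0) by (apply Rinv_0_lt_compat; lra).
    assert (Pm : 0 < / m) by (apply Rinv_0_lt_compat; lra).
    assert (P2 : 0 < / (s / 2)) by (apply Rinv_0_lt_compat; lra).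
    assert (PLa : 0 < La) by (unfold La; nra).
    (* On the circle [c] moves by at most 2 s |t - t0|. As [d] is also the new truncation level, it
       must not exceed [k0]. *)
    set (d := Rmin k0 (e / (La * (2 * s)))).
    assert (Hd : 0 < d).
    { apply Rmin_glb_lt; [exact Hk0|]. apply Rdiv_lt_0_compat; [exact He|nra]. }
    exists d. split; [exact Hd|]. intros t _ Ht. set (c := circ s t).
    assert (D1 : d <= k0) by apply Rmin_l.
    assert (D2 : d <= e / (La * (2 * s))) by apply Rmin_r.
    set (g := Cmod (c - c0)).
    assert (Hg : La * g <= e).
    { assert (G : g <= 2 * s * Rabs (t - t0)) by (apply circ_lipschitz; lra).
      apply Rle_trans with (La * (2 * s * (e / (La * (2 * s))))).
      - apply Rmult_le_compat_l; [lra|]. eapply Rle_trans; [exact G|]. apply Rmult_le_compat_l; lra.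
      - right; field; lra. }
    assert (Pg : 0 <= g) by apply Cmod_ge_0.
    assert (A1 : cmean (fun u => lmax d (X u - c)) <= cmean (fun u => lmax k0 (X u - c0)) + g / k0).
    { apply Rle_trans with (cmean (fun u => lmax k0 (X u - c))).
      - apply cmean_le.
        + apply rc_lmax; [exact Hd|]. apply cc_minus; [exact HX|apply cc_const].
        + apply rc_lmax; [exact Hk0|]. apply cc_minus; [exact HX|apply cc_const].
        + intros u. apply lmax_mono. lra.
      - apply cmean_lmax_lipschitz; assumption. }
    assert (Lm : forall x, Rabs (lmax m (x - c0) - lmax m (x - c)) <= g / m).
    { intros x. eapply Rle_trans; [apply lmax_lipschitz, Hm|].
      replace (x - c0 - (x - c))%C with (c - c0)%C by ring. apply Rle_refl. }
    assert (A2 : ln (Cmod (x0 - c0)) <= lmax m (x0 - c) + g / m).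
    { rewrite <- (lmax_eq m (x0 - c0)) by (apply Hdist, Hx0).
      assert (L := Lm x0). assert (A := Rle_abs (lmax m (x0 - c0) - lmax m (x0 - c))). lra. }
    assert (A3 : rsum (fun j => wt j * (cmean (fun u => lmax (s / 2) (Y j u - c0)) - ln (Cmod (y0 j - c0)))) J
      <= rsum (fun j => wt j * (cmean (fun u => lmax (s / 2) (Y j u - c)) - lmax m (y0 j - c))) J
         + W * (g / (s / 2) + g / m)).
    { unfold W. rewrite (Rmult_comm (rsum wt J)), <- rsum_scal, <- rsum_plus. apply rsum_le. intros j Hj.
      rewrite (Rmult_comm _ (wt j)), <- Rmult_plus_distr_l. apply Rmult_le_compat_l; [apply Hwt|].
      rewrite <- (lmax_eq m (y0 j - c0)) by (apply Hdist, Hy0, Hj).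
      assert (L := Lm (y0 j)). rewrite Rabs_minus_sym in L.
      assert (A := Rle_abs (lmax m (y0 j - c) - lmax m (y0 j - c0))).
      assert (B := cmean_lmax_lipschitz (Y j) (s / 2) c c0 (HY j) Hs2).
      replace (Cmod (c0 - c)) with g in B.
      2:{ unfold g. rewrite <- Cmod_opp. f_equal. ring. }
      lra. }
    assert (E : La * g = g / k0 + g / m + W * (g / (s / 2) + g / m)) by (unfold La, Rdiv; ring).
    fold c. lra.
  - intros d d' t Hd H. eapply Rle_trans; [|exact H]. apply cmean_le.
    + apply rc_lmax; [lra|]. apply cc_minus; [exact HX|apply cc_const].
    + apply rc_lmax; [lra|]. apply cc_minus; [exact HX|apply cc_const].
    + intros u. apply lmax_mono. lra.
Qed.

(** Averaging over |c| = s: the left side becomes at least log max(|X|, s), the [x0] term at most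
    log max(|x0|, s), each [Y j] term at most log s + Psi, and each subtracted [y0 j] term at least
    log s, so that log s cancels. *)
Lemma averaged_domination (X : R -> CC) (x0 : CC) (J : nat) (wt : nat -> R)
    (Y : nat -> R -> CC) (y0 : nat -> CC) (s m : R) :
  cc X -> (forall j, cc (Y j)) -> (forall j, 0 <= wt j) ->
  pointwise_dominated X x0 J wt Y y0 ->
  0 < s -> 0 < m -> m <= Rabs (Cmod x0 - s) -> (forall j, (j < J)%nat -> m <= Rabs (Cmod (y0 j) - s)) ->
  cmean (fun u => lmax s (X u)) <= ln (Rmax (Cmod x0) s) +
    rsum (fun j => wt j * cmean (fun u => Psi (Cmod (Y j u) / s))) J.
Proof.
  intros HX HY Hwt Hdom Hs Hm Hx0 Hy0.
  set (W := rsum wt J). assert (PW : 0 <= W) by (apply rsum_pos; auto).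
  apply le_epsilon. intros e0 He0.
  (* One error each from [uniform_truncation], [S1] and [S3], and two per unit of weight from
     [S4]. *)
  set (e := e0 / (3 + 2 * W)). assert (He : 0 < e) by (apply Rdiv_lt_0_compat; lra).
  assert (Ee : (3 + 2 * W) * e = e0) by (unfold e; field; lra).
  destruct (uniform_truncation X x0 J wt Y y0 s m e) as [k [Hk H]]; auto.
  (* A single number [M] of nodes has to serve the three truncation levels k, m and s / 2. *)
  set (k1 := Rmin k (Rmin m (s / 2))).
  assert (Hk1 : 0 < k1) by (repeat apply Rmin_glb_lt; lra).
  assert (K1 : k1 <= k) by apply Rmin_l.
  assert (K2 : k1 <= Rmin m (s / 2)) by apply Rmin_r.
  assert (K3 : Rmin m (s / 2) <= m) by apply Rmin_l.
  assert (K4 : Rmin m (s / 2) <= s / 2) by apply Rmin_r.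
  destruct (large_nat (2 * s / k1 * (2 * PI)) e He) as [M [HM HMe]].
  specialize (HMe M (le_n M)).
  assert (PM : 0 < INR M) by (apply lt_0_INR, HM).
  assert (P := two_PI_pos).
  assert (Hlip : forall k', k1 <= k' -> 2 * s / k' * (2 * PI / INR M) <= e).
  { intros k' Hk'. eapply Rle_trans; [|exact HMe].
    replace (2 * s / k1 * (2 * PI) / INR M) with (2 * s / k1 * (2 * PI / INR M)) by (field; lra).
    apply Rmult_le_compat_r; [left; apply Rdiv_lt_0_compat; lra|].
    apply Rmult_le_compat_l; [lra|]. apply Rinv_le_contravar; lra. }
  assert (Happ : forall k' x, k1 <= k' ->
     Rabs (avg M (fun t => lmax k' (x - circ s t)) - cmean (fun t => lmax k' (x - circ s t))) <= e).
  { intros k' x Hk'. apply avg_lmax_circ; auto; lra. }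
  assert (Hrc : forall Z k' t, cc Z -> 0 < k' -> rc (fun u => lmax k' (Z u - circ s t))).
  { intros Z k' t HZ Hk'. apply rc_lmax; [exact Hk'|]. apply cc_minus; [exact HZ|apply cc_const]. }
  destruct (cmean_avg (fun u t => lmax k (X u - circ s t)) M) as [R1 E1].
  { intros t. apply Hrc; assumption. }
  assert (S1 : cmean (fun u => lmax s (X u)) <= avg M (fun t => cmean (fun u => lmax k (X u - circ s t))) + e).
  { rewrite <- E1, <- (cmean_const e), <- cmean_plus by (auto; intros t; apply continuous_const).
    apply cmean_le.
    - apply rc_lmax; assumption.
    - intros t. apply cont_plus; [apply R1|apply continuous_const].
    - intros u. assert (L := circle_log_lower s k (X u) Hs Hk).
      assert (A := Happ k (X u) K1). apply Rabs_le_between' in A. unfold lmax at 1. lra. }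
  assert (S2 := avg_le M _ _ HM H).
  rewrite !avg_plus, avg_const, avg_rsum in S2 by exact HM.
  assert (S3 : avg M (fun t => lmax m (x0 - circ s t)) <= ln (Rmax (Cmod x0) s) + e).
  { assert (A := Happ m x0 ltac:(lra)). apply Rabs_le_between' in A.
    assert (B := circle_log_upper s m x0 Hs Hm Hx0). lra. }
  assert (S4 : rsum (fun j => avg M (fun t => wt j * (cmean (fun u => lmax (s / 2) (Y j u - circ s t)) - lmax m (y0 j - circ s t)))) J
     <= rsum (fun j => wt j * cmean (fun u => Psi (Cmod (Y j u) / s))) J + W * (2 * e)).
  { unfold W. rewrite (Rmult_comm (rsum wt J)), <- rsum_scal, <- rsum_plus. apply rsum_le. intros j Hj.
    rewrite avg_scal, (Rmult_comm (2 * e)), <- Rmult_plus_distr_l. apply Rmult_le_compat_l; [apply Hwt|].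
    assert (T : avg M (fun t => cmean (fun u => lmax (s / 2) (Y j u - circ s t)) - lmax m (y0 j - circ s t))
       = avg M (fun t => cmean (fun u => lmax (s / 2) (Y j u - circ s t))) + -1 * avg M (fun t => lmax m (y0 j - circ s t))).
    { rewrite <- avg_scal, <- avg_plus. unfold avg. f_equal. apply rsum_ext. intros; ring. }
    rewrite T. clear T.
    destruct (cmean_avg (fun u t => lmax (s / 2) (Y j u - circ s t)) M) as [R2 E2].
    { intros t. apply Hrc; [apply HY|lra]. }
    assert (U1 : avg M (fun t => cmean (fun u => lmax (s / 2) (Y j u - circ s t)))
        <= ln s + cmean (fun u => Psi (Cmod (Y j u) / s)) + e).
    { rewrite <- E2.
      assert (RP : rc (fun u => Psi (Cmod (Y j u) / s))) by (apply rc_Psi, HY).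
      apply Rle_trans with (cmean (fun u => (ln s + e) + Psi (Cmod (Y j u) / s))).
      - apply cmean_le; auto.
        + intros t. apply cont_plus; [apply continuous_const|apply RP].
        + intros u. assert (A := Happ (s / 2) (Y j u) ltac:(lra)). apply Rabs_le_between' in A.
          assert (B := circle_log_Psi s (Y j u) Hs). lra.
      - rewrite cmean_plus by (auto; intros t; apply continuous_const). rewrite cmean_const. lra. }
    assert (U2 : ln s <= avg M (fun t => lmax m (y0 j - circ s t)) + e).
    { assert (A := Happ m (y0 j) ltac:(lra)). apply Rabs_le_between' in A.
      assert (B := circle_log_lower s m (y0 j) Hs Hm).
      assert (ln s <= ln (Rmax (Cmod (y0 j)) s)) by (apply ln_le'; [exact Hs|apply Rmax_r]). lra. }
    lra. }
  lra.
Qed.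

(** * From logarithms to squares *)

(** [Psi] with the slope doubled, which absorbs the move from a scale in (S0 / 2, S0) to S0. *)
Definition Psi2 (u : R) : R := Rmax 0 (8 * u - 1).

(** The given scale may coincide with |x0| or some |y0 j|; a smaller one, within a factor 2, does
    not. *)
Lemma log_domination_all_scales (X : R -> CC) (x0 : CC) (J : nat) (wt : nat -> R)
    (Y : nat -> R -> CC) (y0 : nat -> CC) (S0 : R) :
  cc X -> (forall j, cc (Y j)) -> (forall j, 0 <= wt j) ->
  pointwise_dominated X x0 J wt Y y0 -> 0 < S0 ->
  cmean (fun u => lmax S0 (X u)) - ln S0 <= Psi2 (Cmod x0 / S0) +
    rsum (fun j => wt j * cmean (fun u => Psi2 (Cmod (Y j u) / S0))) J.
Proof.
  intros HX HY Hwt Hdom HS0.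
  destruct (avoid_finite (fun j => match j with O => Cmod x0 | S i => Cmod (y0 i) end) (S J) (S0 / 2) S0)
    as [s [m [Hs [Hm Hav]]]]; [lra|].
  assert (A := averaged_domination X x0 J wt Y y0 s m HX HY Hwt Hdom ltac:(lra) Hm
     (Hav 0%nat ltac:(lia)) (fun j Hj => Hav (S j) ltac:(lia))).
  assert (Hscale : forall x, 0 <= x -> 4 * (x / s) <= 8 * (x / S0)).
  { intros x Hx. unfold Rdiv. assert (/ s <= 2 * / S0); [|nra].
    apply (Rmult_le_reg_r (s * S0)); [nra|].
    replace (/ s * (s * S0)) with S0 by (field; lra).
    replace (2 * / S0 * (s * S0)) with (2 * s) by (field; lra). lra. }
  (* The positive part of log (|X| / s) decreases in s, so lowering the scale goes the right way. *)
  assert (B1 : cmean (fun u => lmax S0 (X u)) - ln S0 <= cmean (fun u => lmax s (X u)) - ln s).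
  { assert (cmean (fun u => lmax S0 (X u)) <= cmean (fun u => (ln S0 - ln s) + lmax s (X u))).
    - apply cmean_le.
      + apply rc_lmax; assumption.
      + intros t. apply cont_plus; [apply continuous_const|]. apply rc_lmax; [lra|exact HX].
      + intros u. unfold lmax.
        replace (ln S0 - ln s) with (ln (S0 / s)) by (apply ln_div; lra).
        assert (P1 : 0 < S0 / s) by (apply Rdiv_lt_0_compat; lra).
        assert (P2 : s <= Rmax (Cmod (X u)) s) by apply Rmax_r.
        rewrite <- ln_mult by lra. apply ln_le'; [apply Rlt_le_trans with S0; [lra|apply Rmax_r]|].
        assert (P3 : 1 <= S0 / s).
        { apply (Rmult_le_reg_r s); [lra|]. replace (S0 / s * s) with S0 by (field; lra). lra. }
        apply Rmax_lub.
        * assert (Cmod (X u) <= Rmax (Cmod (X u)) s) by apply Rmax_l.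
          assert (X0 := Cmod_ge_0 (X u)). nra.
        * replace S0 with (S0 / s * s) at 1 by (field; lra). apply Rmult_le_compat_l; lra.
    - rewrite cmean_plus in H.
      + rewrite cmean_const in H. lra.
      + intros t; apply continuous_const.
      + apply rc_lmax; [lra|exact HX]. }
  assert (B2 : ln (Rmax (Cmod x0) s) - ln s <= Psi2 (Cmod x0 / S0)).
  { assert (Px := Cmod_ge_0 x0). unfold Psi2. destruct (Rle_dec (Cmod x0) s) as [L|L].
    - rewrite Rmax_right by assumption. eapply Rle_trans; [|apply Rmax_l]. lra.
    - rewrite Rmax_left by lra. eapply Rle_trans; [|apply Rmax_r].
      rewrite <- ln_div by lra.
      assert (E := exp_ineq1_le (ln (Cmod x0 / s))).
      assert (P1 : 0 < Cmod x0 / s) by (apply Rdiv_lt_0_compat; lra).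
      rewrite exp_ln in E by exact P1. assert (Z := Hscale (Cmod x0) Px). lra. }
  assert (B3 : rsum (fun j => wt j * cmean (fun u => Psi (Cmod (Y j u) / s))) J
     <= rsum (fun j => wt j * cmean (fun u => Psi2 (Cmod (Y j u) / S0))) J).
  { apply rsum_le. intros j _. apply Rmult_le_compat_l; [apply Hwt|].
    apply cmean_le.
    - apply rc_Psi, HY.
    - intros t. apply cont_max; [apply continuous_const|]. apply cont_minus; [|apply continuous_const].
      apply cont_mult; [apply continuous_const|]. apply cont_mult; [apply rc_Cmod, HY|apply continuous_const].
    - intros u. unfold Psi, Psi2. assert (Z := Hscale (Cmod (Y j u)) (Cmod_ge_0 _)).
      apply Rmax_lub; [apply Rmax_l|]. eapply Rle_trans; [|apply Rmax_r]. lra. }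
  lra.
Qed.

Lemma lmax_ge_ln_level (k : R) (x : CC) : 0 < k -> ln k <= lmax k x.
Proof. intros Hk. apply ln_le'; [exact Hk|apply Rmax_r]. Qed.

(** A single scale suffices: if 2 y < |x| <= 4 y then |x|^2 <= 16 y^2 <= 32 y^2 log (|x| / y),
    because log 2 > 1/2. Values up to 2 sg, which have no such scale, are covered by 16 sg^2. *)
Lemma dyadic_lower (x : CC) (sg : R) (I : nat) : 0 < sg -> Cmod x <= sg * 2 ^ I ->
  Cmod x ^ 2 <= 16 * sg ^ 2 + 32 * rsum (fun i => (sg * 2 ^ i) ^ 2 * (lmax (sg * 2 ^ i) x - ln (sg * 2 ^ i))) I.
Proof.
  intros Hsg. assert (Px := Cmod_ge_0 x).
  set (T := fun i => (sg * 2 ^ i) ^ 2 * (lmax (sg * 2 ^ i) x - ln (sg * 2 ^ i))).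
  assert (Hpos : forall i, 0 <= T i).
  { intros i. unfold T. assert (P : 0 < sg * 2 ^ i) by (apply Rmult_lt_0_compat; [exact Hsg|apply pow_lt; lra]).
    apply Rmult_le_pos; [apply pow_le; lra|]. assert (L := lmax_ge_ln_level _ x P). lra. }
  induction I as [|I IH]; intros H.
  - simpl in *. nra.
  - destruct (Rle_dec (Cmod x) (sg * 2 ^ I)) as [L|L].
    + specialize (IH L). simpl rsum. specialize (Hpos I). lra.
    + destruct I as [|I].
      * assert (H0 : 0 <= rsum T 1) by (apply rsum_pos; auto).
        simpl in H. simpl pow. nra.
      * assert (R1 : T I <= rsum T (S (S I))) by (apply rsum_term; [exact Hpos|lia]).
        assert (P : 0 < sg * 2 ^ I) by (apply Rmult_lt_0_compat; [exact Hsg|apply pow_lt; lra]).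
        set (y := sg * 2 ^ I) in *.
        assert (H' : Cmod x <= 4 * y).
        { eapply Rle_trans; [exact H|]. unfold y. right. simpl. ring. }
        assert (L' : 2 * y < Cmod x).
        { apply Rle_lt_trans with (sg * 2 ^ S I); [|lra]. unfold y. right. simpl. ring. }
        assert (Hl : / 2 <= lmax y x - ln y).
        { rewrite lmax_eq by lra. rewrite <- ln_div by lra.
          apply Rle_trans with (ln 2); [left; apply ln_lt_2|].
          apply ln_le'; [lra|]. apply (Rmult_le_reg_r y); [exact P|].
          replace (Cmod x / y * y) with (Cmod x) by (field; lra). lra. }
        assert (R2 : y ^ 2 * / 2 <= T I).
        { change (T I) with (y ^ 2 * (lmax y x - ln y)). apply Rmult_le_compat_l; [apply pow_le; lra|exact Hl]. }
        assert (R3 : Cmod x ^ 2 <= (4 * y) ^ 2) by (apply pow_incr; lra).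
        assert (0 <= sg ^ 2) by (apply pow_le; lra). nra.
Qed.

(** A scale y contributes at most 8 x y, and nothing once y >= 8 x; the geometric sum is controlled
    by its largest term. The minimum in the induction statement keeps track of both regimes. *)
Lemma dyadic_upper (x sg : R) (I : nat) : 0 <= x -> 0 < sg ->
  rsum (fun i => (sg * 2 ^ i) ^ 2 * Psi2 (x / (sg * 2 ^ i))) I <= 128 * x ^ 2.
Proof.
  intros Hx Hsg. set (T := fun i => (sg * 2 ^ i) ^ 2 * Psi2 (x / (sg * 2 ^ i))).
  assert (K : rsum T I <= 8 * x * Rmin (sg * 2 ^ I) (16 * x)).
  { induction I as [|I IH]; simpl rsum.
    - apply Rmult_le_pos; [lra|]. apply Rmin_glb; [simpl; lra|lra].
    - assert (P : 0 < sg * 2 ^ I) by (apply Rmult_lt_0_compat; [exact Hsg|apply pow_lt; lra]).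
      replace (sg * 2 ^ S I) with (2 * (sg * 2 ^ I)) by (simpl; ring).
      set (y := sg * 2 ^ I) in *. change (T I) with (y ^ 2 * Rmax 0 (8 * (x / y) - 1)).
      assert (E : y ^ 2 * (8 * (x / y)) = 8 * x * y) by (field; lra).
      destruct (Rle_dec y (8 * x)) as [L|L].
      + rewrite (Rmin_left (2 * y)) by lra. rewrite Rmin_left in IH by lra.
        assert (y ^ 2 * Rmax 0 (8 * (x / y) - 1) <= 8 * x * y); [|lra].
        assert (0 <= y ^ 2) by (apply pow_le; lra).
        unfold Rmax; destruct (Rle_dec 0 (8 * (x / y) - 1)); [nra|]. rewrite Rmult_0_r.
        apply Rmult_le_pos; lra.
      + rewrite Rmax_left.
        * rewrite Rmult_0_r, Rplus_0_r. eapply Rle_trans; [exact IH|].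
          apply Rmult_le_compat_l; [lra|]. apply Rle_min_compat_r. lra.
        * assert (8 * (x / y) <= 1); [|lra]. apply (Rmult_le_reg_r y); [exact P|].
          replace (8 * (x / y) * y) with (8 * x) by (field; lra). lra. }
  eapply Rle_trans; [exact K|].
  apply Rle_trans with (8 * x * (16 * x)); [|right; ring].
  apply Rmult_le_compat_l; [lra|apply Rmin_r].
Qed.

Lemma rsum_exchange (a : nat -> nat -> R) (I J : nat) :
  rsum (fun i => rsum (fun j => a i j) J) I = rsum (fun j => rsum (fun i => a i j) I) J.
Proof.
  induction I as [|I IH]; simpl.
  - induction J as [|J IHJ]; simpl; [reflexivity|]. rewrite <- IHJ. ring.
  - rewrite IH, <- rsum_plus. reflexivity.
Qed.

(** The constant is 32 times 128, from [dyadic_lower] and [dyadic_upper]. The bound [B] only limits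
    the number of scales and leaves no trace in the conclusion. *)
Theorem mean_square_domination (X : R -> CC) (x0 : CC) (J : nat) (wt : nat -> R)
    (Y : nat -> R -> CC) (y0 : nat -> CC) (B : R) :
  cc X -> (forall j, cc (Y j)) -> (forall j, 0 <= wt j) -> (forall u, Cmod (X u) <= B) ->
  pointwise_dominated X x0 J wt Y y0 ->
  cmean (fun u => Cmod (X u) ^ 2) <=
    4096 * (Cmod x0 ^ 2 + rsum (fun j => wt j * cmean (fun u => Cmod (Y j u) ^ 2)) J).
Proof.
  intros HX HY Hwt HB Hdom.
  apply le_epsilon. intros e He.
  (* The lowest scale is chosen so that the term 16 sg^2 of [dyadic_lower] equals [e]. *)
  set (sg := sqrt (e / 16)). assert (Hsg : 0 < sg) by (apply sqrt_lt_R0; lra).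
  assert (Esg : 16 * sg ^ 2 = e) by (unfold sg; rewrite pow2_sqrt by lra; lra).
  assert (HI : exists I, B <= sg * 2 ^ I).
  { destruct (INR_unbounded (B / sg)) as [N HN]. exists N.
    assert (INR N <= 2 ^ N).
    { clear. induction N as [|N IH]; [simpl; lra|]. rewrite S_INR. simpl.
      assert (1 <= 2 ^ N) by (apply pow_R1_Rle; lra). lra. }
    apply Rle_trans with (sg * (B / sg)); [right; field; lra|]. apply Rmult_le_compat_l; lra. }
  destruct HI as [I HI].
  set (Si := fun i => sg * 2 ^ i).
  assert (HSi : forall i, 0 < Si i) by (intros i; apply Rmult_lt_0_compat; [exact Hsg|apply pow_lt; lra]).
  assert (Hrl : forall i, rc (fun u => lmax (Si i) (X u) - ln (Si i))).
  { intros i t. apply cont_minus; [apply rc_lmax; auto|apply continuous_const]. }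
  assert (HrP : forall j i, rc (fun u => Psi2 (Cmod (Y j u) / Si i))).
  { intros j i t. apply cont_max; [apply continuous_const|]. apply cont_minus; [|apply continuous_const].
    apply cont_mult; [apply continuous_const|]. apply cont_mult; [apply rc_Cmod, HY|apply continuous_const]. }
  assert (Hterm : forall i, rc (fun u => Si i ^ 2 * (lmax (Si i) (X u) - ln (Si i)))).
  { intros i t. apply cont_mult; [apply continuous_const|apply Hrl]. }
  assert (T1 : cmean (fun u => Cmod (X u) ^ 2) <=
     e + 32 * rsum (fun i => Si i ^ 2 * (cmean (fun u => lmax (Si i) (X u)) - ln (Si i))) I).
  { apply Rle_trans with (cmean (fun u => e + 32 * rsum (fun i => Si i ^ 2 * (lmax (Si i) (X u) - ln (Si i))) I)).
    - apply cmean_le.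
      + apply rc_pow, rc_Cmod, HX.
      + intros t. apply cont_plus; [apply continuous_const|]. apply cont_mult; [apply continuous_const|].
        apply (rc_rsum (fun i u => Si i ^ 2 * (lmax (Si i) (X u) - ln (Si i)))), Hterm.
      + intros u. rewrite <- Esg. apply dyadic_lower; [exact Hsg|]. eapply Rle_trans; [apply HB|exact HI].
    - rewrite cmean_plus, cmean_const, cmean_scal.
      + rewrite cmean_rsum by apply Hterm. right. f_equal. f_equal. apply rsum_ext. intros i _.
        rewrite cmean_scal by apply Hrl. rewrite cmean_minus, cmean_const; [reflexivity| |].
        * apply rc_lmax; auto.
        * intros t; apply continuous_const.
      + apply (rc_rsum (fun i u => Si i ^ 2 * (lmax (Si i) (X u) - ln (Si i)))), Hterm.
      + intros t; apply continuous_const.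
      + intros t. apply cont_mult; [apply continuous_const|].
        apply (rc_rsum (fun i u => Si i ^ 2 * (lmax (Si i) (X u) - ln (Si i)))), Hterm. }
  assert (T2 : rsum (fun i => Si i ^ 2 * (cmean (fun u => lmax (Si i) (X u)) - ln (Si i))) I <=
     rsum (fun i => Si i ^ 2 * Psi2 (Cmod x0 / Si i)) I +
     rsum (fun i => rsum (fun j => wt j * (Si i ^ 2 * cmean (fun u => Psi2 (Cmod (Y j u) / Si i)))) J) I).
  { rewrite <- rsum_plus. apply rsum_le. intros i _.
    rewrite (rsum_ext _ (fun j => Si i ^ 2 * (wt j * cmean (fun u => Psi2 (Cmod (Y j u) / Si i)))))
      by (intros; ring).
    rewrite rsum_scal, <- Rmult_plus_distr_l. apply Rmult_le_compat_l; [apply pow_le; left; apply HSi|].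
    apply log_domination_all_scales with (y0 := y0); auto. }
  assert (T3 := dyadic_upper (Cmod x0) sg I (Cmod_ge_0 _) Hsg). fold Si in T3.
  rewrite rsum_exchange in T2.
  assert (T4 : rsum (fun j => rsum (fun i => wt j * (Si i ^ 2 * cmean (fun u => Psi2 (Cmod (Y j u) / Si i)))) I) J
    <= 128 * rsum (fun j => wt j * cmean (fun u => Cmod (Y j u) ^ 2)) J).
  { rewrite <- rsum_scal. apply rsum_le. intros j _. rewrite rsum_scal.
    replace (128 * (wt j * cmean (fun u => Cmod (Y j u) ^ 2)))
      with (wt j * (128 * cmean (fun u => Cmod (Y j u) ^ 2))) by ring.
    apply Rmult_le_compat_l; [apply Hwt|].
    assert (Hr2 : forall i, rc (fun u => Si i ^ 2 * Psi2 (Cmod (Y j u) / Si i))).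
    { intros i t. apply cont_mult; [apply continuous_const|apply HrP]. }
    rewrite (rsum_ext _ (fun i => cmean (fun u => Si i ^ 2 * Psi2 (Cmod (Y j u) / Si i)))).
    2:{ intros i _. symmetry. apply cmean_scal, HrP. }
    rewrite <- (cmean_rsum (fun i u => Si i ^ 2 * Psi2 (Cmod (Y j u) / Si i))) by exact Hr2.
    rewrite <- cmean_scal by apply rc_pow, rc_Cmod, HY.
    apply cmean_le.
    - apply (rc_rsum (fun i u => Si i ^ 2 * Psi2 (Cmod (Y j u) / Si i))), Hr2.
    - intros t. apply cont_mult; [apply continuous_const|apply (rc_pow (fun u => Cmod (Y j u))), rc_Cmod, HY].
    - intros u. apply dyadic_upper; [apply Cmod_ge_0|exact Hsg]. }
  unfold Si in *. lra.
Qed.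

(** * Disk automorphisms and zero-free majorants of fibres *)

Definition mob (a z : CC) : CC := ((a - z) / (1 - Cconj a * z))%C.

Lemma one_minus_conj_nz (a z : CC) : Cmod a < 1 -> Cmod z < 1 -> (1 - Cconj a * z)%C <> RtoC 0.
Proof.
  intros Ha Hz E.
  assert (E' : RtoC 1 = (Cconj a * z)%C).
  { replace (RtoC 1) with (1 - Cconj a * z + Cconj a * z)%C by ring. rewrite E. ring. }
  apply (f_equal Cmod) in E'. rewrite Cmod_1, Cmod_mult, Cmod_conj in E'.
  assert (P1 := Cmod_ge_0 a). assert (P2 := Cmod_ge_0 z). nra.
Qed.

Lemma mob_identity (a z : CC) :
  Cmod (1 - Cconj a * z) ^ 2 - Cmod (a - z) ^ 2 = (1 - Cmod a ^ 2) * (1 - Cmod z ^ 2).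
Proof.
  apply RtoC_inj. rewrite RtoC_minus, RtoC_mult, !RtoC_minus, !Cmod2_conj.
  rewrite !Cminus_conj, Cmult_conj, Cconj_conj.
  replace (Cconj (RtoC 1)) with (RtoC 1) by (apply injective_projections; simpl; ring). ring.
Qed.

Lemma mob_disk (a z : CC) : Cmod a < 1 -> Cmod z < 1 -> Cmod (mob a z) < 1.
Proof.
  intros Ha Hz. assert (N := one_minus_conj_nz a z Ha Hz). unfold mob. rewrite Cmod_div by exact N.
  assert (I := mob_identity a z). apply Cmod_gt_0 in N.
  assert (P1 := Cmod_ge_0 a). assert (P2 := Cmod_ge_0 z). assert (P3 := Cmod_ge_0 (a - z)).
  apply Rlt_div_l; [exact N|]. simpl in I.
  assert (0 < (1 - Cmod a * (Cmod a * 1)) * (1 - Cmod z * (Cmod z * 1))) by (apply Rmult_lt_0_compat; nra).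
  nra.
Qed.

Lemma mob_nz (a z : CC) : Cmod a < 1 -> Cmod z < 1 -> z <> a -> mob a z <> RtoC 0.
Proof.
  intros Ha Hz Hne. assert (N := one_minus_conj_nz a z Ha Hz).
  apply Cmult_neq_0; [apply Cminus_eq_contra; auto|].
  apply Cmod_gt_0. rewrite Cmod_inv by exact N. apply Rinv_0_lt_compat, Cmod_gt_0, N.
Qed.

Lemma mob_holo (a : CC) : Cmod a < 1 -> holo 1 (mob a).
Proof.
  intros Ha. apply (holo_mult 1 (fun z => (a - z)%C) (fun z => (/ (1 - Cconj a * z))%C)).
  - apply holo_minus; [apply holo_const|apply holo_id].
  - apply (holo_inv 1 (fun z => (1 - Cconj a * z)%C)).
    + apply holo_minus; [apply holo_const|apply holo_mult; [apply holo_const|apply holo_id]].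
    + intros z Hz. apply one_minus_conj_nz; assumption.
Qed.

Lemma mob_0 (a : CC) : mob a (RtoC 0) = a.
Proof. unfold mob. replace (1 - Cconj a * 0)%C with (RtoC 1) by ring. field. Qed.

Lemma mob_invol (a z : CC) : Cmod a < 1 -> Cmod z < 1 -> mob a (mob a z) = z.
Proof.
  intros Ha Hz. assert (N := one_minus_conj_nz a z Ha Hz).
  assert (N2 := one_minus_conj_nz a a Ha Ha).
  assert (E1 : (a - mob a z)%C = ((1 - Cconj a * a) * z / (1 - Cconj a * z))%C) by (unfold mob; field; exact N).
  assert (E2 : (1 - Cconj a * mob a z)%C = ((1 - Cconj a * a) / (1 - Cconj a * z))%C) by (unfold mob; field; exact N).
  unfold mob at 1. rewrite E1, E2. field. split; assumption.
Qed.

(** Composition with the involution [mob a] moves a zero at [x] to [mob a x]; this carries a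
    factorisation of F - c over to F composed with [mob a]. *)
Lemma mob_factor (a x : CC) : Cmod a < 1 -> Cmod x < 1 -> exists u, holo 1 u /\
  forall z, Cmod z < 1 -> (mob a z - x = (z - mob a x) * u z)%C.
Proof.
  intros Ha Hx. set (y := mob a x). assert (Hy : Cmod y < 1) by (apply mob_disk; assumption).
  assert (Ny := one_minus_conj_nz a y Ha Hy).
  exists (fun z => (- (1 - Cconj a * a) * / (1 - Cconj a * y) * / (1 - Cconj a * z))%C). split.
  - apply (holo_mult 1 (fun _ => (- (1 - Cconj a * a) * / (1 - Cconj a * y))%C) (fun z => (/ (1 - Cconj a * z))%C));
      [apply holo_const|].
    apply (holo_inv 1 (fun z => (1 - Cconj a * z)%C)).
    + apply holo_minus; [apply holo_const|apply holo_mult; [apply holo_const|apply holo_id]].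
    + intros z Hz. apply one_minus_conj_nz; assumption.
  - intros z Hz. rewrite <- (mob_invol a x) by assumption. fold y. unfold mob.
    assert (Nz := one_minus_conj_nz a z Ha Hz). field. split; assumption.
Qed.

Lemma mob_zprod (a : CC) (l : list CC) : Cmod a < 1 -> (forall x, In x l -> Cmod x < 1) ->
  exists u, holo 1 u /\ forall z, Cmod z < 1 -> zprod l (mob a z) = (zprod (map (mob a) l) z * u z)%C.
Proof.
  intros Ha. induction l as [|x l IH]; intros Hl.
  - exists (fun _ => RtoC 1). split; [apply holo_const|]. intros z _. simpl. ring.
  - destruct IH as [u [Hu E]]; [intros y Hy; apply Hl; now right|].
    destruct (mob_factor a x Ha) as [v [Hv Ev]]; [apply Hl; now left|].
    exists (fun z => (v z * u z)%C). split; [apply holo_mult; assumption|]. intros z Hz.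
    simpl. fold (zprod l (mob a z)) (zprod (map (mob a) l) z). rewrite E, Ev by exact Hz. ring.
Qed.

Lemma lsum_map (f : CC -> R) (g : CC -> CC) (l : list CC) : lsum f (map g l) = lsum (fun a => f (g a)) l.
Proof. induction l as [|a l IH]; [reflexivity|]. simpl. unfold lsum in *. now rewrite IH. Qed.

Lemma lsum_scal (c : R) (f : CC -> R) (l : list CC) : lsum (fun a => c * f a) l = c * lsum f l.
Proof. induction l as [|a l IH]; simpl; [ring|]. unfold lsum in *. rewrite IH. ring. Qed.

Lemma lsum_rsum (f : nat -> CC -> R) (J : nat) (l : list CC) :
  lsum (fun a => rsum (fun j => f j a) J) l = rsum (fun j => lsum (f j) l) J.
Proof.
  induction J as [|J IH]; simpl.
  - induction l; simpl; [reflexivity|]. unfold lsum in *. rewrite IHl. ring.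
  - rewrite lsum_plus, IH. reflexivity.
Qed.

(* [Q] is [q] times the factors [1 - conj a * z], which dominate [z - a] on the disk. *)
Lemma remove_zeros (l : list CC) (q : CC -> CC) : holo 1 q -> (forall a, In a l -> a <> RtoC 0 /\ Cmod a < 1) ->
  exists Q, holo 1 Q /\ (forall z, Cmod z < 1 -> Cmod (zprod l z * q z) <= Cmod (Q z)) /\
    (forall z, Cmod z < 1 -> q z <> RtoC 0 -> Q z <> RtoC 0) /\
    Cmod (Q (RtoC 0)) = Cmod (zprod l (RtoC 0) * q (RtoC 0)) * exp (lsum (fun a => ln (/ Cmod a)) l).
Proof.
  intros Hq. induction l as [|a l IH]; intros Ha.
  - exists q. split; [exact Hq|]. split; [|split; [auto|]].
    + intros z _. simpl. right. f_equal. ring.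
    + simpl. rewrite exp_0, Rmult_1_r. f_equal. ring.
  - destruct IH as [Q [H1 [H2 [H3 H4]]]]; [intros b Hb; apply Ha; now right|].
    destruct (Ha a (or_introl eq_refl)) as [Na La].
    assert (Pa : 0 < Cmod a) by (apply Cmod_gt_0, Na).
    exists (fun z => ((1 - Cconj a * z) * Q z)%C). split; [|split; [|split]].
    + apply (holo_mult 1 (fun z => (1 - Cconj a * z)%C) Q); [|exact H1].
      apply holo_minus; [apply holo_const|apply holo_mult; [apply holo_const|apply holo_id]].
    + intros z Hz. simpl. fold (zprod l z). rewrite <- Cmult_assoc, (Cmod_mult (z - a)), (Cmod_mult (1 - _)).
      apply Rmult_le_compat; auto using Cmod_ge_0.
      assert (I := mob_identity a z). replace (z - a)%C with (- (a - z))%C by ring. rewrite Cmod_opp.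
      assert (P1 := Cmod_ge_0 (a - z)). assert (P2 := Cmod_ge_0 (1 - Cconj a * z)). assert (P3 := Cmod_ge_0 z).
      assert (0 <= (1 - Cmod a ^ 2) * (1 - Cmod z ^ 2)) by (apply Rmult_le_pos; simpl; nra).
      apply Rsqr_incr_0_var; [unfold Rsqr; simpl in *; lra|exact P2].
    + intros z Hz Hqz. apply Cmult_neq_0; [apply one_minus_conj_nz; assumption|auto].
    + simpl. fold (zprod l (RtoC 0)). change (fold_right _ 0 l) with (lsum (fun a => ln (/ Cmod a)) l).
      rewrite exp_plus, exp_ln by (apply Rinv_0_lt_compat, Pa).
      replace (1 - Cconj a * 0)%C with (RtoC 1) by ring. rewrite Cmult_1_l, H4.
      rewrite <- Cmult_assoc, (Cmod_mult (0 - a)). replace (0 - a)%C with (- a)%C by ring. rewrite Cmod_opp.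
      field. lra.
Qed.

(** The zeros of phi - w in |z| <= r are finitely many; each is exchanged for a larger zero-free
    factor. The price at 0 is the exponential of a finite partial sum of N. *)
Lemma fiber_majorant (phi : CC -> CC) (w : CC) (r : R) : holo 1 phi -> w <> phi (RtoC 0) -> 0 < r < 1 ->
  exists Q x, holo 1 Q /\ (forall z, Cmod z < 1 -> Cmod (phi z - w) <= Cmod (Q z)) /\
    (forall z, Cmod z <= r -> Q z <> RtoC 0) /\ Rbar_le (Finite x) (nevanlinna phi w) /\
    Cmod (Q (RtoC 0)) = Cmod (phi (RtoC 0) - w) * exp x.
Proof.
  intros Hphi Hw Hr.
  assert (C0 := zero_in_disk).
  assert (Hd : holo 1 (fun z => (phi z - w)%C)) by (apply holo_minus; [exact Hphi|apply holo_const]).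
  assert (Hn : (phi (RtoC 0) - w)%C <> RtoC 0) by (apply Cminus_eq_contra; auto).
  destruct (holo_factor (fun z => (phi z - w)%C) r Hd Hr Hn) as [l [q [Hq [E [Hl Hq0]]]]].
  assert (Hl0 : forall a, In a l -> a <> RtoC 0 /\ Cmod a < 1).
  { intros a Ha. split; [|specialize (Hl a Ha); lra].
    exact (zeros_nz l q (fun z => (phi z - w)%C) E Hn a Ha). }
  destruct (remove_zeros l q Hq Hl0) as [Q [H1 [H2 [H3 H4]]]].
  exists Q, (lsum (fun a => ln (/ Cmod a)) l). split; [exact H1|]. split; [|split; [|split]].
  - intros z Hz. rewrite E by exact Hz. auto.
  - intros z Hz. apply H3; [lra|auto].
  - apply (nevanlinna_ge phi q w l); auto. intros a Ha. apply Hl0, Ha.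
  - rewrite E by exact C0. exact H4.
Qed.

(** Majorants of single fibres multiply, and a repeated point counts with its multiplicity. *)
Lemma fibers_majorant (phi : CC -> CC) (l : list CC) (M : CC -> R) (r : R) : holo 1 phi -> 0 < r < 1 ->
  (forall w, In w l -> w <> phi (RtoC 0) /\ Rbar_le (nevanlinna phi w) (Finite (M w))) ->
  exists Q, holo 1 Q /\ (forall z, Cmod z < 1 -> Cmod (zprod l (phi z)) <= Cmod (Q z)) /\
    (forall z, Cmod z <= r -> Q z <> RtoC 0) /\
    Cmod (Q (RtoC 0)) <= Cmod (zprod l (phi (RtoC 0))) * exp (lsum M l).
Proof.
  intros Hphi Hr. induction l as [|w l IH]; intros Hl.
  - exists (fun _ => RtoC 1). split; [apply holo_const|]. split; [intros; simpl; lra|].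
    split; [intros; apply C1_nz|]. simpl. rewrite exp_0. lra.
  - destruct IH as [Q [H1 [H2 [H3 H4]]]]; [intros v Hv; apply Hl; now right|].
    destruct (Hl w (or_introl eq_refl)) as [Hw HM].
    destruct (fiber_majorant phi w r Hphi Hw Hr) as [P [x [K1 [K2 [K3 [K4 K5]]]]]].
    assert (Hx : x <= M w) by exact (Rbar_le_trans (Finite x) _ (Finite (M w)) K4 HM).
    exists (fun z => (P z * Q z)%C). split; [apply holo_mult; assumption|]. split; [|split].
    + intros z Hz. simpl. fold (zprod l (phi z)). rewrite !Cmod_mult.
      apply Rmult_le_compat; auto using Cmod_ge_0.
    + intros z Hz. apply Cmult_neq_0; auto.
    + simpl. fold (zprod l (phi (RtoC 0))). change (fold_right _ 0 l) with (lsum M l).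
      rewrite !Cmod_mult, exp_plus, K5.
      apply Rle_trans with ((Cmod (phi (RtoC 0) - w) * exp (M w)) * (Cmod (zprod l (phi (RtoC 0))) * exp (lsum M l))).
      * apply Rmult_le_compat; auto using Cmod_ge_0.
        -- apply Rmult_le_pos; [apply Cmod_ge_0|left; apply exp_pos].
        -- apply Rmult_le_compat_l; [apply Cmod_ge_0|apply exp_le', Hx].
      * right. ring.
Qed.

Lemma polar (z : CC) : exists t, z = circ (Cmod z) t.
Proof.
  destruct (Ceq_dec z (RtoC 0)) as [->|n].
  - exists 0. rewrite Cmod_0. apply injective_projections; simpl; ring.
  - assert (P := proj1 (Cmod_gt_0 z) n). set (m := Cmod z) in *.
    assert (Hm : fst z ^ 2 + snd z ^ 2 = m ^ 2).
    { unfold m, Cmod. rewrite pow2_sqrt; [reflexivity|]. apply Rplus_le_le_0_compat; apply pow2_ge_0. }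
    set (x := fst z / m). set (y := snd z / m).
    assert (Hxy : x * x + y * y = 1).
    { unfold x, y. replace (fst z / m * (fst z / m) + snd z / m * (snd z / m))
        with ((fst z ^ 2 + snd z ^ 2) / m ^ 2) by (field; lra). rewrite Hm. field. lra. }
    assert (Hx : -1 <= x <= 1) by nra.
    assert (Ez : z = (m * x, m * y)) by (apply injective_projections; unfold x, y; simpl; field; lra).
    assert (Hs : sin (acos x) = Rabs y).
    { rewrite sin_acos by exact Hx. rewrite <- sqrt_Rsqr_abs. f_equal. unfold Rsqr. lra. }
    destruct (Rle_dec 0 y) as [L|L].
    + exists (acos x). unfold circ. rewrite cos_acos, Hs, Rabs_right by lra. exact Ez.
    + exists (- acos x). unfold circ. rewrite cos_neg, sin_neg, cos_acos, Hs, Rabs_left by lra.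
      rewrite Ropp_involutive. exact Ez.
Qed.

Lemma self_map_compact (phi : CC -> CC) (r : R) : self_map phi -> 0 <= r < 1 ->
  exists R0, 0 < R0 < 1 /\ forall z, Cmod z <= r -> Cmod (phi z) <= R0.
Proof.
  intros [Hphi Hself] Hr. change (holo 1 phi) in Hphi.
  destruct (compact_unif (fun d p => forall t, Cmod (phi (circ p t)) <= 1 - d) 0 r) as [d [Hd H]].
  - intros p Hp.
    assert (Hc : cc (fun t => phi (circ p t))) by (apply (cc_holo 1); [exact Hphi|lra]).
    assert (P := two_PI_pos).
    destruct (continuity_ab_maj (fun t => Cmod (phi (circ p t))) 0 (2 * PI)) as [x [Hx _]]; [lra| |].
    { intros c _. apply continuity_pt_filterlim. apply (rc_Cmod _ Hc c). }
    set (e := 1 - Cmod (phi (circ p x))).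
    assert (He : 0 < e).
    { assert (X : in_disk (phi (circ p x))) by (apply Hself; unfold in_disk; rewrite Cmod_circ; lra).
      unfold in_disk in X. unfold e. lra. }
    destruct (circle_unif phi p) with (e := e / 2) as [d [Hd H]]; try lra.
    { intros z Hz. apply (holo_cont 1); [exact Hphi|lra]. }
    exists (Rmin d (e / 2)). split; [apply Rmin_glb_lt; lra|].
    intros p' _ Hp' t.
    assert (M1 := Rmin_l d (e / 2)). assert (M2 := Rmin_r d (e / 2)).
    specialize (H p' ltac:(lra) t).
    destruct (circ_period_pt 1 t) as [t' [Ht' E]].
    assert (B : Cmod (phi (circ p t)) <= 1 - e).
    { rewrite circ_RtoC, <- E, <- circ_RtoC. unfold e. specialize (Hx t' Ht'). lra. }
    replace (phi (circ p' t)) with ((phi (circ p' t) - phi (circ p t)) + phi (circ p t))%C by ring.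
    eapply Rle_trans; [apply Cmod_triangle|]. lra.
  - intros d d' t Hd H u. specialize (H u). lra.
  (* Capping at 1/2 makes the resulting radius positive. *)
  - exists (1 - Rmin d (1 / 2)). assert (M1 := Rmin_l d (1 / 2)). assert (M2 := Rmin_r d (1 / 2)).
    assert (0 < Rmin d (1 / 2)) by (apply Rmin_glb_lt; lra).
    split; [lra|]. intros z Hz. destruct (polar z) as [t ->].
    specialize (H (Cmod z)). assert (Pz := Cmod_ge_0 z). specialize (H ltac:(lra) t). lra.
Qed.

(** * Counting functions and compositions *)

Lemma circle_min_pos (u : R -> CC) : cc u -> (forall t, u t <> RtoC 0) ->
  exists k, 0 < k /\ forall t, 0 <= t <= 2 * PI -> k <= Cmod (u t).
Proof.
  intros H Hn. assert (P := two_PI_pos).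
  destruct (continuity_ab_min (fun t => Cmod (u t)) 0 (2 * PI)) as [x [Hx _]]; [lra| |].
  - intros c _. apply continuity_pt_filterlim. apply (rc_Cmod _ H c).
  - exists (Cmod (u x)). split; [apply Cmod_gt_0, Hn|exact Hx].
Qed.

(** F(phi) - c is the product of the phi - w over the listed c-points [w] of F, times q(phi). With
    zero-free majorants in place of the phi - w it is dominated by a function [G] without zeros on
    |z| <= s, for which the mean of log |G| is at most log |G(0)|. *)
Lemma composition_log_upper (phi F : CC -> CC) (c : CC) (l : list CC) (q : CC -> CC) (M : CC -> R) (r s : R) :
  self_map phi -> 0 < r < s -> s < 1 -> holo 1 q ->
  (forall z, Cmod z < 1 -> (F z - c = zprod l z * q z)%C) ->
  (forall z, Cmod z <= s -> q (phi z) <> RtoC 0) ->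
  F (phi (RtoC 0)) <> c ->
  (forall w, In w l -> w <> phi (RtoC 0) /\ Rbar_le (nevanlinna phi w) (Finite (M w))) ->
  exists k, 0 < k /\ cmean (fun t => lmax k (F (phi (circ r t)) - c)) <=
    ln (Cmod (F (phi (RtoC 0)) - c)) + lsum M l.
Proof.
  intros [Hphi Hself] Hr Hs Hq E Hqn Hc HM. change (holo 1 phi) in Hphi.
  assert (C0 := zero_in_disk).
  destruct (fibers_majorant phi l M s Hphi ltac:(lra) HM) as [Q [H1 [H2 [H3 H4]]]].
  set (G := fun z => (Q z * q (phi z))%C).
  assert (HG : holo 1 G) by (apply holo_mult; [exact H1|apply (holo_comp 1 1 q phi); assumption]).
  assert (HGn : forall z, Cmod z <= s -> G z <> RtoC 0) by (intros z Hz; apply Cmult_neq_0; auto).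
  assert (HGd : forall z, Cmod z < 1 -> Cmod (F (phi z) - c) <= Cmod (G z)).
  { intros z Hz. rewrite E by (apply Hself, Hz). unfold G. rewrite !Cmod_mult.
    apply Rmult_le_compat_r; [apply Cmod_ge_0|auto]. }
  assert (HcG : cc (fun t => G (circ r t))) by (apply (cc_holo 1); [exact HG|lra]).
  assert (HnG : forall t, G (circ r t) <> RtoC 0) by (intros t; apply HGn; rewrite Cmod_circ; lra).
  (* Truncation below the minimum of |G| on the circle keeps the left side under log |G|. *)
  destruct (circle_min_pos _ HcG HnG) as [k [Hk Hkm]].
  exists k. split; [exact Hk|].
  assert (HcF : cc (fun t => (F (phi (circ r t)) - c)%C)).
  { assert (HF : holo 1 (fun z => (F (phi z) - c)%C)).
    { apply (holo_ext 1 (fun z => (zprod l (phi z) * q (phi z))%C)).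
      - intros z Hz. symmetry. apply E, Hself, Hz.
      - apply (holo_comp 1 1 (fun w => (zprod l w * q w)%C) phi); try assumption.
        apply holo_mult; [apply holo_zprod|exact Hq]. }
    apply (cc_holo 1 r (fun z => (F (phi z) - c)%C) HF). lra. }
  apply Rle_trans with (cmean (fun t => ln (Cmod (G (circ r t))))).
  - apply cmean_le.
    + apply rc_lmax; assumption.
    + apply rc_ln; assumption.
    + intros t. apply ln_le'; [apply Rlt_le_trans with k; [exact Hk|apply Rmax_r]|].
      apply Rmax_lub.
      * apply HGd. rewrite Cmod_circ; lra.
      * destruct (circ_period_pt 1 t) as [t' [Ht' Et]].
        rewrite circ_RtoC, <- Et, <- circ_RtoC. apply Hkm, Ht'.
  - eapply Rle_trans.
    + apply (jensen_zero_free G s r); [apply (holo_sub 1); [lra|exact HG]|lra|]. intros z Hz. apply HGn. lra.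
    + assert (P : 0 < Cmod (F (phi (RtoC 0)) - c)) by (apply Cmod_gt_0, Cminus_eq_contra, Hc).
      rewrite <- (ln_exp (lsum M l)), <- ln_mult by (auto using exp_pos).
      apply ln_le'; [apply Cmod_gt_0, HGn; rewrite Cmod_0; lra|].
      unfold G. rewrite E by (apply Hself; exact C0). rewrite !Cmod_mult.
      replace (Cmod (zprod l (phi (RtoC 0))) * Cmod (q (phi (RtoC 0))) * exp (lsum M l))
        with (Cmod (zprod l (phi (RtoC 0))) * exp (lsum M l) * Cmod (q (phi (RtoC 0)))) by ring.
      apply Rmult_le_compat_r; [apply Cmod_ge_0|exact H4].
Qed.

(* Index 0 carries the disk automorphism exchanging 0 and [phi 0]; it absorbs the singularity of the
   counting function at [phi 0]. *)
Definition test_fun (a : CC) (F : CC -> CC) (j : nat) : CC -> CC :=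
  match j with O => fun z => F (mob a z) | S _ => F end.

(** The majorant of N is summed over the c-points of F in |w| <= R0, a disk containing phi of |z| <=
    s. Each resulting sum of [blog] is bounded through [jensen_zeros], for F on the circles rho_j
    and for F composed with [mob a] at index 0. The exceptions w = a and w = 0 correspond to the
    excluded values c = F a and c = F 0. *)
Lemma composition_dominated (phi F : CC -> CC) (J : nat) (wt rho : nat -> R) (r s R0 : R) :
  self_map phi -> holo 1 F -> 0 < r < s -> s < 1 -> 0 < R0 < 1 ->
  (forall z, Cmod z <= s -> Cmod (phi z) <= R0) ->
  (forall j, 0 <= wt j) -> (forall j, 0 < rho j < 1) ->
  let a := phi (RtoC 0) in
  (forall w, Cmod w <= R0 -> w <> a -> w <> RtoC 0 ->
     Rbar_le (nevanlinna phi w) (Finite (wt 0%nat * blog (rho 0%nat) (mob a w)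
       + rsum (fun j => wt (S j) * blog (rho (S j)) w) (S J)))) ->
  pointwise_dominated (fun t => F (phi (circ r t))) (F a) (S (S J)) wt
    (fun j t => test_fun a F j (circ (rho j) t)) (fun j => test_fun a F j (RtoC 0)).
Proof.
  intros Hphi HF Hr Hs HR0 Hbd Hwt Hrho a HM c k Hk Hc0 Hcj.
  assert (C0 := zero_in_disk).
  assert (Ha : Cmod a < 1) by (apply (proj2 Hphi), C0).
  (* All indices from 1 on have base value F 0, and with [S (S J)] indices there is always an index
     1. *)
  assert (Hc1 : c <> F (RtoC 0)) by (apply (Hcj 1%nat); lia).
  assert (Hd : holo 1 (fun z => (F z - c)%C)) by (apply holo_minus; [exact HF|apply holo_const]).
  assert (Hn0 : (F (RtoC 0) - c)%C <> RtoC 0) by (apply Cminus_eq_contra; auto).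
  destruct (holo_factor (fun z => (F z - c)%C) R0 Hd HR0 Hn0) as [l [q [Hq [E [Hl Hqn]]]]].
  assert (HlF : forall w, In w l -> Cmod w < 1 /\ F w = c).
  { intros w Hw. assert (L : Cmod w < 1) by (specialize (Hl w Hw); lra). split; [exact L|].
    apply (proj2 (Ceq_minus _ _)). rewrite E by exact L.
    destruct (Classical_Prop.classic (zprod l w = RtoC 0)) as [Z|Z]; [rewrite Z; ring|].
    exfalso. exact (zprod_nz_inv l w Z w Hw eq_refl). }
  set (M := fun w => wt 0%nat * blog (rho 0%nat) (mob a w)
       + rsum (fun j => wt (S j) * blog (rho (S j)) w) (S J)).
  destruct (composition_log_upper phi F c l q M r s) as [k0 [Hk0 Hup]]; auto.
  { intros w Hw. destruct (HlF w Hw) as [L Ew].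
    assert (Na : w <> a) by (intros ->; apply Hc0; auto).
    split; [exact Na|]. apply HM; auto. intros ->. apply Hc1. auto. }
  exists k0. split; [exact Hk0|]. eapply Rle_trans; [exact Hup|]. fold a. apply Rplus_le_compat_l.
  unfold M. rewrite lsum_plus, lsum_scal, lsum_rsum, (rsum_shift _ (S J)).
  apply Rplus_le_compat.
  - apply Rmult_le_compat_l; [apply Hwt|]. simpl test_fun.
    destruct (mob_zprod a l Ha) as [u [Hu Eu]]; [intros x Hx; apply HlF, Hx|].
    assert (J0 := jensen_zeros (map (mob a) l) (fun z => (u z * q (mob a z))%C)
       (fun z => (F (mob a z) - c)%C) (rho 0%nat) k (Hrho 0%nat) Hk).
    rewrite lsum_map, mob_0 in J0. rewrite mob_0.
    assert (J1 : ln (Cmod (F a - c)) + lsum (fun w => blog (rho 0%nat) (mob a w)) l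
       <= cmean (fun t => lmax k (F (mob a (circ (rho 0%nat) t)) - c))).
    { apply J0.
      - apply holo_mult; [exact Hu|]. apply (holo_comp 1 1 q (mob a)); auto using mob_holo.
        intros z Hz. apply mob_disk; assumption.
      - intros z Hz. rewrite E by (apply mob_disk; assumption). rewrite Eu by exact Hz. ring.
      - apply Cminus_eq_contra. auto. }
    lra.
  - apply rsum_le. intros j _. rewrite lsum_scal. apply Rmult_le_compat_l; [apply Hwt|].
    simpl test_fun.
    assert (J0 := jensen_zeros l q (fun z => (F z - c)%C) (rho (S j)) k (Hrho (S j)) Hk Hq E Hn0).
    cbv beta in J0. lra.
Qed.

(** * Majorants of the counting function by positive parts of logarithms *)

Lemma mob_sym (a w : CC) : Cmod a < 1 -> Cmod w < 1 -> Cmod (mob w a) = Cmod (mob a w).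
Proof.
  intros Ha Hw. unfold mob. rewrite !Cmod_div by (apply one_minus_conj_nz; assumption).
  replace (w - a)%C with (- (a - w))%C by ring. rewrite Cmod_opp.
  replace (1 - Cconj w * a)%C with (Cconj (1 - Cconj a * w)).
  - now rewrite Cmod_conj.
  - rewrite Cminus_conj, Cmult_conj, Cconj_conj.
    replace (Cconj (RtoC 1)) with (RtoC 1) by (apply injective_projections; simpl; ring). ring.
Qed.

(** The composition of [mob w] with phi is bounded by 1 and vanishes on the fibre of [w], so
    Jensen's inequality bounds the zero sum by minus the logarithm of its modulus at 0. *)
Lemma littlewood (phi : CC -> CC) (w : CC) : self_map phi -> Cmod w < 1 -> w <> phi (RtoC 0) ->
  Rbar_le (nevanlinna phi w) (Finite (ln (/ Cmod (mob (phi (RtoC 0)) w)))).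
Proof.
  intros [Hphi Hself] Hw Hne. change (holo 1 phi) in Hphi.
  assert (C0 := zero_in_disk).
  set (a := phi (RtoC 0)) in *. assert (Ha : Cmod a < 1) by (apply Hself, C0).
  unfold nevanlinna. destruct (excluded_middle_informative _) as [X|_]; [contradiction|].
  apply Lub_Rbar_correct. intros x [L [HL1 [HL2 ->]]]. simpl.
  destruct (divisor_factor phi w L Hphi HL1 HL2) as [g [Hg Eg]].
  set (l := expand L) in *.
  set (G := fun z => mob w (phi z)).
  assert (HG : holo 1 G) by (apply (holo_comp 1 1 (mob w) phi); auto using mob_holo).
  set (h := fun z => (- RtoC 1 * g z * / (1 - Cconj w * phi z))%C).
  assert (Hh : holo 1 h).
  { apply (holo_mult 1 (fun z => (- RtoC 1 * g z)%C) (fun z => (/ (1 - Cconj w * phi z))%C)).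
    - apply holo_mult; [apply holo_const|exact Hg].
    - apply (holo_inv 1 (fun z => (1 - Cconj w * phi z)%C)).
      + apply holo_minus; [apply holo_const|apply holo_mult; [apply holo_const|exact Hphi]].
      + intros z Hz. apply one_minus_conj_nz; [exact Hw|apply Hself, Hz]. }
  assert (EG : forall z, Cmod z < 1 -> G z = (zprod l z * h z)%C).
  { intros z Hz. assert (N := one_minus_conj_nz w (phi z) Hw (Hself z Hz)).
    unfold G, h, mob, Cdiv. replace (w - phi z)%C with (- (phi z - w))%C by ring.
    rewrite Eg by exact Hz. ring. }
  assert (HG0 : G (RtoC 0) <> RtoC 0).
  { apply mob_nz; auto. }
  assert (P0 : 0 < Cmod (G (RtoC 0))) by (apply Cmod_gt_0, HG0).
  rewrite weighted_log_sum_expand. fold l.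
  rewrite <- mob_sym by assumption. change (mob w a) with (G (RtoC 0)).
  apply blog_sum_limit.
  - intros b Hb. apply Cmod_gt_0. exact (zeros_nz l h G EG HG0 b Hb).
  - intros r Hr. assert (K := jensen_zeros_sq l h G r Hr Hh EG HG0).
    assert (K1 : int_mean2 G r <= 1).
    { apply (cmean_le_const (fun t => Cmod (G (circ r t)) ^ 2)).
      - apply rc_pow, rc_Cmod. apply (cc_holo 1); [exact HG|lra].
      - intros t. rewrite <- (pow1 2). apply pow_incr. split; [apply Cmod_ge_0|].
        left. apply mob_disk; [exact Hw|]. apply Hself. unfold in_disk. rewrite Cmod_circ; lra. }
    rewrite ln_Rinv by exact P0.
    assert (K2 : ln (Cmod (G (RtoC 0)) ^ 2 * exp (2 * lsum (blog r) l)) <= ln 1).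
    { apply ln_le'; [apply Rmult_lt_0_compat; [apply pow_lt, P0|apply exp_pos]|lra]. }
    rewrite ln_mult, ln_exp, ln_1 in K2 by (try apply exp_pos; apply pow_lt, P0).
    replace (Cmod (G (RtoC 0)) ^ 2) with (Cmod (G (RtoC 0)) * Cmod (G (RtoC 0))) in K2 by ring.
    rewrite ln_mult in K2 by assumption. lra.
Qed.

Lemma blog_pos (r : R) (a : CC) : 0 < Cmod a -> 0 <= blog r a.
Proof.
  intros Ha. unfold blog. rewrite <- ln_1. apply ln_le'; [lra|].
  apply (Rmult_le_reg_r (Cmod a)); [exact Ha|].
  replace (Rmax r (Cmod a) / Cmod a * Cmod a) with (Rmax r (Cmod a)) by (field; lra).
  rewrite Rmult_1_l. apply Rmax_r.
Qed.

Definition rho_seq (j : nat) : R := exp (- (/ 2) ^ j).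

Lemma dyadic_index (x : R) (J : nat) : 0 < x -> x < 2 -> (/ 2) ^ J <= x ->
  exists j, (j < S J)%nat /\ (/ 2) ^ j <= x < 2 * (/ 2) ^ j.
Proof.
  intros Hx Hx2. induction J as [|J IH]; intros H.
  - exists 0%nat. split; [lia|]. simpl in *. lra.
  - destruct (Rle_dec ((/ 2) ^ J) x) as [L|L].
    + destruct (IH L) as [j [Hj K]]. exists j. split; [lia|exact K].
    + exists (S J). split; [lia|]. split; [exact H|]. simpl. lra.
Qed.

(** One term is enough: for h = 2^(-j) <= L / 2 < 2 h the logarithm [blog] is at least L - h >= L /
    2, and L^(2n) <= (4 h)^(2n) = 16^n 4^(-nj). The condition on [J] guarantees that this j occurs
    in the sum. *)
Lemma log_power_dyadic (n J : nat) (w : CC) : 0 < Cmod w -> exp (-1) <= Cmod w -> Cmod w < 1 ->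
  (/ 2) ^ J <= ln (/ Cmod w) / 2 ->
  ln (/ Cmod w) ^ (2 * n + 1) <= 2 * 16 ^ n * rsum (fun j => (/ 4) ^ (n * j) * blog (rho_seq j) w) (S J).
Proof.
  intros Hw He Hw1 HJ. set (L := ln (/ Cmod w)) in *.
  assert (HL : 0 < L <= 1).
  { unfold L. rewrite ln_Rinv by exact Hw. split.
    - assert (ln (Cmod w) < ln 1) by (apply ln_increasing; lra). rewrite ln_1 in H. lra.
    - assert (ln (exp (-1)) <= ln (Cmod w)) by (apply ln_le'; [apply exp_pos|exact He]).
      rewrite ln_exp in H. lra. }
  destruct (dyadic_index (L / 2) J) as [j [Hj [H1 H2]]]; try lra.
  assert (Ph : forall m, 0 < (/ 2) ^ m) by (intros; apply pow_lt; lra).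
  set (h := (/ 2) ^ j) in *.
  assert (Bj : L / 2 <= blog (rho_seq j) w).
  { assert (B := blog_ge (rho_seq j) w (exp_pos _) Hw). fold L in B.
    unfold rho_seq in B at 1. rewrite ln_exp in B. fold h in B. lra. }
  assert (T : (/ 4) ^ (n * j) * blog (rho_seq j) w <= rsum (fun j => (/ 4) ^ (n * j) * blog (rho_seq j) w) (S J)).
  { apply (rsum_term (fun j => (/ 4) ^ (n * j) * blog (rho_seq j) w)); [|exact Hj].
    intros i. apply Rmult_le_pos; [apply pow_le; lra|apply blog_pos, Hw]. }
  assert (P16 : 0 < 16 ^ n) by (apply pow_lt; lra).
  apply Rle_trans with (2 * 16 ^ n * ((/ 4) ^ (n * j) * blog (rho_seq j) w)).
  2:{ apply Rmult_le_compat_l; [lra|exact T]. }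
  rewrite pow_add, pow_1.
  assert (E4 : 16 ^ n * (/ 4) ^ (n * j) = (4 * h) ^ (2 * n)).
  { rewrite (Nat.mul_comm n j), pow_mult, <- Rpow_mult_distr. rewrite pow_mult. f_equal.
    unfold h. replace (/ 4) with (/ 2 * / 2) by lra. rewrite !Rpow_mult_distr. simpl. ring. }
  assert (LP : L ^ (2 * n) <= (4 * h) ^ (2 * n)) by (apply pow_incr; lra).
  replace (2 * 16 ^ n * ((/ 4) ^ (n * j) * blog (rho_seq j) w))
    with (16 ^ n * (/ 4) ^ (n * j) * (2 * blog (rho_seq j) w)) by ring.
  rewrite E4. apply Rmult_le_compat; try lra. apply pow_le; lra.
Qed.

(** Littlewood's bound is the logarithm for radius 1, but Jensen's formula takes place on a circle
    of radius p < 1. For |w| <= d the automorphism stays in a disk of radius p0 < p, where [blog p]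
    is bounded below by [la], and the difference - log p is absorbed into [K]. *)
Lemma nevanlinna_middle (phi : CC -> CC) (d : R) : self_map phi -> d < 1 ->
  exists K p, 0 < K /\ 0 < p < 1 /\ forall w, Cmod w <= d -> w <> phi (RtoC 0) ->
    Rbar_le (nevanlinna phi w) (Finite (K * blog p (mob (phi (RtoC 0)) w))).
Proof.
  intros Hphi Hd1. assert (C0 : Cmod (RtoC 0) < 1) by (rewrite Cmod_0; lra).
  set (a := phi (RtoC 0)). assert (Ha : Cmod a < 1) by (apply (proj2 Hphi), C0).
  (* [d] may be negative, whereas [self_map_compact] takes a radius. *)
  set (d' := Rmax d 0). assert (Hd' : 0 <= d' < 1) by (split; [apply Rmax_r|apply Rmax_lub_lt; lra]).
  destruct (self_map_compact (mob a) d') as [p0 [Hp0 Hm]]; [|exact Hd'|].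
  { split; [exact (mob_holo a Ha)|]. intros z Hz. apply mob_disk; assumption. }
  set (p := (1 + p0) / 2). set (la := ln (p / p0)).
  assert (Hp : 0 < p < 1) by (unfold p; lra).
  assert (Hla : 0 < la).
  { unfold la. rewrite <- ln_1. apply ln_increasing; [lra|]. apply (Rmult_lt_reg_r p0); [lra|].
    replace (p / p0 * p0) with p by (field; lra). unfold p; lra. }
  assert (Hlp : 0 < - ln p).
  { assert (ln p < ln 1) by (apply ln_increasing; lra). rewrite ln_1 in H. lra. }
  assert (HK : 0 < 1 + - ln p / la) by (assert (0 < - ln p / la) by (apply Rdiv_lt_0_compat; lra); lra).
  exists (1 + - ln p / la), p. split; [exact HK|]. split; [exact Hp|].
  intros w Hw Hwa.
  assert (Hwd : Cmod w <= d') by (eapply Rle_trans; [exact Hw|apply Rmax_l]).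
  eapply Rbar_le_trans; [apply littlewood; [exact Hphi|lra|exact Hwa]|]. fold a. simpl.
  specialize (Hm w Hwd). set (x := Cmod (mob a w)) in *.
  assert (Px : 0 < x).
  { apply Cmod_gt_0, mob_nz; auto. lra. }
  assert (B := blog_ge p (mob a w) ltac:(lra) Px). fold x in B.
  assert (B2 : la <= blog p (mob a w)).
  { unfold la, blog. fold x. apply ln_le'; [apply Rdiv_lt_0_compat; lra|].
    apply Rmult_le_compat; try lra.
    - left; apply Rinv_0_lt_compat; lra.
    - apply Rmax_l.
    - apply Rinv_le_contravar; lra. }
  assert (E : - ln p <= - ln p / la * blog p (mob a w)).
  { apply Rle_trans with (- ln p / la * la); [right; field; lra|].
    apply Rmult_le_compat_l; [left; apply Rdiv_lt_0_compat; lra|exact B2]. }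
  lra.
Qed.

(** * Sufficiency *)

(** The m-th power of 1 + y <= m (1 + y / m) <= m exp (y / m). *)
Lemma power_exp_bound (m : nat) (y : R) : (1 <= m)%nat -> 0 <= y -> (1 + y) ^ m <= INR m ^ m * exp y.
Proof.
  intros Hm Hy. assert (Pm : 1 <= INR m) by (apply (le_INR 1), Hm).
  assert (E : exp y = exp (y / INR m) ^ m).
  { rewrite exp_pow_INR. f_equal. field. lra. }
  rewrite E, <- Rpow_mult_distr. apply pow_incr. split; [lra|].
  assert (H := exp_ineq1_le (y / INR m)).
  assert (0 <= y / INR m) by (apply Rdiv_le_0_compat; lra).
  apply Rle_trans with (INR m * (1 + y / INR m)).
  - replace (INR m * (1 + y / INR m)) with (INR m + y) by (field; lra). lra.
  - apply Rmult_le_compat_l; lra.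
Qed.

(* [y / ((1 + y) (2 + y))] is the increment of [y / (1 + y)] between [y/2] and [y], so the dyadic
   sum telescopes. *)
Lemma dyadic_moment (n : nat) : (1 <= n)%nat -> exists C, 0 < C /\ forall J k,
  INR (S k) ^ (2 * n) * rsum (fun j => (/ 4) ^ (n * j) * (rho_seq j ^ 2) ^ k) J <= C.
Proof.
  intros Hn. set (m := (2 * n + 1)%nat). set (A := 2 * INR m ^ m).
  assert (Pm : 0 < INR m) by (apply lt_0_INR; unfold m; lia).
  assert (PA : 0 < A) by (assert (0 < INR m ^ m) by (apply pow_lt, Pm); unfold A; lra).
  assert (Pe := exp_pos 2).
  exists (A * exp 2). split; [nra|]. intros J k.
  set (y := fun j => INR (S k) * (/ 2) ^ j). set (g := fun x => x / (1 + x)).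
  assert (Ph : forall j, 0 < (/ 2) ^ j) by (intros; apply pow_lt; lra).
  assert (Pk : 0 < INR (S k)) by (apply lt_0_INR; lia).
  assert (Py : forall j, 0 < y j) by (intros j; apply Rmult_lt_0_compat; auto).
  assert (Hterm : forall j, INR (S k) ^ (2 * n) * ((/ 4) ^ (n * j) * (rho_seq j ^ 2) ^ k)
     <= A * exp 2 * (g (y j) - g (y (S j)))).
  { intros j. set (h := (/ 2) ^ j).
    assert (Hh : 0 < h <= 1).
    { split; [apply Ph|]. unfold h. rewrite <- (pow1 j). apply pow_incr; lra. }
    assert (E1 : INR (S k) ^ (2 * n) * (/ 4) ^ (n * j) = y j ^ (2 * n)).
    { unfold y. rewrite Rpow_mult_distr. f_equal. rewrite <- pow_mult.
      replace (j * (2 * n))%nat with (2 * (n * j))%nat by lia. rewrite (pow_mult (/ 2)). f_equal. simpl. lra. }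
    (* Passing from k to k + 1 in the exponent costs exp (2 h), which is at most exp 2. *)
    assert (E2 : (rho_seq j ^ 2) ^ k = exp (2 * h) * exp (- (2 * y j))).
    { unfold rho_seq. fold h. rewrite <- exp_plus, <- pow_mult.
      rewrite exp_pow_INR. f_equal. unfold y. fold h. rewrite mult_INR, (S_INR k). simpl. ring. }
    rewrite <- Rmult_assoc, E1, E2.
    assert (Ey : y (S j) = y j / 2) by (unfold y; simpl; field).
    rewrite Ey. specialize (Py j). set (x := y j) in *.
    assert (Eg : g x - g (x / 2) = x / ((1 + x) * (2 + x))) by (unfold g; field; lra).
    rewrite Eg.
    assert (Eh : exp (2 * h) <= exp 2) by (apply exp_le'; lra).
    assert (B := power_exp_bound m x ltac:(unfold m; lia) ltac:(lra)).
    (* With n >= 1 a factor x can be split off to match the increment of [g]; the remaining power is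
       absorbed by the exponential. *)
    assert (B2 : x ^ (2 * n) * ((1 + x) * (2 + x)) <= x * (A * exp x)).
    { replace (2 * n)%nat with (S (2 * n - 1)) by lia. simpl pow.
      replace (x * x ^ (n + (n + 0) - 1) * ((1 + x) * (2 + x))) with (x * (x ^ (n + (n + 0) - 1) * ((1 + x) * (2 + x)))) by ring.
      apply Rmult_le_compat_l; [lra|].
      apply Rle_trans with ((1 + x) ^ (n + (n + 0) - 1) * ((1 + x) * (2 * (1 + x)))).
      - apply Rmult_le_compat; [apply pow_le; lra|nra|apply pow_incr; lra|nra].
      - replace ((1 + x) ^ (n + (n + 0) - 1) * ((1 + x) * (2 * (1 + x)))) with (2 * (1 + x) ^ m).
        + unfold A. rewrite Rmult_assoc. apply Rmult_le_compat_l; [lra|exact B].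
        + unfold m. replace (2 * n + 1)%nat with ((n + (n + 0) - 1) + 2)%nat by lia. rewrite pow_add. simpl. ring. }
    assert (Pex := exp_pos x). assert (Pex2 := exp_pos (- (2 * x))).
    assert (E3 : exp x * exp (- (2 * x)) <= 1).
    { rewrite <- exp_plus, <- exp_0. apply exp_le'. lra. }
    apply (Rmult_le_reg_r ((1 + x) * (2 + x))); [nra|].
    replace (A * exp 2 * (x / ((1 + x) * (2 + x))) * ((1 + x) * (2 + x))) with (x * A * exp 2) by (field; lra).
    replace (x ^ (2 * n) * (exp (2 * h) * exp (- (2 * x))) * ((1 + x) * (2 + x)))
      with ((x ^ (2 * n) * ((1 + x) * (2 + x))) * exp (- (2 * x)) * exp (2 * h)) by ring.
    assert (P2h := exp_pos (2 * h)).
    apply Rmult_le_compat; try lra.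
    - apply Rmult_le_pos; [|lra]. apply Rmult_le_pos; [apply pow_le; lra|nra].
    - apply Rle_trans with (x * (A * exp x) * exp (- (2 * x))); [apply Rmult_le_compat_r; lra|].
      replace (x * (A * exp x) * exp (- (2 * x))) with (x * A * (exp x * exp (- (2 * x)))) by ring.
      rewrite <- (Rmult_1_r (x * A)) at 2. apply Rmult_le_compat_l; [nra|exact E3]. }
  rewrite <- rsum_scal.
  apply Rle_trans with (rsum (fun j => A * exp 2 * (g (y j) - g (y (S j)))) J).
  - apply rsum_le. intros j _. apply Hterm.
  - rewrite rsum_scal.
    assert (Tel : rsum (fun j => g (y j) - g (y (S j))) J = g (y 0%nat) - g (y J)).
    { clear. induction J as [|J IH]; simpl; [ring|]. rewrite IH. ring. }
    rewrite Tel.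
    assert (G0 : g (y 0%nat) <= 1) by (unfold g; specialize (Py 0%nat); apply Rle_div_l; lra).
    assert (GJ : 0 <= g (y J)) by (unfold g; specialize (Py J); apply Rdiv_le_0_compat; lra).
    rewrite <- (Rmult_1_r (A * exp 2)) at 2. apply Rmult_le_compat_l; [nra|lra].
Qed.

Lemma is_lim_seq_rsum (u : nat -> nat -> R) (l : nat -> R) (J : nat) :
  (forall j, (j < J)%nat -> is_lim_seq (u j) (l j)) ->
  is_lim_seq (fun K => rsum (fun j => u j K) J) (rsum l J).
Proof.
  induction J as [|J IH]; intros H; simpl; [apply is_lim_seq_const|].
  apply is_lim_seq_plus'; [apply IH; auto|apply H; lia].
Qed.

Lemma rho_seq_bounds (j : nat) : 0 < rho_seq j < 1.
Proof.
  split; [apply exp_pos|]. rewrite <- exp_0. apply exp_increasing.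
  assert (0 < (/ 2) ^ j) by (apply pow_lt; lra). lra.
Qed.

Lemma index_power (n k : nat) : (1 <= n)%nat -> INR (k + n) ^ n <= INR n ^ n * INR (S k) ^ n.
Proof.
  intros Hn. rewrite <- Rpow_mult_distr, <- mult_INR. apply pow_incr.
  split; [apply pos_INR|]. apply le_INR. nia.
Qed.

(** Parseval on each circle: n derivatives multiply the squared coefficients by about k^(2n), and
    [dyadic_moment] takes this back. The constant is uniform in [J], since the number of scales will
    depend on the radius r. *)
Lemma derivative_dyadic_means (n : nat) : (1 <= n)%nat -> exists C, 0 < C /\ forall f J, in_H2 f ->
  rsum (fun j => (/ 4) ^ (n * j) * int_mean2 (Cderiv_n n f) (rho_seq j)) J <= C * H2_norm2 f.
Proof.
  intros Hn. destruct (dyadic_moment n Hn) as [C [HC HCk]].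
  assert (Pn : 0 < INR n) by (apply lt_0_INR; lia).
  assert (Pnn : 0 < INR n ^ (2 * n)) by (apply pow_lt, Pn).
  exists (INR n ^ (2 * n) * C). split; [nra|]. intros f J Hf.
  set (F := Cderiv_n n f). assert (HF : holo 1 F) by apply (holo_deriv_n n f (proj1 Hf)).
  set (u := fun j K => (/ 4) ^ (n * j) * rsum (fun k => Cmod (coef F k) ^ 2 * (rho_seq j ^ 2) ^ k) K).
  assert (L : is_lim_seq (fun K => rsum (fun j => u j K) J)
     (rsum (fun j => (/ 4) ^ (n * j) * int_mean2 F (rho_seq j)) J)).
  { apply is_lim_seq_rsum. intros j _. unfold u. apply is_lim_seq_mult'; [apply is_lim_seq_const|].
    apply parseval; [exact HF|apply rho_seq_bounds]. }
  apply (is_lim_seq_le _ (fun _ => INR n ^ (2 * n) * C * H2_norm2 f) (Finite _) (Finite _)) with (2 := L);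
    [|apply is_lim_seq_const].
  intros K. unfold u.
  rewrite (rsum_ext _ (fun j => rsum (fun k => Cmod (coef F k) ^ 2 * ((/ 4) ^ (n * j) * (rho_seq j ^ 2) ^ k)) K)).
  2:{ intros j _. rewrite <- rsum_scal. apply rsum_ext. intros; ring. }
  rewrite rsum_exchange.
  apply Rle_trans with (rsum (fun k => INR n ^ (2 * n) * C * Cmod (coef f (n + k)) ^ 2) K).
  - apply rsum_le. intros k _. rewrite rsum_scal.
    assert (A := coef_deriv_n n f k (proj1 Hf)). fold F in A.
    assert (PF := Cmod_ge_0 (coef F k)).
    set (x := Cmod (coef f (n + k))). rewrite (Nat.add_comm k n) in A. fold x in A.
    assert (Px : 0 <= x) by apply Cmod_ge_0.
    assert (I := index_power n k Hn). rewrite (Nat.add_comm k n) in I.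
    assert (Hsq : Cmod (coef F k) ^ 2 <= (INR n ^ n * INR (S k) ^ n * x) ^ 2).
    { apply pow_incr. split; [exact PF|]. eapply Rle_trans; [exact A|].
      apply Rmult_le_compat_r; assumption. }
    set (Sj := rsum (fun j => (/ 4) ^ (n * j) * (rho_seq j ^ 2) ^ k) J) in *.
    assert (PS : 0 <= Sj).
    { apply rsum_pos. intros j _. apply Rmult_le_pos; [apply pow_le; lra|].
      apply pow_le, pow_le. assert (X := rho_seq_bounds j). lra. }
    specialize (HCk J k). fold Sj in HCk.
    apply Rle_trans with ((INR n ^ n * INR (S k) ^ n * x) ^ 2 * Sj); [apply Rmult_le_compat_r; assumption|].
    replace ((INR n ^ n * INR (S k) ^ n * x) ^ 2 * Sj)
      with (INR n ^ (2 * n) * (INR (S k) ^ (2 * n) * Sj) * x ^ 2).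
    2:{ replace (2 * n)%nat with (n + n)%nat by lia. rewrite !pow_add. ring. }
    apply Rmult_le_compat_r; [apply pow_le, Px|]. apply Rmult_le_compat_l; [lra|exact HCk].
  - rewrite rsum_scal. apply Rmult_le_compat_l; [nra|].
    eapply Rle_trans; [|apply (coef_sum_le_norm2 f (n + K) Hf)].
    rewrite rsum_split.
    assert (0 <= rsum (fun k => Cmod (coef f k) ^ 2) n) by (apply rsum_pos; intros; apply pow_le, Cmod_ge_0). lra.
Qed.

(** The norm enters with a small constant, and the rest is seen only through f^(n) on a fixed
    compact disk. [K] and [R1] are independent of f and r, which gives boundedness and, for weakly
    null sequences, compactness. *)
Lemma main_estimate (phi : CC -> CC) (n : nat) : self_map phi -> (1 <= n)%nat ->
  (forall eps : R, 0 < eps -> exists delta : R, delta < 1 /\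
     forall w : CC, delta < Cmod w -> Cmod w < 1 ->
       Rbar_le (nevanlinna phi w) (Finite (eps * (ln (/ Cmod w)) ^ (2 * n + 1)))) ->
  forall e, 0 < e -> exists K R1, 0 < K /\ 0 < R1 < 1 /\ forall f B r, in_H2 f -> 0 < r < 1 ->
    (forall w, Cmod w <= R1 -> Cmod (Cderiv_n n f w) <= B) ->
    int_mean2 (Dop phi n f) r <= e * H2_norm2 f + K * B ^ 2.
Proof.
  intros Hphi Hn Ho e He.
  assert (C0 := zero_in_disk).
  set (a := phi (RtoC 0)). assert (Ha : Cmod a < 1) by (apply (proj2 Hphi), C0).
  destruct (derivative_dyadic_means n Hn) as [C [HC HCf]].
  assert (P16 : 0 < 16 ^ n) by (apply pow_lt; lra).
  (* The product of the constants of [mean_square_domination], [log_power_dyadic] and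
     [derivative_dyadic_means]. *)
  set (eps := e / (4096 * (2 * 16 ^ n * C))).
  assert (Heps : 0 < eps) by (apply Rdiv_lt_0_compat; [exact He|]; repeat apply Rmult_lt_0_compat; lra).
  destruct (Ho eps Heps) as [delta [Hdelta Hbig]].
  (* Beyond [delta] the hypothesis applies, and beyond exp (-1) so does [log_power_dyadic]. *)
  set (d := Rmax delta (exp (-1))).
  assert (Hd1 : delta <= d) by apply Rmax_l. assert (Hd2 : exp (-1) <= d) by apply Rmax_r.
  assert (Hd : d < 1).
  { apply Rmax_lub_lt; [exact Hdelta|]. rewrite <- exp_0. apply exp_increasing. lra. }
  destruct (nevanlinna_middle phi d Hphi Hd) as [K0 [p [HK0 [Hp Hmid]]]]. fold a in Hmid.
  (* [R1] bounds the image of |z| <= p under [mob a], which contains [a] and all values met by the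
     index 0 mean. *)
  destruct (self_map_compact (mob a) p) as [R1 [HR1 HmR]]; [|lra|].
  { split; [exact (mob_holo a Ha)|]. intros z Hz. apply mob_disk; assumption. }
  exists (4096 * (1 + K0)), R1. split; [lra|]. split; [exact HR1|].
  intros f B r Hf Hr HB.
  set (F := Cderiv_n n f) in *. assert (HF : holo 1 F) by apply (holo_deriv_n n f (proj1 Hf)).
  set (s := (1 + r) / 2).
  destruct (self_map_compact phi s Hphi) as [R0 [HR0 Hsup]]; [unfold s; lra|].
  assert (HlR : 0 < ln (/ R0) / 2).
  { rewrite ln_Rinv by lra. assert (L : ln R0 < ln 1) by (apply ln_increasing; lra).
    rewrite ln_1 in L. lra. }
  (* The number of scales grows with r, because N must be majorised on all of |w| <= R0. *)
  assert (HJ : exists J, (/ 2) ^ J <= ln (/ R0) / 2).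
  { destruct (pow_lt_1_zero (/ 2)) with (y := ln (/ R0) / 2) as [J HJ].
    - rewrite Rabs_right; lra.
    - exact HlR.
    - exists J. specialize (HJ J (le_n J)).
      assert (X := Rle_abs ((/ 2) ^ J)). lra. }
  destruct HJ as [J HJ].
  set (wt := fun j => match j with O => K0 | S i => eps * (2 * 16 ^ n) * (/ 4) ^ (n * i) end).
  set (rho := fun j => match j with O => p | S i => rho_seq i end).
  assert (Hwt : forall j, 0 <= wt j).
  { intros [|j]; simpl; [lra|]. apply Rmult_le_pos; [|apply pow_le; lra]. apply Rmult_le_pos; lra. }
  assert (Hrho : forall j, 0 < rho j < 1) by (intros [|j]; simpl; [exact Hp|apply rho_seq_bounds]).
  assert (Hdom : pointwise_dominated (fun t => F (phi (circ r t))) (F a) (S (S J)) wt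
    (fun j t => test_fun a F j (circ (rho j) t)) (fun j => test_fun a F j (RtoC 0))).
  { apply (composition_dominated phi F J wt rho r s R0); auto; try (unfold s; lra).
    intros w Hw Hwa Hw0. assert (Pw : 0 < Cmod w) by (apply Cmod_gt_0, Hw0).
    assert (Pm : 0 < Cmod (mob a w)).
    { apply Cmod_gt_0, mob_nz; auto. lra. }
    assert (S1 : 0 <= rsum (fun j => wt (S j) * blog (rho (S j)) w) (S J)).
    { apply rsum_pos. intros j _. apply Rmult_le_pos; [apply Hwt|apply blog_pos, Pw]. }
    assert (S2 : 0 <= K0 * blog p (mob a w)) by (apply Rmult_le_pos; [lra|apply blog_pos, Pm]).
    (* Away from the unit circle index 0 alone dominates N, near it the dyadic indices do; the other
       terms are nonnegative. *)
    destruct (Rle_dec (Cmod w) d) as [L|L].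
    - eapply Rbar_le_trans; [apply Hmid; [exact L|exact Hwa]|]. fold a. simpl wt at 1. simpl rho at 1.
      change (K0 * blog p (mob a w) <= K0 * blog p (mob a w) + rsum (fun j => wt (S j) * blog (rho (S j)) w) (S J)).
      lra.
    - eapply Rbar_le_trans; [apply Hbig; lra|].
      change (eps * ln (/ Cmod w) ^ (2 * n + 1) <= K0 * blog p (mob a w)
         + rsum (fun j => wt (S j) * blog (rho (S j)) w) (S J)).
      assert (T := log_power_dyadic n J w Pw ltac:(lra) ltac:(lra)).
      assert (HJw : (/ 2) ^ J <= ln (/ Cmod w) / 2).
      { eapply Rle_trans; [exact HJ|]. assert (ln (/ R0) <= ln (/ Cmod w)); [|lra].
        apply ln_le'; [apply Rinv_0_lt_compat; lra|]. apply Rinv_le_contravar; lra. }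
      specialize (T HJw).
      rewrite (rsum_ext _ (fun j => eps * (2 * 16 ^ n) * ((/ 4) ^ (n * j) * blog (rho_seq j) w)))
        by (intros; simpl wt; simpl rho; ring).
      rewrite rsum_scal.
      apply (Rmult_le_compat_l eps) in T; [|lra]. lra. }
  assert (HcY : forall j, cc (fun t => test_fun a F j (circ (rho j) t))).
  { intros j. apply (cc_holo 1); [|specialize (Hrho j); lra].
    destruct j as [|j]; [|exact HF]. apply (holo_comp 1 1 F (mob a)); auto using mob_holo.
    intros z Hz. apply mob_disk; assumption. }
  assert (HcX : cc (fun t => F (phi (circ r t)))).
  { apply (cc_holo 1 r (fun z => F (phi z))); [|lra].
    apply (holo_comp 1 1 F phi); [exact HF|exact (proj1 Hphi)|exact (proj2 Hphi)]. }
  destruct (circle_bound (fun z => F (phi z)) r HcX) as [BX [_ HBX]].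
  assert (Main := mean_square_domination _ _ _ _ _ _ BX HcX HcY Hwt HBX Hdom).
  change (int_mean2 (Dop phi n f) r <= e * H2_norm2 f + 4096 * (1 + K0) * B ^ 2).
  change (int_mean2 (Dop phi n f) r) with (cmean (fun u => Cmod (F (phi (circ r u))) ^ 2)).
  rewrite rsum_shift in Main.
  assert (B1 : Cmod (F a) ^ 2 <= B ^ 2).
  { apply pow_incr. split; [apply Cmod_ge_0|]. apply HB. rewrite <- (mob_0 a). apply HmR.
    rewrite Cmod_0. lra. }
  assert (B2 : cmean (fun u => Cmod (test_fun a F 0 (circ (rho 0%nat) u)) ^ 2) <= B ^ 2).
  { apply cmean_le_const.
    - apply (rc_pow (fun u => Cmod (test_fun a F 0 (circ (rho 0%nat) u)))), rc_Cmod, HcY.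
    - intros t. apply pow_incr. split; [apply Cmod_ge_0|]. simpl. apply HB, HmR. rewrite Cmod_circ; lra. }
  assert (B3 : rsum (fun j => wt (S j) * cmean (fun u => Cmod (test_fun a F (S j) (circ (rho (S j)) u)) ^ 2)) (S J)
     <= eps * (2 * 16 ^ n) * (C * H2_norm2 f)).
  { rewrite (rsum_ext _ (fun j => eps * (2 * 16 ^ n) * ((/ 4) ^ (n * j) * int_mean2 F (rho_seq j)))).
    2:{ intros j _. simpl wt. rewrite (Rmult_assoc (eps * (2 * 16 ^ n))). reflexivity. }
    rewrite rsum_scal. apply Rmult_le_compat_l; [apply Rmult_le_pos; lra|]. apply HCf, Hf. }
  assert (B4 : K0 * cmean (fun u => Cmod (test_fun a F 0 (circ (rho 0%nat) u)) ^ 2) <= K0 * B ^ 2)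
    by (apply Rmult_le_compat_l; lra).
  assert (E : 4096 * (eps * (2 * 16 ^ n) * (C * H2_norm2 f)) = e * H2_norm2 f).
  { unfold eps. field. lra. }
  change (wt 0%nat) with K0 in Main. lra.
Qed.

Lemma holo_disk_bound (F : CC -> CC) (R1 : R) : holo 1 F -> 0 < R1 < 1 ->
  exists B, forall w, Cmod w <= R1 -> Cmod (F w) <= B.
Proof.
  intros HF HR. destruct (growth_geom (coef F) 0 R1 (coef_growth F HF)) as (C & y & HC & Hy & H); [lra|].
  exists (C * / (1 - y)). intros w Hw.
  apply (ctends_Cmod_le _ _ _ (coef_ps F HF w ltac:(lra))). intros K.
  eapply Rle_trans; [apply Cmod_csum_le|].
  apply Rle_trans with (rsum (fun k => C * y ^ k) K).
  - apply rsum_le. intros k _. specialize (H k). rewrite pow_O, Rmult_1_l in H.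
    eapply Rle_trans; [|exact H]. rewrite Cmod_mult, Cmod_pow.
    apply Rmult_le_compat_l; [apply Cmod_ge_0|]. apply pow_incr. split; [apply Cmod_ge_0|exact Hw].
  - rewrite rsum_scal. apply Rmult_le_compat_l; [lra|]. apply rsum_geom_le. lra.
Qed.

(** * Extraction of subsequences and compactness *)

Lemma bounded_subsequence_R (x : nat -> R) (B : R) : (forall n, Rabs (x n) <= B) ->
  exists s l, (forall k, (s k < s (S k))%nat) /\ is_lim_seq (fun k => x (s k)) (Finite l).
Proof.
  intros HB.
  destruct (Bolzano_Weierstrass x (fun c => - B <= c <= B) (compact_P3 (- B) B)) as [l Hl].
  { intros n. apply Rabs_le_between, HB. }
  assert (Hfreq : forall k N, exists p, (N < p)%nat /\ Rabs (x p - l) < / (INR k + 1)).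
  { intros k N. assert (Pk := pos_INR k).
    assert (Hd : 0 < / (INR k + 1)) by (apply Rinv_0_lt_compat; lra).
    destruct (Hl (disc l (mkposreal _ Hd)) (S N)) as [p [Hp1 Hp2]].
    - exists (mkposreal _ Hd). intros y Hy; exact Hy.
    - exists p. split; [lia|]. exact Hp2. }
  set (nxt := fun k N => proj1_sig (constructive_indefinite_description _ (Hfreq k N))).
  assert (Hnxt : forall k N, (N < nxt k N)%nat /\ Rabs (x (nxt k N) - l) < / (INR k + 1)).
  { intros k N. exact (proj2_sig (constructive_indefinite_description _ (Hfreq k N))). }
  set (s := fix s k := match k with O => nxt 0%nat 0%nat | S j => nxt (S j) (s j) end).
  exists s, l. split; [intros k; apply (Hnxt (S k) (s k))|].
  assert (Hs : forall k, Rabs (x (s k) - l) < / (INR k + 1)).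
  { intros [|k]; [apply (Hnxt 0%nat 0%nat)|apply (Hnxt (S k) (s k))]. }
  apply is_lim_seq_spec. intros e.
  destruct (INR_unbounded (/ e)) as [N HN]. exists N. intros k Hk.
  eapply Rlt_trans; [apply Hs|].
  assert (Pe := cond_pos e). assert (INR N <= INR k) by (apply le_INR, Hk).
  rewrite <- (Rinv_inv e). apply Rinv_lt_contravar; [|lra].
  assert (0 < / e) by (apply Rinv_0_lt_compat, Pe). nra.
Qed.

Lemma strict_mono_lt (s : nat -> nat) : (forall k, (s k < s (S k))%nat) -> forall i j, (i < j)%nat -> (s i < s j)%nat.
Proof. intros H i j Hij. induction Hij; [apply H|]. specialize (H m). lia. Qed.

Lemma bounded_subsequence_C (x : nat -> CC) (B : R) : (forall n, Cmod (x n) <= B) ->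
  exists s l, (forall k, (s k < s (S k))%nat) /\ ctends (fun k => x (s k)) l.
Proof.
  intros HB.
  destruct (bounded_subsequence_R (fun n => fst (x n)) B) as [s1 [l1 [Hs1 Hl1]]].
  { intros n. eapply Rle_trans; [apply Rabs_fst_le|apply HB]. }
  destruct (bounded_subsequence_R (fun n => snd (x (s1 n))) B) as [s2 [l2 [Hs2 Hl2]]].
  { intros n. eapply Rle_trans; [apply Rabs_snd_le|apply HB]. }
  exists (fun k => s1 (s2 k)), (l1, l2). split.
  - intros k. apply (strict_mono_lt s1 Hs1), Hs2.
  - assert (Hl1' : is_lim_seq (fun k => fst (x (s1 (s2 k)))) l1).
    { apply (is_lim_seq_subseq (fun k => fst (x (s1 k))) l1 s2); [|exact Hl1].
      apply eventually_subseq. exact Hs2. }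
    apply (ctends_bound _ _ (fun k => Rabs (fst (x (s1 (s2 k))) - l1) + Rabs (snd (x (s1 (s2 k))) - l2))).
    + intros k. apply (Cmod_le_Rabs (x (s1 (s2 k)) - (l1, l2))%C).
    + replace (Finite 0) with (Finite (0 + 0)) by (f_equal; ring). apply is_lim_seq_plus'.
      * exact (is_lim_seq_abs_minus (fun k => fst (x (s1 (s2 k)))) l1 Hl1').
      * exact (is_lim_seq_abs_minus (fun k => snd (x (s1 (s2 k)))) l2 Hl2).
Qed.

(** Cantor's diagonal: along [sub j] the coefficients of index below j converge, and the diagonal
    runs inside [sub j] from k = j on. *)
Lemma diagonal_subsequence (x : nat -> nat -> CC) (B : R) : (forall j k, Cmod (x j k) <= B) ->
  exists s l, (forall k, (s k < s (S k))%nat) /\ forall j, ctends (fun k => x j (s k)) (l j).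
Proof.
  intros HB.
  assert (Hstep : forall j (sb : nat -> nat), exists t, (forall k, (t k < t (S k))%nat) /\
     exists l, ctends (fun k => x j (sb (t k))) l).
  { intros j sb. destruct (bounded_subsequence_C (fun k => x j (sb k)) B) as [t [l [Ht Hl]]].
    - intros k. apply HB.
    - exists t. split; [exact Ht|now exists l]. }
  set (t := fun j sb => proj1_sig (constructive_indefinite_description _ (Hstep j sb))).
  assert (Ht : forall j sb, (forall k, (t j sb k < t j sb (S k))%nat) /\
     exists l, ctends (fun k => x j (sb (t j sb k))) l).
  { intros j sb. exact (proj2_sig (constructive_indefinite_description _ (Hstep j sb))). }
  set (sub := fix sub j := match j with O => fun k => k | S i => fun k => sub i (t i (sub i) k) end).
  assert (Hsub : forall j k, (sub j k < sub j (S k))%nat).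
  { induction j as [|j IH]; intros k; simpl; [lia|].
    apply (strict_mono_lt (sub j) IH). apply Ht. }
  assert (Hnest : forall j d k, exists m, (k <= m)%nat /\ sub (j + d)%nat k = sub j m).
  { intros j d. induction d as [|d IH]; intros k.
    - exists k. rewrite Nat.add_0_r. auto.
    - rewrite Nat.add_succ_r. simpl.
      destruct (IH (t (j + d)%nat (sub (j + d)%nat) k)) as [m [Hm E]].
      exists m. split; [|exact E].
      assert (G := increasing_seq_ge _ (proj1 (Ht (j + d)%nat (sub (j + d)%nat))) k). lia. }
  assert (Hl : forall j, exists l, ctends (fun k => x j (sub k k)) l).
  { intros j. destruct (proj2 (Ht j (sub j))) as [l Hl]. exists l.
    rewrite ctends_eps in *. intros e He. destruct (Hl e He) as [N HN].
    exists (N + S j)%nat. intros k Hk.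
    destruct (Hnest (S j) (k - S j)%nat k) as [m [Hm E]].
    replace (S j + (k - S j))%nat with k in E by lia. rewrite E. apply (HN m). lia. }
  exists (fun k => sub k k), (fun j => proj1_sig (constructive_indefinite_description _ (Hl j))).
  split.
  (* [sub (S k) (S k)] is [sub k] at an index no smaller than S k. *)
  - intros k. simpl. apply Nat.lt_le_trans with (sub k (S k)); [apply Hsub|].
    assert (G := increasing_seq_ge _ (proj1 (Ht k (sub k))) (S k)).
    destruct (Nat.eq_dec (S k) (t k (sub k) (S k))) as [E|n]; [rewrite <- E; lia|].
    apply Nat.lt_le_incl, (strict_mono_lt (sub k) (Hsub k)). lia.
  - intros j. exact (proj2_sig (constructive_indefinite_description _ (Hl j))).
Qed.

(** Head and tail: finitely many coefficients tend to 0, and on |w| <= R1 the remaining ones, being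
    bounded, contribute the tail of a geometric series. *)
Lemma derivatives_uniformly_small (v : nat -> CC -> CC) (n : nat) (R1 B : R) : (1 <= n)%nat -> 0 < R1 < 1 ->
  (forall k, holo 1 (v k)) -> (forall k j, Cmod (coef (v k) j) <= B) ->
  (forall j, is_lim_seq (fun k => Cmod (coef (v k) j)) 0) ->
  forall e, 0 < e -> exists N, forall k, (N <= k)%nat -> forall w, Cmod w <= R1 ->
    Cmod (Cderiv_n n (v k) w) <= e.
Proof.
  intros Hn HR Hv HB Hlim e He.
  assert (PB : 0 <= B) by (eapply Rle_trans; [apply Cmod_ge_0|apply (HB 0%nat 0%nat)]).
  destruct (poly_geom_bound n R1) as (C & y & HC & Hy & Hpg); [lra|].
  set (D := INR n ^ n * C). assert (PD : 0 < D).
  { apply Rmult_lt_0_compat; [apply pow_lt, lt_0_INR; lia|exact HC]. }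
  (* [I] is the cut between head and tail; it makes the tail D B y^I / (1 - y) at most e / 2. *)
  destruct (pow_lt_1_zero y) with (y := e * (1 - y) / (2 * (D * B + 1))) as [I HI].
  { rewrite Rabs_right; lra. }
  { apply Rdiv_lt_0_compat; nra. }
  specialize (HI I (le_n I)).
  assert (HIy : D * B * y ^ I * / (1 - y) <= e / 2).
  { assert (X := Rle_abs (y ^ I)).
    assert (Y : y ^ I <= e * (1 - y) / (2 * (D * B + 1))) by lra.
    assert (PI' : 0 <= y ^ I) by (apply pow_le; lra).
    assert (PDB : 0 <= D * B) by nra.
    apply (Rmult_le_reg_r (1 - y)); [lra|].
    replace (D * B * y ^ I * / (1 - y) * (1 - y)) with (D * B * y ^ I) by (field; lra).
    apply Rle_trans with ((D * B + 1) * y ^ I); [nra|].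
    apply Rle_trans with ((D * B + 1) * (e * (1 - y) / (2 * (D * B + 1)))); [apply Rmult_le_compat_l; lra|].
    right; field; lra. }
  assert (Hfin : is_lim_seq (fun k => rsum (fun i => D * Cmod (coef (v k) (i + n))) I) (rsum (fun _ => 0) I)).
  { apply is_lim_seq_rsum. intros i _. replace 0 with (D * 0) by ring.
    apply is_lim_seq_mult'; [apply is_lim_seq_const|apply Hlim]. }
  replace (rsum (fun _ => 0) I) with 0 in Hfin by (clear; induction I; simpl; lra).
  destruct (is_lim_seq_small _ (e / 2) Hfin) as [N HN]; [lra|].
  exists N. intros k Hk w Hw. specialize (HN k Hk).
  set (F := Cderiv_n n (v k)). assert (HF : holo 1 F) by (apply holo_deriv_n, Hv).
  set (T := fun i => D * y ^ i * Cmod (coef (v k) (i + n))).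
  assert (PT : forall i, 0 <= T i).
  { intros i. apply Rmult_le_pos; [apply Rmult_le_pos; [lra|apply pow_le; lra]|apply Cmod_ge_0]. }
  apply (ctends_Cmod_le _ _ _ (coef_ps F HF w ltac:(lra))). intros K.
  eapply Rle_trans; [apply Cmod_csum_le|].
  apply Rle_trans with (rsum T K).
  - apply rsum_le. intros i _. rewrite Cmod_mult, Cmod_pow.
    assert (A := coef_deriv_n n (v k) i (Hv k)). fold F in A.
    assert (A2 := index_power n i Hn). specialize (Hpg i).
    assert (Pw := Cmod_ge_0 w). assert (Pc := Cmod_ge_0 (coef (v k) (i + n))).
    assert (Pn : 0 <= INR n ^ n) by (apply pow_le, pos_INR).
    assert (Pwi : 0 <= Cmod w ^ i) by (apply pow_le, Pw).
    assert (Hwi : Cmod w ^ i <= R1 ^ i) by (apply pow_incr; lra).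
    apply Rle_trans with ((INR n ^ n * INR (S i) ^ n * Cmod (coef (v k) (i + n))) * R1 ^ i).
    + apply Rmult_le_compat; auto using Cmod_ge_0. eapply Rle_trans; [exact A|].
      apply Rmult_le_compat_r; assumption.
    + unfold T, D.
      replace (INR n ^ n * INR (S i) ^ n * Cmod (coef (v k) (i + n)) * R1 ^ i)
        with (INR n ^ n * (INR (S i) ^ n * R1 ^ i) * Cmod (coef (v k) (i + n))) by ring.
      replace (INR n ^ n * C * y ^ i) with (INR n ^ n * (C * y ^ i)) by ring.
      apply Rmult_le_compat_r; [exact Pc|]. apply Rmult_le_compat_l; assumption.
  - apply Rle_trans with (rsum T (I + K)); [rewrite Nat.add_comm; apply rsum_mono, PT|].
    rewrite rsum_split.
    assert (X1 : rsum T I <= e / 2).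
    { eapply Rle_trans; [|left; eapply Rle_lt_trans; [apply Rle_abs|exact HN]].
      apply rsum_le. intros i _. unfold T.
      assert (y ^ i <= 1) by (rewrite <- (pow1 i); apply pow_incr; lra).
      assert (Pc := Cmod_ge_0 (coef (v k) (i + n))).
      apply Rmult_le_compat_r; [exact Pc|]. rewrite <- (Rmult_1_r D) at 2. apply Rmult_le_compat_l; lra. }
    assert (X2 : rsum (fun i => T (I + i)%nat) K <= e / 2).
    { eapply Rle_trans; [|exact HIy].
      apply Rle_trans with (rsum (fun i => D * B * y ^ I * y ^ i) K).
      - apply rsum_le. intros i _. unfold T. rewrite pow_add.
        assert (0 <= y ^ I) by (apply pow_le; lra). assert (0 <= y ^ i) by (apply pow_le; lra).
        replace (D * B * y ^ I * y ^ i) with (D * (y ^ I * y ^ i) * B) by ring.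
        apply Rmult_le_compat_l; [|apply HB]. apply Rmult_le_pos; [lra|]. apply Rmult_le_pos; assumption.
      - rewrite rsum_scal. apply Rmult_le_compat_l.
        + apply Rmult_le_pos; [nra|apply pow_le; lra].
        + apply rsum_geom_le; lra. }
    lra.
Qed.

(** A weak limit [f] is built from coefficientwise limits along a diagonal subsequence; the
    differences are bounded and weakly null, so both terms of [main_estimate] become small. *)
Theorem little_o_imp_compact (phi : CC -> CC) (n : nat) : self_map phi -> (1 <= n)%nat ->
  (forall eps : R, 0 < eps -> exists delta : R, delta < 1 /\
     forall w : CC, delta < Cmod w -> Cmod w < 1 ->
       Rbar_le (nevanlinna phi w) (Finite (eps * (ln (/ Cmod w)) ^ (2 * n + 1)))) ->
  compact_on_H2 (Dop phi n).
Proof.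
  intros Hphi Hn Ho. assert (Hest := main_estimate phi n Hphi Hn Ho).
  assert (HD : forall f, holo 1 f -> holo 1 (Dop phi n f)).
  { intros f Hf. apply (holo_comp 1 1 (Cderiv_n n f) phi); [apply holo_deriv_n, Hf|exact (proj1 Hphi)|exact (proj2 Hphi)]. }
  assert (HT : forall f, in_H2 f -> in_H2 (Dop phi n f)).
  (* Boundedness needs the estimate with e = 1 only; [B] may depend on f. *)
  { intros f Hf. destruct (Hest 1 Rlt_0_1) as [K [R1 [HK [HR1 H]]]].
    destruct (holo_disk_bound (Cderiv_n n f) R1 (holo_deriv_n n f (proj1 Hf)) HR1) as [B HB].
    apply (H2_of_bound _ (1 * H2_norm2 f + K * B ^ 2)); [apply HD, Hf|].
    intros r Hr. apply H; assumption. }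
  split; [exact HT|]. intros u Hu.
  assert (Hcb : forall k j, Cmod (coef (u k) j) <= 1).
  { intros k j. destruct (Hu k) as [H1 H2]. eapply Rle_trans; [apply coef_le_norm, H1|].
    rewrite <- sqrt_1. apply sqrt_le_1_alt, H2. }
  destruct (diagonal_subsequence (fun j k => coef (u k) j) 1) as [s [l [Hs Hl]]].
  { intros j k. apply Hcb. }
  assert (Hlb : forall j, Cmod (l j) <= 1).
  { intros j. apply (ctends_Cmod_le _ _ _ (Hl j)). intros k. apply Hcb. }
  assert (Hg : growth l).
  { intros r Hr. exists 1. split; [lra|]. intros k.
    assert (r ^ k <= 1) by (rewrite <- (pow1 k); apply pow_incr; lra).
    assert (0 <= r ^ k) by (apply pow_le; lra).
    assert (X := Hlb k). assert (Y := Cmod_ge_0 (l k)). nra. }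
  destruct (growth_ps l Hg) as [f Hf]. assert (Hfh : holo 1 f) by (eapply ps_holo; eassumption).
  assert (Hfc : forall j, coef f j = l j) by (apply coef_unique; assumption).
  assert (Hf2 : in_H2 f /\ H2_norm2 f <= 1).
  { apply H2_of_coef; [exact Hfh|]. intros K.
    (* Fatou's lemma for the coefficients: finite sums pass to the limit, and the bound 1 is uniform
       in K. *)
    assert (Llim : is_lim_seq (fun k => rsum (fun j => Cmod (coef (u (s k)) j) ^ 2) K)
       (rsum (fun j => Cmod (coef f j) ^ 2) K)).
    { apply (is_lim_seq_rsum (fun j k => Cmod (coef (u (s k)) j) ^ 2)). intros j _. rewrite Hfc.
      assert (Hm : is_lim_seq (fun k => Cmod (coef (u (s k)) j)) (Cmod (l j))).
      { apply is_lim_seq_spec. intros e. destruct (proj1 (ctends_eps _ _) (Hl j) e (cond_pos e)) as [N HN].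
        exists N. intros k Hk. eapply Rle_lt_trans; [apply Rabs_Cmod_minus|]. apply HN, Hk. }
      apply (is_lim_seq_ext (fun k => Cmod (coef (u (s k)) j) * Cmod (coef (u (s k)) j))); [intros; ring|].
      replace (Cmod (l j) ^ 2) with (Cmod (l j) * Cmod (l j)) by ring.
      apply is_lim_seq_mult'; assumption. }
    apply (is_lim_seq_le _ (fun _ => 1) (Finite _) (Finite _)) with (2 := Llim); [|apply is_lim_seq_const].
    intros k. destruct (Hu (s k)) as [H1 H2]. eapply Rle_trans; [apply coef_sum_le_norm2, H1|exact H2]. }
  destruct Hf2 as [Hf2 Hf1].
  exists s, (Dop phi n f). split; [exact Hs|]. split; [apply HT, Hf2|].
  set (v := fun k z => (u (s k) z - f z)%C).
  assert (Hv : forall k, in_H2 (v k) /\ H2_norm2 (v k) <= 4).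
  { intros k. destruct (Hu (s k)) as [H1 H2]. destruct (H2_minus (u (s k)) f H1 Hf2) as [A1 A2].
    split; [exact A1|]. unfold v. lra. }
  assert (Hvc : forall k j, coef (v k) j = (coef (u (s k)) j - l j)%C).
  { intros k j. unfold v. rewrite coef_minus, Hfc; [reflexivity|exact (proj1 (proj1 (Hu (s k))))|exact Hfh]. }
  assert (Hvlim : forall j, is_lim_seq (fun k => Cmod (coef (v k) j)) 0).
  { intros j. apply (is_lim_seq_ext (fun k => Cmod (coef (u (s k)) j - l j))); [|exact (Hl j)].
    intros k. now rewrite Hvc. }
  assert (Hvb : forall k j, Cmod (coef (v k) j) <= 2).
  { intros k j. rewrite Hvc. unfold Cminus. eapply Rle_trans; [apply Cmod_triangle|]. rewrite Cmod_opp.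
    specialize (Hcb (s k) j). specialize (Hlb j). lra. }
  apply is_lim_seq_spec. intros e. assert (Pe := cond_pos e).
  (* The differences have squared norm at most 4, so this term is at most e / 4; the choice of [b]
     makes the other one e / 4. *)
  destruct (Hest (e / 16)) as [K [R1 [HK [HR1 H]]]]; [lra|].
  set (b := sqrt (e / (4 * K))).
  assert (Pb : 0 < b) by (apply sqrt_lt_R0, Rdiv_lt_0_compat; lra).
  assert (Eb : K * b ^ 2 = e / 4).
  { unfold b. rewrite pow2_sqrt by (left; apply Rdiv_lt_0_compat; lra). field. lra. }
  destruct (derivatives_uniformly_small v n R1 2 Hn HR1 (fun k => proj1 (proj1 (Hv k))) Hvb Hvlim b Pb) as [N HN].
  exists N. intros k Hk.
  set (W := fun z => (Dop phi n (u (s k)) z - Dop phi n f z)%C).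
  assert (HW : holo 1 W) by (apply holo_minus; apply HD; [exact (proj1 (proj1 (Hu (s k))))|exact Hfh]).
  destruct (H2_of_bound W (e / 2) HW) as [HW1 HW2].
  { intros r Hr. rewrite (mean2_ext W (Dop phi n (v k)) r Hr).
    - eapply Rle_trans; [apply (H (v k) b r (proj1 (Hv k)) Hr); intros w Hw; apply HN; assumption|].
      destruct (Hv k) as [_ X]. assert (e / 16 * H2_norm2 (v k) <= e / 16 * 4) by (apply Rmult_le_compat_l; lra). lra.
    - intros z Hz. unfold W, Dop, v. symmetry. apply Cderiv_n_minus; [exact (proj1 (proj1 (Hu (s k))))|exact Hfh|].
      apply (proj2 Hphi), Hz. }
  rewrite Rminus_0_r. rewrite Rabs_right by (apply Rle_ge, norm2_pos, HW1).
  change (H2_norm2 W < e). lra.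
Qed.

Theorem theorem2p2 (phi : CC -> CC) (n : nat) :
  self_map phi -> (1 <= n)%nat ->
  (compact_on_H2 (Dop phi n) <->
   forall eps : R, 0 < eps ->
     exists delta : R, delta < 1 /\
       forall w : CC, delta < Cmod w -> Cmod w < 1 ->
         Rbar_le (nevanlinna phi w) (Finite (eps * (ln (/ Cmod w)) ^ (2 * n + 1)))).
Proof.
  intros Hphi Hn. split.
  - apply compact_imp_little_o, Hphi.
  - apply little_o_imp_compact; assumption.
Qed.
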